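(* Let $r\in\mathbb{N}$, $m\in\mathbb{N}_0$ and let $\Lambda:=\{\nu_1,\ldots,\nu_r\}\subseteq\{0,\ldots,m\}$ be an ordered multiset with $\nu_1=0$. Define $m_\Lambda:=\max(\nu_1,\ldots,\nu_r)$. Let $a\in(l_0(\mathbb{Z}))^{r\times r}$ be such that $1$ is a simple eigenvalue of $\widehat{a}(0)$ and $2^k$ is not an eigenvalue of $\widehat{a}(0)$ for every $k\in\mathbb{N}$. Let $\upsilon_a\in(l_0(\mathbb{Z}))^{1\times r}$ be an order $m_\Lambda+1$ matching filter of the mask $a$ such that the first nonzero entry of $\widehat{\upsilon_a}(0)$ is $1$. Let $\phi$ be a vector of compactly supported distributions satisfying $\widehat{\phi}(2\xi)=\widehat{a}(\xi)\widehat{\phi}(\xi)$ and $\widehat{\upsilon_a}(0)\widehat{\phi}(0)=1$. (1) If the generalized Hermite subdivision scheme of type $\Lambda$ with mask $a$ is convergent with limiting functions in $C^m(\mathbb{R})$, then $\operatorname{sm}_\infty(a)>0$, $\operatorname{sm}_\infty(\phi)>m$, and the matching filter $\upsilon_a$ must satisfy $$\widehat{\upsilon_a}(\xi)=[(i\xi)^{\nu_1}+O(|\xi|^{\nu_1+1}),\,(i\xi)^{\nu_2}+O(|\xi|^{\nu_2+1}),\,\ldots,\,(i\xi)^{\nu_r}+O(|\xi|^{\nu_r+1})],\quad\xi\to0.\qquad( * )$$ (2) If $\operatorname{sm}_\infty(a)>m_\Lambda$, $\operatorname{sm}_\infty(\phi)>m$ and the matching filter $\upsilon_a$ satisfies $(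 * )$, then the generalized Hermite subdivision scheme of type $\Lambda$ with mask $a$ is convergent with limiting functions in $C^m(\mathbb{R})$.
   Context: Notation. $\mathbb{N}_0=\mathbb{N}\cup\{0\}$. ''Ordered multiset'' means that $\nu_1,\dots,\nu_r\in\{0,\dots,m\}$ are listed in order and need not be distinct. $(l(\mathbb{Z}))^{s\times r}$ is the space of all sequences $\mathbb{Z}\to\mathbb{C}^{s\times r}$, and $(l_0(\mathbb{Z}))^{s\times r}$ its subspace of finitely supported sequences; $(l_0(\mathbb{Z}))^r:=(l_0(\mathbb{Z}))^{r\times1}$; $\|\cdot\|_{(l_\infty(\mathbb{Z}))^r}$ is the sup norm. $\boldsymbol{\delta}$ is the Dirac sequence ($\boldsymbol{\delta}(0)=1$, $\boldsymbol{\delta}(k)=0$ for $k\neq0$); $I_r$ is the identity matrix; $e_\ell$ is the $\ell$-th unit coordinate column vector in $\mathbb{R}^r$. Convolution: $[u*v](j)=\sum_{k}u(j-k)v(k)$. Symbol: $\widehat{u}(\xi):=\sum_{k\in\mathbb{Z}}u(k)e^{-ik\xi}$. Fourier transform: $\widehat{f}(\xi)=\int_{\mathbb{R}}f(x)e^{-ix\xi}dx$, extended to tempered distributions. $\widehat f(\xi)=\widehat g(\xi)+O(|\xi|^{k})$, $\xi\to0$, means $\widehat f^{(j)}(0)=\widehat g^{(j)}(0)$ for $j=0,\dots,k-1$. Subdivision operator: $(\mathcal{S}_av)(j):=2\sum_{k\in\mathbb{Z}}v(k)a(j-2k)$ for $v\in(l(\mathbb{Z}))^{s\times r}$, $j\in\mathbb{Z}$.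 Matching filter: $\upsilon_a\in(l_0(\mathbb{Z}))^{1\times r}$ is an order $k$ matching filter of $a$ if $\widehat{\upsilon_a}(0)\neq0$ and $\widehat{\upsilon_a}(2\xi)\widehat{a}(\xi)=\widehat{\upsilon_a}(\xi)+O(|\xi|^{k})$ as $\xi\to0$. Generalized Hermite subdivision scheme: the generalized Hermite subdivision scheme of type $\Lambda$ with mask $a$ is convergent with limiting functions in $C^m(\mathbb{R})$ if for any $w_0\in(l(\mathbb{Z}))^{1\times r}$ there exists a scalar function $\eta\in C^m(\mathbb{R})$ ($m$ times continuously differentiable) such that for every constant $K>0$, $\lim_{n\to\infty}\sup_{k\in\mathbb{Z}\cap[-2^nK,2^nK]}|(\mathcal{S}_a^nw_0)(k)2^{\nu_\ell n}e_\ell-\eta^{(\nu_\ell)}(2^{-n}k)|=0$ for $\ell=1,\ldots,r$. Quantity $\operatorname{sm}_\infty(a)$: $a$ has order $k$ sum rules with a matching filter $v\in(l_0(\mathbb{Z}))^{1\times r}$ if $\widehat{v}(0)\neq0$, $\widehat{v}(2\xi)\widehat{a}(\xi)=\widehat{v}(\xi)+O(|\xi|^{k})$ and $\widehat{v}(2\xi)\widehat{a}(\xi+\pi)=O(|\xi|^{k})$ as $\xi\to0$. Let $\operatorname{sr}(a)$ be the largest $k\in\mathbb{N}_0$ such that $a$ has order $k$ sum rules with some matching filter, and let $v$ be such a filter for $k=\operatorname{sr}(a)$. With $\mathscr{V}_{j-1,v}:=\{u\in(l_0(\mathbb{Z}))^r:\widehat{v}(\xi)\widehat{u}(\xi)=O(|\xi|^{j}),\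 \xi\to0\}$ (so $\mathscr{V}_{-1,v}=(l_0(\mathbb{Z}))^r$), put $\rho_j(a,v)_\infty:=\sup\{\limsup_{n\to\infty}\|(\mathcal{S}_a^n(\boldsymbol{\delta}I_r))*u\|_{(l_\infty(\mathbb{Z}))^r}^{1/n}:u\in\mathscr{V}_{j-1,v}\}$ and $\operatorname{sm}_\infty(a):=-\log_2\rho_{\operatorname{sr}(a)}(a,v)_\infty$ (the value does not depend on the choice of $v$). Smoothness exponent of a function: for $f\in L_\infty(\mathbb{R})$, $\operatorname{sm}_\infty(f)$ is the supremum of $n+\tau$ with $n\in\mathbb{N}_0$, $0\le\tau<1$ such that $f\in W^n_\infty(\mathbb{R})$ (i.e. $f,\dots,f^{(n-1)}$ are absolutely continuous functions in $L_\infty(\mathbb{R})$ and $f^{(n)}\in L_\infty(\mathbb{R})$) and $f^{(n)}\in\operatorname{Lip}(\tau,L_\infty)$, meaning there is $C>0$ with $\|f^{(n)}-f^{(n)}(\cdot-t)\|_{L_\infty(\mathbb{R})}\le C|t|^\tau$ for all $t\in\mathbb{R}$. For a vector $\phi=[\phi_1,\dots,\phi_r]^{\mathsf T}$, $\operatorname{sm}_\infty(\phi):=\min_\ell\operatorname{sm}_\infty(\phi_\ell)$; the condition $\operatorname{sm}_\infty(\phi)>m$ includes that every entry of $\phi$ is in $L_\infty(\mathbb{R})$. *)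

(* Defs.v *)
From HB Require Import structures.
From mathcomp Require Import all_boot all_order all_algebra.
From mathcomp Require Import all_classical all_reals all_analysis.
From mathcomp Require Export complex.

Set Implicit Arguments.
Unset Strict Implicit.
Unset Printing Implicit Defensive.

Import Order.TTheory GRing.Theory Num.Theory.
Import numFieldNormedType.Exports.
Import ComplexField.

Local Open Scope classical_set_scope.
Local Open Scope ring_scope.
Local Open Scope complex_scope.

Section ComplexValuedFunctions.
Variable R : realType.
Implicit Types (f g : R -> R[i]).
Local Notation mu := (@lebesgue_measure R).

(* [normc] is [R]-valued, unlike [`|z|] which lives in [R[i]]. *)
Definition cmod (z : R[i]) : R := Normc.normc z.

(* e^{i t} *)
Definition cis (t : R) : R[i] := cos t +i* sin t.

Definition Ref f : R -> R := fun x => complex.Re (f x).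
Definition Imf f : R -> R := fun x => complex.Im (f x).

(* The n-th derivative of a complex-valued function of a real variable; it is
   only meaningful where the components are sufficiently differentiable. *)
Definition cderivn (n : nat) f : R -> R[i] :=
  fun x => derive1n n (Ref f) x +i* derive1n n (Imf f) x.

Definition C_ (n : nat) f : Prop :=
  (forall j, (j < n)%N -> forall x,
     derivable (derive1n j (Ref f)) x 1 /\ derivable (derive1n j (Imf f)) x 1) /\
  continuous (derive1n n (Ref f)) /\ continuous (derive1n n (Imf f)).

Definition smooth f : Prop := forall n, C_ n f.

(* f(xi) = g(xi) + O(|xi|^k) as xi -> 0, for f and g smooth near 0: the
   derivatives of orders 0, ..., k-1 agree at 0. *)
Definition eqO (k : nat) f g : Prop :=
  forall j, (j < k)%N -> cderivn j f 0 = cderivn j g 0.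

Definition mx_eqO (k s r : nat) (F G : R -> 'M[R[i]]_(s, r)) : Prop :=
  forall i j, eqO k (fun xi => F xi i j) (fun xi => G xi i j).

Definition cintegral f : R[i] :=
  Rintegral mu setT (Ref f) +i* Rintegral mu setT (Imf f).

Definition Linfty_norm f : \bar R := Lnorm mu +oo%E (fun x => (cmod (f x))%:E).

Definition Linfty f : Prop :=
  [/\ measurable_fun setT (Ref f), measurable_fun setT (Imf f) &
      (Linfty_norm f < +oo)%E].

Definition absolutely_continuous_fun f : Prop :=
  forall e : R, 0 < e -> exists2 d : R, 0 < d &
    forall (n : nat) (a b : 'I_n -> R),
      (forall i, a i <= b i) ->
      (forall i j, i != j -> b i <= a j \/ b j <= a i) ->
      \sum_(i < n) (b i - a i) < d ->
      \sum_(i < n) cmod (f (b i) - f (a i)) < e.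

(* f (an almost-everywhere class) lies in W^n_oo(R), and g 0, ..., g n
   represent f, f', ..., f^(n). *)
Definition Sobolev_derivs (n : nat) f (g : nat -> R -> R[i]) : Prop :=
  [/\ {ae mu, forall x, g 0%N x = f x},
      forall j, (j <= n)%N -> Linfty (g j),
      forall j, (j < n)%N -> absolutely_continuous_fun (g j) &
      forall j, (j < n)%N -> {ae mu, forall x,
        is_derive (x : R) (1 : R) (Ref (g j)) (Ref (g j.+1) x) /\
        is_derive (x : R) (1 : R) (Imf (g j)) (Imf (g j.+1) x)}].

Definition Lip_infty (tau : R) f : Prop :=
  exists2 c : R, 0 < c & forall t : R,
    (Linfty_norm (fun x => f x - f (x - t))%R <= (c * `|t| `^ tau)%R%:E)%E.

Definition sm_infty_fun f : \bar R :=
  ereal_sup [set s | exists (n : nat) (tau : R) (g : nat -> R -> R[i]),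
    [/\ 0 <= tau < 1, Sobolev_derivs n f g, Lip_infty tau (g n) &
        s = (n%:R + tau)%:E]].

Definition sm_infty_vec (r : nat) (f : 'I_r -> R -> R[i]) : \bar R :=
  \big[Order.min/+oo%E]_(l < r) sm_infty_fun (f l).

End ComplexValuedFunctions.

Section Distributions.
Variable R : realType.

(* Compactly supported distributions are the continuous linear functionals on
   C^oo(R); the values of T at functions that are not smooth are irrelevant. *)
Definition cs_distribution (T : (R -> R[i]) -> R[i]) : Prop :=
  (forall (c : R[i]) (f g : R -> R[i]), smooth f -> smooth g ->
     T (fun x => c * f x + g x) = c * T f + T g) /\
  (exists (N : nat) (K c : R), forall (f : R -> R[i]) (M : R), smooth f ->
     (forall (j : nat) (x : R), (j <= N)%N -> `|x| <= K ->
        cmod (cderivn j f x) <= M) ->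
     cmod (T f) <= c * M).

(* The Fourier transform of a compactly supported distribution is the function
   xi |-> <T, e^{-i xi .}>. *)
Definition fourier (T : (R -> R[i]) -> R[i]) (xi : R) : R[i] :=
  T (fun x => cis (- (x * xi))).

Definition fourier_vec (r : nat) (T : 'I_r -> (R -> R[i]) -> R[i]) (xi : R) :
  'cV[R[i]]_r := \col_l fourier (T l) xi.

(* T is the regular distribution given by f; as f is a priori not compactly
   supported, this is tested on compactly supported functions only. *)
Definition represents (f : R -> R[i]) (T : (R -> R[i]) -> R[i]) : Prop :=
  forall g : R -> R[i], smooth g ->
    (exists K : R, forall x, K < `|x| -> g x = 0) ->
    T g = cintegral (fun x => f x * g x).

(* sm_oo(phi) > s, including that the entries of phi are in L_oo(R). *)
Definition sm_infty_dist_gt (r : nat) (phi : 'I_r -> (R -> R[i]) -> R[i])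
    (s : \bar R) : Prop :=
  exists f : 'I_r -> R -> R[i],
    [/\ forall l, Linfty (f l), forall l, represents (f l) (phi l) &
        (s < sm_infty_vec f)%E].

End Distributions.

Section Sequences.
Variable R : realType.

Definition fin_supp (s r : nat) (u : int -> 'M[R[i]]_(s, r)) : Prop :=
  finite_set [set k | u k != 0].

Definition dirac_mx (r : nat) : int -> 'M[R[i]]_r :=
  fun k => if k == 0 then 1%:M else 0.

(* The sums over all integers below are sums of finitely supported families,
   provided [u], resp. [u] or [v], resp. [a], is finitely supported. *)
Definition symbol (s r : nat) (u : int -> 'M[R[i]]_(s, r)) (xi : R) :
    'M[R[i]]_(s, r) :=
  \sum_(k \in [set: int]) cis (- (k%:~R * xi)) *: u k.

Definition seq_conv (s r t : nat) (u : int -> 'M[R[i]]_(s, r))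
    (v : int -> 'M[R[i]]_(r, t)) : int -> 'M[R[i]]_(s, t) :=
  fun j => \sum_(k \in [set: int]) u (j - k) *m v k.

Definition subdiv (s r : nat) (a : int -> 'M[R[i]]_r)
    (v : int -> 'M[R[i]]_(s, r)) : int -> 'M[R[i]]_(s, r) :=
  fun j => 2 *: \sum_(k \in [set: int]) v k *m a (j - 2 * k).

Definition matching_filter (r : nat) (a : int -> 'M[R[i]]_r) (k : nat)
    (v : int -> 'rV[R[i]]_r) : Prop :=
  [/\ fin_supp v, symbol v 0 != 0 &
      mx_eqO k (fun xi => symbol v (2 * xi) *m symbol a xi) (symbol v)].

Definition sum_rules (r : nat) (a : int -> 'M[R[i]]_r) (k : nat)
    (v : int -> 'rV[R[i]]_r) : Prop :=
  matching_filter a k v /\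
  mx_eqO k (fun xi => symbol v (2 * xi) *m symbol a (xi + pi)) (fun=> 0).

(* The largest order of sum rules; the default value 0 is used only if there is
   no largest order. *)
Definition sr (r : nat) (a : int -> 'M[R[i]]_r) : nat :=
  xget 0%N [set k | (exists v, sum_rules a k v) /\
    forall k', (exists v, sum_rules a k' v) -> (k' <= k)%N].

Definition sr_filter (r : nat) (a : int -> 'M[R[i]]_r) : int -> 'rV[R[i]]_r :=
  xget (fun=> 0) [set v | sum_rules a (sr a) v].

(* [V_ j v] is the space with index j - 1. *)
Definition V_ (r : nat) (j : nat) (v : int -> 'rV[R[i]]_r) :
    set (int -> 'cV[R[i]]_r) :=
  [set u | fin_supp u /\
           mx_eqO j (fun xi => symbol v xi *m symbol u xi) (fun=> 0)].

Definition linfty_norm (r : nat) (w : int -> 'cV[R[i]]_r) : \bar R :=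
  ereal_sup [set x | exists k l, x = (cmod (w k l ord0))%:E].

Definition rho_infty (r : nat) (j : nat) (a : int -> 'M[R[i]]_r)
    (v : int -> 'rV[R[i]]_r) : \bar R :=
  ereal_sup [set limn_esup (fun n : nat =>
      (linfty_norm (seq_conv (iter n (subdiv a) (dirac_mx r)) u)
         `^ n%:R^-1)%E)
    | u in V_ j v].

Definition sm_infty_mask (r : nat) (a : int -> 'M[R[i]]_r) : \bar R :=
  (- (lne (rho_infty (sr a) a (sr_filter a)) * ((ln 2)^-1)%:E))%E.

Definition hermite_convergent (r m : nat) (nu : 'I_r -> 'I_m.+1)
    (a : int -> 'M[R[i]]_r) : Prop :=
  forall w0 : int -> 'rV[R[i]]_r, exists2 eta : R -> R[i], C_ m eta &
    forall K : R, 0 < K -> forall l : 'I_r,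
      (fun n : nat => ereal_sup [set
          (cmod (iter n (subdiv a) w0 k ord0 l * 2 ^+ (nu l * n)
                 - cderivn (nu l) eta (2 ^- n * k%:~R)))%:E
        | k in [set k : int | `|k%:~R| <= 2 ^+ n * K :> R]]) @ \oo --> 0%E.

Definition hermite_filter_cond (r m : nat) (nu : 'I_r -> 'I_m.+1)
    (v : int -> 'rV[R[i]]_r) : Prop :=
  forall l : 'I_r, eqO (nu l).+1 (fun xi => symbol v xi ord0 l)
                                 (fun xi => (0 +i* xi) ^+ nu l).

End Sequences.

(* Main.v *)
(* Let A_n be the n-th subdivision of the Dirac sequence, so that the scheme
   converges iff, for every l, the l-th column of A_n scaled by 2^(nu_l n) samples
   the nu_l-th derivative of a limit vector eta; A_n * u is governed by the finite
   dimensional transition operators T_0, T_1 acting on u.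

   Sufficiency.  Let F be the C^m representative of phi.  By refinability A_n
   applied to the samples p of F on Z is again F, sampled on 2^-n Z.  If the sum
   rules have order s and matching filter v, every u is a combination of the
   differences nabla^q p, q < s, plus a sequence annihilated by the first s moments
   against v, on which the scheme decays like q^n with q 2^M < 1, M = max nu.
   Comparing moments against the given filter, condition ( * ) says that
   delta e_l = nabla^(nu_l) p + (higher differences) + (decaying part), and
   2^(nu_l n) nabla^(nu_l) F on 2^-n Z converges to F^(nu_l).

   Necessity.  The limits eta of the columns form a compactly supported refinable
   vector.  Passing to the limit in the moments of a matching filter subdivided n
   times identifies its moments, which is ( * ), and iterating the refinement
   equation of the Fourier transform identifies eta with phi.  The operators T_b
   tend to 0 along all words on the kernel of u |-> lim A_n * u, and so do 2^m T_b
   on differences of eta^(m); by finite dimensionality the decay is geometric,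
   which gives sm(a) > 0 and Hoelder continuity of eta^(m).  The orders of the sum
   rules are bounded, so that sr(a) is not a default value: T_0 acts as 2^-q on the
   q-th layer of the moment filtration, and all layers are visible in one window. *)
Require Import Defs.
From mathcomp Require Import all_boot all_order all_algebra.
From mathcomp Require Import all_classical all_reals all_analysis.
From mathcomp Require Import measurable_realfun ess_sup_inf ring lra zify.
Import Order.TTheory GRing.Theory Num.Theory.
Import numFieldNormedType.Exports.
Local Open Scope classical_set_scope.
Local Open Scope ring_scope.
Local Open Scope complex_scope.
Set Implicit Arguments.
Unset Strict Implicit.
Unset Printing Implicit Defensive.

(** * Complex-valued functions of a real variable *)

(** Nothing ties the data together a priori: [sr_filter a], behind [sm_infty_mask a], is chosen
    independently of [va], and [phi] is only a distribution. Filters are compared through growth. Up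
    to the order of matching, pairing A_n * u with a matching filter multiplies the moment of order
    d by 2^n, while about 2^n terms with weights of size 2^(nd) yield at most a constant times
    2^(n(d+1)) times the size of A_n * u. Decay faster than 2^(-nd) therefore kills this moment for
    every matching filter. Conversely, once the scheme converges, all matching filters are tested
    against the same limits, which fixes their low moments up to the single factor [kap].
    Distributions are compared through their Fourier transforms, so the uniqueness theorem
    [dist_inj] carries both the refinement equation of the representative of [phi] and the
    identification of the limit with [phi]. The radius [Na.+1] that recurs below is the fixed point
    of the halving of supports under T_0 and T_1; it is what makes the relevant spaces finite
    dimensional. *)

Section Modulus.
Variable R : realType.
Implicit Types z w : R[i].

Lemma cmod0 : cmod (0 : R[i]) = 0.
Proof. exact: Normc.normc0. Qed.

Lemma cmod_ge0 z : 0 <= cmod z.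
Proof. by case: z => a b; rewrite /cmod /= sqrtr_ge0. Qed.

Lemma cmodD z w : cmod (z + w) <= cmod z + cmod w.
Proof. exact: le_normcD. Qed.

Lemma cmodN z : cmod (- z) = cmod z.
Proof. exact: normcN. Qed.

Lemma cmodB z w : cmod (z - w) <= cmod z + cmod w.
Proof. by rewrite -(cmodN w); exact: cmodD. Qed.

Lemma cmodBC z w : cmod (z - w) = cmod (w - z).
Proof. by rewrite -cmodN opprB. Qed.

Lemma cmodM z w : cmod (z * w) = cmod z * cmod w.
Proof. exact: Normc.normcM. Qed.

Lemma cmodX z n : cmod (z ^+ n) = cmod z ^+ n.
Proof.
elim: n => [|n IH]; first by rewrite !expr0; exact: Normc.normc1.
by rewrite !exprS cmodM IH.
Qed.

Lemma cmodR (x : R) : cmod x%:C = `|x|.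
Proof. by rewrite /cmod /= expr0n /= addr0 sqrtr_sqr. Qed.

Lemma cmod_eq0 z : (cmod z == 0) = (z == 0).
Proof.
by apply/eqP/eqP => [/Normc.eq0_normc//|->]; rewrite cmod0.
Qed.

Lemma cmod_gt0 z : (0 < cmod z) = (z != 0).
Proof. by rewrite lt0r cmod_ge0 andbT cmod_eq0. Qed.

Lemma cmodi : cmod ('i : R[i]) = 1.
Proof. by rewrite /cmod /= expr0n /= add0r expr1n sqrtr1. Qed.

Lemma cmod_Re z : `|complex.Re z| <= cmod z.
Proof.
case: z => a b; rewrite /cmod /= -(sqrtr_sqr a) ler_sqrt ?lerDl ?sqr_ge0//.
by rewrite addr_ge0 ?sqr_ge0.
Qed.

Lemma cmod_Im z : `|complex.Im z| <= cmod z.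
Proof.
case: z => a b; rewrite /cmod /= -(sqrtr_sqr b) ler_sqrt ?lerDr ?sqr_ge0//.
by rewrite addr_ge0 ?sqr_ge0.
Qed.

Lemma cmod_le_ReIm z : cmod z <= `|complex.Re z| + `|complex.Im z|.
Proof.
rewrite [X in cmod X]complexE; apply: le_trans (cmodD _ _) _.
by rewrite cmodM cmodi mul1r !cmodR.
Qed.

Lemma cmod_sum (I : Type) (s : seq I) (P : pred I) (F : I -> R[i]) :
  cmod (\sum_(i <- s | P i) F i) <= \sum_(i <- s | P i) cmod (F i).
Proof.
elim/big_rec2: _ => [|i x y _ h]; first by rewrite cmod0.
by apply: le_trans (cmodD _ _) _; rewrite lerD2l.
Qed.

Lemma cmod_nat n : cmod (n%:R : R[i]) = n%:R.
Proof. by rewrite -(rmorph_nat (real_complex R)) cmodR normr_nat. Qed.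

Lemma cmod_int (k : int) : cmod (k%:~R : R[i]) = `|k%:~R|.
Proof. by rewrite -(rmorph_int (real_complex R)) cmodR. Qed.

Lemma cmodV z : cmod z^-1 = (cmod z)^-1.
Proof. exact: Normc.normcV. Qed.

Lemma cmod_cis (t : R) : cmod (cis t) = 1.
Proof. by rewrite /cmod /cis /= cos2Dsin2 sqrtr1. Qed.

Lemma cisD (s t : R) : cis (s + t) = cis s * cis t.
Proof.
by apply/eqP; rewrite eq_complex /= cosD sinD; apply/andP; split;
  apply/eqP; ring.
Qed.

Lemma cis0 : cis (0 : R) = 1.
Proof. by rewrite /cis cos0 sin0. Qed.

Lemma ReM z w : complex.Re (z * w) =
  complex.Re z * complex.Re w - complex.Im z * complex.Im w.
Proof. by case: z => ? ?; case: w. Qed.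

Lemma ImM z w : complex.Im (z * w) =
  complex.Re z * complex.Im w + complex.Im z * complex.Re w.
Proof. by case: z => ? ?; case: w => ? ? /=; rewrite addrC. Qed.

Lemma ReD z w : complex.Re (z + w) = complex.Re z + complex.Re w.
Proof. by case: z => ? ?; case: w. Qed.

Lemma ImD z w : complex.Im (z + w) = complex.Im z + complex.Im w.
Proof. by case: z => ? ?; case: w. Qed.

Lemma ReN z : complex.Re (- z) = - complex.Re z.
Proof. by case: z. Qed.

Lemma ImN z : complex.Im (- z) = - complex.Im z.
Proof. by case: z. Qed.

Lemma eqReIm z w : complex.Re z = complex.Re w -> complex.Im z = complex.Im w ->
  z = w.
Proof. by case: z => ? ?; case: w => ? ? /= -> ->. Qed.

Lemma cmod_sum_le (I : finType) (F : I -> R[i]) (e : R) :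
  (forall i, cmod (F i) <= e) -> cmod (\sum_i F i) <= #|I|%:R * e.
Proof.
move=> h; apply: le_trans (cmod_sum _ _ _) _.
apply: (@le_trans _ _ (\sum_(i : I) e)); first exact: ler_sum.
by rewrite sumr_const mulr_natl.
Qed.

End Modulus.

(** * Calculus of derivatives of complex-valued functions *)

Section ComplexDerivative.
Variable R : realType.
Implicit Types (f g : R -> R[i]) (F G : nat -> R -> R[i]).

(** A relation, because [cderivn] is total and its value alone does not say that the derivative
    exists. The relation carries existence and value together. *)
Definition cder f g := forall x : R,
  is_derive x (1 : R) (Ref f) (Ref g x) /\ is_derive x (1 : R) (Imf f) (Imf g x).

Lemma cderE f g g' : cder f g -> g =1 g' -> cder f g'.
Proof. by move=> h /funext <-. Qed.

Lemma cder_cst (c : R[i]) : cder (fun=> c) (fun=> 0).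
Proof. by move=> x; split; exact: is_derive_cst. Qed.

Lemma cderD f g f' g' : cder f f' -> cder g g' ->
  cder (fun x => f x + g x) (fun x => f' x + g' x).
Proof.
move=> hf hg x; have [hfr hfi] := hf x; have [hgr hgi] := hg x; split.
  rewrite /Ref (_ : (fun x => _) = Ref f + Ref g); last first.
    by apply/funext => y; rewrite ReD.
  by rewrite ReD; exact: is_deriveD.
rewrite /Imf (_ : (fun x => _) = Imf f + Imf g); last first.
  by apply/funext => y; rewrite ImD.
by rewrite ImD; exact: is_deriveD.
Qed.

Lemma cderM f g f' g' : cder f f' -> cder g g' ->
  cder (fun x => f x * g x) (fun x => f' x * g x + f x * g' x).
Proof.
move=> hf hg x; have [hfr hfi] := hf x; have [hgr hgi] := hg x; split.
  rewrite /Ref (_ : (fun x => _) = Ref f * Ref g - Imf f * Imf g); last first.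
    by apply/funext => y; rewrite ReM.
  apply: is_derive_eq; rewrite ReD !ReM /= /Ref /Imf /GRing.scale /=; ring.
rewrite /Imf (_ : (fun x => _) = Ref f * Imf g + Imf f * Ref g); last first.
  by apply/funext => y; rewrite ImM.
apply: (is_derive_eq (is_deriveD (is_deriveM hfr hgi) (is_deriveM hfi hgr))).
rewrite ImD !ImM /= /Ref /Imf /GRing.scale /=; ring.
Qed.

Lemma cderZ (c : R[i]) f f' : cder f f' -> cder (fun x => c * f x) (fun x => c * f' x).
Proof.
move=> h; apply: cderE (cderM (cder_cst c) h) _ => x; by rewrite mul0r add0r.
Qed.

Lemma cderN f f' : cder f f' -> cder (fun x => - f x) (fun x => - f' x).
Proof.
move=> h; have := cderZ (-1) h.
rewrite (_ : (fun x => -1 * f x) = (fun x => - f x)); last first.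
  by apply/funext => x; rewrite mulN1r.
by move/cderE; apply=> x; rewrite mulN1r.
Qed.

Lemma cderB f g f' g' : cder f f' -> cder g g' ->
  cder (fun x => f x - g x) (fun x => f' x - g' x).
Proof. by move=> hf hg; apply: cderD => //; exact: cderN. Qed.

Lemma cder_sum (I : Type) (s : seq I) (P : pred I) (F G : I -> R -> R[i]) :
  (forall i, P i -> cder (F i) (G i)) ->
  cder (fun x => \sum_(i <- s | P i) F i x) (fun x => \sum_(i <- s | P i) G i x).
Proof.
move=> h; elim: s => [|i s IH].
  rewrite (_ : (fun _ => _) = fun=> 0); last by apply/funext => x; rewrite big_nil.
  by apply: cderE (cder_cst 0) _ => x; rewrite big_nil.
rewrite (_ : (fun _ => _) = fun x =>
   (if P i then F i x else 0) + \sum_(j <- s | P j) F j x); last first.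
  by apply/funext => x; rewrite big_cons; case: ifP => //; rewrite add0r.
apply: cderE (cderD (f' := fun x => if P i then G i x else 0) _ IH) _ => [|x].
  by case: (boolP (P i)) => [/h//|_]; exact: cder_cst.
by rewrite big_cons; case: ifP => //; rewrite add0r.
Qed.

Lemma cder_comp f f' (s t : R) : cder f f' ->
  cder (fun x => f (s * x + t)) (fun x => s%:C * f' (s * x + t)).
Proof.
move=> h x; have [hr hi] := h (s * x + t).
have d : is_derive x (1 : R) (fun y => s * y + t) s.
  apply: is_derive_eq; rewrite /= /GRing.scale /=; ring.
split.
  rewrite {2}/Ref ReM /= mul0r subr0 mulrC.
  exact: (@is_derive1_comp _ (Ref f) (fun y => s * y + t) _ _ _ hr d).
rewrite {2}/Imf ImM /= mul0r addr0 mulrC.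
exact: (@is_derive1_comp _ (Imf f) (fun y => s * y + t) _ _ _ hi d).
Qed.

Lemma cder_comp_shift f f' (t : R) : cder f f' ->
  cder (fun x => f (x + t)) (fun x => f' (x + t)).
Proof.
move=> h; have := @cder_comp f f' 1 t h.
rewrite (_ : (fun x => f (1 * x + t)) = fun x => f (x + t)); last first.
  by apply/funext => x; rewrite mul1r.
by move/cderE; apply=> x; rewrite !mul1r.
Qed.

Lemma cder_id : cder (fun x => x%:C) (fun=> 1).
Proof.
move=> x; split => /=; rewrite /Ref /Imf /=; first exact: is_derive_id.
exact: is_derive_cst.
Qed.

Lemma cder_cis (s : R) : cder (fun x => cis (s * x)) (fun x => s%:C * 'i * cis (s * x)).
Proof.
suff h : cder (@cis R) (fun x => 'i * cis x).
  have := cder_comp s 0 h.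
  rewrite (_ : (fun x => cis (s * x + 0)) = fun x => cis (s * x)); last first.
    by apply/funext => x; rewrite addr0.
  by move/cderE; apply=> x; rewrite addr0 mulrA.
move=> x; split; rewrite /Ref /Imf /=.
  by rewrite mul0r mul1r sub0r; exact: is_derive_cos.
by rewrite mul0r mul1r add0r; exact: is_derive_sin.
Qed.

Lemma cderX f f' n : cder f f' ->
  cder (fun x => f x ^+ n) (fun x => n%:R * f' x * f x ^+ n.-1).
Proof.
move=> h; elim: n => [|n IH].
  rewrite (_ : (fun x => _) = fun=> 1); last by apply/funext => x; rewrite expr0.
  by apply: cderE (cder_cst 1) _ => x; rewrite !mul0r.
rewrite (_ : (fun x => _) = fun x => f x * f x ^+ n); last first.
  by apply/funext => x; rewrite exprS.
apply: cderE (cderM h IH) _ => x /=; case: n {IH} => [|n] /=.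
  by rewrite !expr0 !(mul0r, mulr0, addr0, mul1r, mulr1).
by rewrite -[n.+2]addn1 natrD exprS; ring.
Qed.

Lemma cder_Re f f' : cder f f' -> forall x, is_derive x (1 : R) (Ref f) (Ref f' x).
Proof. by move=> h x; case: (h x). Qed.

Lemma cder_Im f f' : cder f f' -> forall x, is_derive x (1 : R) (Imf f) (Imf f' x).
Proof. by move=> h x; case: (h x). Qed.

Definition ccont f := continuous (Ref f) /\ continuous (Imf f).

Lemma cder_ccont f f' : cder f f' -> ccont f.
Proof.
move=> h; split=> x; apply: differentiable_continuous; apply/derivable1_diffP.
  exact: (@ex_derive _ _ _ _ _ _ _ (cder_Re h x)).
exact: (@ex_derive _ _ _ _ _ _ _ (cder_Im h x)).
Qed.

Lemma cder_uniq f g g' : cder f g -> cder f g' -> g = g'.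
Proof.
move=> h h'; apply/funext => x; apply: eqReIm.
  by rewrite -[LHS](@derive_val _ _ _ _ _ _ _ (cder_Re h x))
     -[RHS](@derive_val _ _ _ _ _ _ _ (cder_Re h' x)).
by rewrite -[LHS](@derive_val _ _ _ _ _ _ _ (cder_Im h x))
   -[RHS](@derive_val _ _ _ _ _ _ _ (cder_Im h' x)).
Qed.

(** Higher derivatives are never computed by unfolding [derive1n]: a candidate sequence is exhibited
    whose consecutive terms are related by [cder], and this lemma identifies it with the iterated
    derivatives. *)
Lemma cderivn_tower n F : (forall j, (j < n)%N -> cder (F j) (F j.+1)) ->
  forall j, (j <= n)%N ->
  derive1n j (Ref (F 0%N)) = Ref (F j) /\ derive1n j (Imf (F 0%N)) = Imf (F j).
Proof.
move=> h; elim=> [|j IH] jn; first by rewrite !derive1n0.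
have [e1 e2] := IH (ltnW jn).
rewrite !derive1nS e1 e2; split; apply/funext => x; rewrite derive1E.
  exact: (@derive_val _ _ _ _ _ _ _ (cder_Re (h j jn) x)).
exact: (@derive_val _ _ _ _ _ _ _ (cder_Im (h j jn) x)).
Qed.

Lemma cderivnE n F : (forall j, (j < n)%N -> cder (F j) (F j.+1)) ->
  forall j, (j <= n)%N -> cderivn j (F 0%N) = F j.
Proof.
move=> h j jn; have [e1 e2] := cderivn_tower h jn.
by apply/funext => x; rewrite /cderivn e1 e2 /Ref /Imf; case: (F j x).
Qed.

Lemma cderivn0 f : cderivn 0 f = f.
Proof. by apply/funext => x; rewrite /cderivn !derive1n0 /Ref /Imf; case: (f x). Qed.

Lemma C_tower n F : (forall j, (j < n)%N -> cder (F j) (F j.+1)) ->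
  ccont (F n) -> C_ n (F 0%N).
Proof.
move=> h [cr ci]; split; last first.
  by have [-> ->] := cderivn_tower h (leqnn n).
move=> j jn x; have [-> ->] := cderivn_tower h (ltnW jn); split.
  exact: (@ex_derive _ _ _ _ _ _ _ (cder_Re (h j jn) x)).
exact: (@ex_derive _ _ _ _ _ _ _ (cder_Im (h j jn) x)).
Qed.

Lemma Ref_cderivn k f : Ref (cderivn k f) = derive1n k (Ref f).
Proof. by apply/funext. Qed.

Lemma Imf_cderivn k f : Imf (cderivn k f) = derive1n k (Imf f).
Proof. by apply/funext. Qed.

Lemma C_cder n f : C_ n f -> forall j, (j < n)%N -> cder (cderivn j f) (cderivn j.+1 f).
Proof.
move=> [h _] j jn x; have [hr hi] := h j jn x.
rewrite !Ref_cderivn !Imf_cderivn !derive1nS !derive1E.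
by split; apply/derivableP; [exact: hr|exact: hi].
Qed.

Lemma C_ccont n f : C_ n f -> forall j, (j <= n)%N -> ccont (cderivn j f).
Proof.
move=> h j; rewrite leq_eqVlt => /orP[/eqP ->|jn].
  by case: h => _ [hr hi]; split; rewrite ?Ref_cderivn ?Imf_cderivn.
exact: cder_ccont (C_cder h jn).
Qed.

Lemma C_le n k f : (k <= n)%N -> C_ n f -> C_ k f.
Proof.
move=> kn h; rewrite -[f]cderivn0; apply: (@C_tower k (fun j => cderivn j f)).
  by move=> j jk; apply: (C_cder h); exact: leq_trans jk kn.
exact: C_ccont h _ kn.
Qed.

Lemma smooth_tower F : (forall j, cder (F j) (F j.+1)) -> smooth (F 0%N).
Proof.
by move=> h n; apply: C_tower => //; exact: cder_ccont (h n).
Qed.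

Lemma smooth_cder f : smooth f -> forall j, cder (cderivn j f) (cderivn j.+1 f).
Proof. by move=> h j; exact: C_cder (h j.+1) _ (ltnSn j). Qed.

End ComplexDerivative.

Section Smoothness.
Variable R : realType.
Implicit Types (f g : R -> R[i]).

Lemma C0E f : C_ 0 f <-> ccont f.
Proof.
by split=> [[_]//|h]; split => //; rewrite !derive1n0.
Qed.

Lemma C_S n f f' : cder f f' -> C_ n f' -> C_ n.+1 f.
Proof.
move=> h hn; pose F j := if j is j'.+1 then cderivn j' f' else f.
apply: (@C_tower _ _ F).
  by case=> [|j] jn; [rewrite /= cderivn0|exact: C_cder hn _ _].
exact: C_ccont hn _ (leqnn n).
Qed.

Lemma cderivnS n f f' : cder f f' -> cderivn n.+1 f = cderivn n f'.
Proof.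
move=> h; apply/funext => x; rewrite /cderivn !derive1Sn.
have -> : derive1 (Ref f) = Ref f'.
  by apply/funext => y; rewrite derive1E (@derive_val _ _ _ _ _ _ _ (cder_Re h y)).
suff -> : derive1 (Imf f) = Imf f' by [].
by apply/funext => y; rewrite derive1E (@derive_val _ _ _ _ _ _ _ (cder_Im h y)).
Qed.

Lemma C_inv n f : C_ n.+1 f -> exists2 f', cder f f' & C_ n f'.
Proof.
move=> h; exists (cderivn 1 f).
  by have := C_cder h (ltn0Sn n); rewrite cderivn0.
apply: (@C_tower _ n (fun j => cderivn j.+1 f)) => [j jn|].
  exact: C_cder h _ _.
exact: C_ccont h _ (leqnn _).
Qed.

Lemma ccontD f g : ccont f -> ccont g -> ccont (fun x => f x + g x).
Proof.
move=> [fr fi] [gr gi]; split.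
  rewrite (_ : Ref _ = Ref f \+ Ref g); last by apply/funext => y; rewrite /Ref ReD.
  by move=> x; apply: cvgD; [exact: fr|exact: gr].
rewrite (_ : Imf _ = Imf f \+ Imf g); last by apply/funext => y; rewrite /Imf ImD.
by move=> x; apply: cvgD; [exact: fi|exact: gi].
Qed.

Lemma ccontM f g : ccont f -> ccont g -> ccont (fun x => f x * g x).
Proof.
move=> [fr fi] [gr gi]; split.
  rewrite (_ : Ref _ = fun x => Ref f x * Ref g x - Imf f x * Imf g x); last first.
    by apply/funext => y; rewrite /Ref ReM.
  by move=> x; apply: cvgB; apply: cvgM; [exact: fr|exact: gr|exact: fi|exact: gi].
rewrite (_ : Imf _ = fun x => Ref f x * Imf g x + Imf f x * Ref g x); last first.
  by apply/funext => y; rewrite /Imf ImM.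
by move=> x; apply: cvgD; apply: cvgM; [exact: fr|exact: gi|exact: fi|exact: gr].
Qed.

Lemma ccont_cst (c : R[i]) : ccont (fun=> c : R[i]).
Proof. exact: cder_ccont (cder_cst _). Qed.

Lemma ccont_sum (I : Type) (s : seq I) (P : pred I) (F : I -> R -> R[i]) :
  (forall i, P i -> ccont (F i)) -> ccont (fun x => \sum_(i <- s | P i) F i x).
Proof.
move=> h; elim: s => [|i s IH].
  rewrite (_ : (fun _ => _) = fun=> 0); last by apply/funext => x; rewrite big_nil.
  exact: ccont_cst.
rewrite (_ : (fun _ => _) = fun x =>
   (if P i then F i x else 0) + \sum_(j <- s | P j) F j x); last first.
  by apply/funext => x; rewrite big_cons; case: ifP => //; rewrite add0r.
apply: ccontD => //; case: (boolP (P i)) => [/h//|_]; exact: ccont_cst.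
Qed.

Lemma ccont_comp f (s t : R) : ccont f -> ccont (fun x => f (s * x + t)).
Proof.
move=> [fr fi]; split=> x.
  apply: (@continuous_comp _ _ _ (fun x => s * x + t) (Ref f)); last exact: fr.
  by apply: cvgD; [apply: cvgMr; exact: cvg_id|exact: cvg_cst].
apply: (@continuous_comp _ _ _ (fun x => s * x + t) (Imf f)); last exact: fi.
by apply: cvgD; [apply: cvgMr; exact: cvg_id|exact: cvg_cst].
Qed.

Lemma C_D n f g : C_ n f -> C_ n g -> C_ n (fun x => f x + g x).
Proof.
elim: n f g => [|n IH] f g.
  by rewrite !C0E; exact: ccontD.
move=> /C_inv[f' ff' hf] /C_inv[g' gg' hg].
by apply: C_S (cderD ff' gg') _; exact: IH.
Qed.

Lemma C_M n f g : C_ n f -> C_ n g -> C_ n (fun x => f x * g x).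
Proof.
elim: n f g => [|n IH] f g.
  by rewrite !C0E; exact: ccontM.
move=> hf1 hg1; move: (hf1) (hg1) => /C_inv[f' ff' hf] /C_inv[g' gg' hg].
apply: C_S (cderM ff' gg') _; apply: C_D; apply: IH => //.
- exact: C_le (leqnSn n) hg1.
- exact: C_le (leqnSn n) hf1.
Qed.

Lemma C_comp n f (s t : R) : C_ n f -> C_ n (fun x => f (s * x + t)).
Proof.
elim: n f => [|n IH] f.
  by rewrite !C0E; exact: ccont_comp.
move=> /C_inv[f' ff' hf]; apply: C_S (cder_comp s t ff') _.
apply: C_M; last exact: IH.
exact: (@smooth_tower _ (fun j => if j is 0%N then fun=> s%:C else fun=> 0))
  (fun j => if j is 0%N then cder_cst _ else cder_cst _) n.
Qed.

Lemma C_cst n (c : R[i]) : C_ n (fun=> c : R[i]).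
Proof.
elim: n c => [|n IH] c; first by rewrite C0E; exact: ccont_cst.
exact: C_S (cder_cst c) (IH 0).
Qed.

Lemma C_sum n (I : Type) (s : seq I) (P : pred I) (F : I -> R -> R[i]) :
  (forall i, P i -> C_ n (F i)) -> C_ n (fun x => \sum_(i <- s | P i) F i x).
Proof.
move=> h; elim: s => [|i s IH].
  rewrite (_ : (fun _ => _) = fun=> 0); last by apply/funext => x; rewrite big_nil.
  exact: C_cst.
rewrite (_ : (fun _ => _) = fun x =>
   (if P i then F i x else 0) + \sum_(j <- s | P j) F j x); last first.
  by apply/funext => x; rewrite big_cons; case: ifP => //; rewrite add0r.
apply: C_D => //; case: (boolP (P i)) => [/h//|_]; exact: C_cst.
Qed.

Lemma smoothD f g : smooth f -> smooth g -> smooth (fun x => f x + g x).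
Proof. by move=> hf hg n; exact: C_D. Qed.

Lemma smoothM f g : smooth f -> smooth g -> smooth (fun x => f x * g x).
Proof. by move=> hf hg n; exact: C_M. Qed.

Lemma smooth_cst (c : R[i]) : smooth (fun=> c : R[i]).
Proof. by move=> n; exact: C_cst. Qed.

Lemma smooth_id : smooth (fun x : R => x%:C).
Proof. by move=> [|n]; [rewrite C0E; exact: cder_ccont (@cder_id R)|exact: C_S (@cder_id R) (C_cst n 1)]. Qed.

Lemma smooth_cis (s : R) : smooth (fun x => cis (s * x)).
Proof.
elim=> [|n IH]; first by rewrite C0E; exact: cder_ccont (cder_cis s).
by apply: C_S (cder_cis s) _; apply: C_M => //; exact: C_cst.
Qed.

Lemma smoothX f n : smooth f -> smooth (fun x => f x ^+ n).
Proof.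
move=> h; elim: n => [|n IH].
  exact: (smooth_cst 1).
rewrite (_ : (fun _ => _) = fun x => f x * f x ^+ n); first exact: smoothM.
by apply/funext => x; rewrite exprS.
Qed.

Lemma smooth_sum (I : Type) (s : seq I) (P : pred I) (F : I -> R -> R[i]) :
  (forall i, P i -> smooth (F i)) -> smooth (fun x => \sum_(i <- s | P i) F i x).
Proof. by move=> h n; apply: C_sum => i Pi; exact: h. Qed.

Lemma smooth_poly (p : {poly R[i]}) : smooth (fun x : R => p.[x%:C]).
Proof.
rewrite (_ : (fun _ => _) = fun x : R => \sum_(i < size p) p`_i * x%:C ^+ i); last first.
  by apply/funext => x; rewrite horner_coef.
apply: smooth_sum => i _; apply: smoothM; first exact: smooth_cst.
exact: smoothX smooth_id.
Qed.

Lemma cder_poly (p : {poly R[i]}) : cder (fun x : R => p.[x%:C]) (fun x => p^`().[x%:C]).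
Proof.
elim/poly_ind: p => [|p c IH].
  rewrite (_ : (fun _ => _) = fun=> 0); last by apply/funext => x; rewrite horner0.
  by apply: cderE (cder_cst 0) _ => x; rewrite deriv0 horner0.
rewrite (_ : (fun _ => _) = fun x : R => p.[x%:C] * x%:C + c); last first.
  by apply/funext => x; rewrite hornerMXaddC.
apply: cderE (cderD (cderM IH (@cder_id R)) (cder_cst c)) _ => x.
by rewrite derivMXaddC !hornerE /=; ring.
Qed.

(* The constant 2 pays for treating the real and imaginary parts separately. *)
Lemma cmvt f f' (M x y : R) : cder f f' ->
  (forall z, Num.min x y <= z <= Num.max x y -> cmod (f' z) <= M) ->
  cmod (f y - f x) <= 2 * `|y - x| * M.
Proof.
move=> h; wlog xy : x y / x <= y.
  move=> W b; have [xy|/ltW yx] := leP x y; first exact: W.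
  by rewrite cmodBC distrC; apply: W => // z; rewrite minC maxC; exact: b.
rewrite (min_idPl xy) (max_idPr xy) => b.
have hr : exists2 c, c \in `[x, y]%R & Ref f y - Ref f x = Ref f' c * (y - x).
  apply: MVT_segment => // [z _|]; first exact: cder_Re.
  by apply: derivable_within_continuous => z _; apply: (@ex_derive _ _ _ _ _ _ _ (cder_Re h z)).
have hi : exists2 c, c \in `[x, y]%R & Imf f y - Imf f x = Imf f' c * (y - x).
  apply: MVT_segment => // [z _|]; first exact: cder_Im.
  by apply: derivable_within_continuous => z _; apply: (@ex_derive _ _ _ _ _ _ _ (cder_Im h z)).
apply: le_trans (cmod_le_ReIm _) _.
case: hr => c; rewrite in_itv /= => cxy ec; case: hi => d; rewrite in_itv /= => dxy ed.
rewrite ReD ImD ReN ImN; rewrite /Ref in ec; rewrite /Imf in ed.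
rewrite ec ed !normrM -mulrA mulr_natl mulr2n [`|y - x| * M]mulrC.
apply: lerD; apply: ler_wpM2r => //.
  exact: le_trans (cmod_Re _) (b _ cxy).
exact: le_trans (cmod_Im _) (b _ dxy).
Qed.

Lemma ccont_bounded f (a b : R) : ccont f ->
  exists2 M : R, 0 <= M & forall x, a <= x <= b -> cmod (f x) <= M.
Proof.
move=> [hr hi]; have [ab|ba] := leP a b; last first.
  by exists 0 => // x /andP[ax xb]; move: (le_trans ax xb); rewrite leNgt ba.
have cont (g : R -> R) : continuous g -> exists2 M : R, 0 <= M &
    forall x, a <= x <= b -> `|g x| <= M.
  move=> cg; have : {within `[a, b], continuous (fun x => `|g x|)}.
    apply: continuous_subspaceT => x.
    by apply: (@continuous_comp _ _ _ g (fun x => `|x|)); [exact: cg|exact: norm_continuous].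
  case/(EVT_max ab) => c _ hc; exists `|g c| => // x xab; exact: hc.
have [M M0 hM] := cont _ hr; have [M' M'0 hM'] := cont _ hi.
exists (M + M'); first exact: addr_ge0.
move=> x xab; apply: le_trans (cmod_le_ReIm _) _; apply: lerD.
  exact: hM.
exact: hM'.
Qed.

End Smoothness.

(** * Polynomial approximation together with derivatives *)

Section Weierstrass.
Variable R : realType.

(* The [n]-th Bernstein operator: the expectation of [g] at a binomial variable
   with parameters [n] and [q], computed one trial at a time. *)
Fixpoint bernstein (C : nzRingType) (q : C) (n : nat) (g : nat -> C) : C :=
  if n is n'.+1 then
    (1 - q) * bernstein q n' g + q * bernstein q n' (fun k => g k.+1)
  else g 0%N.

(** The right-hand side is the mean of A + B (k - s)^2 under the binomial law: variance plus squared
    bias. The centre [s] stays free because conditioning on a success of one trial moves it to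
    [s - 1]. *)
Lemma bernstein_close (t : R) (n : nat) (g : nat -> R[i]) (z : R[i]) (A B s : R) :
  0 <= t <= 1 -> (forall k, cmod (g k - z) <= A + B * (k%:R - s) ^+ 2) ->
  cmod (bernstein t%:C n g - z) <= A + B * (n%:R * t * (1 - t) + (n%:R * t - s) ^+ 2).
Proof.
move=> /andP[t0 t1]; elim: n g s => [|n IH] g s h /=.
  by rewrite !mul0r add0r; exact: h 0%N.
have -> : (1 - t%:C) * bernstein t%:C n g + t%:C * bernstein t%:C n (fun k => g k.+1) - z =
  (1 - t)%:C * (bernstein t%:C n g - z) + t%:C * (bernstein t%:C n (fun k => g k.+1) - z).
  by rewrite rmorphB rmorph1; ring.
apply: le_trans (cmodD _ _) _; rewrite !cmodM !cmodR.
rewrite ger0_norm ?subr_ge0// ger0_norm//.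
have h1 := IH _ _ h.
have h2 : cmod (bernstein t%:C n (fun k => g k.+1) - z) <=
    A + B * (n%:R * t * (1 - t) + (n%:R * t - (s - 1)) ^+ 2).
  apply: IH => k; apply: le_trans (h k.+1) _.
  by rewrite -natr1 (_ : k%:R + 1 - s = k%:R - (s - 1)) //; ring.
apply: le_trans (lerD (ler_wpM2l _ h1) (ler_wpM2l t0 h2)) _; first by rewrite subr_ge0.
by rewrite -natr1 le_eqVlt; apply/orP; left; apply/eqP; ring.
Qed.

Lemma horner_bernstein (q : {poly R[i]}) (n : nat) (g : nat -> R[i]) (x : R[i]) :
  (bernstein q n (fun k => (g k)%:P)).[x] = bernstein q.[x] n g.
Proof. by elim: n g => [|n IH] g /=; rewrite !hornerE // !IH. Qed.

Lemma poly_approx (h h' : R -> R[i]) (K e : R) : 0 < K -> 0 < e ->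
  cder h h' -> ccont h' ->
  exists p : {poly R[i]}, forall x : R, `|x| <= K -> cmod (p.[x%:C] - h x) <= e.
Proof.
move=> K0 e0 hh' ch'.
have [M M0 hM] := ccont_bounded (- K) K ch'.
pose e1 := e / 2; have e10 : 0 < e1 by rewrite divr_gt0.
(* With this [B] the linear bound 2 M |y - x| of [cmvt] is dominated by e1 + B (y - x)^2, by the
   inequality between arithmetic and geometric mean; the quadratic shape is what [bernstein_close]
   accepts. *)
pose B := M ^+ 2 / e1.
have hB x y : `|x| <= K -> `|y| <= K -> cmod (h y - h x) <= e1 + B * (y - x) ^+ 2.
  move=> xK yK; have : cmod (h y - h x) <= 2 * `|y - x| * M.
    apply: cmvt hh' _ => z; rewrite ge_min le_max => hz; apply: hM; move: hz xK yK.
    rewrite !ler_norml => /andP[/orP[?|?] /orP[?|?]] /andP[? ?] /andP[? ?]; lra.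
  move/le_trans; apply; rewrite -(real_normK (num_real (y - x))).
  set d := `|y - x|; rewrite -(ler_pM2l e10) /B.
  have -> : e1 * (e1 + M ^+ 2 / e1 * d ^+ 2) = e1 ^+ 2 + M ^+ 2 * d ^+ 2.
    by field; rewrite gt_eqF.
  have := sqr_ge0 (e1 - M * d); nra.
have [n nB] : exists n : nat, B * K ^+ 2 / e1 <= n.+1%:R.
  exists (Num.truncn (B * K ^+ 2 / e1)); apply/ltW; apply: truncnS_gt.
(* The nodes are clipped at [K] because [bernstein_close] asks for its bound at every natural [k],
   while [h'] is controlled only on [-K, K]. Clipping does not increase the distance to [x]. *)
pose nd k : R := Num.min (- K + 2 * K * k%:R / n.+1%:R) K.
have ndK k : `|nd k| <= K.
  rewrite ler_norml /nd ge_min lexx orbT andbT le_min lerDl divr_ge0 ?mulr_ge0//=.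
  - lra.
  - exact: ltW.
pose q : {poly R[i]} := ((2 * K)^-1)%:C *: ('X + (K%:C)%:P).
exists (bernstein q n.+1 (fun k => (h (nd k))%:P)) => x xK.
rewrite horner_bernstein.
pose t := (x + K) / (2 * K).
have -> : q.[x%:C] = t%:C.
  by rewrite /q !hornerE /= -rmorphD -rmorphM /t mulrC.
have t01 : 0 <= t <= 1.
  move: xK; rewrite ler_norml => /andP[xK1 xK2].
  rewrite /t divr_ge0 ?ler_pdivrMr ?mulr_gt0 ?mul1r//=; lra.
have nz : (n.+1%:R : R) != 0 by rewrite pnatr_eq0.
have xE : x = - K + 2 * K * t by rewrite /t mulrC divfK ?mulf_neq0 ?gt_eqF//; ring.
have := @bernstein_close t n.+1 (fun k => h (nd k)) (h x) e1 (B * (2 * K / n.+1%:R) ^+ 2) (n.+1%:R * t) t01.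
rewrite subrr expr0n addr0 => /(_ _)/le_trans; apply.
  move=> k; apply: le_trans (hB _ _ xK (ndK k)) _; rewrite lerD2l -mulrA ler_wpM2l//.
    by rewrite /B divr_ge0 ?sqr_ge0// ltW.
  rewrite -exprMn (_ : 2 * K / n.+1%:R * (k%:R - n.+1%:R * t) = - K + 2 * K * k%:R / n.+1%:R - x); last first.
    by rewrite xE; field.
  rewrite -(real_normK (num_real (nd k - x))) -(real_normK (num_real (_ - x))).
  rewrite lerXn2r ?nnegrE// /nd.
  have [//|] := leP (- K + 2 * K * k%:R / n.+1%:R) K.
  set y := - K + _ => Ky; move: xK; rewrite ler_norml => /andP[_ xK].
  by rewrite (ger0_norm (_ : 0 <= K - x)) ?(ger0_norm (_ : 0 <= y - x)); lra.
have n0 : (0 : R) < n.+1%:R by [].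
have -> : B * (2 * K / n.+1%:R) ^+ 2 * (n.+1%:R * t * (1 - t)) = 4 * (t * (1 - t)) * (B * K ^+ 2 / n.+1%:R).
  by field.
have hb : B * K ^+ 2 / n.+1%:R <= e1.
  by rewrite ler_pdivrMr// [leRHS]mulrC -ler_pdivrMr.
have t4 : 4 * (t * (1 - t)) <= 1 by have := sqr_ge0 (2 * t - 1); nra.
have b0 : 0 <= B * K ^+ 2 / n.+1%:R.
  by rewrite divr_ge0// mulr_ge0 ?sqr_ge0// /B divr_ge0 ?sqr_ge0// ltW.
have -> : e = e1 + e1 by rewrite /e1; field.
rewrite lerD2l; apply: le_trans hb; rewrite -[leRHS]mul1r; exact: ler_wpM2r.
Qed.

Definition poly_prim (p : {poly R[i]}) : {poly R[i]} :=
  \sum_(i < size p) (p`_i / i.+1%:R) *: 'X^(i.+1).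

Lemma deriv_prim p : (poly_prim p)^`() = p.
Proof.
rewrite /poly_prim raddf_sum /= -[RHS]coefK poly_def; apply: eq_bigr => i _.
rewrite derivZ derivXn -scalerMnr scalerMnl; congr (_ *: _).
by rewrite -mulr_natr divfK// pnatr_eq0.
Qed.

(** Approximating the derivative to order N and integrating the polynomial gains one order, so only
    the case N = 0 needs Bernstein polynomials. *)
Lemma smooth_poly_approx (N : nat) (g : R -> R[i]) (K e : R) : 0 < K -> 0 < e ->
  smooth g -> exists p : {poly R[i]}, forall (j : nat) (x : R), (j <= N)%N ->
    `|x| <= K -> cmod (cderivn j (fun x => p.[x%:C] - g x) x) <= e.
Proof.
move=> K0 e0; elim: N g e e0 => [|N IH] g e e0 sg.
  have [g' gg' cg'] := C_inv (sg 1%N).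
  have [p hp] := poly_approx K0 e0 gg' (proj1 (C0E _) cg').
  by exists p => j x; rewrite leqn0 => /eqP -> xK; rewrite cderivn0; exact: hp.
have gg' := smooth_cder sg 0; rewrite cderivn0 in gg'.
have sg' : smooth (cderivn 1 g).
  exact: (@smooth_tower _ (fun j => cderivn j.+1 g)) (fun j => smooth_cder sg _).
(* Integration from 0 over a length of at most [K] costs the factor 2 K of [cmvt]; the additional 1
   makes [e'] at most [e] for the derivatives themselves. *)
pose e' := e / (1 + 2 * K).
have e'0 : 0 < e' by rewrite divr_gt0// ltr_pwDl// mulr_ge0// ltW.
have [p' hp'] := IH _ _ e'0 sg'.
(* The integration constant makes [p] and [g] agree at 0, where the mean value estimate starts. *)
pose p := poly_prim p' + (g 0 - (poly_prim p').[0])%:P.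
have dp : p^`() = p' by rewrite derivD derivC addr0 deriv_prim.
have d := cderB (cder_poly p) gg'; rewrite dp in d.
have e'e : e' <= e.
  rewrite /e' ler_pdivrMr ?ltr_pwDl ?mulr_ge0 ?(ltW K0)//.
  by rewrite mulrDr mulr1 lerDl mulr_ge0 ?(ltW e0)// mulr_ge0// ltW.
exists p => -[|j] x jN xK; last first.
  by rewrite (cderivnS _ d); apply: le_trans e'e; exact: hp'.
rewrite cderivn0; have := @cmvt _ _ _ e' 0 x d.
have -> : p.[0%:C] - g 0 = 0.
  by rewrite /p hornerD hornerC rmorph0; ring.
rewrite !subr0 => /(_ _)/le_trans; apply.
  move=> z; rewrite ge_min le_max => hz.
  have zK : `|z| <= K.
    by move: hz xK; rewrite !ler_norml => /andP[/orP[?|?] /orP[?|?]] /andP[? ?]; lra.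
  by have := hp' 0%N z (leq0n _) zK; rewrite cderivn0.
apply: (@le_trans _ _ (2 * K * e')); first by apply: ler_wpM2r; [exact: ltW|apply: ler_wpM2l].
have eE : e = (1 + 2 * K) * e' by rewrite mulrC /e' divfK// gt_eqF// ltr_pwDl// mulr_ge0// ltW.
rewrite [leRHS]eE -subr_ge0 (_ : _ - _ = e'); first exact: ltW.
by ring.
Qed.

End Weierstrass.

(** * Compactly supported distributions *)

Section FourierInjective.
Variable R : realType.
Implicit Types (T : (R -> R[i]) -> R[i]) (f g : R -> R[i]).

Lemma dist_lin T (c : R[i]) f g : cs_distribution T -> smooth f -> smooth g ->
  T (fun x => c * f x + g x) = c * T f + T g.
Proof. by case=> h _; exact: h. Qed.

Lemma dist_cst0 T : cs_distribution T -> T (fun=> 0) = 0.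
Proof.
move=> hT; have := dist_lin (-1) hT (smooth_cst 0) (smooth_cst 0).
by under eq_fun do rewrite mulr0 addr0; rewrite mulN1r addNr.
Qed.

Lemma distZ T (c : R[i]) f : cs_distribution T -> smooth f ->
  T (fun x => c * f x) = c * T f.
Proof.
move=> hT sf; have := dist_lin c hT sf (smooth_cst 0).
by under eq_fun do rewrite addr0; rewrite dist_cst0 // addr0.
Qed.

Lemma distD T f g : cs_distribution T -> smooth f -> smooth g ->
  T (fun x => f x + g x) = T f + T g.
Proof.
move=> hT sf sg; have := dist_lin 1 hT sf sg.
by under eq_fun do rewrite mul1r; rewrite mul1r.
Qed.

Lemma dist_sum T (I : Type) (s : seq I) (F : I -> R -> R[i]) :
  cs_distribution T -> (forall i, smooth (F i)) ->
  T (fun x => \sum_(i <- s) F i x) = \sum_(i <- s) T (F i).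
Proof.
move=> hT h; elim: s => [|i s IH].
  by under eq_fun do rewrite big_nil; rewrite big_nil dist_cst0.
under eq_fun do rewrite big_cons.
by rewrite big_cons distD ?IH //; exact: smooth_sum.
Qed.

(** Positive constants may be assumed: enlarging [K] asks more of the test function, and [M] is
    nonnegative since it bounds a modulus at 0. *)
Lemma dist_bound T : cs_distribution T ->
  exists (N : nat) (K c : R), [/\ 0 < K, 0 < c &
    forall f M, smooth f ->
      (forall j x, (j <= N)%N -> `|x| <= K -> cmod (cderivn j f x) <= M) ->
      cmod (T f) <= c * M].
Proof.
move=> [_ [N [K [c h]]]]; exists N, (`|K| + 1), (`|c| + 1); split.
- by have := normr_ge0 K; lra.
- by have := normr_ge0 c; lra.
move=> f M sf hf.
have M0 : 0 <= M.
  by apply: le_trans (hf 0%N 0 (leq0n _) _); rewrite ?cmod_ge0 ?normr0 ?addr_ge0.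
apply: (@le_trans _ _ (c * M)).
  apply: h => // j x jN xK; apply: hf => //; apply: le_trans xK _.
  by apply: le_trans (ler_norm _) _; rewrite lerDl.
by apply: ler_wpM2r => //; apply: le_trans (ler_norm _) _; rewrite lerDl.
Qed.

(** The remainder of e^(-i x xi) after [j] terms of its series. Differentiation in x multiplies by
    -i xi and lowers [j], so bounds on the remainders alone control all derivatives. *)
Definition cis_rem (xi : R) (j : nat) (x : R) : R[i] :=
  cis (- (x * xi)) - \sum_(i < j) (- ('i * xi%:C)) ^+ i / i`!%:R * x%:C ^+ i.

Lemma cisN_smooth (xi : R) : smooth (fun x => cis (- (x * xi))).
Proof.
rewrite (_ : (fun _ => _) = fun x => cis (- xi * x)); first exact: smooth_cis.
by apply/funext => x; rewrite mulNr mulrC.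
Qed.

Lemma smooth_monom (c : R[i]) i : smooth (fun x => c * x%:C ^+ i).
Proof. by apply: smoothM; [exact: smooth_cst|exact: smoothX (@smooth_id R)]. Qed.

Lemma cis_rem_smooth (xi : R) j : smooth (cis_rem xi j).
Proof.
apply: smoothD; first exact: cisN_smooth.
rewrite (_ : (fun _ => _) = fun x => -1 * \sum_(i < j) (- ('i * xi%:C)) ^+ i / i`!%:R * x%:C ^+ i).
  apply: smoothM; first exact: smooth_cst.
  by apply: smooth_sum => i _; exact: smooth_monom.
by apply/funext => x; rewrite mulN1r.
Qed.

Lemma cder_cisN (xi : R) : cder (fun x => cis (- (x * xi)))
  (fun x => - ('i * xi%:C) * cis (- (x * xi))).
Proof.
rewrite (_ : (fun x => cis _) = fun x => cis (- xi * x)); last first.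
  by apply/funext => x; rewrite mulNr mulrC.
apply: cderE (cder_cis _) _ => x.
by rewrite [- xi * x]mulrC mulrN rmorphN /=; ring.
Qed.

Lemma cder_cis_rem (xi : R) j :
  cder (cis_rem xi j) (fun x => - ('i * xi%:C) * cis_rem xi j.-1 x).
Proof.
have hs := cder_sum (index_enum 'I_j) (P := predT)
  (F := fun i x => (- ('i * xi%:C)) ^+ i / i`!%:R * x%:C ^+ i)
  (fun i _ => cderZ _ (cderX i (@cder_id R))).
apply: cderE (cderB (cder_cisN xi) hs) _ => x /=.
rewrite /cis_rem mulrBr; congr (_ - _); case: j {hs} => [|j] /=.
  by rewrite !big_ord0 mulr0.
rewrite big_ord_recl /= !mul0r mulr0 add0r mulr_sumr; apply: eq_bigr => i _.
rewrite /bump /= add1n add0n exprS factS natrM mulr1.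
have ne1 : (i.+1%:R : R[i]) != 0 by rewrite pnatr_eq0.
have ne2 : (i`!%:R : R[i]) != 0 by rewrite pnatr_eq0 -lt0n fact_gt0.
by field; rewrite nat1r ne1 ne2.
Qed.

Lemma cis_rem_le (xi K x : R) j : `|x| <= K ->
  cmod (cis_rem xi j x) <= (2 * K * `|xi|) ^+ j.
Proof.
elim: j x => [|j IH] x xK; first by rewrite /cis_rem big_ord0 subr0 cmod_cis expr0.
have := @cmvt _ _ _ (`|xi| * (2 * K * `|xi|) ^+ j) 0 x (cder_cis_rem xi j.+1).
have -> : cis_rem xi j.+1 0 = 0.
  rewrite /cis_rem mul0r oppr0 cis0 big_ord_recl /= expr0 fact0 divr1 mulr1.
  by rewrite big1 ?addr0 ?subrr // => i _; rewrite rmorph0 expr0n mulr0.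
rewrite !subr0 => /(_ _)/le_trans; apply.
  move=> z; rewrite ge_min le_max => hz; rewrite cmodM cmodN cmodM cmodi mul1r cmodR.
  apply: ler_wpM2l => //; apply: IH.
  by move: hz xK; rewrite !ler_norml => /andP[/orP[?|?] /orP[?|?]] /andP[? ?]; lra.
rewrite exprS -!mulrA; apply: ler_wpM2l => //.
have K0 : 0 <= K := le_trans (normr_ge0 _) xK.
by apply: ler_wpM2r xK; rewrite !mulr_ge0 // exprn_ge0 // !mulr_ge0.
Qed.

Lemma cderivn_cis_rem (xi : R) j n :
  cderivn n (cis_rem xi j) = fun x => (- ('i * xi%:C)) ^+ n * cis_rem xi (j - n) x.
Proof.
pose F n x := (- ('i * xi%:C)) ^+ n * cis_rem xi (j - n) x.
have F0 : F 0%N = cis_rem xi j by apply/funext => x; rewrite /F expr0 mul1r subn0.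
rewrite -F0; apply: (@cderivnE _ n F _ n (leqnn n)) => k _.
apply: cderE (cderZ _ (cder_cis_rem xi (j - k))) _ => x.
by rewrite /F subnS exprSr mulrA.
Qed.

(** Once the lower monomials are killed, [T] maps the remainder of order j + 1 to a constant times
    xi^j T(x^j), whereas continuity of [T] bounds this value by a constant times xi^(j+1). Small xi
    forces T(x^j) = 0. *)
Lemma dist_monom0 T j : cs_distribution T -> (forall xi, fourier T xi = 0) ->
  T (fun x => x%:C ^+ j) = 0.
Proof.
move=> hT h0; have [N [K [c [K0 c0 hb]]]] := dist_bound hT.
elim/ltn_ind: j => j IH.
pose B := (2 * K + 1) ^+ j.+1.
have key (xi : R) : 0 < xi <= 1 -> cmod (T (fun x => x%:C ^+ j)) <= j`!%:R * c * B * xi.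
  move=> /andP[xi0 xi1].
  have eT : T (cis_rem xi j.+1) = - ((- ('i * xi%:C)) ^+ j / j`!%:R * T (fun x => x%:C ^+ j)).
    rewrite (_ : cis_rem xi j.+1 = fun x => -1 * (\sum_(i < j.+1)
       (- ('i * xi%:C)) ^+ i / i`!%:R * x%:C ^+ i) + cis (- (x * xi))); last first.
      by apply/funext => x; rewrite mulN1r addrC.
    rewrite dist_lin //; [|by apply: smooth_sum => i _; exact: smooth_monom
                          |exact: cisN_smooth].
    have := h0 xi; rewrite /fourier => ->; rewrite addr0 mulN1r; congr (- _).
    rewrite dist_sum //; last by move=> i; exact: smooth_monom.
    rewrite big_ord_recr /= big1 ?add0r; last first.
      move=> i _; rewrite distZ //; last exact: smoothX (@smooth_id R).
      by rewrite IH ?mulr0.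
    by rewrite distZ //; exact: smoothX (@smooth_id R).
  have : cmod (T (cis_rem xi j.+1)) <= c * (B * xi ^+ j.+1).
    apply: hb; first exact: cis_rem_smooth.
    move=> n x nN xK; rewrite cderivn_cis_rem cmodM cmodX cmodN cmodM cmodi mul1r.
    rewrite cmodR gtr0_norm//.
    (* Derivatives up to order j + 1 share the powers of xi with the remainder that is left; beyond
       it the remainder is the exponential itself and xi^n is at most xi^(j+1), because xi is at
       most 1. *)
    have [nj|jn] := leqP n j.+1.
      rewrite -[in xi ^+ j.+1](subnKC nj) exprD mulrCA; apply: ler_wpM2l.
        by rewrite exprn_ge0 // ltW.
      apply: le_trans (cis_rem_le _ _ xK) _.
      rewrite gtr0_norm// exprMn; apply: ler_wpM2r; first by rewrite exprn_ge0 // ltW.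
      apply: (@le_trans _ _ ((2 * K + 1) ^+ (j.+1 - n))).
        by apply: lerXn2r; rewrite ?nnegrE; nra.
      by apply: ler_weXn2l; [nra|rewrite leq_subr].
    rewrite (eqP (ltnW jn : (j.+1 - n == 0)%N)) /cis_rem big_ord0 subr0 cmod_cis mulr1.
    apply: (@le_trans _ _ (xi ^+ j.+1)); first by apply: ler_wiXn2l; rewrite ?(ltW xi0)// ltnW.
    rewrite -[leLHS]mul1r; apply: ler_wpM2r; first by rewrite exprn_ge0 // ltW.
    by apply: exprn_ege1; nra.
  rewrite eT cmodN !cmodM cmodV cmodX cmodN cmodM cmodi mul1r cmodR cmod_nat gtr0_norm//.
  set t := cmod (T _) => hle.
  have f0 : (0 : R) < j`!%:R by rewrite ltr0n fact_gt0.
  have xj : 0 < xi ^+ j by rewrite exprn_gt0.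
  rewrite -(ler_pM2l xj) -(ler_pM2l (_ : 0 < (j`!%:R)^-1)) ?invr_gt0//.
  rewrite exprSr in hle; apply: le_trans (le_trans _ hle) _.
    by rewrite le_eqVlt; apply/orP; left; apply/eqP; ring.
  rewrite le_eqVlt; apply/orP; left; apply/eqP; field; exact: lt0r_neq0.
apply/eqP; rewrite -cmod_eq0 eq_le cmod_ge0 andbT leNgt; apply/negP => t0.
set t := cmod _ in t0 key.
set D := j`!%:R * c * B in key.
have D1 : 0 <= D by rewrite /D !mulr_ge0 // ?ltW // exprn_gt0 //; nra.
pose xi := Num.min 1 (t / (2 * (D + 1))).
have xi0 : 0 < xi by rewrite /xi lt_min ltr01 divr_gt0 // mulr_gt0 // ltr_pwDr.
have := key xi; rewrite xi0 ge_min lexx => /(_ isT).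
have : xi <= t / (2 * (D + 1)) by rewrite /xi ge_min lexx orbT.
rewrite ler_pdivlMr ?mulr_gt0 ?ltr_pwDr// => h1 h2; nra.
Qed.

(* The vanishing Fourier transform kills monomials, by Taylor expansion at 0, and
   polynomials are dense by Bernstein approximation of a high derivative. *)
Theorem dist_inj T g : cs_distribution T -> (forall xi, fourier T xi = 0) ->
  smooth g -> T g = 0.
Proof.
move=> hT h0 sg; have [N [K [c [K0 c0 hb]]]] := dist_bound hT.
apply/eqP; rewrite -cmod_eq0 eq_le cmod_ge0 andbT leNgt; apply/negP => t0.
have e0 : 0 < cmod (T g) / (2 * c) by rewrite divr_gt0 // mulr_gt0.
have [p hp] := smooth_poly_approx N K0 e0 sg.
have Tp : T (fun x => p.[x%:C]) = 0.
  under eq_fun do rewrite horner_coef.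
  rewrite dist_sum //; last by move=> i; exact: smooth_monom.
  apply: big1 => i _; rewrite distZ //; last exact: smoothX (@smooth_id R).
  by rewrite dist_monom0 ?mulr0.
have := hb (fun x => p.[x%:C] - g x) _ _ hp.
have -> : T (fun x => p.[x%:C] - g x) = - T g.
  rewrite (_ : (fun x => _) = fun x => -1 * g x + p.[x%:C]); last first.
    by apply/funext => x; rewrite mulN1r addrC.
  by rewrite dist_lin // ?Tp ?addr0 ?mulN1r //; exact: smooth_poly.
rewrite cmodN => /(_ _)/wrap[].
  rewrite (_ : (fun x => _) = fun x => p.[x%:C] + -1 * g x); last first.
    by apply/funext => x; rewrite mulN1r.
  apply: smoothD; first exact: smooth_poly.
  by apply: smoothM => //; exact: smooth_cst.
apply/negP; rewrite -ltNge (_ : c * _ = cmod (T g) / 2).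
  by rewrite ltr_pdivrMr // ltr_pMr // ltr1n.
by field; rewrite gt_eqF.
Qed.

End FourierInjective.

(** * Sequences, masks and moments *)

Section IntegerSums.
Variable V : zmodType.
Implicit Types (f g : int -> V) (N M : nat).

(** An explicit radius in place of [fin_supp]: it reduces sums over all integers to one list and
    turns the bookkeeping for convolution and subdivision into integer arithmetic. *)
Definition supp N f := forall k, (N < `|k|)%N -> f k = 0.

Definition int_range N : seq int := [seq i%:Z - N%:Z | i <- iota 0 (N.*2).+1].

Lemma mem_int_range N k : (k \in int_range N) = (`|k| <= N)%N.
Proof.
apply/mapP/idP => [[i +]|kN]; first by rewrite mem_iota => /andP[_ h] ->; lia.
by exists (absz (k + N%:Z)%R); rewrite ?mem_iota; lia.
Qed.

Lemma int_range_uniq N : uniq (int_range N).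
Proof. by rewrite map_inj_uniq ?iota_uniq // => i j; lia. Qed.

Lemma size_int_range N : size (int_range N) = (N.*2).+1.
Proof. by rewrite size_map size_iota. Qed.

Lemma Zsum_seq N f : supp N f ->
  \sum_(k \in [set: int]) f k = \sum_(k <- int_range N) f k.
Proof.
move=> h; rewrite (fsbigE (int_range N)) ?int_range_uniq //.
  by apply: eq_bigl => k; rewrite in_setT.
by move=> k _; rewrite mem_int_range -ltnNge; exact: h.
Qed.

Lemma supp_le N M f : (N <= M)%N -> supp N f -> supp M f.
Proof. by move=> NM h k kM; apply: h; exact: leq_ltn_trans kM. Qed.

Lemma ZsumD N f g : supp N f -> supp N g ->
  \sum_(k \in [set: int]) (f k + g k) =
  \sum_(k \in [set: int]) f k + \sum_(k \in [set: int]) g k.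
Proof.
move=> hf hg; rewrite !(@Zsum_seq N) ?big_split // => k kN.
by rewrite hf // hg // addr0.
Qed.

Lemma ZsumN N f : supp N f ->
  \sum_(k \in [set: int]) - f k = - \sum_(k \in [set: int]) f k.
Proof.
move=> hf; rewrite !(@Zsum_seq N) ?sumrN // => k kN.
by rewrite hf // oppr0.
Qed.

Lemma ZsumB N f g : supp N f -> supp N g ->
  \sum_(k \in [set: int]) (f k - g k) =
  \sum_(k \in [set: int]) f k - \sum_(k \in [set: int]) g k.
Proof.
move=> hf hg; rewrite (@ZsumD N) ?(@ZsumN N) // => k kN.
by rewrite hg // oppr0.
Qed.

Lemma Zsum_shift (c : int) f :
  \sum_(k \in [set: int]) f (k + c) = \sum_(k \in [set: int]) f k.
Proof.
rewrite [RHS](reindex_fsbigT (fun k => k + c)) //.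
by exists (fun k => k - c) => k; [rewrite addrK|rewrite subrK].
Qed.

Lemma Zsum_rev (c : int) f :
  \sum_(k \in [set: int]) f (c - k) = \sum_(k \in [set: int]) f k.
Proof.
rewrite [RHS](reindex_fsbigT (fun k => c - k)) //.
by exists (fun k => c - k) => k; rewrite opprB addrC subrK.
Qed.

Lemma Zsum_swap N (F : int -> int -> V) :
  (forall i j, (N < `|i|)%N || (N < `|j|)%N -> F i j = 0) ->
  \sum_(i \in [set: int]) \sum_(j \in [set: int]) F i j =
  \sum_(j \in [set: int]) \sum_(i \in [set: int]) F i j.
Proof.
move=> h.
have h1 i : supp N (F i) by move=> j jN; apply: h; rewrite jN orbT.
have h2 j : supp N (fun i => F i j) by move=> i iN; apply: h; rewrite iN.
transitivity (\sum_(i <- int_range N) \sum_(j <- int_range N) F i j).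
  rewrite (@Zsum_seq N); first by apply: eq_bigr => i _; exact: Zsum_seq.
  by move=> i iN; rewrite (Zsum_seq (h1 i)) big1 // => j _; apply: h; rewrite iN.
rewrite exchange_big (@Zsum_seq N) /=.
  by apply: eq_bigr => i _; rewrite (Zsum_seq (h2 _)).
by move=> i iN; rewrite (Zsum_seq (h2 i)) big1 // => j _; apply: h; rewrite iN orbT.
Qed.

Lemma Zsum1 (k0 : int) f : (forall k, k != k0 -> f k = 0) ->
  \sum_(k \in [set: int]) f k = f k0.
Proof.
move=> h; rewrite (fsbigE [:: k0]) //=.
  by rewrite big_cons big_nil in_setT addr0.
by move=> k _; rewrite inE; exact: h.
Qed.

(** Applied to a sum and to its alternating version, this separates the even from the odd half; the
    sum rules are exploited in this form. *)
Lemma Zsum_parity N f : supp N f -> \sum_(k \in [set: int]) f k =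
  \sum_(k \in [set: int]) f (2 * k) + \sum_(k \in [set: int]) f (2 * k + 1).
Proof.
move=> h; pose g b k := f (2 * k + b%:Z).
have hg b : (b < 2)%N -> supp N (g b) by move=> b2 k kN; apply: h; lia.
transitivity (\sum_(k \in [set: int]) (g 0%N k + g 1%N k)); last first.
  rewrite (@ZsumD N); [|exact: hg|exact: hg].
  by congr (_ + _); apply: eq_fsbigr => k _; rewrite /g ?addr0.
have h2 : supp (N.*2.+1) f by apply: supp_le h; lia.
rewrite (Zsum_seq h2) (@Zsum_seq N.+1) => [|k kN]; last by rewrite !hg ?addr0 //; lia.
move: (int_range_uniq N.+1) (mem_int_range N.+1); move: (int_range N.+1) => s us ms.
move: (int_range_uniq N.*2.+1) (mem_int_range N.*2.+1); move: (int_range N.*2.+1) => s' us' ms'.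
rewrite big_split /= /g.
rewrite -[X in _ = X + _](big_map (fun k => 2 * k + 0) xpredT f).
rewrite -[X in _ = _ + X](big_map (fun k => 2 * k + 1) xpredT f) -big_cat /=.
rewrite [RHS](bigID (fun k => (`|k| <= N.*2.+1)%N)) /= [X in _ = _ + X]big1 ?addr0; last first.
  by move=> k; rewrite -ltnNge => kN; apply: h; lia.
rewrite -[RHS]big_filter; apply: perm_big; apply: uniq_perm.
- exact: us'.
- apply: filter_uniq; rewrite cat_uniq !map_inj_uniq ?us ?andbT /=; try by move=> x y; lia.
  by apply/hasPn => x /mapP[y _ ->]; apply/mapP => -[z _]; lia.
move=> k; rewrite mem_filter mem_cat ms'.
case: (boolP (`|k| <= N.*2.+1)%N) => //= kN; apply/esym/orP.
have [kodd|keven] := boolP (odd `|k|).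
  right; apply/mapP; exists ((k - 1) %/ 2)%Z; last by lia.
  by rewrite ms; lia.
left; apply/mapP; exists (k %/ 2)%Z; last by lia.
by rewrite ms; lia.
Qed.

End IntegerSums.

Lemma Zsum_hom (V W : zmodType) (h : V -> W) N (f : int -> V) : supp N f ->
  h 0 = 0 -> {morph h : x y / x + y} ->
  h (\sum_(k \in [set: int]) f k) = \sum_(k \in [set: int]) h (f k).
Proof.
move=> hf h0 hD; rewrite (Zsum_seq hf) (@Zsum_seq _ N) ?(big_morph h hD h0) //.
by move=> k kN; rewrite hf.
Qed.

Section MatrixSums.
Variable C : comNzRingType.

Lemma Zsum_mulmxl N p q s (A : 'M[C]_(p, q)) (f : int -> 'M[C]_(q, s)) : supp N f ->
  A *m (\sum_(k \in [set: int]) f k) = \sum_(k \in [set: int]) A *m f k.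
Proof.
move=> hf; apply: (Zsum_hom hf); first exact: mulmx0.
by move=> x y; exact: mulmxDr.
Qed.

Lemma Zsum_mulmxr N p q s (f : int -> 'M[C]_(p, q)) (A : 'M[C]_(q, s)) : supp N f ->
  (\sum_(k \in [set: int]) f k) *m A = \sum_(k \in [set: int]) f k *m A.
Proof.
move=> hf; apply: (Zsum_hom (h := fun x => x *m A) hf); first exact: mul0mx.
by move=> x y; exact: mulmxDl.
Qed.

Lemma Zsum_scale N p q (c : C) (f : int -> 'M[C]_(p, q)) : supp N f ->
  c *: (\sum_(k \in [set: int]) f k) = \sum_(k \in [set: int]) c *: f k.
Proof.
move=> hf; apply: (Zsum_hom hf); first exact: scaler0.
by move=> x y; exact: scalerDr.
Qed.

Lemma Zsum_mxE N p q (f : int -> 'M[C]_(p, q)) i j : supp N f ->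
  (\sum_(k \in [set: int]) f k) i j = \sum_(k \in [set: int]) f k i j.
Proof.
move=> hf; apply: (Zsum_hom (h := fun x : 'M[C]_(p, q) => x i j) hf).
  by rewrite mxE.
by move=> x y; rewrite mxE.
Qed.

Lemma Zsum_mulr N (c : C) (f : int -> C) : supp N f ->
  c * (\sum_(k \in [set: int]) f k) = \sum_(k \in [set: int]) c * f k.
Proof.
move=> hf; apply: (Zsum_hom hf); first exact: mulr0.
by move=> x y; exact: mulrDr.
Qed.

End MatrixSums.

Lemma fin_suppP (R : realType) s r (u : int -> 'M[R[i]]_(s, r)) :
  fin_supp u <-> exists N, supp N u.
Proof.
split=> [/finite_seqP[l ul]|[N hN]].
  exists (\max_(k <- l) `|k|)%N => k kl; apply/eqP/negP => /negP uk.
  have kl' : k \in l by have : [set k | u k != 0] k by []; rewrite ul.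
  by move: kl; rewrite ltnNge (@leq_bigmax_seq _ l xpredT (fun k : int => `|k|%N)).
apply: (@sub_finite_set _ _ [set` int_range N]); last exact: finite_seq.
move=> k /= uk; rewrite mem_int_range leqNgt; apply/negP => kN.
by move: uk; rewrite hN // eqxx.
Qed.

(** * Powers of the subdivision operator and the transition operators *)

Section SubdivisionPowers.
Variables (R : realType) (r : nat) (a : int -> 'M[R[i]]_r) (Na : nat).
Hypothesis supp_a : supp Na a.
Local Notation C := R[i].

Definition Apow (n : nat) : int -> 'M[C]_r := iter n (subdiv a) (dirac_mx R r).

Lemma ApowS n k : Apow n.+1 k = 2 *: \sum_(j \in [set: int]) Apow n j *m a (k - 2 * j).
Proof. by []. Qed.

(** The predecessor is what makes the induction close: 2 (2^n - 1) + 1 = 2^(n+1) - 1. *)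
Lemma Apow_supp_strong n : supp (Na * (2 ^ n).-1)%N (Apow n).
Proof.
elim: n => [|n IH] k kN.
  by rewrite /Apow /= /dirac_mx; case: eqP => // k0; move: kN; rewrite k0.
rewrite ApowS fsbig1 ?scaler0 // => j _.
have [jN|jN] := ltnP (Na * (2 ^ n).-1)%N `|j|; first by rewrite IH ?mul0mx.
rewrite supp_a ?mulmx0 //; move: kN jN; rewrite expnS.
move: (expn_gt0 2 n); case: (2 ^ n)%N => //= p _; nia.
Qed.

Lemma Apow_supp n : supp (Na * 2 ^ n)%N (Apow n).
Proof. by apply: supp_le (@Apow_supp_strong n); rewrite leq_mul2l leq_pred orbT. Qed.

Lemma subdiv_supp s (w : int -> 'M[C]_(s, r)) N : supp N w -> supp (2 * N + Na) (subdiv a w).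
Proof.
move=> hw k kN; rewrite /subdiv fsbig1 ?scaler0 // => j _.
have [jN|jN] := ltnP N `|j|; first by rewrite hw ?mul0mx.
by rewrite supp_a ?mulmx0 //; lia.
Qed.

(** Subdivision turns a shift by one into a shift by two, so [n] steps applied to arbitrary data
    superpose the translates of A_n by multiples of 2^n. No support condition on [w] is needed, as
    A_n is finitely supported. *)
Lemma iter_subdivE s (w : int -> 'M[C]_(s, r)) n k :
  iter n (subdiv a) w k = \sum_(j \in [set: int]) w j *m Apow n (k - (2 ^ n)%N%:Z * j).
Proof.
elim: n k => [|n IH] k.
  rewrite (Zsum1 (k0 := k)) /=; first by rewrite /Apow /= mul1r subrr mulmx1.
  by move=> j /eqP jk; rewrite /Apow /= /dirac_mx; case: eqP => [|_]; [lia|rewrite mulmx0].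
rewrite iterS /subdiv.
under eq_fsbigr do rewrite IH.
have p0 : (0 < 2 ^ n)%N by rewrite expn_gt0.
set N := (`|k| + Na + Na)%N.
have sW j : supp (`|j| + Na)%N (fun i => w i *m Apow n (j - (2 ^ n)%N%:Z * i)).
  move=> i iN; rewrite Apow_supp ?mulmx0 //; move: p0 iN.
  by case: (2 ^ n)%N => // p _; nia.
have sA i : supp (Na * 2 ^ n)%N (fun j => Apow n j *m a (k - (2 ^ n.+1)%N%:Z * i - 2 * j)).
  by move=> j jN; rewrite Apow_supp ?mul0mx.
transitivity (2 *: \sum_(j \in [set: int]) \sum_(i \in [set: int])
   w i *m Apow n (j - (2 ^ n)%N%:Z * i) *m a (k - 2 * j)).
  by congr (_ *: _); apply: eq_fsbigr => j _; rewrite (Zsum_mulmxr _ (sW j)).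
rewrite (@Zsum_swap _ N); last first.
  move=> j i h; have [jN|jN] := ltnP (`|k| + Na)%N `|j|.
    by rewrite supp_a ?mulmx0 //; lia.
  rewrite Apow_supp ?mulmx0 ?mul0mx //; move: p0 h jN; rewrite /N.
  by case: (2 ^ n)%N => // p _; nia.
rewrite (@Zsum_scale _ (`|k| + Na + Na)%N); last first.
  move=> i iN; apply: fsbig1 => j _; have [jN|jN] := ltnP (`|k| + Na)%N `|j|.
    by rewrite supp_a ?mulmx0 //; lia.
  rewrite Apow_supp ?mulmx0 ?mul0mx //; move: p0 iN jN; rewrite /N.
  by case: (2 ^ n)%N => // p _; nia.
apply: eq_fsbigr => i _; rewrite ApowS -scalemxAr; congr (_ *: _).
rewrite -(Zsum_shift ((2 ^ n)%N%:Z * i)) (Zsum_mulmxl _ (sA i)).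
apply: eq_fsbigr => j _; rewrite mulmxA; congr (_ *m _ *m a _).
  by congr Apow; lia.
by rewrite expnS; lia.
Qed.

Lemma seq_conv_Apow_refine (F : R -> 'cV[C]_r) n x :
  (forall x, F x = 2 *: \sum_(k \in [set: int]) a k *m F (2 * x - k%:~R)) ->
  F x = \sum_(j \in [set: int]) Apow n j *m F (2 ^+ n * x - j%:~R).
Proof.
move=> hF; elim: n x => [|n IH] x.
  rewrite (Zsum1 (k0 := 0)) /=.
    by rewrite /Apow /= /dirac_mx eqxx mul1mx expr0 mul1r subr0.
  by move=> j /negPf j0; rewrite /Apow /= /dirac_mx j0 mul0mx.
rewrite IH; set N := (Na * 2 ^ n)%N; set M := (2 * N + Na)%N.
have s1 y : supp Na (fun k => a k *m F (y - k%:~R)) by move=> k kN; rewrite supp_a ?mul0mx.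
transitivity (\sum_(j \in [set: int]) \sum_(k \in [set: int])
   2 *: (Apow n j *m a (k - 2 * j) *m F (2 ^+ n.+1 * x - k%:~R))).
  apply: eq_fsbigr => j _; rewrite hF -scalemxAr (Zsum_mulmxl _ (s1 _)).
  rewrite -[X in _ *: X](Zsum_shift (- (2 * j))) -(@Zsum_scale _ (absz (2 * j)%R + Na)%N).
    congr (_ *: _); apply: eq_fsbigr => k _; rewrite mulmxA; congr (_ *m F _).
    rewrite exprS !rmorphB !rmorphM /=; ring.
  by move=> k kN; rewrite supp_a ?mulmx0 ?mul0mx //; lia.
rewrite (@Zsum_swap _ M); last first.
  move=> j k h; have [jN|jN] := ltnP N `|j|; first by rewrite Apow_supp ?mul0mx ?scaler0.
  by rewrite supp_a ?mulmx0 ?mul0mx ?scaler0 //; lia.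
apply: eq_fsbigr => k _; rewrite ApowS -scalemxAl (@Zsum_mulmxr _ N); last first.
  by move=> j jN; rewrite Apow_supp ?mul0mx.
rewrite (@Zsum_scale _ N) // => j jN.
by rewrite Apow_supp ?mul0mx.
Qed.

Lemma refine_dyadic (F : R -> 'cV[C]_r) n (k : int) :
  (forall x, F x = 2 *: \sum_(k \in [set: int]) a k *m F (2 * x - k%:~R)) ->
  F (2 ^- n * k%:~R) = seq_conv (Apow n) (fun j => F j%:~R) k.
Proof.
move=> hF; rewrite (seq_conv_Apow_refine n _ hF) /seq_conv -[LHS](Zsum_rev k).
apply: eq_fsbigr => j _; congr (_ *m F _).
by rewrite mulrA divff ?mul1r ?expf_neq0 // rmorphB /= opprB addrC subrK.
Qed.

(* Transition operators: [A_(n+1) * u] at [2 i + g] is [A_n * trans g u] at [i]. *)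
Definition trans (g : int) (u : int -> 'cV[C]_r) : int -> 'cV[C]_r :=
  fun j => 2 *: \sum_(t \in [set: int]) a (2 * j + g - t) *m u t.

(** The map N -> (Na + 1 + N) / 2 fixes [Na.+1] and decreases every larger radius. This is the
    origin of the window used for all finite dimensional arguments. *)
Lemma trans_supp N g u : (`|g| <= 1)%N -> supp N u -> supp ((Na + 1 + N) %/ 2)%N (trans g u).
Proof.
move=> g1 hu j jN; rewrite /trans fsbig1 ?scaler0 // => t _.
have [tN|tN] := ltnP N `|t|; first by rewrite hu ?mulmx0.
by rewrite supp_a ?mul0mx //; lia.
Qed.

Lemma seq_conv_trans n u N g i : supp N u ->
  seq_conv (Apow n.+1) u (2 * i + g) = seq_conv (Apow n) (trans g u) i.
Proof.
move=> hu; rewrite /seq_conv /trans.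
set M := (`|i| + Na * 2 ^ n + N)%N.
transitivity (\sum_(t \in [set: int]) \sum_(j \in [set: int])
   2 *: (Apow n (i - j) *m a (2 * j + g - t) *m u t)).
  apply: eq_fsbigr => t _; rewrite ApowS -scalemxAl.
  have s1 : supp (Na * 2 ^ n)%N (fun j => Apow n j *m a (2 * i + g - t - 2 * j)).
    by move=> j jN; rewrite Apow_supp ?mul0mx.
  rewrite (Zsum_mulmxr _ s1) (@Zsum_scale _ (Na * 2 ^ n)%N) => [|j jN]; last first.
    by rewrite Apow_supp ?mul0mx.
  rewrite -[LHS](Zsum_rev i).
  apply: eq_fsbigr => j _.
  congr (_ *: _).
  congr (_ *m _).
  congr (_ *m _).
  congr (a _).
  by ring.
rewrite (@Zsum_swap _ M); last first.
  move=> t j h; have [tN|tN] := ltnP N `|t|; first by rewrite hu ?mulmx0 ?scaler0.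
  by rewrite Apow_supp ?mul0mx ?scaler0 //; lia.
apply: eq_fsbigr => j _; rewrite -scalemxAr (@Zsum_mulmxl _ N) ?(@Zsum_scale _ N).
- by apply: eq_fsbigr => t _; rewrite mulmxA.
- by move=> t tN; rewrite hu ?mulmx0.
- by move=> t tN; rewrite hu ?mulmx0.
Qed.

End SubdivisionPowers.

(** * Symbols, their derivatives at 0, and moments *)

Section Symbols.
Variable R : realType.
Local Notation C := R[i].

Lemma symbol_seq s r (u : int -> 'M[C]_(s, r)) N xi : supp N u ->
  symbol u xi = \sum_(k <- int_range N) cis (- (k%:~R * xi)) *: u k.
Proof. by move=> hu; apply: Zsum_seq => k kN; rewrite hu ?scaler0. Qed.

(** A symbol is a finite sum of exponentials, each derivative producing a factor -i k. Every
    condition up to O(|xi|^k) thereby becomes a finite set of linear conditions on moments. *)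
Lemma cderivn_symbol s r (u : int -> 'M[C]_(s, r)) N q i j : supp N u ->
  cderivn q (fun xi => symbol u xi i j) 0 =
  (- 'i) ^+ q * \sum_(k \in [set: int]) k%:~R ^+ q * u k i j.
Proof.
move=> hu; have supp_u t : supp N (fun k : int => k%:~R ^+ t * u k i j).
  by move=> k kN; rewrite hu ?mxE ?mulr0.
pose F t xi := \sum_(k <- int_range N)
  (- ('i * k%:~R)) ^+ t * u k i j * cis (- k%:~R * xi).
have -> : (fun xi => symbol u xi i j) = F 0%N.
  apply/funext => xi; rewrite (symbol_seq _ hu) summxE; apply: eq_bigr => k _.
  by rewrite mxE expr0 mul1r mulrC mulNr.
rewrite (@cderivnE _ q F _ q (leqnn q)) => [|t _]; last first.
  apply: cderE (cder_sum _ (fun k _ => cderZ _ (cder_cis _))) _ => x.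
  apply: eq_bigr => k _; rewrite exprSr rmorphN rmorph_int; ring.
rewrite /F (Zsum_seq (supp_u q)) mulr_sumr; apply: eq_bigr => k _.
by rewrite mulr0 cis0 mulr1 -mulNr exprMn mulrA.
Qed.

Lemma i_neq0 : ('i : C) != 0.
Proof. by rewrite -cmod_gt0 cmodi. Qed.

Lemma mx_eqO_symbol s r (u w : int -> 'M[C]_(s, r)) N k : supp N u -> supp N w ->
  mx_eqO k (symbol u) (symbol w) <->
  forall q i j, (q < k)%N -> \sum_(t \in [set: int]) t%:~R ^+ q * u t i j =
                             \sum_(t \in [set: int]) t%:~R ^+ q * w t i j.
Proof.
move=> hu hw; have nz q : (- 'i : C) ^+ q != 0 by rewrite expf_neq0 // oppr_eq0 i_neq0.
split=> [h q i j qk|h i j q qk].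
  by have := h i j q qk; rewrite (cderivn_symbol _ _ _ hu) (cderivn_symbol _ _ _ hw)
    => /(mulfI (nz q)).
by rewrite (cderivn_symbol _ _ _ hu) (cderivn_symbol _ _ _ hw) (h _ i j qk).
Qed.

Lemma symbolZ s r (u : int -> 'M[C]_(s, r)) N c xi : supp N u ->
  symbol (fun k => c *: u k) xi = c *: symbol u xi.
Proof.
move=> hu; rewrite /symbol (@Zsum_scale _ N) => [|k kN]; last by rewrite hu ?scaler0.
by apply: eq_fsbigr => k _; rewrite !scalerA mulrC.
Qed.

Lemma symbol_conv s r t (u : int -> 'M[C]_(s, r)) (w : int -> 'M[C]_(r, t)) N M xi :
  supp N u -> supp M w -> symbol (seq_conv u w) xi = symbol u xi *m symbol w xi.
Proof.
move=> hu hw; rewrite /symbol /seq_conv.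
transitivity (\sum_(k \in [set: int]) \sum_(j \in [set: int])
  cis (- (k%:~R * xi)) *: (u (k - j) *m w j)).
  apply: eq_fsbigr => k _; rewrite (@Zsum_scale _ M) // => j jM.
  by rewrite hw ?mulmx0.
rewrite (@Zsum_swap _ (N + M)); last first.
  move=> k j h; have [jM|jM] := ltnP M `|j|; first by rewrite hw ?mulmx0 ?scaler0.
  by rewrite hu ?mul0mx ?scaler0 //; lia.
rewrite (@Zsum_mulmxl _ M) => [|j jM]; last by rewrite hw ?scaler0.
apply: eq_fsbigr => j _; rewrite (@Zsum_mulmxr _ N) => [|k kN]; last by rewrite hu ?scaler0.
rewrite -[LHS](Zsum_shift j); apply: eq_fsbigr => k _.
rewrite addrK -scalemxAr -scalemxAl scalerA; congr (_ *: _).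
by rewrite -cisD; congr cis; rewrite rmorphD /=; ring.
Qed.

Lemma symbol_subdiv s r (a : int -> 'M[C]_r) (v : int -> 'M[C]_(s, r)) N M xi :
  supp M a -> supp N v ->
  symbol (subdiv a v) xi = 2 *: (symbol v (2 * xi) *m symbol a xi).
Proof.
move=> ha hv; have sub_supp := subdiv_supp ha hv.
rewrite /symbol /subdiv.
transitivity (2 *: \sum_(k \in [set: int]) \sum_(j \in [set: int])
  cis (- (k%:~R * xi)) *: (v j *m a (k - 2 * j))).
  rewrite (@Zsum_scale _ (2 * N + M)) => [|k kN]; last first.
    apply: fsbig1 => j _; have [jN|jN] := ltnP N `|j|.
      by rewrite hv ?mul0mx ?scaler0.
    by rewrite ha ?mulmx0 ?scaler0 //; lia.
  apply: eq_fsbigr => k _; rewrite scalerA mulrC -scalerA; congr (_ *: _).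
  rewrite (@Zsum_scale _ N) // => j jN.
  by rewrite hv ?mul0mx.
congr (_ *: _); rewrite (@Zsum_swap _ (2 * N + M)); last first.
  move=> k j h; have [jN|jN] := ltnP N `|j|; first by rewrite hv ?mul0mx ?scaler0.
  by rewrite ha ?mulmx0 ?scaler0 //; lia.
rewrite (@Zsum_mulmxr _ N) => [|j jN]; last by rewrite hv ?scaler0.
apply: eq_fsbigr => j _; rewrite (@Zsum_mulmxl _ M) => [|k kM]; last first.
  by rewrite ha ?scaler0.
rewrite -[LHS](Zsum_shift (2 * j)); apply: eq_fsbigr => k _.
rewrite addrK -scalemxAr -scalemxAl scalerA; congr (_ *: _).
by rewrite -cisD; congr cis; rewrite rmorphD rmorphM /=; ring.
Qed.

Lemma cis_pi : cis (pi : R) = -1.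
Proof. by apply: eqReIm; rewrite /cis /= ?cospi ?sinpi ?oppr0. Qed.

Lemma cis_nat (x : R) n : cis (n%:R * x) = cis x ^+ n.
Proof.
elim: n => [|n IH]; first by rewrite mul0r cis0 expr0.
by rewrite -natr1 mulrDl mul1r cisD IH exprSr.
Qed.

Lemma cis_int_pi (k : int) : cis (- (k%:~R * pi)) = (-1) ^+ `|k|%N :> C.
Proof.
case: k => n.
  rewrite -mulrN cis_nat; congr (_ ^+ _).
  by apply: eqReIm; rewrite /cis /= ?cosN ?sinN ?cospi ?sinpi ?oppr0.
by rewrite NegzE rmorphN /= mulNr opprK cis_nat cis_pi.
Qed.

Lemma symbol_pi s r (a : int -> 'M[C]_(s, r)) xi :
  symbol a (xi + pi) = symbol (fun k => (-1) ^+ `|k|%N *: a k) xi.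
Proof.
apply: eq_fsbigr => k _; rewrite mulrDr opprD cisD cis_int_pi scalerA.
by congr (_ *: _).
Qed.

Lemma signB2 (j k : int) : (-1) ^+ absz (j - 2 * k)%R = (-1) ^+ `|j|%N :> C.
Proof. by rewrite -signr_odd -[RHS]signr_odd; congr (_ ^+ nat_of_bool _); lia. Qed.

Lemma subdiv_sign s r (a : int -> 'M[C]_r) (v : int -> 'M[C]_(s, r)) N j : supp N v ->
  subdiv (fun k => (-1) ^+ `|k|%N *: a k) v j = (-1) ^+ `|j|%N *: subdiv a v j.
Proof.
move=> hv; rewrite /subdiv scalerA mulrC -scalerA; congr (_ *: _).
rewrite (@Zsum_scale _ N) => [|k kN]; last by rewrite hv ?mul0mx.
by apply: eq_fsbigr => k _; rewrite signB2 scalemxAr.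
Qed.

Section FiltersAndMoments.
Variables (r : nat) (a : int -> 'M[C]_r) (Na : nat).
Hypothesis supp_a : supp Na a.

(** The symbol of [subdiv a v] is twice the left-hand side of the matching condition, so matching
    says that [v] and its subdivision have moments in the ratio 1 : 2. *)
Lemma matching_filterP (v : int -> 'rV[C]_r) k N : supp N v ->
  matching_filter a k v <-> symbol v 0 != 0 /\
    forall q l, (q < k)%N ->
      \sum_(t \in [set: int]) t%:~R ^+ q * subdiv a v t ord0 l =
      2 * \sum_(t \in [set: int]) t%:~R ^+ q * v t ord0 l.
Proof.
move=> hv; set M := (2 * N + Na)%N.
have hS : supp M (fun k => 2^-1 *: subdiv a v k).
  by move=> t tM; rewrite (subdiv_supp supp_a hv) ?scaler0.
have hv' : supp M v by apply: supp_le hv; rewrite /M; lia.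
have e : symbol (fun k => 2^-1 *: subdiv a v k) =
         fun xi => symbol v (2 * xi) *m symbol a xi.
  apply/funext => xi; rewrite (symbolZ _ _ (subdiv_supp supp_a hv)).
  by rewrite (symbol_subdiv _ supp_a hv) scalerA mulVf ?scale1r // pnatr_eq0.
have sS q l : supp M (fun t : int => t%:~R ^+ q * subdiv a v t ord0 l).
  by move=> t tM; rewrite (subdiv_supp supp_a hv) // mxE mulr0.
have key q l : \sum_(t \in [set: int]) t%:~R ^+ q * (2^-1 *: subdiv a v t) ord0 l =
    2^-1 * \sum_(t \in [set: int]) t%:~R ^+ q * subdiv a v t ord0 l.
  by rewrite (Zsum_mulr _ (sS q l)); apply: eq_fsbigr => t _; rewrite mxE mulrCA.
split=> [[_ v0]|[v0 h]].
  rewrite -e (mx_eqO_symbol _ hS hv') => h; split=> // q l qk.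
  have hq := h q ord0 l qk; rewrite key in hq.
  by rewrite -hq mulVKf // pnatr_eq0.
split=> //; first by apply/fin_suppP; exists N.
rewrite -e; apply/(mx_eqO_symbol _ hS hv') => q i j qk.
by rewrite (ord1 i) key h // mulKf // pnatr_eq0.
Qed.

(** Shifting the symbol of the mask by pi multiplies it by (-1)^|k|, and this sign passes to
    [subdiv a v] because j - 2 k has the parity of j. *)
Lemma sum_rulesP (v : int -> 'rV[C]_r) k N : supp N v ->
  sum_rules a k v <-> matching_filter a k v /\
    forall q l, (q < k)%N ->
      \sum_(t \in [set: int]) (-1) ^+ `|t|%N * (t%:~R ^+ q * subdiv a v t ord0 l) = 0.
Proof.
move=> hv; set M := (2 * N + Na)%N; rewrite /sum_rules.
have hs : supp Na (fun k => (-1) ^+ `|k|%N *: a k).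
  by move=> t tN; rewrite supp_a ?scaler0.
have hS : supp M (fun k => 2^-1 *: ((-1) ^+ `|k|%N *: subdiv a v k)).
  by move=> t tM; rewrite (subdiv_supp supp_a hv) ?scaler0.
have h0 : supp M (fun=> 0 : 'rV[C]_r) by [].
have e : symbol (fun k => 2^-1 *: ((-1) ^+ `|k|%N *: subdiv a v k)) =
         fun xi => symbol v (2 * xi) *m symbol a (xi + pi).
  apply/funext => xi; rewrite symbol_pi.
  rewrite (_ : (fun k => _) = fun k => 2^-1 *: subdiv (fun k => (-1) ^+ `|k|%N *: a k) v k).
    rewrite (symbolZ _ _ (subdiv_supp hs hv)) (symbol_subdiv _ hs hv) scalerA.
    by rewrite mulVf ?scale1r // pnatr_eq0.
  by apply/funext => t; rewrite (subdiv_sign _ _ hv).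
have e0 : symbol (fun=> 0 : 'rV[C]_r) = fun=> 0.
  by apply/funext => xi; apply: fsbig1 => t _; rewrite scaler0.
have sS q l : supp M (fun t : int => (-1) ^+ `|t|%N * (t%:~R ^+ q * subdiv a v t ord0 l)).
  by move=> t tM; rewrite (subdiv_supp supp_a hv) // mxE !mulr0.
have key q l : \sum_(t \in [set: int]) t%:~R ^+ q * (2^-1 *: ((-1) ^+ `|t|%N *: subdiv a v t)) ord0 l =
    2^-1 * \sum_(t \in [set: int]) (-1) ^+ `|t|%N * (t%:~R ^+ q * subdiv a v t ord0 l).
  rewrite (Zsum_mulr _ (sS q l)); apply: eq_fsbigr => t _; rewrite !mxE; ring.
rewrite -e -e0 (mx_eqO_symbol _ hS h0); split=> -[h1 h]; split=> //.
  move=> q l qk; have := h q ord0 l qk; rewrite key [RHS]fsbig1 => [/eqP|t _].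
    by rewrite mulf_eq0 invr_eq0 pnatr_eq0 /= => /eqP.
  by rewrite mxE mulr0.
move=> q i j qk; rewrite (ord1 i) key h // mulr0 fsbig1 // => t _.
by rewrite mxE mulr0.
Qed.

Lemma V_P (v : int -> 'rV[C]_r) (u : int -> 'cV[C]_r) k N M : supp N v -> supp M u ->
  V_ k v u <-> forall q, (q < k)%N ->
    \sum_(t \in [set: int]) t%:~R ^+ q * seq_conv v u t ord0 ord0 = 0.
Proof.
move=> hv hu; rewrite /V_ /=.
have hS : supp (N + M) (seq_conv v u).
  move=> t tN; rewrite /seq_conv fsbig1 // => j _.
  have [jM|jM] := ltnP M `|j|; first by rewrite hu ?mulmx0.
  by rewrite hv ?mul0mx //; lia.
have h0 : supp (N + M) (fun=> 0 : 'M[C]_1) by [].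
have e : symbol (seq_conv v u) = fun xi => symbol v xi *m symbol u xi.
  by apply/funext => xi; exact: symbol_conv hv hu.
have e0 : symbol (fun=> 0 : 'M[C]_1) = fun=> 0.
  by apply/funext => xi; apply: fsbig1 => t _; rewrite scaler0.
rewrite -e -e0 (mx_eqO_symbol _ hS h0); split=> [[_ h] q qk|h].
  have := h q ord0 ord0 qk; rewrite [RHS]fsbig1 // => t _.
  by rewrite mxE mulr0.
split; first by apply/fin_suppP; exists M.
move=> q i j qk; rewrite (ord1 i) (ord1 j) h // fsbig1 // => t _.
by rewrite mxE mulr0.
Qed.

End FiltersAndMoments.

(** The constant (-1)^n n! is the n-th derivative i^n n! of (i xi)^n at 0, divided by the factor
    (-i)^n of [cderivn_symbol]. *)
Lemma eqO_entry r (v : int -> 'rV[C]_r) N l n : supp N v ->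
  eqO n.+1 (fun xi => symbol v xi ord0 l) (fun xi => (0 +i* xi) ^+ n) <->
  forall q, (q <= n)%N -> \sum_(t \in [set: int]) t%:~R ^+ q * v t ord0 l =
    if q == n then (-1) ^+ n * n`!%:R else 0.
Proof.
move=> hv.
pose F j (x : R) : C := (n ^_ j)%:R * 'i ^+ n * x%:C ^+ (n - j).
have e : (fun xi => (0 +i* xi) ^+ n) = F 0%N.
  apply/funext => x; rewrite /F ffactn0 mul1r subn0 -exprMn; congr (_ ^+ _).
  by apply: eqReIm => /=; rewrite ?mulr0 ?mul0r ?mul1r ?subr0 ?addr0 ?add0r.
have dF j : cderivn j (F 0%N) = F j.
  apply: (@cderivnE _ j F _ j (leqnn j)) => i _.
  apply: cderE (cderZ _ (cderX _ (@cder_id R))) _ => x.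
  rewrite /F ffactnSr natrM subnS; ring.
have F0 q : (q <= n)%N -> F q 0 = if q == n then 'i ^+ n * n`!%:R else 0.
  move=> qn; rewrite /F; case: eqP => [->|qn'].
    by rewrite ffactnn subnn expr0 mulr1 mulrC.
  by rewrite rmorph0 expr0n subn_eq0 leqNgt ltn_neqAle qn andbT; move/eqP: qn' => -> /=; rewrite mulr0.
have nz q : (- 'i : C) ^+ q != 0 by rewrite expf_neq0 // oppr_eq0 i_neq0.
have ii : (-'i : C) ^+ n * (-1) ^+ n = 'i ^+ n by rewrite -exprMn mulrN1 opprK.
have eq1 q : cderivn q (fun xi => symbol v xi ord0 l) 0 =
  cderivn q (fun xi => (0 +i* xi) ^+ n) 0 <->
  (- 'i) ^+ q * (\sum_(t \in [set: int]) t%:~R ^+ q * v t ord0 l) = F q 0.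
  by rewrite e dF (cderivn_symbol _ _ _ hv).
have eq2 q : (q <= n)%N -> F q 0 = (- 'i) ^+ q * (if q == n then (-1) ^+ n * n`!%:R else 0).
  move=> /F0 ->; case: eqP => [->|_]; last by rewrite mulr0.
  by rewrite mulrA ii.
split=> h q qn.
  have /eq1 := h q qn.
  by rewrite eq2 // => /(mulfI (nz q)).
by apply/eq1; rewrite eq2 // h.
Qed.

End Symbols.

(** * A contraction principle *)

Section Contraction.
Variable R : realType.
Local Notation C := R[i].

(** Among the matrices with rows in [P] one of maximal rank spans everything, since adjoining a
    missing vector of [P] would raise the rank. It extracts a basis from a subspace given only as a
    predicate. *)
Lemma submodule_basis (K : fieldType) D (P : 'rV[K]_D -> Prop) :
  P 0 -> (forall c u v, P u -> P v -> P (c *: u + v)) ->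
  exists2 B : 'M[K]_D, forall i, P (row i B) & forall u, P u -> (u <= B)%MS.
Proof.
move=> P0 PD.
have Pspan m (B : 'M[K]_(m, D)) : (forall i, P (row i B)) -> forall u, (u <= B)%MS -> P u.
  move=> hB u /submxP[y ->]; rewrite mulmx_sum_row.
  elim/big_rec: _ => [//|i v _ Pv]; exact: PD.
pose Q k := `[< exists2 B : 'M[K]_D, forall i, P (row i B) & \rank B = k >].
have exQ : exists k, Q k.
  by exists (\rank (0 : 'M[K]_D)); apply/asboolP; exists 0 => // i; rewrite row0.
have ubQ k : Q k -> (k <= D)%N by move=> /asboolP[B _ <-]; exact: rank_leq_col.
case: (ex_maxnP exQ ubQ) => k /asboolP[B hB rB] kmax; exists B => // u Pu.
apply/negPn/negP => uB.
have hX i : P (row i (<<col_mx B u>>%MS : 'M[K]_D)).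
  apply: (Pspan _ (col_mx B u)) => [j|].
    by rewrite -(splitK j); case: (fintype.split j) => j' /=; rewrite ?rowKu ?rowKd // row_id.
  by rewrite (submx_trans (row_sub _ _)) // genmxE.
have := kmax (\rank (<<col_mx B u>>%MS : 'M[K]_D)).
have -> : Q (\rank (<<col_mx B u>>%MS : 'M[K]_D)) by apply/asboolP; exists <<col_mx B u>>%MS.
move=> /(_ isT); rewrite leqNgt -rB; apply/negP/negPn.
have BX : (B <= <<col_mx B u>>)%MS by rewrite genmxE -addsmxE addsmxSl.
rewrite ltn_neqAle mxrankS // andbT; apply/negP => /eqP e.
move: uB; rewrite (submx_trans (_ : (u <= <<col_mx B u>>)%MS)) //.
  by rewrite genmxE -addsmxE addsmxSr.
by rewrite -(geq_leqif (mxrank_leqif_sup BX)) e.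
Qed.

Definition words (E : Type) (T : bool -> E -> E) (w : seq bool) (u : E) : E :=
  foldl (fun v g => T g v) u w.

(** Bernoulli's inequality at 1/(2n). It provides a rate q < 1 with q^n at least 1/2 without taking
    an n-th root. *)
Lemma bernoulli_half (n : nat) : (0 < n)%N ->
  2^-1 <= (1 - (2 * n%:R)^-1) ^+ n :> R.
Proof.
move=> n0; have nR : (0 : R) < n%:R by rewrite ltr0n.
set x := (2 * n%:R)^-1.
have x0 : 0 <= x by rewrite /x invr_ge0 mulr_ge0 // ltW.
have x1 : x <= 1.
  rewrite /x invf_le1 ?mulr_gt0 //.
  have : (1 : R) <= n%:R by rewrite ler1n.
  lra.
have h k : 1 - k%:R * x <= (1 - x) ^+ k.
  elim: k => [|k IH]; first by rewrite mul0r subr0 expr0.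
  rewrite exprS; apply: le_trans (ler_wpM2l _ IH); last by rewrite subr_ge0.
  rewrite -natr1; have : 0 <= k%:R * x * x by rewrite !mulr_ge0.
  nra.
apply: le_trans (h n); rewrite le_eqVlt; apply/orP; left; apply/eqP.
by rewrite /x; field; rewrite gt_eqF.
Qed.

Variables (E : lmodType C) (D : nat) (co : E -> 'rV[C]_D) (P : E -> Prop).
Variable T : bool -> E -> E.
Hypothesis co_lin : forall c u v, co (c *: u + v) = c *: co u + co v.
Hypothesis P0 : P 0.
Hypothesis P_lin : forall c u v, P u -> P v -> P (c *: u + v).
Hypothesis co_inj : forall u, P u -> co u = 0 -> u = 0.
Hypothesis T_lin : forall g c u v, T g (c *: u + v) = c *: T g u + T g v.
Hypothesis T_P : forall g u, P u -> P (T g u).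

Definition entries_le (b : R) (u : E) := forall i, cmod (co u ord0 i) <= b.

Let co0 : co 0 = 0.
Proof. by have := co_lin (-1) 0 0; rewrite scaleN1r addNr scaleN1r addNr. Qed.

Let words_lin w c u v : words T w (c *: u + v) = c *: words T w u + words T w v.
Proof. by elim: w u v => //= g w IH u v; rewrite T_lin IH. Qed.

Let words0 w : words T w 0 = 0.
Proof. by have := words_lin w (-1) 0 0; rewrite scaleN1r addNr scaleN1r addNr. Qed.

Let words_P w u : P u -> P (words T w u).
Proof. by elim: w u => //= g w IH u Pu; apply/IH/T_P. Qed.

Let words_bound n u : exists2 K : R, 0 <= K &
  forall w, (size w <= n)%N -> entries_le K (words T w u).
Proof.
elim: n u => [|n IH] u.
  exists (\sum_i cmod (co u ord0 i)); first by apply: sumr_ge0 => i _; exact: cmod_ge0.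
  move=> [|//] _ i; rewrite (bigD1 i) //= lerDl; apply: sumr_ge0 => j _.
  exact: cmod_ge0.
have [K0 K00 h0] := IH (T false u); have [K1 K10 h1] := IH (T true u).
exists (K0 + K1 + \sum_i cmod (co u ord0 i)).
  by rewrite !addr_ge0 //; apply: sumr_ge0 => i _; exact: cmod_ge0.
move=> [|g w] /= wn i.
  rewrite (bigD1 i) //= -[leLHS]addr0 addrCA lerD2l !addr_ge0 //.
  by apply: sumr_ge0 => j _; exact: cmod_ge0.
apply: (@le_trans _ _ (K0 + K1)); last first.
  by rewrite lerDl; apply: sumr_ge0 => j _; exact: cmod_ge0.
case: g; first by apply: le_trans (h1 w wn i) _; rewrite lerDr.
by apply: le_trans (h0 w wn i) _; rewrite lerDl.
Qed.

(* The words of some fixed length halve the elements of a basis, up to its size,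
   hence contract the whole finite-dimensional space. *)
Lemma contraction :
  (forall u, P u -> forall e : R, 0 < e -> exists n0 : nat, forall w,
     (n0 <= size w)%N -> entries_le e (words T w u)) ->
  exists q K : R, [/\ 0 < q < 1, 0 <= K & forall u b w, P u -> entries_le b u ->
    entries_le (K * q ^+ size w * b) (words T w u)].
Proof.
move=> decay.
have [||B hB Bmax] := @submodule_basis _ D (fun x => exists2 u, P u & co u = x).
- by exists 0.
- move=> c x y [u Pu <-] [v Pv <-]; exists (c *: u + v); first exact: P_lin.
  exact: co_lin.
have [e he] : exists e : 'I_D -> E, forall i, P (e i) /\ co (e i) = row i B.
  have := fun i => hB i; move=> /(_ _)/cid2-h.
  by exists (fun i => projT1 (cid2 (hB i))) => i; case: cid2.
pose y u := co u *m pinvmx B.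
have Plc u : P (\sum_i y u ord0 i *: e i).
  elim/big_rec: _ => [//|i v _ Pv]; apply: P_lin => //; exact: (he i).1.
have co_sum (F : 'I_D -> C) : co (\sum_i F i *: e i) = \sum_i F i *: row i B.
  elim/big_rec2: _ => [//|i x v _ <-]; by rewrite co_lin (he i).2.
have uE u : P u -> u = \sum_i y u ord0 i *: e i.
  move=> Pu; apply/eqP; rewrite -subr_eq0; apply/eqP.
  rewrite addrC -scaleN1r; apply: co_inj; first exact: P_lin.
  rewrite co_lin co_sum -mulmx_sum_row /y mulmxKpV ?scaleN1r ?addNr //.
  by apply: Bmax; exists u.
(* A bound for the passage from the coordinates [co u] to the coefficients of [u] in the chosen
   basis. *)
pose Kp := \sum_i \sum_j cmod (pinvmx B i j).
have Kp0 : 0 <= Kp.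
  by apply: sumr_ge0 => i _; apply: sumr_ge0 => j _; exact: cmod_ge0.
have yle u b i : 0 <= b -> entries_le b u -> cmod (y u ord0 i) <= Kp * b.
  move=> b0 hb; rewrite mxE; apply: le_trans (cmod_sum _ _ _) _.
  rewrite /Kp mulr_suml; apply: ler_sum => j _; rewrite cmodM mulrC.
  apply: ler_pM => //; try exact: cmod_ge0.
  rewrite (bigD1 i) //= lerDl; apply: sumr_ge0 => k _; exact: cmod_ge0.
have words_sum w (F : 'I_D -> C) :
    words T w (\sum_i F i *: e i) = \sum_i F i *: words T w (e i).
  by elim/big_rec2: _ => [|i x v _ <-]; rewrite ?words0 ?words_lin.
have step u b w K : P u -> entries_le b u -> 0 <= K -> 0 <= b ->
    (forall i, entries_le K (words T w (e i))) ->
    entries_le (D%:R * Kp * K * b) (words T w u).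
  move=> Pu hb K0 b0 hK i; rewrite (uE u Pu) words_sum.
  have -> : co (\sum_j y u ord0 j *: words T w (e j)) =
            \sum_j y u ord0 j *: co (words T w (e j)).
    by elim/big_rec2: _ => [|j x v _ <-]; rewrite ?co0 ?co_lin.
  rewrite summxE; have -> : D%:R * Kp * K * b = #|'I_D|%:R * ((Kp * b) * K).
    by rewrite card_ord; ring.
  apply: cmod_sum_le => j; rewrite mxE cmodM.
  by apply: ler_pM; rewrite ?cmod_ge0 ?yle //; exact: hK.
(* Small enough that D Kp ep is at most 1/2, so a word that is [ep]-small on the basis halves every
   vector. *)
pose ep := (2 * (D%:R + 1) * (Kp + 1))^-1.
have ep0 : 0 < ep by rewrite invr_gt0 !mulr_gt0 // ltr_wpDl.
have [n n0 hn] : exists2 n, (0 < n)%N & forall w i, (n <= size w)%N ->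
    entries_le ep (words T w (e i)).
  have := fun i => decay _ (he i).1 _ ep0.
  move=> h; pose f i := projT1 (cid (h i)).
  exists (\max_i f i).+1 => // w i wn; apply: (projT2 (cid (h i))).
  by apply: leq_trans wn; apply: leqW; apply: (leq_bigmax (F := f)).
have [K1 K10 hK1] : exists2 K1, 0 <= K1 & forall w i, (size w <= n)%N ->
    entries_le K1 (words T w (e i)).
  have h := fun i => words_bound n (e i).
  exists (\sum_i projT1 (cid2 (h i))).
    by apply: sumr_ge0 => i _; case: cid2.
  move=> w i wn l; rewrite (bigD1 i) //=; apply: ler_wpDr.
    by apply: sumr_ge0 => j _; case: cid2.
  by case: cid2 => K _ hK /=; exact: hK.
pose q := 1 - (2 * n%:R)^-1 : R.
have nR : (1 : R) <= n%:R by rewrite ler1n.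
have q01 : 0 < q < 1.
  rewrite /q subr_gt0 invf_lt1 ?mulr_gt0 ?(lt_le_trans ltr01 nR) //.
  rewrite ltrBlDr ltrDl invr_gt0 mulr_gt0 ?(lt_le_trans ltr01 nR) // andbT; lra.
have qn : 2^-1 <= q ^+ n := bernoulli_half n0.
case/andP: (q01) => q0 q1.
(* The factor 2 pays for words shorter than [n], where q^(size w) is still at least q^n and hence at
   least 1/2. *)
pose K := 2 * (D%:R * Kp * K1).
have KK : 0 <= D%:R * Kp * K1 by rewrite !mulr_ge0.
exists q, K; split=> //; first by rewrite /K mulr_ge0.
move=> u b w; have [s sw] := ubnP (size w); elim: s w u b sw => // s IH w u b sw Pu hb i.
have b0 : 0 <= b := le_trans (cmod_ge0 _) (hb i).
have [wn|nw] := ltnP (size w) n.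
  apply: le_trans (step u b w K1 Pu hb K10 b0 _ i) _ => [j|].
    by apply: hK1; exact: ltnW.
  apply: ler_wpM2r => //; rewrite /K.
  have : q ^+ n <= q ^+ size w by apply: ler_wiXn2l; rewrite ?(ltW q0) ?(ltW q1) ?(ltnW wn).
  nra.
have -> : words T w u = words T (drop n w) (words T (take n w) u).
  by rewrite /words -foldl_cat cat_take_drop.
(* The first [n] letters gain a factor 1/2, which is at most q^n; the rest of the word is left to
   the induction hypothesis. *)
have h1 : entries_le (2^-1 * b) (words T (take n w) u).
  move=> j; apply: le_trans (step u b _ ep Pu hb (ltW ep0) b0 _ j) _ => [k|].
    by apply: hn; rewrite size_take_min (minn_idPl nw).
  apply: ler_wpM2r => //; rewrite /ep -(ler_pM2r (_ : 0 < 2 * (D%:R + 1) * (Kp + 1))).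
    rewrite mulfVK ?gt_eqF ?mulr_gt0 ?ltr_wpDl //.
    have D0 : (0 : R) <= D%:R by [].
    nra.
  by rewrite !mulr_gt0 // ltr_wpDl.
apply: le_trans (IH _ _ _ _ _ h1 i) _.
- by rewrite size_drop; lia.
- exact: words_P.
rewrite size_drop !mulrA; apply: ler_wpM2r => //.
rewrite -[in leRHS](subnK nw) exprD mulrA; apply: ler_wpM2l => //.
apply: mulr_ge0; last by rewrite exprn_ge0 // ltW.
by rewrite /K; apply: mulr_ge0.
Qed.

End Contraction.

(** * Smooth representatives of Sobolev and Lipschitz classes *)

Section AbsoluteContinuity.
Variable R : realType.
Local Notation mu := (@lebesgue_measure R).

(** Families of intervals are lists running from right to left, so that adding an interval on the
    right is a cons. This suits the continuous induction in [ac_bound]. *)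
Definition ac_on (a b : R) (h : R -> R) := forall e : R, 0 < e ->
  exists2 d : R, 0 < d & forall s : seq (R * R),
    all (fun p => (a <= p.1) && (p.1 <= p.2) && (p.2 <= b)) s ->
    pairwise (fun p q => q.2 <= p.1) s ->
    \sum_(p <- s) (p.2 - p.1) < d -> \sum_(p <- s) `|h p.2 - h p.1| < e.

Lemma nbhs_ball_real (x : R) (P : R -> Prop) : (\forall y \near x, P y) ->
  exists2 e : R, 0 < e & forall y, `|y - x| < e -> P y.
Proof.
move/nbhs_ballP => [e e0 h]; exists e => // y yx; apply: h.
by rewrite /ball /= distrC.
Qed.

Lemma is_derive_increment (h : R -> R) (s d e : R) : is_derive s (1 : R) h d -> 0 < e ->
  exists2 eta : R, 0 < eta & forall y, `|y - s| < eta ->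
    `|h y - h s - d * (y - s)| <= e * `|y - s|.
Proof.
move=> [+ +] e0; rewrite /derivable /derive => /cvgP; set l := lim _.
move=> cv le; rewrite le in cv.
move/cvgrPdist_le: cv => /(_ _ e0) /nbhs_ballP[eta eta0 hE].
exists eta => // y ys; have [->|ny] := eqVneq y s.
  by rewrite !subrr mulr0 subrr normr0 mulr0.
have t0 : y - s != 0 by rewrite subr_eq0.
have := hE (y - s); rewrite /ball /= sub0r normrN => /(_ ys t0).
rewrite /= (_ : (y - s) *: 1 + s = y) => [hle|]; last first.
  by rewrite /GRing.scale /= mulr1 subrK.
have -> : h y - h s - d * (y - s) = - (d - (y - s)^-1 *: (h y - h s)) * (y - s).
  by rewrite /GRing.scale /=; field.
by rewrite normrM normrN; apply: ler_wpM2r.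
Qed.

(** Continuous induction replaces a covering theorem. The exceptional null set lies in an open set
    of small measure, on which absolute continuity bounds the total increment; at every other point
    the derivative bounds increments with slope M + e1. *)
Lemma ac_bound (h : R -> R) (a b M : R) : a <= b -> 0 <= M -> ac_on a b h ->
  {ae mu, forall x : R, a <= x <= b ->
     exists2 d, is_derive x (1 : R) h d & `|d| <= M} ->
  `|h b - h a| <= M * (b - a).
Proof.
move=> ab M0 hac [Z [mZ Z0 hZ]].
apply/ler_addgt0Pr => e e0.
pose e1 := e / (2 * (b - a + 1)).
have ba1 : 0 < b - a + 1 by rewrite ltr_wpDl // subr_ge0.
have e10 : 0 < e1 by rewrite divr_gt0 // mulr_gt0.
have [d d0 hd] := hac (e / 2) ltac:(by rewrite divr_gt0).
have [U [oU ZU Ud]] : exists U : set R, [/\ open U, Z `<=` U & (mu U < d%:E)%E].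
  have [|U [oU ZU hU]] := @lebesgue_regularity_outer _ Z d mZ _ d0; first by rewrite [X in (X < _)%E](Z0 : mu Z = 0%E) ltry.
  exists U; split => //; have mU := open_measurable oU.
  rewrite (_ : U = Z `|` (U `\` Z)); last by rewrite setDUK.
  apply: le_lt_trans hU; apply: le_trans (measureU2 _ _ _) _ => //.
    exact: measurableD.
  by rewrite [X in (X + _)%E](Z0 : mu Z = 0%E) add0e.
have mU := open_measurable oU.
(* The list records the intervals inside [U] used on the way to [x]. Bounding their total length by
   the measure of [U] up to [x] keeps it below [d] however many intervals are collected. *)
pose good x (s : seq (R * R)) := [/\
  all (fun p => (a <= p.1) && (p.1 <= p.2) && (p.2 <= x)) s,
  pairwise (fun p q => q.2 <= p.1) s,
  ((\sum_(p <- s) (p.2 - p.1))%:E <= mu (U `&` `]a, x]%classic))%E &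
  `|h x - h a| <= (M + e1) * (x - a) + \sum_(p <- s) `|h p.2 - h p.1|].
pose S := [set x | a <= x <= b /\ exists s, good x s].
have Sa : S a.
  split; first by rewrite lexx.
  exists [::]; split => //; first by rewrite big_nil measure_ge0.
  by rewrite !subrr normr0 mulr0 big_nil addr0.
have hS : has_sup S by split; [exists a|exists b => x [/andP[]]].
set s0 := sup S.
have as0 : a <= s0 by apply: ub_le_sup => //; case: hS.
have s0b : s0 <= b by apply: ge_sup; [exists a|move=> x [/andP[]]].
(* It is not known beforehand that [S] contains its supremum, so the step jumps across [s0]: either
   over an interval inside [U], or with the increment estimate of the derivative at [s0] on both
   sides. *)
have extend : exists2 eta : R, 0 < eta & forall x y, S x -> s0 - eta < x <= s0 ->
    s0 <= y < s0 + eta -> y <= b -> S y.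
  have [Us|Us] := pselect (U s0).
    have [eta eta0 hU] := nbhs_ball_real (open_nbhs_nbhs (conj oU Us)).
    exists eta => // x y [/andP[ax xb] [s [s1 s2 s3 s4]]] /andP[xs xs'] /andP[ys ys'] yb.
    have xy : x <= y := le_trans xs' ys.
    split; first by rewrite (le_trans ax xy).
    exists ((x, y) :: s); split.
    - rewrite /= ax xy lexx /=; apply: sub_all s1 => p /andP[/andP[-> ->] /= h1].
      exact: le_trans h1 xy.
    - rewrite /= s2 andbT; apply: sub_all s1 => p /andP[_ /= h1]; exact: h1.
    - rewrite big_cons /= (_ : U `&` `]a, y]%classic = (U `&` `]a, x]%classic) `|` `]x, y]%classic).
        rewrite measureU //; first 1 last.
        - exact: measurableI.
        - apply/seteqP; split=> // z [[_]] /=; rewrite !in_itv /= => /andP[_ zx] /andP[xz _].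
          by move: (lt_le_trans xz zx); rewrite ltxx.
        have mxy : (mu `]x, y]%classic = (y - x)%:E)%E.
          rewrite lebesgue_measure_itv /= lte_fin; case: ltP => [_|yx]; first by rewrite EFinB.
          by have -> : y - x = 0 by apply/eqP; rewrite subr_eq0 eq_le xy yx.
        rewrite addrC EFinD; apply: leeD => //.
        by rewrite -mxy.
      apply/seteqP; split=> z /=; rewrite !in_itv /=.
        move=> [Uz /andP[az zy]]; have [zx|xz] := leP z x; first by left; rewrite az.
        by right; rewrite zy.
      move=> [[Uz /andP[az zx]]|/andP[xz zy]].
        by split => //; rewrite az (le_trans zx xy).
      split; last by rewrite (le_lt_trans ax xz).
      by apply: hU; rewrite ltr_norml; apply/andP; split; lra.
    - rewrite big_cons /=.
      have : `|h y - h a| <= `|h y - h x| + `|h x - h a| by exact: ler_distD.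
      have : 0 <= (M + e1) * (y - x) by rewrite mulr_ge0 ?subr_ge0 // addr_ge0 // ltW.
      nra.
  have Zs : ~ Z s0 by move=> /ZU.
  have [dd hdd dM] : exists2 dd, is_derive s0 (1 : R) h dd & `|dd| <= M.
    by apply: contrapT => hn; apply: Zs; apply: hZ => /=; rewrite as0 s0b => /(_ isT).
  have [eta eta0 hE] := is_derive_increment hdd e10.
  exists eta => // x y [/andP[ax xb] [s [s1 s2 s3 s4]]] /andP[xs xs'] /andP[ys ys'] yb.
  have xy : x <= y := le_trans xs' ys.
  split; first by rewrite (le_trans ax xy).
  exists s; split => //.
  - by apply: sub_all s1 => p /andP[-> /= h1]; exact: le_trans h1 xy.
  - apply: le_trans s3 _; apply: le_measure; rewrite ?inE; [exact: measurableI|exact: measurableI|].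
    apply: setIS => z /=; rewrite !in_itv /= => /andP[-> zx] /=; exact: le_trans zx xy.
  have h1 : `|h y - h s0 - dd * (y - s0)| <= e1 * (y - s0).
    have := hE y; rewrite ger0_norm ?subr_ge0 //; apply; lra.
  have h2 : `|h x - h s0 - dd * (x - s0)| <= e1 * (s0 - x).
    have := hE x; rewrite distrC ger0_norm ?subr_ge0 //; apply; lra.
  have h3 : `|dd * (y - x)| <= M * (y - x).
    by rewrite normrM (ger0_norm (_ : 0 <= y - x)) ?subr_ge0 // ler_wpM2r ?subr_ge0.
  move: h1 h2 h3 s4; rewrite !ler_norml; set V := \sum_(p <- s) _.
  by move=> /andP[? ?] /andP[? ?] /andP[? ?] /andP[? ?]; apply/andP; split; nra.
have [eta eta0 hext] := extend.
have [x Sx xs] := sup_adherent eta0 hS; rewrite -/s0 in xs.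
have xs0 : x <= s0 by apply: ub_le_sup => //; case: hS.
have Sb : S b.
  have [bs|sb] := leP b (s0 + eta / 2).
    by apply: (hext x) => //; [rewrite xs|lra].
  exfalso; have Sy : S (s0 + eta / 2) by apply: (hext x); rewrite ?xs //; lra.
  have : s0 + eta / 2 <= s0 by apply: ub_le_sup => //; case: hS.
  lra.
case: Sb => _ [s [s1 s2 s3 s4]]; apply: le_trans s4 _.
have : \sum_(p <- s) `|h p.2 - h p.1| < e / 2.
  apply: hd => //; rewrite -lte_fin; apply: le_lt_trans s3 _; apply: le_lt_trans Ud.
  by apply: le_measure; rewrite ?inE //; exact: measurableI.
have : e1 * (b - a) <= e / 2.
  have -> : e / 2 = e1 * (b - a + 1) by rewrite /e1; field; rewrite gt_eqF.
  by apply: ler_wpM2l; [exact: ltW|lra].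
nra.
Qed.

Lemma ac_on_fun (a b : R) (f : R -> R[i]) (h : R -> R) :
  (forall x y, `|h x - h y| <= cmod (f x - f y)) ->
  absolutely_continuous_fun f -> ac_on a b h.
Proof.
move=> hf hac e e0; have [d d0 hd] := hac e e0; exists d => // s s1 s2 s3.
have hp i : (i < size s)%N -> (nth (0, 0) s i) \in s by move=> ?; exact: mem_nth.
rewrite (big_nth (0, 0)) big_mkord; rewrite (big_nth (0, 0)) big_mkord in s3.
apply: le_lt_trans (hd (size s) (fun i => (nth (0, 0) s i).1) (fun i => (nth (0, 0) s i).2) _ _ s3).
- by apply: ler_sum => i _; exact: hf.
- by move=> i; have /(allP s1)/andP[/andP[]] := hp i (ltn_ord i).
move=> i j; have /pairwiseP := s2 => /(_ (0, 0)) hpw ij.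
have [ij'|ji|/val_inj e'] := ltngtP i j; last by rewrite e' eqxx in ij.
  by right; apply: hpw => //; rewrite inE.
by left; apply: hpw => //; rewrite inE.
Qed.

Lemma ac_on_lipschitz (a b L : R) (h : R -> R) : 0 <= L ->
  (forall x y, a <= x <= b -> a <= y <= b -> `|h y - h x| <= L * `|y - x|) -> ac_on a b h.
Proof.
move=> L0 hL e e0; exists (e / (L + 1)); first by rewrite divr_gt0 // ltr_wpDl.
move=> s s1 _; rewrite ltr_pdivlMr ?ltr_wpDl //; apply: le_lt_trans.
rewrite mulr_suml big_seq [leRHS]big_seq; apply: ler_sum => p /(allP s1)/andP[/andP[h1 h2] h3].
apply: le_trans (hL _ _ _ _) _; rewrite ?h1 ?h3 ?andbT ?(le_trans h2) ?(le_trans h1) //.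
by rewrite ger0_norm ?subr_ge0 // mulrC ler_wpM2l ?subr_ge0 // lerDl.
Qed.

Lemma ac_onB (a b : R) (h g : R -> R) : ac_on a b h -> ac_on a b g ->
  ac_on a b (fun x => h x - g x).
Proof.
move=> hh hg e e0; have e20 : 0 < e / 2 by rewrite divr_gt0.
have [d d0 hd] := hh _ e20; have [d' d'0 hd'] := hg _ e20.
exists (Num.min d d'); first by rewrite lt_min d0.
move=> s s1 s2; rewrite lt_min => /andP[h1 h2].
have := ltrD (hd s s1 s2 h1) (hd' s s1 s2 h2); rewrite -splitr; apply: le_lt_trans.
rewrite -big_split /=; apply: ler_sum => p _.
rewrite (_ : h p.2 - g p.2 - (h p.1 - g p.1) = (h p.2 - h p.1) - (g p.2 - g p.1)).
  exact: ler_normB.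
by ring.
Qed.

End AbsoluteContinuity.

(** * Antiderivatives, and derivatives known almost everywhere *)

Section Antiderivative.
Variable R : realType.
Local Notation mu := (@lebesgue_measure R).

Lemma real_cauchy (u : nat -> R) :
  (forall e : R, 0 < e -> exists N, forall n, (N <= n)%N -> `|u n - u N| <= e) ->
  exists l : R, forall e : R, 0 < e -> exists N, forall n, (N <= n)%N -> `|u n - l| <= e.
Proof.
move=> hu; have : cvg (u @ \oo).
  apply/cauchy_cvgP; apply: cauchy_exP => e e0.
  have [N hN] := hu (e / 2) ltac:(by rewrite divr_gt0).
  exists (u N); exists N => // n Nn; rewrite /ball /= distrC.
  by apply: le_lt_trans (hN n Nn) _; lra.
move/cvgP; set l := lim _ => cv; exists l => e e0.
move/cvgrPdist_le: cv => /(_ e e0) [N _ hN]; exists N => n Nn.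
by rewrite distrC; exact: hN.
Qed.

Lemma derive_mvt_le (h h' : R -> R) (M x y : R) :
  (forall z, Num.min x y <= z <= Num.max x y -> is_derive z (1 : R) h (h' z)) ->
  (forall z, Num.min x y <= z <= Num.max x y -> `|h' z| <= M) ->
  `|h y - h x| <= M * `|y - x|.
Proof.
wlog xy : x y / x <= y.
  move=> W d b; have [xy|/ltW yx] := leP x y; first exact: W.
  by rewrite distrC [`|y - x|]distrC; apply: W; rewrite // minC maxC.
rewrite (min_idPl xy) (max_idPr xy) => d b.
have [||c] := @MVT_segment _ h h' x y xy.
- by move=> z; rewrite in_itv /= => /andP[/ltW xz /ltW zy]; apply: d; rewrite xz.
- apply: derivable_within_continuous => z; rewrite in_itv /= => hz.
  exact: (@ex_derive _ _ _ _ _ _ _ (d z hz)).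
rewrite in_itv /= => hc ->; rewrite normrM; apply: ler_wpM2r => //; exact: b.
Qed.

Lemma antiderivative_right (k : R -> R) (a : R) : continuous k ->
  exists G : R -> R, forall x, a < x -> is_derive x (1 : R) G (k x).
Proof.
move=> ck; exists (fun x => \int[mu]_(t in `[a, x]) k t) => x ax.
have xu : x < x + 1 by rewrite ltrDl.
have ik : mu.-integrable `[a, (x + 1)] (EFin \o k).
  apply: continuous_compact_integrable; first exact: segment_compact.
  exact: continuous_subspaceT.
have [d e] := continuous_FTC1_closed xu ik ax (ck x).
by rewrite -e derive1E; apply/derivableP.
Qed.

(** The fundamental theorem yields primitives only to the right of a base point. The primitives
    started at -n and normalised to vanish at 0 agree on common intervals, hence glue. *)
Lemma antiderivative (k : R -> R) : continuous k ->
  exists G : R -> R, forall x, is_derive x (1 : R) G (k x).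
Proof.
move=> ck; have h n := cid (antiderivative_right (- n%:R) ck).
pose g n := projT1 (h n); have hg n (x : R) : - n%:R < x -> is_derive x (1 : R) (g n) (k x).
  exact: (projT2 (h n)).
pose N (x : R) := (Num.truncn `|x|).+1.
have hN x : `|x| < (N x)%:R by exact: truncnS_gt.
exists (fun x => g (N x) x - g (N x) 0) => x0.
have agree n m (y : R) : `|y| < n%:R -> `|y| < m%:R -> g n y - g n 0 = g m y - g m 0.
  move=> yn ym; apply/eqP; rewrite -subr_eq0 -normr_le0.
  have := @derive_mvt_le (fun z => g n z - g m z) (fun=> 0) 0 0 y.
  rewrite mul0r (_ : g n y - g m y - _ = g n y - g n 0 - (g m y - g m 0)); last by ring.
  apply=> z hz; last by rewrite normr0.
  have zb k' : `|y| < k'%:R -> - k'%:R < z.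
    move=> yk; move: hz yk; rewrite ge_min ltr_norml.
    by move=> /andP[/orP[?|?] _] /andP[? ?]; [have : (0 : R) <= k'%:R by []|]; lra.
  have := is_deriveB (hg n z (zb _ yn)) (hg m z (zb _ ym)).
  by rewrite subrr.
have d0 : is_derive x0 (1 : R) (fun y => g (N x0).+1 y - g (N x0).+1 0) (k x0).
  have x0N : - (N x0).+1%:R < x0.
    by have := hN x0; rewrite ltr_norml -[(N x0).+1%:R]natr1 => /andP[? ?]; lra.
  have := is_deriveB (hg _ _ x0N) (is_derive_cst (g (N x0).+1 0) x0 1).
  by rewrite subr0.
apply: near_eq_is_derive d0.
have : \forall y \near x0, `|y - x0| < 1.
  by apply/nbhs_ballP; exists 1 => //= y; rewrite /ball /= distrC.
apply: filterS => y yx; apply: agree.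
  rewrite -natr1; have := hN x0; have := ler_distD x0 y 0; rewrite !subr0; lra.
exact: hN.
Qed.

Lemma continuous_bounded_itv (k : R -> R) (a b : R) : continuous k ->
  exists2 M : R, 0 <= M & forall x, a <= x <= b -> `|k x| <= M.
Proof.
move=> ck; have cc : ccont (fun x => (k x)%:C).
  by apply: conj; [exact: ck|move=> x; exact: cvg_cst].
have [M M0 hM] := ccont_bounded a b cc.
by exists M => // x xab; have := hM x xab; rewrite cmodR.
Qed.

(** Subtracting a primitive of [k] leaves an absolutely continuous function with derivative 0 almost
    everywhere, which is constant by [ac_bound] with M = 0. *)
Lemma ac_ae_derivative (g k : R -> R) : (forall a b, ac_on a b g) -> continuous k ->
  {ae mu, forall x : R, is_derive x (1 : R) g (k x)} ->
  forall x, is_derive x (1 : R) g (k x).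
Proof.
move=> hac ck hd; have [G hG] := antiderivative ck.
have hc a b : a <= b -> g b - G b = g a - G a.
  move=> ab; apply/eqP; rewrite -subr_eq0 -normr_le0.
  have := @ac_bound R (fun x => g x - G x) a b 0 ab (lexx 0); rewrite mul0r; apply.
    apply: ac_onB; first exact: hac.
    have [M M0 hM] := continuous_bounded_itv a b ck.
    apply: (ac_on_lipschitz M0) => x y /andP[ax xb] /andP[ay yb].
    apply: (derive_mvt_le (fun z _ => hG z)) => z; rewrite ge_min le_max => hz; apply: hM.
    by move: hz => /andP[/orP[?|?] /orP[?|?]]; apply/andP; split; lra.
  move: hd; apply: filterS; first exact: (ae_filter_ringOfSetsType mu).
  move=> x hx _; exists 0; last by rewrite normr0.
  by rewrite -[0](subrr (k x)); apply: is_deriveB.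
move=> x; have -> : g = fun y => G y + (g 0 - G 0).
  apply/funext => y; have [y0|/ltW y0] := leP y 0.
    by rewrite (hc _ _ y0); ring.
  by rewrite -(hc _ _ y0); ring.
by have := is_deriveD (hG x) (is_derive_cst (g 0 - G 0) x 1); rewrite addr0.
Qed.

(** Translation invariance comes from uniqueness of Lebesgue measure: its pushforward under a
    translation has the right value on half-open intervals. *)
Lemma negligible_shift (A : set R) (t : R) : mu.-negligible A ->
  mu.-negligible [set x | A (x + t)].
Proof.
have ms : measurable_fun [set: R] (fun x : R => x + t).
  by apply: measurable_funD => //; exact: measurable_cst.
have shiftE (B : set R) : measurable B -> mu B = mu [set x | B (x + t)].
  have [m mE] : exists m : {measure set (measurableTypeR R) -> \bar R},
      forall B, m B = mu [set x | B (x + t)].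
    pose f : measurableTypeR R -> measurableTypeR R := fun x : R => x + t.
    by unshelve eexists (pushforward mu f : {measure set (measurableTypeR R) -> \bar R}).
  move=> mB; rewrite -[RHS]mE; apply: lebesgue_measure_unique => //.
  move=> X [[a b] /= _ <-]; rewrite mE.
  rewrite (_ : [set x | `]a, b]%classic (x + t)] = `]a - t, b - t]%classic); last first.
    by apply/seteqP; split=> x /=; rewrite !in_itv /= => /andP[? ?]; apply/andP; split; lra.
  rewrite !lebesgue_measure_itv /= !lte_fin ltrD2r; case: ifP => // _.
  by rewrite -!EFinB; congr EFin; ring.
move=> [B [mB B0 AB]]; exists [set x | B (x + t)]; split.
- by rewrite -[X in measurable X]setTI; exact: ms.
- by rewrite -shiftE.
- by move=> x; exact: AB.
Qed.

Lemma ae_shift (P : R -> Prop) (t : R) : {ae mu, forall x, P x} ->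
  {ae mu, forall x, P (x + t)}.
Proof. by move=> /(@negligible_shift _ t). Qed.

Lemma ae_imp (P Q : R -> Prop) : (forall x, P x -> Q x) ->
  {ae mu, forall x, P x} -> {ae mu, forall x, Q x}.
Proof. move=> h; apply: filterS; [exact: (ae_filter_ringOfSetsType mu)|exact: h]. Qed.

Lemma ae_and (P Q : R -> Prop) : {ae mu, forall x, P x} -> {ae mu, forall x, Q x} ->
  {ae mu, forall x, P x /\ Q x}.
Proof. move=> hp hq; apply: filterI; [exact: (ae_filter_ringOfSetsType mu)|exact: hp|exact: hq]. Qed.

Lemma ae_dense (P : R -> Prop) (a b : R) : a < b -> {ae mu, forall x, P x} ->
  exists2 x, a < x < b & P x.
Proof.
move=> ab [Z [mZ Z0 hZ]]; apply: contrapT => hn.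
have : (mu `]a, b[%classic <= mu Z)%E.
  apply: le_measure; rewrite ?inE // => x /=; rewrite in_itv /= => xab.
  by apply: hZ => Px; apply: hn; exists x.
rewrite [X in (_ <= X)%E](Z0 : mu Z = 0%E) lebesgue_measure_itv /= lte_fin ab -EFinB lee_fin.
lra.
Qed.

End Antiderivative.

(** * Continuous representatives of Hoelder classes *)

Section HoelderRepresentative.
Variable R : realType.
Local Notation mu := (@lebesgue_measure R).

Lemma powR_small (c tau e : R) : 0 < c -> 0 < tau -> 0 < e ->
  exists2 d : R, 0 < d & forall t : R, `|t| <= d -> c * `|t| `^ tau <= e.
Proof.
move=> c0 t0 e0; have ec : 0 < e / c by rewrite divr_gt0.
exists ((e / c) `^ tau^-1); first by rewrite powR_gt0.
move=> t ht; rewrite mulrC -ler_pdivlMr //.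
apply: (@le_trans _ _ (((e / c) `^ tau^-1) `^ tau)).
  by apply: ge0_ler_powR; rewrite ?nnegrE ?powR_ge0 // ltW.
by rewrite -powRrM mulVf ?gt_eqF // powRr1 // ltW.
Qed.

Section Bounded.
Variables (f : R -> R) (M : R).
Hypothesis mf : measurable_fun [set: R] f.
Hypothesis fM : forall x, `|f x| <= M.

Let M0 : 0 <= M.
Proof. exact: le_trans (normr_ge0 _) (fM 0). Qed.

Let int_itv (A : set R) (a b : R) : measurable A -> A `<=` `[a, b]%classic ->
  mu.-integrable A (EFin \o f).
Proof.
move=> mA AI; suff : mu.-integrable `[a, b] (EFin \o f) by exact: integrableS.
apply: measurable_bounded_integrable => //.
- by rewrite /= lebesgue_measure_itv /=; case: ifP => _; rewrite ?ltry // -EFinB ltry.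
- exact: measurable_funS mf.
- by exists M; split; [exact: num_real|move=> x Mx y _ /=; exact: le_trans (fM y) (ltW Mx)].
Qed.

Let I (x h : R) := \int[mu]_(t in `]x, (x + h)]) f t.

Let primE (a x h : R) : a <= x -> 0 <= h ->
  \int[mu]_(t in `[a, (x + h)]) f t - \int[mu]_(t in `[a, x]) f t = I x h.
Proof.
move=> ax h0; apply: Rintegral_itvB.
- exact: (@int_itv _ a (x + h)).
- by rewrite bnd_simp.
- by rewrite bnd_simp lerDl.
Qed.

Let I_bound x h : 0 <= h -> `|I x h| <= M * h.
Proof.
move=> h0; have iI : mu.-integrable `]x, (x + h)] (EFin \o f).
  by apply: (@int_itv _ x (x + h)) => //; exact: subset_itv_oc_cc.
apply: le_trans (le_normr_Rintegral _ iI) _ => //.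
have fin : mu `]x, (x + h)]%classic = h%:E.
  rewrite lebesgue_measure_itv /= lte_fin; case: ltP => [_|].
    by rewrite -EFinB; congr EFin; ring.
  by rewrite gerDl => h0'; congr EFin; apply/eqP; rewrite eq_le h0.
have -> : M * h = \int[mu]_(t in `]x, (x + h)]) M.
  by rewrite Rintegral_cst //; congr (_ * _); exact: (congr1 fine (esym fin)).
apply: le_Rintegral => //; first exact: integrable_norm iI.
apply: measurable_bounded_integrable => //.
- by rewrite [X in (X < _)%E](fin : mu _ = h%:E) ltry.
- by exists `|M|; split; [exact: num_real|move=> z Mz y _ /=; exact: ltW].
Qed.

Let prim_lip (a : R) x y : a <= x -> a <= y ->
  `|\int[mu]_(t in `[a, y]) f t - \int[mu]_(t in `[a, x]) f t| <= M * `|y - x|.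
Proof.
wlog xy : x y / x <= y.
  move=> W ax ay; have [xy|/ltW yx] := leP x y; first exact: W.
  by rewrite distrC [`|y - x|]distrC; exact: W.
move=> ax ay; rewrite -{1}(subrKC x y) primE ?subr_ge0 //.
by apply: le_trans (I_bound _ _) _; rewrite ?subr_ge0 // ger0_norm ?subr_ge0.
Qed.

Let prim_derive (a : R) : {ae mu, forall x, a < x ->
  is_derive x (1 : R) (fun y => \int[mu]_(t in `[a, y]) f t) (f x)}.
Proof.
have h1 (y : R) : mu.-integrable [set` Interval (BLeft a) (BRight y)] (EFin \o f).
  exact: (@int_itv _ a y).
have h2 : locally_integrable [set: R] f.
  split => //; first exact: openT.
  move=> K _ cK; have [B [_ hB]] := compact_bounded cK.
  have /integrableP[_] : mu.-integrable K (EFin \o f).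
    apply: (@int_itv _ (- (B + 1)) (B + 1)); first exact: compact_measurable.
    move=> x Kx /=; rewrite in_itv /= -ler_norml; apply: hB => //; by rewrite ltrDl.
  by [].
have := FTC1 h1 h2; apply: ae_imp.
move=> x hx ax; have [d e] := hx ax.
by rewrite -e derive1E; apply/derivableP.
Qed.

Variables (c tau : R).
Hypothesis c0 : 0 < c.
Hypothesis tau0 : 0 < tau.
Hypothesis f_lip : forall t, {ae mu, forall x, `|f x - f (x - t)| <= c * `|t| `^ tau}.

(** The null set in [f_lip] depends on the shift, so no pair of points can be fixed for [f] itself.
    Integration removes the exception: the shifted difference of a primitive has an almost
    everywhere bounded derivative, and [ac_bound] applies. *)
Let I_lip x y h : 0 <= h -> `|I y h - I x h| <= c * `|y - x| `^ tau * h.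
Proof.
move=> h0; set t := y - x; pose a := Num.min x y - 1.
pose G z := \int[mu]_(s in `[a, z]) f s.
have ax : a < x by rewrite /a ltrBlDr gt_min ltrDl ltr01.
have ay : a < y by rewrite /a ltrBlDr gt_min [y < y + 1]ltrDl ltr01 orbT.
have xt : x + t = y by rewrite /t; ring.
have := @ac_bound R (fun z => G (z + t) - G z) x (x + h) (c * `|t| `^ tau).
rewrite lerDl h0 mulr_ge0 ?powR_ge0 ?(ltW c0) // => /(_ isT isT).
have -> : x + h - x = h by ring.
have -> : G (x + h + t) - G (x + h) - (G (x + t) - G x) = I y h - I x h.
  have e : x + h + t = y + h by rewrite -xt; ring.
  by rewrite -(primE (ltW ax) h0) -(primE (ltW ay) h0) e xt /G; ring.
apply.
  apply: ac_onB; apply: (ac_on_lipschitz M0) => z w /andP[xz zh] /andP[xw wh].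
    have -> : w - z = (w + t) - (z + t) by ring.
    by apply: prim_lip; lra.
  by apply: prim_lip; lra.
have h1 := prim_derive a; have h2 := ae_shift t h1; have h3 := f_lip (- t).
have := ae_and (ae_and h1 h2) h3; apply: ae_imp.
move=> z [[hz1 hz2] hz3] /andP[xz _].
have az : a < z := lt_le_trans ax xz.
have azt : a < z + t by rewrite (lt_le_trans ay) // -xt lerD2r.
exists (f (z + t) - f z); last first.
  by rewrite distrC; move: hz3; rewrite opprK normrN.
apply: is_deriveB; last exact: hz1.
have d : is_derive z (1 : R) (fun y => y + t) 1.
  by have := is_deriveD (is_derive_id z (1 : R)) (is_derive_cst t z 1); rewrite addr0.
by have := @is_derive1_comp _ G (fun y => y + t) z _ _ (hz2 azt) d; rewrite mulr1.
Qed.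

Let good x := forall e : R, 0 < e -> exists2 d : R, 0 < d &
  forall h, 0 <= h -> h < d -> `|I x h - f x * h| <= e * h.

Let ae_good : {ae mu, forall x, good x}.
Proof.
have : {ae mu, forall x : R, forall n : nat, - n%:R < x ->
  is_derive x (1 : R) (fun y => \int[mu]_(t in `[- n%:R, y]) f t) (f x)}.
  by apply: ae_foralln => n; exact: prim_derive.
apply: ae_imp.
move=> x hx e e0; pose n := (Num.truncn `|x|).+1.
have xn : `|x| < n%:R by exact: truncnS_gt.
have nx : - n%:R < x by move: xn; rewrite ltr_norml => /andP[].
have [d d0 hd] := is_derive_increment (hx n nx) e0; exists d => // h h0 hd'.
have := hd (x + h); rewrite (_ : x + h - x = h); last by ring.
rewrite (ger0_norm h0) => /(_ hd'); have := primE (ltW nx) h0; rewrite -/n => ->.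
exact.
Qed.

(** The averages of [f] over [x, x + 1/(k+1)] are Hoelder in x uniformly in k and converge at almost
    every point. Such points are dense, so equicontinuity gives convergence everywhere to a
    continuous limit. *)
Lemma hoelder_rep_bounded : exists2 F : R -> R, continuous F & {ae mu, forall x, F x = f x}.
Proof.
pose u x k := k.+1%:R * I x k.+1%:R^-1.
have k0 (k : nat) : (0 : R) < k.+1%:R by [].
have u_lip x y k : `|u y k - u x k| <= c * `|y - x| `^ tau.
  rewrite /u -mulrBr normrM gtr0_norm // mulrC -ler_pdivlMr //.
  by apply: I_lip; rewrite invr_ge0 ltW.
have u_good x : good x -> forall e : R, 0 < e -> exists N, forall k, (N <= k)%N -> `|u x k - f x| <= e.
  move=> gx e e0; have [d d0 hd] := gx e e0.
  exists (Num.truncn d^-1) => k kN.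
  have hk : k.+1%:R^-1 < d.
    rewrite invf_plt ?posrE //; apply: lt_le_trans (truncnS_gt _) _.
    by rewrite ler_nat.
  have := hd k.+1%:R^-1; rewrite invr_ge0 ltW // => /(_ isT hk).
  rewrite -(ler_pM2l (k0 k)) -{1}(gtr0_norm (k0 k)) -normrM => /le_trans-/(_ e).
  rewrite mulrCA divff ?gt_eqF // mulr1 => /(_ (lexx _)).
  by rewrite mulrBr mulrCA divff ?gt_eqF // mulr1.
have u_cauchy x : forall e : R, 0 < e -> exists N, forall k, (N <= k)%N -> `|u x k - u x N| <= e.
  move=> e e0; have e4 : 0 < e / 4 by rewrite divr_gt0.
  have [d d0 hd] := powR_small c0 tau0 e4.
  have xxd : x < x + d by rewrite ltrDl.
  have [y /andP[xy yx] gy] := ae_dense xxd ae_good.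
  have [N hN] := u_good y gy _ e4; exists N => k kN.
  have yxd : `|y - x| <= d by rewrite ger0_norm; lra.
  have := le_trans (u_lip x y k) (hd _ yxd); have := le_trans (u_lip x y N) (hd _ yxd).
  have := hN k kN; have := hN N (leqnn N).
  rewrite !ler_norml => /andP[? ?] /andP[? ?] /andP[? ?] /andP[? ?]; apply/andP; split; lra.
have h x := cid (real_cauchy (u_cauchy x)).
pose F x := projT1 (h x).
have FE x : forall e : R, 0 < e -> exists N, forall k, (N <= k)%N -> `|u x k - F x| <= e.
  exact: (projT2 (h x)).
exists F.
  move=> x; apply/cvgrPdist_le => e e0; have e3 : 0 < e / 3 by rewrite divr_gt0.
  have [d d0 hd] := powR_small c0 tau0 e3.
  apply/nbhs_ballP; exists d => // y /=; rewrite /ball /= => xy.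
  have [N hN] := FE x _ e3; have [N' hN'] := FE y _ e3.
  have := hN _ (leq_maxl N N'); have := hN' _ (leq_maxr N N').
  have := le_trans (u_lip y x (maxn N N')) (hd _ (ltW xy)).
  rewrite !ler_norml => /andP[? ?] /andP[? ?] /andP[? ?]; apply/andP; split; lra.
move: ae_good; apply: ae_imp.
move=> x gx; apply/eqP; rewrite -subr_eq0 -normr_le0; apply/ler_addgt0Pr => e e0.
have e2 : 0 < e / 2 by rewrite divr_gt0.
have [N hN] := FE x _ e2; have [N' hN'] := u_good x gx _ e2.
have := hN _ (leq_maxl N N'); have := hN' _ (leq_maxr N N').
rewrite !ler_norml => /andP[? ?] /andP[? ?]; apply/andP; split; lra.
Qed.

End Bounded.

(** Truncation at [|M|] makes the almost sure bound hold everywhere. It changes [f] on a null set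
    only and, being 1-Lipschitz, preserves the Hoelder estimate. *)
Lemma hoelder_rep (f : R -> R) (M c tau : R) : measurable_fun [set: R] f ->
  {ae mu, forall x, `|f x| <= M} -> 0 < c -> 0 < tau ->
  (forall t, {ae mu, forall x, `|f x - f (x - t)| <= c * `|t| `^ tau}) ->
  exists2 F : R -> R, continuous F & {ae mu, forall x, F x = f x}.
Proof.
move=> mf fM c0 t0 lf.
pose K := `|M|; pose g x := Num.max (- K) (Num.min K (f x)).
have K0 : 0 <= K by exact: normr_ge0.
have gK x : `|g x| <= K.
  rewrite /g ler_norml le_max lexx ge_max ge_min lexx /= !andbT; lra.
have mg : measurable_fun [set: R] g.
  by apply: measurable_maxr; [exact: measurable_cst|apply: measurable_minr => //; exact: measurable_cst].
have gl x y : `|g x - g y| <= `|f x - f y|.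
  have h1 : f x - f y <= `|f x - f y| := ler_norm _.
  have h2 : f y - f x <= `|f x - f y| by rewrite distrC ler_norm.
  have h3 : 0 <= `|f x - f y| := normr_ge0 _.
  move: h1 h2 h3; set n := `|f x - f y| => h1 h2 h3; rewrite /g !maxEle !minEle ler_norml.
  by case: (leP K (f x)) => ?; case: (leP K (f y)) => ?; 
    do ?[case: (leP (- K) _) => ?]; apply/andP; split; lra.
have [t|F cF hF] := @hoelder_rep_bounded g K mg gK c tau c0 t0.
  by apply: (ae_imp _ (lf t)) => x; exact: le_trans.
exists F => //; have := ae_and hF fM; apply: ae_imp.
move=> x [-> fx]; rewrite /g; have : `|f x| <= K by exact: le_trans fx (ler_norm _).
rewrite ler_norml => /andP[f1 f2].
by rewrite (min_idPr f2) (max_idPr f1).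
Qed.

Lemma absolutely_continuous_ccont (f : R -> R[i]) : absolutely_continuous_fun f -> ccont f.
Proof.
have key (h : R -> R) : (forall a b, ac_on a b h) -> continuous h.
  move=> hh x; apply/cvgrPdist_le => e e0.
  have [d d0 hd] := hh (x - 1) (x + 1) _ e0.
  have dm : 0 < Num.min d 1 by rewrite lt_min d0 ltr01.
  apply/nbhs_ballP; exists (Num.min d 1) => // y /=; rewrite /ball /= lt_min => /andP[xyd xy1].
  have := hd [:: (Num.min x y, Num.max x y)]; rewrite /= !big_cons !big_nil !addr0 /=.
  move: xyd xy1; case: (leP x y) => xy; rewrite ltr_norml => /andP[? ?]; rewrite ltr_norml => /andP[? ?].
    move=> /(_ _ isT)/wrap[]; first by rewrite xy /=; apply/andP; split=> //; apply/andP; split; lra.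
    by rewrite distrC => h1; apply/ltW/h1; lra.
  move=> /(_ _ isT)/wrap[]; first by rewrite (ltW xy) /=; apply/andP; split=> //; apply/andP; split; lra.
  by move=> h1; apply/ltW/h1; lra.
move=> hf; apply: conj; apply: key => a b; apply: ac_on_fun hf => x y.
  by rewrite /Ref -ReN -ReD; exact: cmod_Re.
by rewrite /Imf -ImN -ImD; exact: cmod_Im.
Qed.

Lemma Linfty_norm_ae (f : R -> R[i]) (y : \bar R) : (Linfty_norm f <= y)%E ->
  {ae mu, forall x, ((cmod (f x))%:E <= y)%E}.
Proof.
rewrite /Linfty_norm unlock; case: ifP => [_ /ess_supP|].
  apply: ae_imp.
  by move=> x /=; rewrite ger0_norm ?cmod_ge0.
move/negP; case; rewrite (@lt_le_trans _ _ (mu `]0, 1[%classic)) //.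
  by rewrite lebesgue_measure_itv /= lte_fin ltr01 -EFinB lte_fin; lra.
by apply: le_measure; rewrite ?inE.
Qed.

Lemma Linfty_bound (f : R -> R[i]) : Linfty f ->
  exists M : R, {ae mu, forall x, cmod (f x) <= M}.
Proof.
move=> [_ _]; have := @Linfty_norm_ae f (Linfty_norm f) (lexx _).
case: (Linfty_norm f) => [M h _|//|h _].
  by exists M; apply: ae_imp h => x; rewrite lee_fin.
by exists 0; apply: ae_imp h => x; rewrite leeNy_eq.
Qed.

(** From n + tau > m and tau < 1, either n > m and [g m] is continuous by absolute continuity, or n
    = m with tau > 0 and [g m] has a continuous Hoelder representative. Below order m,
    [ac_ae_derivative] upgrades the almost everywhere derivatives. *)
Lemma sm_infty_regular (m : nat) (f : R -> R[i]) :
  (m%:R%:E < sm_infty_fun f)%E ->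
  exists2 F, C_ m F & {ae mu, forall x, F x = f x}.
Proof.
move=> /ereal_sup_gt[_ [n [tau [g [tau01 [g0 gL gAC gD] gLip ->]]]]].
rewrite lte_fin => mn; case/andP: tau01 => tau0 tau1.
have step j h : (j < n)%N -> ccont h -> {ae mu, forall x, h x = g j.+1 x} -> cder (g j) h.
  move=> jn [hr hi] hh x; split.
    apply: ac_ae_derivative => //.
      by move=> a b; apply: ac_on_fun (gAC j jn) => y z; rewrite /Ref -ReN -ReD; exact: cmod_Re.
    have := ae_and (gD j jn) hh; apply: ae_imp => y [[? _] e].
    by rewrite /Ref e.
  apply: ac_ae_derivative => //.
    by move=> a b; apply: ac_on_fun (gAC j jn) => y z; rewrite /Imf -ImN -ImD; exact: cmod_Im.
  have := ae_and (gD j jn) hh; apply: ae_imp => y [[_ ?] e].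
  by rewrite /Imf e.
have aeE (h : R -> R[i]) : {ae mu, forall x, h x = h x} by apply: nearW.
have mle : (m <= n)%N.
  by rewrite -ltnS -(ltr_nat R) -natr1; lra.
have [h [hc hh]] : exists h, ccont h /\ {ae mu, forall x, h x = g m x}.
  move: mle; rewrite leq_eqVlt => /orP[/eqP e|mn']; last first.
    by exists (g m); split => //; exact: absolutely_continuous_ccont (gAC m mn').
  rewrite e in mn *; have t0 : 0 < tau by lra.
  have [mr mi _] := gL n (leqnn n); have [M hM] := Linfty_bound (gL n (leqnn n)).
  have [c c0 hc] := gLip.
  have lip t : {ae mu, forall x, cmod (g n x - g n (x - t)) <= c * `|t| `^ tau}.
    have := Linfty_norm_ae (hc t); apply: ae_imp.
    by move=> x; rewrite lee_fin.
  have [|t|hr cr er] := hoelder_rep mr _ c0 t0 (M := M).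
  - move: hM; apply: ae_imp.
    by move=> x; exact: le_trans (cmod_Re _).
  - move: (lip t); apply: ae_imp.
    by move=> x; apply: le_trans; rewrite /Ref -ReN -ReD; exact: cmod_Re.
  have [|t|hi ci ei] := hoelder_rep mi _ c0 t0 (M := M).
  - move: hM; apply: ae_imp.
    by move=> x; exact: le_trans (cmod_Im _).
  - move: (lip t); apply: ae_imp.
    by move=> x; apply: le_trans; rewrite /Imf -ImN -ImD; exact: cmod_Im.
  exists (fun x => hr x +i* hi x); split; first by apply: conj.
  have := ae_and er ei; apply: ae_imp => x [-> ->].
  by rewrite /Ref /Imf; case: (g n x).
pose F j := if j == m then h else g j.
exists (F 0%N).
  apply: (@C_tower _ m F); last by rewrite /F eqxx.
  move=> j jm; rewrite /F (ltn_eqF jm); case: eqP => [e|/eqP jm'].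
    by apply: step; rewrite ?e //; exact: leq_trans mle.
  apply: step => //; first exact: leq_trans jm mle.
  by apply: absolutely_continuous_ccont; apply: gAC; rewrite (leq_trans _ mle) // ltn_neqAle jm'.
have := g0; rewrite /F; case: eqP => [e|_]; last by [].
move=> _; rewrite -e in hh; have := ae_and g0 hh; apply: ae_imp.
by move=> x [<- ->].
Qed.

End HoelderRepresentative.

(** * Smooth cutoffs and integrals of compactly supported functions *)

Section Bump.
Variable R : realType.

(** The functions p(1/x) e^(-1/x) extended by 0 form a family closed under differentiation, which
    acts on the polynomial by p -> X^2 (p - p'). *)
Definition flat (p : {poly R}) (x : R) : R :=
  if 0 < x then p.[x^-1] * expR (- x^-1) else 0.

(** Since e^t = (e^(t/n))^n and e^(t/n) is at least t/n. *)
Lemma pow_expRN_le (n : nat) (t : R) : 0 <= t -> t ^+ n * expR (- t) <= n%:R ^+ n.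
Proof.
move=> t0; case: n => [|n]; first by rewrite !expr0 mul1r expR_le1 oppr_le0.
have n0 : (0 : R) < n.+1%:R by [].
rewrite expRN -ler_pdivlMr ?invr_gt0 ?expR_gt0 // invrK.
have -> : expR t = expR (t / n.+1%:R) ^+ n.+1.
  by rewrite -expRM_natl mulrC divfK // gt_eqF.
rewrite -exprMn; apply: lerXn2r; rewrite ?nnegrE ?mulr_ge0 ?expR_ge0 //.
rewrite mulrC -ler_pdivrMr //; apply: le_trans (expR_ge1Dx _).
by rewrite lerDr.
Qed.

Lemma poly_expRN_bound (p : {poly R}) : exists2 B : R, 0 <= B &
  forall t : R, 0 <= t -> `|p.[t] * expR (- t)| <= B.
Proof.
exists (\sum_(i < size p) `|p`_i| * i%:R ^+ i).
  by apply: sumr_ge0 => i _; rewrite mulr_ge0 // exprn_ge0.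
move=> t t0; rewrite horner_coef mulr_suml; apply: le_trans (ler_norm_sum _ _ _) _.
apply: ler_sum => i _; rewrite -mulrA normrM; apply: ler_wpM2l => //.
rewrite ger0_norm ?mulr_ge0 ?exprn_ge0 ?expR_ge0 //; exact: pow_expRN_le.
Qed.

Lemma flat_quadratic p : exists2 B : R, 0 <= B & forall x, `|flat p x| <= B * x ^+ 2.
Proof.
have [B B0 hB] := poly_expRN_bound (p * 'X ^+ 2); exists B => // x.
rewrite /flat; case: ltP => x0; last by rewrite normr0 mulr_ge0 // sqr_ge0.
have := hB x^-1; rewrite invr_ge0 ltW // => /(_ isT).
rewrite -(ler_pM2r (_ : 0 < x ^+ 2)) ?exprn_gt0 //; apply: le_trans.
rewrite -(gtr0_norm (_ : 0 < x ^+ 2)) ?exprn_gt0 // -normrM le_eqVlt; apply/orP; left.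
apply/eqP; congr `|_|; rewrite !hornerE /=.
have e : x^-1 ^+ 2 * x ^+ 2 = 1 by rewrite -exprMn mulVf ?gt_eqF // expr1n.
by rewrite -[LHS]mulr1 -e; ring.
Qed.

Lemma is_derive_near0 (f : R -> R) (x0 B : R) : f x0 = 0 ->
  (forall x, `|f x| <= B * (x - x0) ^+ 2) -> is_derive x0 (1 : R) f 0.
Proof.
move=> f0 hf.
have cv : (fun h => h^-1 *: ((f \o shift x0) (h *: 1) - f x0)) @ 0^' --> 0.
  apply/cvgrPdist_le => e e0.
  have B1 : 0 < `|B| + 1 by rewrite ltr_wpDl.
  apply/nbhs_ballP; exists (e / (`|B| + 1)); first by rewrite /= divr_gt0.
  move=> h; rewrite /ball /= sub0r normrN => hh h0.
  rewrite f0 sub0r normrN subr0 /GRing.scale /= mulr1 normrM normfV ler_pdivrMl ?normr_gt0 //.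
  apply: le_trans (hf _) _; rewrite addrK -(real_normK (num_real h)) expr2 mulrA mulrC.
  apply: ler_wpM2l => //; apply: (@le_trans _ _ ((`|B| + 1) * `|h|)).
    by apply: ler_wpM2r => //; apply: le_trans (ler_norm _) _; rewrite lerDl.
  by rewrite mulrC -ler_pdivlMr // ltW.
by split; [apply/cvg_ex; exists 0|apply/cvg_lim].
Qed.

Lemma flat_derive p x : is_derive x (1 : R) (flat p) (flat ('X ^+ 2 * (p - p^`())) x).
Proof.
have [x0|x0|<-] := ltgtP 0 x.
- rewrite {2}/flat x0.
  have d1 : is_derive x (1 : R) (fun y : R => y^-1) (- x ^- 2).
    have := @is_deriveV _ id x 1 1 (lt0r_neq0 x0) (is_derive_id x 1).
    by rewrite /GRing.scale /= mulr1.
  have d2 := @is_derive1_comp _ (horner p) _ x _ _ (is_derive_poly p x^-1) d1.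
  have d3 := @is_derive1_comp _ expR (fun y => - y^-1) x _ _ (is_derive_expR _) (is_deriveN d1).
  have := is_deriveM d2 d3; rewrite /GRing.scale /=.
  have -> : p.[x^-1] * (expR (- x^-1) * - - x ^- 2) + expR (- x^-1) * (p^`().[x^-1] * - x ^- 2) =
     ('X ^+ 2 * (p - p^`())).[x^-1] * expR (- x^-1).
    by rewrite !hornerE /= exprVn; ring.
  apply: near_eq_is_derive; near=> y; rewrite /flat ifT //.
  by near: y; exact: lt_nbhsr.
- rewrite {2}/flat ltNge (ltW x0) /=.
  apply: near_eq_is_derive (is_derive_cst 0 x 1); near=> y.
  rewrite /flat ltNge ifF //; apply/negbTE; rewrite negbK; apply: ltW.
  by near: y; exact: lt_nbhsl.
have [B B0 hB] := flat_quadratic p.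
rewrite {2}/flat ltxx; apply: (@is_derive_near0 _ _ B); first by rewrite /flat ltxx.
by move=> y; rewrite subr0.
Unshelve. all: by end_near. Qed.

Lemma smooth_flat : smooth (fun x => (flat 1 x)%:C).
Proof.
pose q j := iter j (fun p : {poly R} => 'X ^+ 2 * (p - p^`())) 1.
apply: (@smooth_tower _ (fun j x => (flat (q j) x)%:C)) => j x; split.
  exact: flat_derive.
exact: is_derive_cst.
Qed.

Lemma flat_gt0 x : (0 < flat 1 x) = (0 < x).
Proof.
rewrite /flat; case: ifP => [x0|/negbT]; last by rewrite ltxx.
by rewrite hornerC mul1r expR_gt0.
Qed.

Lemma flat_ge0 x : 0 <= flat 1 x.
Proof.
by rewrite /flat; case: ifP => // x0; rewrite hornerC mul1r expR_ge0.
Qed.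

Definition rbump (x0 e x : R) : R := flat 1 (x - x0 + e) * flat 1 (x0 + e - x).

Lemma rbump_ge0 x0 e x : 0 <= rbump x0 e x.
Proof. by rewrite mulr_ge0 ?flat_ge0. Qed.

Lemma rbump_gt0 x0 e x : `|x - x0| < e -> 0 < rbump x0 e x.
Proof.
by rewrite ltr_norml => /andP[? ?]; rewrite mulr_gt0 ?flat_gt0 //; lra.
Qed.

Lemma rbump_eq0 x0 e x : e <= `|x - x0| -> rbump x0 e x = 0.
Proof.
rewrite ler_normr => /orP[h|h]; rewrite /rbump /flat.
  by rewrite [X in _ * (if X then _ else _)]ltNge (_ : x0 + e - x <= 0) ?mulr0 //; lra.
by rewrite ltNge (_ : x - x0 + e <= 0) ?mul0r //; lra.
Qed.

Lemma smooth_comp (f : R -> R[i]) s t : smooth f -> smooth (fun x => f (s * x + t)).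
Proof. by move=> h n; exact: C_comp. Qed.

Lemma smooth_bump x0 e : smooth (fun x => (rbump x0 e x)%:C).
Proof.
have -> : (fun x => (rbump x0 e x)%:C) = fun x =>
    (flat 1 (1 * x + (e - x0)))%:C * (flat 1 ((-1) * x + (x0 + e)))%:C.
  apply/funext => x; rewrite -rmorphM /rbump; congr (flat 1 _ * flat 1 _)%:C; ring.
by apply: smoothM; exact: (smooth_comp _ _ smooth_flat).
Qed.

Lemma antiderivative_pos (k G : R -> R) (a b x0 e : R) :
  (forall x, is_derive x (1 : R) G (k x)) -> (forall x, 0 <= k x) ->
  0 < e -> (forall x, `|x - x0| < e -> 0 < k x) -> a <= x0 - e -> x0 + e <= b -> G a < G b.
Proof.
move=> hG k0 e0 kp ax xb.
have cG : continuous G.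
  move=> x; apply: differentiable_continuous; apply/derivable1_diffP.
  exact: (@ex_derive _ _ _ _ _ _ _ (hG x)).
have mono u v : u <= v -> exists2 c, c \in `[u, v]%R & G v - G u = k c * (v - u).
  by move=> uv; apply: MVT_segment => //; exact: continuous_subspaceT.
have nd u v : u <= v -> G u <= G v.
  move=> uv; have [c _ ec] := mono u v uv.
  by rewrite -subr_ge0 ec mulr_ge0 // subr_ge0.
apply: le_lt_trans (nd a (x0 - e / 2) _) _; first lra.
apply: lt_le_trans (nd (x0 + e / 2) b _); last lra.
have [|c] := mono (x0 - e / 2) (x0 + e / 2); first lra.
rewrite in_itv /= => /andP[c1 c2] ec.
rewrite -subr_gt0 ec mulr_gt0 //; last lra.
by apply: kp; rewrite ltr_norml; apply/andP; split; lra.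
Qed.

Lemma cantiderivative (h : R -> R[i]) : ccont h -> exists G, cder G h.
Proof.
move=> [hr hi]; have [Gr dr] := antiderivative hr; have [Gi di] := antiderivative hi.
by exists (fun x => Gr x +i* Gi x) => x; split; [exact: dr|exact: di].
Qed.

(** A normalised primitive of a bump on [0, 1] is a smooth step [Th]; the cutoff is the product of
    two such steps facing each other. *)
Lemma smooth_cutoff (K : R) : 0 < K -> exists chi : R -> R[i], [/\ smooth chi,
  forall x, `|x| <= K -> chi x = 1 & forall x, K + 1 < `|x| -> chi x = 0].
Proof.
move=> K0; pose b := rbump (2^-1) (2^-1) : R -> R.
have sb : smooth (fun x => (b x)%:C) by exact: smooth_bump.
have [G dG] : exists G : R -> R, forall x, is_derive x (1 : R) G (b x).
  apply: antiderivative; have [cr _] := proj1 (C0E _) (sb 0%N); exact: cr.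
have G01 : G 0 < G 1.
  apply: (antiderivative_pos dG (@rbump_ge0 _ _) (_ : 0 < 2^-1) (@rbump_gt0 _ _));
    rewrite ?invr_gt0 //; lra.
pose D := G 1 - G 0; have D0 : D != 0 by rewrite subr_eq0 gt_eqF.
pose Th x : R[i] := ((G x - G 0) / D)%:C.
have dTh : cder Th (fun x => (D^-1)%:C * (b x)%:C).
  move=> x; split; rewrite /Ref /Imf /=; last first.
    by rewrite mulr0 mul0r addr0; exact: is_derive_cst.
  have := is_deriveZ (D^-1) (is_deriveB (dG x) (is_derive_cst (G 0) x 1)).
  rewrite subr0 mulr0 subr0 /GRing.scale /=.
  rewrite (_ : D^-1 \*: (G - cst (G 0)) = fun y => (G y - G 0) / D) //.
  by apply/funext => y; rewrite /GRing.scale /= mulrC.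
have sTh : smooth Th.
  move=> [|n]; first by rewrite C0E; exact: cder_ccont dTh.
  by apply: C_S dTh _; apply: C_M; [exact: C_cst|exact: sb].
have flatG x y : (forall z, Num.min x y <= z <= Num.max x y -> b z = 0) -> G y = G x.
  move=> bz; apply/eqP; rewrite -subr_eq0 -normr_le0.
  have := @derive_mvt_le _ G b 0 x y (fun z _ => dG z); rewrite mul0r; apply=> z hz.
  by rewrite bz // normr0.
have Th0 x : x <= 0 -> Th x = 0.
  move=> x0; rewrite /Th (_ : G x = G 0) ?subrr ?mul0r // ; apply: flatG => z.
  rewrite (min_idPr x0) (max_idPl x0) => /andP[_ z0]; apply: rbump_eq0.
  by rewrite ler_normr; apply/orP; right; lra.
have Th1 x : 1 <= x -> Th x = 1.
  move=> x1; rewrite /Th (_ : G x = G 1) ?divff //; apply: flatG => z.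
  rewrite (min_idPl x1) (max_idPr x1) => /andP[z0 _]; apply: rbump_eq0.
  by rewrite ler_normr; apply/orP; left; lra.
exists (fun x => Th (1 * x + (K + 1)) * Th ((-1) * x + (K + 1))); split.
- by apply: smoothM; exact: smooth_comp.
- by move=> x; rewrite ler_norml => /andP[? ?]; rewrite !Th1 ?mulr1 //; lra.
move=> x; rewrite lter_normr => /orP[?|?]; last by rewrite Th0 ?mul0r //; lra.
by rewrite [X in _ * X]Th0 ?mulr0 //; lra.
Qed.

End Bump.

(** * Integrals of compactly supported continuous functions *)

Section CompactlySupportedIntegrals.
Variable R : realType.
Local Notation mu := (@lebesgue_measure R).
Local Notation C := R[i].
Implicit Types (h f g : R -> C).

Definition csupp (K : R) h := ccont h /\ forall x, K < `|x| -> h x = 0.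

Lemma Rintegral_csupp (h G : R -> R) (K a b : R) : continuous h ->
  (forall x, K < `|x| -> h x = 0) -> (forall x, is_derive x (1 : R) G (h x)) ->
  a < b -> a <= - K -> K <= b -> Rintegral mu setT h = G b - G a.
Proof.
move=> ch hK dG ab aK Kb.
have -> : Rintegral mu setT h = Rintegral mu `[a, b] h.
  rewrite [RHS]Rintegral_mkcond; congr Rintegral; apply/funext => x.
  rewrite patchE; case: ifPn => //; rewrite notin_setE /= in_itv /= => /negP.
  rewrite negb_and -!ltNge => hx; apply: hK; rewrite ltr_normr.
  by case/orP: hx => ?; apply/orP; [right|left]; lra.
rewrite /Rintegral (@continuous_FTC2 _ h G) // ?EFinB //.
- exact: continuous_subspaceT.
- have cG : continuous G.
    move=> x; apply: differentiable_continuous; apply/derivable1_diffP.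
    exact: (@ex_derive _ _ _ _ _ _ _ (dG x)).
  split.
  + by move=> x _; exact: (@ex_derive _ _ _ _ _ _ _ (dG x)).
  + exact: (@cvg_at_right_filter _ _ G a (G a) (cG a)).
  + exact: (@cvg_at_left_filter _ _ G b (G b) (cG b)).
- by move=> x _; rewrite derive1E (@derive_val _ _ _ _ _ _ _ (dG x)).
Qed.

(** Linearity, substitution and integration by parts are all derived from this formula through the
    calculus of [cder], free of integrability conditions. *)
Lemma cintegralE h G (K a b : R) : csupp K h -> cder G h -> a < b -> a <= - K -> K <= b -> cintegral h = G b - G a.
Proof.
move=> [[hr hi] hK] dG ab aK Kb; apply: eqReIm; rewrite ?ReD ?ReN ?ImD ?ImN /=.
  apply: (@Rintegral_csupp (Ref h) (Ref G) _ _ _ hr _ _ ab aK Kb); last exact: cder_Re.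
  by move=> x xK; rewrite /Ref hK.
apply: (@Rintegral_csupp (Imf h) (Imf G) _ _ _ hi _ _ ab aK Kb); last exact: cder_Im.
by move=> x xK; rewrite /Imf hK.
Qed.

Lemma csupp_le K K' h : K <= K' -> csupp K h -> csupp K' h.
Proof. by move=> KK [ch hK]; split => // x xK; apply: hK; exact: le_lt_trans xK. Qed.

Lemma csuppMr K h f : csupp K h -> ccont f -> csupp K (fun x => h x * f x).
Proof.
move=> [ch hK] cf; split; first exact: ccontM.
by move=> x xK; rewrite hK ?mul0r.
Qed.

Lemma csuppZ K h (c : C) : csupp K h -> csupp K (fun x => c * h x).
Proof.
move=> [ch hK]; split; first by apply: ccontM => //; exact: ccont_cst.
by move=> x xK; rewrite hK ?mulr0.
Qed.

Lemma csuppD K h f : csupp K h -> csupp K f -> csupp K (fun x => h x + f x).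
Proof.
move=> [ch hK] [cf fK]; split; first exact: ccontD.
by move=> x xK; rewrite hK ?fK ?addr0.
Qed.

Lemma csupp0 K : csupp K (fun=> 0 : C).
Proof. by split => //; exact: ccont_cst. Qed.

Lemma csupp_sum K (I : Type) (s : seq I) (F : I -> R -> C) :
  (forall i, csupp K (F i)) -> csupp K (fun x => \sum_(i <- s) F i x).
Proof.
move=> h; split; first by apply: ccont_sum => i _; case: (h i).
by move=> x xK; apply: big1 => i _; case: (h i) => _; exact.
Qed.

Lemma cintegral_lin K h f (c : C) : csupp K h -> csupp K f ->
  cintegral (fun x => c * h x + f x) = c * cintegral h + cintegral f.
Proof.
move=> sh sf; have [H dH] := cantiderivative (proj1 sh).
have [F dF] := cantiderivative (proj1 sf).
have d := cderD (cderZ c dH) dF.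
pose b := `|K| + 1; have bK : K <= b by rewrite /b; have := ler_norm K; lra.
have b0 : - b < b by rewrite /b; have := normr_ge0 K; lra.
have bK' : - b <= - K by rewrite lerN2.
have s : csupp K (fun x => c * h x + f x) by apply: csuppD => //; exact: csuppZ.
rewrite (cintegralE s d b0 bK' bK).
rewrite (cintegralE sh dH b0 bK' bK).
rewrite (cintegralE sf dF b0 bK' bK); ring.
Qed.

Lemma cintegral0 : cintegral (fun=> 0 : C) = 0 :> C.
Proof.
have := cintegral_lin (-1) (csupp0 0) (csupp0 0).
by under eq_fun do rewrite mulr0 addr0; rewrite mulN1r addNr.
Qed.

Lemma cintegralZ K h (c : C) : csupp K h ->
  cintegral (fun x => c * h x) = c * cintegral h.
Proof.
move=> sh; have := cintegral_lin c sh (csupp0 K).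
by under eq_fun do rewrite addr0; rewrite cintegral0 addr0.
Qed.

Lemma cintegral_sum K (I : Type) (s : seq I) (F : I -> R -> C) :
  (forall i, csupp K (F i)) ->
  cintegral (fun x => \sum_(i <- s) F i x) = \sum_(i <- s) cintegral (F i).
Proof.
move=> h; elim: s => [|i s IH].
  by under eq_fun do rewrite big_nil; rewrite cintegral0 big_nil.
under eq_fun do rewrite big_cons -[F i _]mul1r.
by rewrite (cintegral_lin 1 (h i) (csupp_sum s h)) mul1r IH big_cons.
Qed.

(** The 4 is the constant 2 of [cmvt] times the factor 2 in the length 2 (K + 1); the added 1 keeps
    the interval nondegenerate for K = 0. *)
Lemma cintegral_le K h (M : R) : 0 <= K -> csupp K h ->
  (forall x, `|x| <= K -> cmod (h x) <= M) -> cmod (cintegral h) <= 4 * (K + 1) * M.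
Proof.
move=> K0 sh hM; have [H dH] := cantiderivative (proj1 sh).
have M0 : 0 <= M by apply: le_trans (hM 0 _); rewrite ?cmod_ge0 ?normr0.
have b1 : - (K + 1) < K + 1 by lra.
have b2 : - (K + 1) <= - K by lra.
have b3 : K <= K + 1 by lra.
rewrite (cintegralE sh dH b1 b2 b3).
have := @cmvt _ _ _ M (- (K + 1)) (K + 1) dH.
have -> : `|K + 1 - - (K + 1)| = 2 * (K + 1) by rewrite ger0_norm; lra.
rewrite !mulrA (_ : 2 * 2 = 4); last by rewrite -natrM.
apply=> z _; have [zK|zK] := leP `|z| K; first exact: hM.
by case: sh => _ -> //; rewrite cmod0.
Qed.

Lemma cintegral_dist K h : 0 <= K -> csupp K h ->
  cs_distribution (fun g => cintegral (fun x => h x * g x)).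
Proof.
move=> K0 sh; split.
  move=> c f g sf sg; have cf := proj1 (C0E _) (sf 0%N); have cg := proj1 (C0E _) (sg 0%N).
  rewrite -(cintegral_lin c (csuppMr sh cf) (csuppMr sh cg)).
  by congr cintegral; apply/funext => x; ring.
have [B B0 hB] := ccont_bounded (- K) K (proj1 sh).
exists 0%N, K, (4 * (K + 1) * B) => g M sg hM.
have cg := proj1 (C0E _) (sg 0%N); rewrite -[leRHS]mulrA.
apply: (@cintegral_le K _ (B * M) K0 (csuppMr sh cg)) => x xK; rewrite cmodM.
apply: ler_pM; rewrite ?cmod_ge0 //; first by apply: hB; rewrite -ler_norml.
by have := hM 0%N x (leqnn _) xK; rewrite cderivn0.
Qed.

Lemma ccont_eps h (x e : R) : ccont h -> 0 < e ->
  exists2 d : R, 0 < d & forall y, `|y - x| < d -> cmod (h y - h x) <= e.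
Proof.
move=> [hr hi] e0; have e2 : 0 < e / 2 by rewrite divr_gt0.
have /cvgrPdist_le/(_ _ e2)/nbhs_ball_real[d d0 hd] := hr x.
have /cvgrPdist_le/(_ _ e2)/nbhs_ball_real[d' d'0 hd'] := hi x.
exists (Num.min d d'); first by rewrite lt_min d0.
move=> y; rewrite lt_min => /andP[h1 h2].
apply: le_trans (cmod_le_ReIm _) _; rewrite ReD ImD ReN ImN (splitr e).
by apply: lerD; rewrite distrC; [exact: hd|exact: hd'].
Qed.

(* Testing against [conj (h x0)] times a real rbump at [x0] makes the real part
   of the integrand positive. *)
Lemma csupp_test0 h (x0 e : R) : ccont h -> 0 < e ->
  (forall g, smooth g -> (forall x, e <= `|x - x0| -> g x = 0) ->
     cintegral (fun x => h x * g x) = 0) -> h x0 = 0.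
Proof.
move=> ch e0 hg; apply/eqP; rewrite -cmod_eq0 eq_le cmod_ge0 andbT leNgt; apply/negP => n0.
have n20 : 0 < cmod (h x0) / 2 by rewrite divr_gt0.
have [d d0 hd] := ccont_eps x0 ch n20.
pose e1 := Num.min d e; have e10 : 0 < e1 by rewrite lt_min d0.
have sb := @smooth_bump R x0 e1.
have cb := proj1 (C0E _) (sb 0%N).
have bout x : e <= `|x - x0| -> (rbump x0 e1 x)%:C = 0 :> C.
  by move=> xe; rewrite rbump_eq0 // /e1 ge_min xe orbT.
pose z := conjc (h x0).
pose k x := z * (h x * (rbump x0 e1 x)%:C).
have ck : csupp (`|x0| + e1) k.
  split; first by apply: ccontM; [exact: ccont_cst|exact: ccontM].
  move=> x xK; rewrite /k rbump_eq0 ?mulr0 //.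
  by have := ler_distD x0 x 0; rewrite !subr0; lra.
have [G dG] := cantiderivative (proj1 ck).
pose b : R := `|x0| + e1 + 1.
have x00 := normr_ge0 x0.
have : cintegral k = 0.
  rewrite (@cintegralZ (`|x0| + e1) (fun x => h x * (rbump x0 e1 x)%:C)) ?hg ?mulr0 //.
  split; first exact: ccontM.
  move=> x xK; rewrite rbump_eq0 ?mulr0 //.
  by have := ler_distD x0 x 0; rewrite !subr0; lra.
have b1 : - b < b by rewrite /b; lra.
have b2 : - b <= - (`|x0| + e1) by rewrite /b; lra.
have b3 : `|x0| + e1 <= b by rewrite /b; lra.
rewrite (cintegralE ck dG b1 b2 b3).
move=> /(congr1 (@complex.Re R)); rewrite ReD ReN /= => /eqP; rewrite subr_eq0 => /eqP eG.
have kRe x : Ref k x = complex.Re (z * h x) * rbump x0 e1 x.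
  by rewrite /Ref /k mulrA; move: (z * h x) => w; rewrite ReM /= mulr0 subr0.
have pos x : `|x - x0| < d -> 0 < complex.Re (z * h x).
  move=> xd; have -> : z * h x = z * h x0 + z * (h x - h x0) by ring.
  have e2 : complex.Re (z * h x0) = cmod (h x0) ^+ 2.
    rewrite /z /cmod; case: (h x0) => u v /=.
    by rewrite mulNr opprK sqr_sqrtr ?addr_ge0 ?sqr_ge0 // !expr2.
  have zc : cmod z = cmod (h x0) by rewrite /z /cmod; case: (h x0) => u v /=; rewrite sqrrN.
  rewrite ReD e2; have := cmod_Re (z * (h x - h x0)); rewrite cmodM zc ler_norml => /andP[lo _].
  have := ler_wpM2l (ltW n0) (hd x xd).
  have : 0 < cmod (h x0) ^+ 2 by rewrite exprn_gt0.
  nra.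
have nn x : 0 <= Ref k x.
  rewrite kRe; have [xe|xe] := leP e1 `|x - x0|; first by rewrite rbump_eq0 ?mulr0.
  rewrite mulr_ge0 ?rbump_ge0 // ltW //; apply: pos.
  by apply: lt_le_trans xe _; rewrite /e1 ge_min lexx.
have := @antiderivative_pos R (Ref k) (Ref G) (- b) b x0 e1 (fun x => cder_Re dG x) nn e10.
rewrite /Ref /b eG ltxx => /(_ _ _ _)/wrap[] //; last 2 first.
- by have := ler_norm (- x0); rewrite normrN; lra.
- by have := ler_norm x0; lra.
move=> x xe; have := kRe x; rewrite /Ref => ->; rewrite mulr_gt0 ?rbump_gt0 //; apply: pos.
by apply: lt_le_trans xe _; rewrite /e1 ge_min lexx.
Qed.

Lemma cder_local0 f f' (u v : R) : cder f f' -> (forall y, u < y < v -> f y = 0) ->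
  forall y, u < y < v -> f' y = 0.
Proof.
move=> d f0 y uyv; have nr : \forall z \near y, u < z < v.
  case/andP: uyv => uy yv; near=> z; apply/andP; split; near: z.
    exact: lt_nbhsr.
  exact: lt_nbhsl.
apply: eqReIm.
  have : is_derive y (1 : R) (fun=> 0) (Ref f' y).
    apply: near_eq_is_derive (cder_Re d y); apply: filterS nr => z /f0.
    by rewrite /Ref => ->.
  by move=> h; rewrite -[LHS](@derive_val _ _ _ _ _ _ _ h) derive_cst.
have : is_derive y (1 : R) (fun=> 0) (Imf f' y).
  apply: near_eq_is_derive (cder_Im d y); apply: filterS nr => z /f0.
  by rewrite /Imf => ->.
by move=> h; rewrite -[LHS](@derive_val _ _ _ _ _ _ _ h) derive_cst.
Unshelve. all: by end_near. Qed.

Lemma cderivn_local0 g (u v : R) j : smooth g -> (forall y, u < y < v -> g y = 0) ->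
  forall y, u < y < v -> cderivn j g y = 0.
Proof.
move=> sg g0; elim: j => [|j IH]; first by rewrite cderivn0.
exact: cder_local0 (smooth_cder sg j) IH.
Qed.

(** The strict inequality K < K' makes [g] vanish near every point of [-K, K], so all its
    derivatives vanish there and the continuity bound applies with M = 0. *)
Lemma dist_local T : cs_distribution T -> exists2 K : R, 0 < K &
  forall g K', smooth g -> K < K' -> (forall y, `|y| < K' -> g y = 0) -> T g = 0.
Proof.
move=> hT; have [N [K [c [K0 c0 hb]]]] := dist_bound hT; exists K => // g K' sg KK g0.
apply/eqP; rewrite -cmod_eq0 eq_le cmod_ge0 andbT -(mulr0 c); apply: hb => //.
move=> j x _; rewrite ler_norml => /andP[x1 x2].
rewrite (@cderivn_local0 g (- K') K') ?cmod0 //; last by apply/andP; split; lra.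
by move=> y; rewrite -ltr_norml; exact: g0.
Qed.

End CompactlySupportedIntegrals.

(** * Uniform continuity and dyadic Riemann sums *)

Section RiemannSums.
Variable R : realType.
Local Notation C := R[i].
Implicit Types (h f g : R -> C).

(** Continuous induction again: [S] collects the points up to which a single [d] serves the whole
    half-line to the left. It starts where [h] still vanishes and is pushed beyond the support. *)
Lemma csupp_uniform (K : R) h : csupp K h -> forall e : R, 0 < e ->
  exists2 d : R, 0 < d & forall x y, `|x - y| < d -> cmod (h x - h y) <= e.
Proof.
move=> [ch hK] e e0; pose a := - (`|K| + 1); pose b := `|K| + 2.
have K0 := normr_ge0 K; have KK := ler_norm K.
pose S := [set x | a <= x <= b /\ exists2 d : R, 0 < d &
  forall y z, y <= x -> z <= x -> `|y - z| < d -> cmod (h y - h z) <= e].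
have Sa : S a.
  split; first by rewrite lexx /a /b; lra.
  exists 1 => // y z; rewrite /a => ya za _; rewrite !hK ?subrr ?cmod0 ?ltW //.
    by rewrite ltr_normr; apply/orP; right; lra.
  by rewrite ltr_normr; apply/orP; right; lra.
have hS : has_sup S by split; [exists a|exists b => x [/andP[]]].
set s := sup S.
have as0 : a <= s by apply: ub_le_sup => //; case: hS.
have s0b : s <= b by apply: ge_sup; [exists a|move=> x [/andP[]]].
have e20 : 0 < e / 2 by rewrite divr_gt0.
have [eta eta0 he] := ccont_eps s ch e20.
have [x Sx xs] := sup_adherent eta0 hS; rewrite -/s in xs.
have xs0 : x <= s by apply: ub_le_sup => //; case: hS.
case: Sx => xab [d d0 hd].
have ext y0 : y0 < s + eta -> exists2 d : R, 0 < d &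
    forall y z, y <= y0 -> z <= y0 -> `|y - z| < d -> cmod (h y - h z) <= e.
  move=> y0s; exists (Num.min d (x - (s - eta))); first by rewrite lt_min d0 subr_gt0.
  have half y : s - eta < y -> y <= y0 -> cmod (h y - h s) <= e / 2.
    by move=> h1 h2; apply: he; rewrite ltr_norml; apply/andP; split; lra.
  move=> y z yy zz; rewrite lt_min => /andP[h1]; rewrite ltr_norml => /andP[h2 h3].
  have [yx|xy] := leP y x; have [zx|xz] := leP z x; first exact: hd.
  - have -> : h y - h z = (h y - h s) - (h z - h s) by ring.
    apply: le_trans (cmodB _ _) _; rewrite (splitr e); apply: lerD; apply: half => //; lra.
  - have -> : h y - h z = (h y - h s) - (h z - h s) by ring.
    apply: le_trans (cmodB _ _) _; rewrite (splitr e); apply: lerD; apply: half => //; lra.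
  - have -> : h y - h z = (h y - h s) - (h z - h s) by ring.
    apply: le_trans (cmodB _ _) _; rewrite (splitr e); apply: lerD; apply: half => //; lra.
have sb : b < s + eta.
  rewrite ltNge; apply/negP => sb.
  have : S (s + eta / 2).
    split; first by apply/andP; split; lra.
    by apply: ext; lra.
  move/(ub_le_sup (proj2 hS)); rewrite -/s; lra.
have [d' d'0 hd'] := ext b sb.
exists (Num.min d' 1); first by rewrite lt_min d'0 ltr01.
move=> y z; rewrite lt_min => /andP[h1 h2].
have [yb|yb] := leP y b; have [zb|zb] := leP z b; first exact: hd'.
- rewrite !hK ?subrr ?cmod0 ?ltW //; rewrite ltr_normr; apply/orP; left;
  move: h2; rewrite ltr_norml /b in zb * => /andP[? ?]; lra.
- rewrite !hK ?subrr ?cmod0 ?ltW //; rewrite ltr_normr; apply/orP; left;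
  move: h2; rewrite ltr_norml /b in yb * => /andP[? ?]; lra.
- rewrite !hK ?subrr ?cmod0 ?ltW //; rewrite ltr_normr; apply/orP; left;
  move: zb yb; rewrite /b => ? ?; lra.
Qed.

Lemma dyadic_supp (V : zmodType) (h : R -> V) (M n : nat) :
  (forall x : R, M%:R < `|x| -> h x = 0) ->
  supp (M * 2 ^ n) (fun k : int => h (2 ^- n * k%:~R)).
Proof.
move=> hM k kM; apply: hM; rewrite normrM ger0_norm ?invr_ge0 ?exprn_ge0 //.
rewrite ltr_pdivlMl ?exprn_gt0 // -intr_norm -natrX -natrM mulnC.
by rewrite -abszE -pmulrn ltr_nat.
Qed.

Lemma riemann_sum (K : R) h : csupp K h -> forall e : R, 0 < e ->
  exists n0 : nat, forall n, (n0 <= n)%N ->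
  cmod (2 ^- n * \sum_(k \in [set: int]) h (2 ^- n * k%:~R) - cintegral h) <= e.
Proof.
move=> sh e e0; pose M := (Num.truncn `|K|).+2.
have KM : `|K| + 1 < M%:R.
  by rewrite /M -[X in _ < X]natr1 ltrD2r; exact: truncnS_gt.
have K0 := normr_ge0 K; have KK := ler_norm K.
have M0 : (0 : R) < M%:R by lra.
(* There are 2 M 2^n cells of length 2^(-n), and [cmvt] costs 2 2^(-n) e' on each: 4 M e' in
   total. *)
pose e' := e / (4 * M%:R); have e'0 : 0 < e' by rewrite divr_gt0 // mulr_gt0.
have [d d0 hd] := csupp_uniform sh e'0.
have [G dG] := cantiderivative (proj1 sh).
have b1 : - M%:R < M%:R :> R by lra.
have b2 : - M%:R <= - K :> R by lra.
have b3 : K <= M%:R by lra.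
rewrite (cintegralE sh dG b1 b2 b3).
exists (Num.truncn d^-1) => n nd.
pose t : R := 2 ^- n.
have t0 : 0 < t by rewrite invr_gt0 exprn_gt0.
have td : t < d.
  rewrite /t invf_plt ?posrE ?exprn_gt0 //; apply: lt_le_trans (truncnS_gt _) _.
  rewrite -natrX ler_nat; apply: leq_ltn_trans nd _; exact: ltn_expl.
pose Q := (M * 2 ^ n)%N.
have QtM : Q%:R * t = M%:R.
  by rewrite /Q natrM natrX /t mulfK // expf_neq0.
have hM (x : R) : M%:R < `|x| -> h x = 0 by move=> xM; case: sh => _; apply; lra.
rewrite (Zsum_seq (@dyadic_supp _ _ _ n hM)) big_map -/Q.
have -> : iota 0 (Q.*2).+1 = index_iota 0 (Q.*2).+1 by rewrite /index_iota subn0.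
rewrite big_nat_recr //= big_mkord.
pose x i := - M%:R + i%:R * t.
have xE i : 2 ^- n * (i%:Z - Q%:Z)%:~R = x i.
  by rewrite rmorphB /= mulrBr -/t [t * Q%:R]mulrC QtM /x mulrC; ring.
rewrite xE (_ : x Q.*2 = M%:R); last by rewrite /x -muln2 natrM mulrAC QtM; ring.
have -> : h M%:R = 0 by case: sh => _; apply; rewrite ger0_norm //; lra.
rewrite addr0.
have -> : G M%:R - G (- M%:R) = \sum_(i < Q.*2) (G (x i.+1) - G (x i)).
  rewrite -(big_mkord xpredT (fun i => G (x i.+1) - G (x i))) telescope_sumr //.
  congr (G _ - G _); last by rewrite /x mul0r addr0.
  by rewrite /x -muln2 natrM mulrAC QtM; ring.
rewrite mulr_sumr -sumrB.
apply: le_trans (cmod_sum_le (e := 2 * t * e') _) _; last first.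
  rewrite card_ord -muln2 natrM.
  have -> : Q%:R * 2 * (2 * t * e') = 4 * (Q%:R * t) * e' by ring.
  by rewrite QtM /e' mulrC divfK // gt_eqF // mulr_gt0.
move=> i; rewrite xE.
have d1 := cderB dG (cderZ (h (x i)) (@cder_id R)).
have := @cmvt _ _ _ e' (x i) (x i.+1) d1.
have xx : x i.+1 - x i = t by rewrite /x -natr1; ring.
rewrite xx gtr0_norm // => hm.
have -> : 2 ^- n * h (x i) - (G (x i.+1) - G (x i)) =
   - (G (x i.+1) - h (x i) * (x i.+1)%:C - (G (x i) - h (x i) * (x i)%:C)).
  have -> : (x i.+1)%:C = (x i)%:C + t%:C by rewrite -rmorphD -xx; congr _%:C; ring.
  have -> : (2 ^- n : C) = t%:C by rewrite /t fmorphV rmorphXn rmorph_nat.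
  ring.
rewrite cmodN; apply: hm => z; rewrite mulr1 ge_min le_max => hz; apply: hd.
have : x i <= x i.+1 by rewrite -subr_ge0 xx ltW.
by move: hz => /andP[/orP[?|?] /orP[?|?]] ?; rewrite ltr_norml; apply/andP; split; lra.
Qed.

End RiemannSums.

(** * From the refinable distribution to a refinable function *)

Section DistributionToFunction.
Variables (R : realType) (r : nat) (a : int -> 'M[R[i]]_r) (Na : nat).
Hypothesis supp_a : supp Na a.
Variables (phi : 'I_r -> (R -> R[i]) -> R[i]) (F : 'I_r -> R -> R[i]).
Hypothesis phi_dist : forall l, cs_distribution (phi l).
Hypothesis phi_ref : forall xi : R,
  fourier_vec phi (2 * xi) = symbol a xi *m fourier_vec phi xi.
Hypothesis F_cont : forall l, ccont (F l).
Hypothesis F_rep : forall l, represents (F l) (phi l).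
Local Notation C := R[i].

Lemma represents_csupp : exists2 K : R, 0 < K & forall l, csupp K (F l).
Proof.
have h l := cid2 (dist_local (phi_dist l)).
pose K := \big[Num.max/1]_(l < r) s2val (h l).
have Kle l : s2val (h l) <= K by rewrite /K (bigD1 l) //= le_max lexx.
have K0 : 0 < K.
  by rewrite /K; elim/big_rec: _ => // l x _ x0; rewrite lt_max x0 orbT.
exists K => // l; split=> // x xK; have := Kle l; case: (h l) => Kl Kl0 hl /= KlK.
apply: (@csupp_test0 _ _ x ((`|x| - K) / 2)) => //; first by rewrite divr_gt0 // subr_gt0.
move=> g sg g0; have := F_rep l sg _ => <-.
  apply: (hl g (K + (`|x| - K) / 2)) => //; first lra.
  move=> y yK; apply: g0; have := ler_distD y x 0; rewrite !subr0 distrC; lra.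
exists (`|x| + (`|x| - K)) => y yK; apply: g0.
by have := ler_distD x y 0; rewrite !subr0; lra.
Qed.

Lemma ccont_cisN (xi : R) : ccont (fun x => cis (- (x * xi))).
Proof. exact: proj1 (C0E _) (cisN_smooth xi 0%N). Qed.

(** Exponentials are not admissible in [represents], which tests on compact supports only. A cutoff
    equal to 1 beyond both supports splits the exponential; the far part is killed by
    [dist_local]. *)
Lemma represents_fourier l xi :
  fourier (phi l) xi = cintegral (fun x => F l x * cis (- (x * xi))).
Proof.
have [K K0 hK] := represents_csupp; have [K' K'0 hl] := dist_local (phi_dist l).
have KK : 0 < K + K' by exact: addr_gt0.
have [chi [schi chi1 chi0]] := smooth_cutoff KK.
have se := cisN_smooth xi.
have s1 : smooth (fun x => chi x * cis (- (x * xi))) by exact: smoothM.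
have s2 : smooth (fun x => cis (- (x * xi)) + -1 * (chi x * cis (- (x * xi)))).
  by apply: smoothD => //; apply: smoothM => //; exact: smooth_cst.
have -> : fourier (phi l) xi = phi l (fun x => chi x * cis (- (x * xi))) +
    phi l (fun x => cis (- (x * xi)) + -1 * (chi x * cis (- (x * xi)))).
  rewrite /fourier -(distD (phi_dist l) s1 s2); congr (phi l _); apply/funext => x; ring.
have -> : phi l (fun x => cis (- (x * xi)) + -1 * (chi x * cis (- (x * xi)))) = 0.
  apply: (hl _ (K + K')) => //; first lra.
  by move=> y yK; rewrite chi1 ?mul1r ?mulN1r ?subrr // ltW.
rewrite addr0 (F_rep l s1); last first.
  by exists (K + K' + 1) => x xK; rewrite chi0 ?mul0r.
congr cintegral; apply/funext => x; have [xK|xK] := leP `|x| K.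
  by rewrite chi1 ?mul1r //; lra.
by case: (hK l) => _ /(_ x xK) ->; rewrite !mul0r.
Qed.

Lemma cintegral_dilate K (h : R -> C) (k : int) (xi : R) : 0 < K -> csupp K h ->
  cintegral (fun x => h (2 * x - k%:~R) * cis (- (x * (2 * xi)))) =
  2^-1 * cis (- (k%:~R * xi)) * cintegral (fun x => h x * cis (- (x * xi))).
Proof.
move=> K0 sh; have sh1 := csuppMr sh (ccont_cisN xi).
have [G dG] := cantiderivative (proj1 sh1).
pose B := K + `|k%:~R| + 1 : R.
have k0 := normr_ge0 (k%:~R : R).
have sh2 : csupp B (fun x => h (2 * x - k%:~R) * cis (- (x * (2 * xi)))).
  apply: csuppMr (ccont_cisN _); split.
    by case: sh => ch _; exact: (@ccont_comp _ h 2 (- k%:~R)).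
  move=> x xB; case: sh => _; apply; move: xB; rewrite /B.
  have := ler_norm (k%:~R : R); have := ler_norm (- k%:~R : R); rewrite normrN.
  by rewrite !ltr_normr => ? ? /orP[?|?]; apply/orP; [left|right]; lra.
have d2 := cderZ (2^-1 * cis (- (k%:~R * xi))) (cder_comp 2 (- k%:~R) dG).
have e2 x : 2^-1 * cis (- (k%:~R * xi)) * ((2 : R)%:C * (h (2 * x + - k%:~R) *
    cis (- ((2 * x + - k%:~R) * xi)))) = h (2 * x - k%:~R) * cis (- (x * (2 * xi))).
  rewrite (_ : - (x * (2 * xi)) = - (k%:~R * xi) + - ((2 * x + - k%:~R) * xi)); last by ring.
  by rewrite cisD rmorph_nat; field.
have d3 := cderE d2 e2.
have b1 : - (2 * B) < 2 * B by rewrite /B; lra.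
have b2 : - (2 * B) <= - B by rewrite /B; lra.
have b3 : B <= 2 * B by rewrite /B; lra.
rewrite (cintegralE sh2 d3 b1 b2 b3).
have kle := ler_norm (k%:~R : R); have := ler_norm (- k%:~R : R); rewrite normrN => kle'.
have c1 : 2 * - (2 * B) + - k%:~R < 2 * (2 * B) + - k%:~R by rewrite /B; lra.
have c2 : 2 * - (2 * B) + - k%:~R <= - K by rewrite /B; lra.
have c3 : K <= 2 * (2 * B) + - k%:~R by rewrite /B; lra.
rewrite (cintegralE sh1 dG c1 c2 c3); ring.
Qed.

Definition Fvec (x : R) : 'cV[C]_r := \col_l F l x.

(** The difference [hh] of both sides is continuous with compact support, and its Fourier transform
    vanishes by [phi_ref]. By [dist_inj] it is the zero distribution, and continuity makes it vanish
    pointwise. *)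
Lemma represents_refine x :
  Fvec x = 2 *: \sum_(k \in [set: int]) a k *m Fvec (2 * x - k%:~R).
Proof.
have [K K0 hK] := represents_csupp; apply/colP => l.
have sA y : supp Na (fun k => a k *m Fvec (2 * y - k%:~R)).
  by move=> k kN; rewrite supp_a ?mul0mx.
pose S y : C := \sum_(k <- int_range Na) \sum_j a k l j * F j (2 * y - k%:~R).
have SE y : (2 *: \sum_(k \in [set: int]) a k *m Fvec (2 * y - k%:~R)) l ord0 = 2 * S y.
  rewrite mxE (Zsum_seq (sA y)) summxE; congr (_ * _); apply: eq_bigr => k _.
  by rewrite mxE; apply: eq_bigr => j _; rewrite mxE.
rewrite SE mxE; apply/eqP; rewrite -subr_eq0; apply/eqP.
pose B := K + Na%:R : R.
have cF k j : csupp B (fun y => F j (2 * y - k%:~R)) \/ k \notin int_range Na.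
  have [kN|kN] := boolP (k \in int_range Na); [left|by right].
  split; first by case: (hK j) => cj _; exact: (@ccont_comp _ (F j) 2 (- k%:~R)).
  move=> y yB; case: (hK j) => _; apply.
  have : `|k%:~R| <= Na%:R :> R.
    by rewrite -intr_norm -abszE -pmulrn ler_nat -mem_int_range.
  move: yB; rewrite /B ler_norml !ltr_normr => + /andP[? ?].
  by case/orP => ?; apply/orP; [left|right]; lra.
(* The guard on [k] is always true inside the sum; it is there because [csupp_sum] and
   [cintegral_sum] ask for a common support radius at every index, listed or not. *)
pose hh y := F l y + -2 * \sum_(k <- int_range Na) \sum_j
   (if k \in int_range Na then a k l j else 0) * F j (2 * y - k%:~R).
have hhE y : F l y - 2 * S y = hh y.
  rewrite /hh mulNr; congr (_ - 2 * _); apply: eq_big_seq => k ->.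
  by [].
rewrite hhE.
have sh0 k j : csupp B (fun y => (if k \in int_range Na then a k l j else 0) * F j (2 * y - k%:~R)).
  case: (cF k j) => [h|/negPf ->]; first exact: csuppZ.
  by under eq_fun do rewrite mul0r; exact: csupp0.
have shF : csupp B (F l) by apply: csupp_le (hK l); rewrite lerDl.
have shsum : csupp B (fun y => \sum_(k <- int_range Na) \sum_j
   (if k \in int_range Na then a k l j else 0) * F j (2 * y - k%:~R)).
  by apply: csupp_sum => k; apply: csupp_sum => j; exact: sh0.
have shh : csupp B hh by apply: csuppD => //; exact: csuppZ.
have B0 : 0 <= B by rewrite addr_ge0 // ltW.
have T0 := cintegral_dist B0 shh.
suff f0 : forall xi, fourier (fun g => cintegral (fun y => hh y * g y)) xi = 0.
  apply: (@csupp_test0 _ hh x 1) => //; first by case: shh.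
  by move=> g sg _; exact: (dist_inj T0 f0 sg).
move=> xi; rewrite /fourier.
have ce := ccont_cisN xi.
have -> : (fun y => hh y * cis (- (y * xi))) = fun y =>
   -2 * (\sum_(k <- int_range Na) \sum_j (if k \in int_range Na then a k l j else 0) *
     (F j (2 * y - k%:~R) * cis (- (y * xi)))) + F l y * cis (- (y * xi)).
  apply/funext => y; rewrite /hh mulrDl addrC -mulrA mulr_suml; congr (_ * _ + _).
  by apply: eq_bigr => k _; rewrite mulr_suml; apply: eq_bigr => j _; rewrite mulrA.
have sk k j : csupp B (fun y => (if k \in int_range Na then a k l j else 0) *
     (F j (2 * y - k%:~R) * cis (- (y * xi)))).
  by under eq_fun do rewrite mulrA; apply: csuppMr.
rewrite (@cintegral_lin _ B) => [||]; first last.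
- exact: csuppMr.
- by apply: csupp_sum => k; apply: csupp_sum => j; exact: sk.
rewrite (@cintegral_sum _ B) => [|k]; last by apply: csupp_sum => j; exact: sk.
rewrite -represents_fourier.
have -> : fourier (phi l) xi = \sum_(k <- int_range Na) \sum_j
   cis (- (k%:~R * (xi / 2))) * a k l j * fourier (phi j) (xi / 2).
  have := phi_ref (xi / 2); rewrite mulrC divfK ?pnatr_eq0 // => /matrixP/(_ l ord0).
  rewrite !mxE => ->; rewrite exchange_big /=; apply: eq_bigr => j _.
  rewrite (symbol_seq _ supp_a) summxE mulr_suml; apply: eq_bigr => k _.
  by rewrite !mxE.
rewrite mulr_sumr -big_split /= big_seq big1 // => k kN.
rewrite (@cintegral_sum _ B) => [|j]; last exact: sk.
rewrite mulr_sumr -big_split /= big1 // => j _.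
rewrite kN represents_fourier.
have := cF k j; rewrite kN => -[cj|//].
rewrite (@cintegralZ _ B); last exact: csuppMr.
have e := cintegral_dilate k (xi / 2) K0 (hK j).
rewrite (_ : 2 * (xi / 2) = xi) in e; last by rewrite mulrC divfK // pnatr_eq0.
by rewrite e; field.
Qed.

End DistributionToFunction.

(** * Moments and matching filters *)

Section Moments.
Variable R : realType.
Local Notation C := R[i].

Definition mom (q : nat) s t (w : int -> 'M[C]_(s, t)) : 'M[C]_(s, t) :=
  \sum_(k \in [set: int]) k%:~R ^+ q *: w k.

(* Convolution for [e = 1], subdivision for [e = 2], iterated subdivision for
   [e = 2 ^ n]. *)
Definition gconv (e : int) s r t (w : int -> 'M[C]_(s, r)) (b : int -> 'M[C]_(r, t)) :
  int -> 'M[C]_(s, t) := fun k => \sum_(j \in [set: int]) w j *m b (k - e * j).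

Lemma mom_seq q s t (w : int -> 'M[C]_(s, t)) N : supp N w ->
  mom q w = \sum_(k <- int_range N) k%:~R ^+ q *: w k.
Proof. by move=> hw; apply: Zsum_seq => k kN; rewrite hw ?scaler0. Qed.

Lemma mom_entry q s t (w : int -> 'M[C]_(s, t)) N i j : supp N w ->
  mom q w i j = \sum_(k \in [set: int]) k%:~R ^+ q * w k i j.
Proof.
move=> hw; rewrite /mom (@Zsum_mxE _ N) => [|k kN]; last by rewrite hw ?scaler0.
by apply: eq_fsbigr => k _; rewrite mxE.
Qed.

Lemma momD q s t (w u : int -> 'M[C]_(s, t)) N c : supp N w -> supp N u ->
  mom q (fun k => c *: w k + u k) = c *: mom q w + mom q u.
Proof.
move=> hw hu; have h : supp N (fun k => c *: w k + u k).
  by move=> k kN; rewrite hw ?hu ?scaler0 ?addr0.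
rewrite (mom_seq _ h) (mom_seq _ hw) (mom_seq _ hu) scaler_sumr -big_split /=.
by apply: eq_bigr => k _; rewrite scalerDr !scalerA [c * _]mulrC.
Qed.

Lemma gconv_supp e s r t (w : int -> 'M[C]_(s, r)) (b : int -> 'M[C]_(r, t)) N M :
  supp N w -> supp M b -> supp (`|e| * N + M) (gconv e w b).
Proof.
move=> hw hb k kN; apply: fsbig1 => j _; have [jN|jN] := ltnP N `|j|.
  by rewrite hw ?mul0mx.
rewrite hb ?mulmx0 //; have : (absz (e * j)%R <= `|e| * N)%N.
  by rewrite abszM leq_mul2l jN orbT.
by lia.
Qed.

Lemma mom_gconv q e s r t (w : int -> 'M[C]_(s, r)) (b : int -> 'M[C]_(r, t)) N M :
  supp N w -> supp M b -> mom q (gconv e w b) =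
  \sum_(i < q.+1) \sum_(k \in [set: int])
    ('C(q, i)%:R * e%:~R ^+ i * k%:~R ^+ (q - i)) *: (mom i w *m b k).
Proof.
move=> hw hb; rewrite (mom_seq _ (gconv_supp (e := e) hw hb)).
set L := (`|e| * N + M)%N.
have sE k : gconv e w b k = \sum_(j <- int_range N) w j *m b (k - e * j).
  by apply: Zsum_seq => j jN; rewrite hw ?mul0mx.
transitivity (\sum_(j <- int_range N) \sum_(k \in [set: int])
    (k + e * j)%:~R ^+ q *: (w j *m b k)).
  under eq_bigr => k _ do rewrite sE scaler_sumr.
  rewrite exchange_big /=; rewrite big_seq [RHS]big_seq; apply: eq_bigr => j.
  rewrite mem_int_range => jN.
  rewrite -[RHS](Zsum_shift (- (e * j))) (@Zsum_seq _ L).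
    by apply: eq_bigr => k _; rewrite subrK.
  move=> k kL; rewrite hb ?mulmx0 ?scaler0 //.
  have : (absz (e * j)%R <= `|e| * N)%N by rewrite abszM leq_mul2l jN orbT.
  by move: kL; rewrite /L; lia.
have s1 i : supp M (fun k => ('C(q, i)%:R * e%:~R ^+ i * k%:~R ^+ (q - i)) *: (mom i w *m b k)).
  by move=> k kM; rewrite hb ?mulmx0 ?scaler0.
under [RHS]eq_bigr => i _ do rewrite (Zsum_seq (s1 i)).
rewrite [RHS]exchange_big /=.
transitivity (\sum_(j <- int_range N) \sum_(k <- int_range M)
    (k + e * j)%:~R ^+ q *: (w j *m b k)).
  apply: eq_bigr => j _; apply: Zsum_seq => k kM.
  by rewrite hb ?mulmx0 ?scaler0.
rewrite exchange_big /=; apply: eq_bigr => k _.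
under [RHS]eq_bigr => i _ do rewrite (mom_seq _ hw) mulmx_suml scaler_sumr.
rewrite [RHS]exchange_big /=; apply: eq_bigr => j _.
rewrite rmorphD rmorphM /= exprDn scaler_suml; apply: eq_bigr => i _.
rewrite -scalemxAl scalerA; congr (_ *: _); rewrite exprMn -mulr_natl; ring.
Qed.

Lemma seq_conv_gconv s r t (w : int -> 'M[C]_(s, r)) (b : int -> 'M[C]_(r, t)) :
  seq_conv w b = gconv 1 w b.
Proof.
apply/funext => k; rewrite /seq_conv /gconv -[LHS](Zsum_rev k).
by apply: eq_fsbigr => j _; rewrite mul1r opprB addrC subrK.
Qed.

Lemma seq_conv_supp s r t (w : int -> 'M[C]_(s, r)) (b : int -> 'M[C]_(r, t)) N M :
  supp N w -> supp M b -> supp (N + M) (seq_conv w b).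
Proof. by move=> hw hb; rewrite seq_conv_gconv; have := gconv_supp (e := 1) hw hb; rewrite mul1n. Qed.

Lemma subdiv_gconv s r (a : int -> 'M[C]_r) (w : int -> 'M[C]_(s, r)) N : supp N w ->
  subdiv a w = gconv 2 (fun k => 2 *: w k) a.
Proof.
move=> hw; apply/funext => k; rewrite /subdiv /gconv (@Zsum_scale _ N) => [|j jN].
  by apply: eq_fsbigr => j _; rewrite scalemxAl.
by rewrite hw ?mul0mx.
Qed.

(** By the binomial expansion in [mom_gconv], the moment of order [q] is linear in the moments of
    the left factor of order at most [q] and sees nothing else of it. *)
Lemma mom_conv_eq q s r t (w w' : int -> 'M[C]_(s, r)) (b : int -> 'M[C]_(r, t)) e N M c :
  supp N w -> supp N w' -> supp M b ->
  (forall i, (i <= q)%N -> mom i w = c *: mom i w') ->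
  mom q (gconv e w b) = c *: mom q (gconv e w' b).
Proof.
move=> hw hw' hb h; rewrite (mom_gconv q e hw hb) (mom_gconv q e hw' hb).
rewrite scaler_sumr; apply: eq_bigr => i _; rewrite (@Zsum_scale _ M) => [|k kM].
  apply: eq_fsbigr => k _; rewrite h; last by rewrite -ltnS.
  by rewrite -scalemxAl !scalerA mulrC.
by rewrite hb ?mulmx0 ?scaler0.
Qed.

Definition nabla s t (u : int -> 'M[C]_(s, t)) : int -> 'M[C]_(s, t) :=
  fun k => u k - u (k - 1).

Lemma nabla_supp s t (u : int -> 'M[C]_(s, t)) N : supp N u -> supp N.+1 (nabla u).
Proof. by move=> hu k kN; rewrite /nabla !hu ?subrr //; lia. Qed.

Lemma iter_nabla_supp s t (u : int -> 'M[C]_(s, t)) N n :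
  supp N u -> supp (N + n) (iter n (@nabla s t) u).
Proof.
by move=> hu; elim: n => [|n IH]; rewrite ?addn0 // addnS; exact: nabla_supp.
Qed.

Lemma seq_conv_nabla s r t (w : int -> 'M[C]_(s, r)) (u : int -> 'M[C]_(r, t)) N :
  supp N u -> seq_conv w (nabla u) = nabla (seq_conv w u).
Proof.
move=> hu; apply/funext => k; rewrite /nabla /seq_conv.
under eq_fsbigr => j _ do rewrite mulmxBr.
rewrite (@ZsumB _ N.+1) => [||j jN].
- congr (_ - _); rewrite -[LHS](Zsum_shift 1); apply: eq_fsbigr => j _.
  by rewrite addrK; congr (w _ *m _); ring.
- by move=> j jN; rewrite hu ?mulmx0 //; lia.
- by rewrite hu ?mulmx0 //; lia.
Qed.

Lemma seq_conv_iter_nabla s r t (w : int -> 'M[C]_(s, r)) (u : int -> 'M[C]_(r, t)) N n :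
  supp N u -> seq_conv w (iter n (@nabla r t) u) = iter n (@nabla s t) (seq_conv w u).
Proof.
move=> hu; elim: n => //= n IH.
by rewrite (seq_conv_nabla _ (iter_nabla_supp (n := n) hu)) IH.
Qed.

Lemma mom_nabla q s t (u : int -> 'M[C]_(s, t)) N : supp N u ->
  mom q (nabla u) = - \sum_(i < q) 'C(q, i)%:R *: mom i u.
Proof.
move=> hu; rewrite /mom.
transitivity (\sum_(k \in [set: int]) k%:~R ^+ q *: u k -
              \sum_(k \in [set: int]) (k + 1)%:~R ^+ q *: u k).
  rewrite -[X in _ - X](Zsum_shift (- 1)) -(@ZsumB _ N.+1).
  - by apply: eq_fsbigr => k _; rewrite subrK scalerBr.
  - by move=> k kN; rewrite hu ?scaler0 //; lia.
  - by move=> k kN; rewrite hu ?scaler0 //; lia.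
rewrite -(@ZsumB _ N); [|by move=> k kN; rewrite hu ?scaler0..].
have s1 i : supp N (fun k : int => k%:~R ^+ i *: u k).
  by move=> k kN; rewrite hu ?scaler0.
rewrite (@Zsum_seq _ N) => [|k kN]; last by rewrite hu ?scaler0 ?subrr.
under [X in - X]eq_bigr => i _ do rewrite (Zsum_seq (s1 i)) scaler_sumr.
rewrite exchange_big -sumrN /=; apply: eq_bigr => k _.
have -> : (k + 1)%:~R ^+ q = k%:~R ^+ q + \sum_(i < q) k%:~R ^+ i *+ 'C(q, i) :> C.
  rewrite rmorphD /= addrC exprDn big_ord_recr /= subnn expr0 mul1r binn mulr1n addrC.
  by congr (_ + _); apply: eq_bigr => i _; rewrite expr1n mul1r.
rewrite scalerDl opprD addrA subrr add0r scaler_suml.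
by congr (- _); apply: eq_bigr => i _; rewrite scalerA mulr_natl.
Qed.

(** Passing from d to d + 1 differences multiplies the leading moment by -(d + 1). The result (-1)^d
    d! is the constant of [eqO_entry], so the filter condition says that a Dirac column has the
    moments of a difference of order [nu l]. *)
Lemma mom_iter_nabla s t (u : int -> 'M[C]_(s, t)) N d : supp N u ->
  (forall q, (q < d)%N -> mom q (iter d (@nabla s t) u) = 0) /\
  mom d (iter d (@nabla s t) u) = ((-1) ^+ d * d`!%:R) *: mom 0 u.
Proof.
move=> hu; elim: d => [|d [IH1 IH2]]; first by split=> //; rewrite expr0 mul1r scale1r.
have hs := iter_nabla_supp (n := d) hu.
split=> [q|]; rewrite (mom_nabla _ hs).
  rewrite ltnS => qd; rewrite big1 ?oppr0 // => i _.
  by rewrite IH1 ?scaler0 // (leq_trans (ltn_ord i)).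
rewrite big_ord_recr /= big1 => [|i _]; last by rewrite IH1 ?scaler0.
rewrite add0r IH2 binSn scalerA -scaleNr; congr (_ *: _).
by rewrite factS natrM exprS; ring.
Qed.

Lemma mom_iter_subdiv r (a : int -> 'M[C]_r) Na (v : int -> 'rV[C]_r) N k n :
  supp Na a -> supp N v ->
  (forall i, (i < k)%N -> mom i (subdiv a v) = 2 *: mom i v) ->
  forall i, (i < k)%N -> mom i (iter n (subdiv a) v) = 2 ^+ n *: mom i v.
Proof.
move=> ha hv h; elim: n => [|n IH] i ik /=; first by rewrite expr0 scale1r.
have [N' hN'] : exists N', supp N' (iter n (subdiv a) v).
  elim: n {IH} => [|n [N' IH]] /=; first by exists N.
  by exists (2 * N' + Na)%N; exact: subdiv_supp.
have s2 M (w : int -> 'rV[C]_r) : supp M w -> supp M (fun k => 2 *: w k).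
  by move=> hw j jM; rewrite hw ?scaler0.
have m2 M (w : int -> 'rV[C]_r) q : supp M w -> mom q (fun k => 2 *: w k) = 2 *: mom q w.
  move=> hw; rewrite (mom_seq _ (s2 _ _ hw)) (mom_seq _ hw) scaler_sumr.
  by apply: eq_bigr => j _; rewrite !scalerA mulrC.
rewrite (subdiv_gconv a hN') (mom_conv_eq (w' := fun k => 2 *: v k) (N := maxn N N') (M := Na) 2 (c := 2 ^+ n)).
- by rewrite -(subdiv_gconv a hv) h // !scalerA exprS mulrC.
- by apply: s2; apply: supp_le hN'; exact: leq_maxr.
- by apply: s2; apply: supp_le hv; exact: leq_maxl.
- by [].
- move=> q qi; rewrite (m2 _ _ _ hN') (m2 _ _ _ hv) IH ?(leq_ltn_trans qi) //.
  by rewrite !scalerA mulrC.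
Qed.

(** Associativity: the matching filter acts on the left-hand side through its subdivisions, while on
    the right only A_n * u enters, whose size is under control. *)
Lemma seq_conv_iter_subdiv r (a : int -> 'M[C]_r) Na (v : int -> 'rV[C]_r) N
    (u : int -> 'cV[C]_r) Nu n :
  supp Na a -> supp N v -> supp Nu u ->
  seq_conv (iter n (subdiv a) v) u = gconv ((2 ^ n)%N%:Z) v (seq_conv (Apow a n) u).
Proof.
move=> ha hv hu; apply/funext => k; rewrite /gconv /seq_conv.
transitivity (\sum_(i \in [set: int]) \sum_(j \in [set: int])
    v j *m Apow a n (k - i - (2 ^ n)%N%:Z * j) *m u i).
  apply: eq_fsbigr => i _; rewrite (iter_subdivE ha) (@Zsum_mulmxr _ N) // => j jN.
  by rewrite hv ?mul0mx.
rewrite (@Zsum_swap _ (maxn N Nu)) => [|i j /orP[]]; first last.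
- by rewrite gtn_max => /andP[jN _]; rewrite hv // !mul0mx.
- by rewrite gtn_max => /andP[_ iN]; rewrite hu // mulmx0.
apply: eq_fsbigr => j _; rewrite (@Zsum_mulmxl _ Nu) => [|i iN]; last by rewrite hu ?mulmx0.
apply: eq_fsbigr => i _; rewrite mulmxA; congr (_ *m Apow a n _ *m _).
by rewrite addrAC.
Qed.

Lemma cmod_Zsum (f : int -> C) N e : supp N f -> (forall k, cmod (f k) <= e) ->
  cmod (\sum_(k \in [set: int]) f k) <= (2 * N).+1%:R * e.
Proof.
move=> hf he; rewrite (Zsum_seq hf) mul2n -size_int_range.
elim: (int_range N) => [|x t IH] /=; first by rewrite big_nil cmod0 mul0r.
rewrite big_cons -[(size t).+1]addn1 natrD mulrDl mul1r [leRHS]addrC.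
by apply: le_trans (cmodD _ _) _; exact: lerD.
Qed.

Lemma cmod_mulmx s r t (A : 'M[C]_(s, r)) (B : 'M[C]_(r, t)) i j x y :
  0 <= x -> (forall l, cmod (A i l) <= x) -> (forall l, cmod (B l j) <= y) ->
  cmod ((A *m B) i j) <= r%:R * (x * y).
Proof.
move=> x0 hA hB; rewrite mxE -[X in X%:R * _]card_ord; apply: cmod_sum_le => l.
by rewrite cmodM; apply: ler_pM => //; exact: cmod_ge0.
Qed.

Lemma supp_bounded s t (v : int -> 'M[C]_(s, t)) N : supp N v ->
  exists2 x : R, 0 <= x & forall k i j, cmod (v k i j) <= x.
Proof.
move=> hv; pose x := \sum_(k <- int_range N) \sum_i \sum_j cmod (v k i j).
have x0 (k : int) : 0 <= \sum_i \sum_j cmod (v k i j).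
  by apply: sumr_ge0 => i _; apply: sumr_ge0 => j _; exact: cmod_ge0.
have x1 : 0 <= x by apply: sumr_ge0.
exists x => // k i j; have [kN|kN] := ltnP N `|k|; first by rewrite hv // mxE cmod0.
rewrite /x (bigD1_seq k) ?int_range_uniq ?mem_int_range //=.
rewrite (bigD1 i) //= (bigD1 j) //= -!addrA lerDl.
rewrite !addr_ge0 // ?sumr_ge0 // => *; try exact: cmod_ge0.
by apply: sumr_ge0 => *; exact: cmod_ge0.
Qed.

Section MatchingMoments.
Variables (r : nat) (a : int -> 'M[C]_r) (Na : nat) (v : int -> 'rV[C]_r) (N : nat).
Hypotheses (ha : supp Na a) (hv : supp N v).

Lemma matching_momP k : matching_filter a k v <->
  symbol v 0 != 0 /\ forall q, (q < k)%N -> mom q (subdiv a v) = 2 *: mom q v.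
Proof.
have hS := subdiv_supp ha hv.
rewrite (matching_filterP ha k hv); split=> -[h0 h]; split=> // q.
  move=> qk; apply/rowP => l; rewrite [RHS]mxE (mom_entry _ _ _ hS) (mom_entry _ _ _ hv).
  exact: h.
move=> l qk; have /rowP/(_ l) E := h q qk.
by rewrite -(mom_entry _ _ _ hS) -(mom_entry _ _ _ hv) [LHS]E mxE.
Qed.

Lemma V_momP k (u : int -> 'cV[C]_r) Nu : supp Nu u ->
  V_ k v u <-> forall q, (q < k)%N -> mom q (seq_conv v u) = 0.
Proof.
move=> hu; have hs := seq_conv_supp hv hu.
rewrite (V_P k hv hu); split=> h q qk.
  by apply/matrixP => i j; rewrite !ord1 (mom_entry _ _ _ hs) h // mxE.
by rewrite -(mom_entry _ _ _ hs) h // mxE.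
Qed.

Lemma eqO_momP l n :
  eqO n.+1 (fun xi => symbol v xi ord0 l) (fun xi => (0 +i* xi) ^+ n) <->
  forall q, (q <= n)%N -> mom q v ord0 l = if q == n then (-1) ^+ n * n`!%:R else 0.
Proof.
by rewrite (eqO_entry l n hv); split=> h q qn; move: (h q qn); rewrite (mom_entry _ _ _ hv).
Qed.

Lemma mom0_symbol : mom 0 v = symbol v 0.
Proof.
by apply: eq_fsbigr => k _; rewrite mulr0 oppr0 cis0 expr0.
Qed.

(** The relation between the moments of [v] and of its subdivision, iterated [n] times and read on
    the other side of [seq_conv_iter_subdiv]. *)
Lemma mom_gconv_matching k (u : int -> 'cV[C]_r) Nu n q : supp Nu u -> matching_filter a k v -> (q < k)%N ->
  mom q (gconv ((2 ^ n)%N%:Z) v (seq_conv (Apow a n) u)) = 2 ^+ n *: mom q (seq_conv v u).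
Proof.
move=> hu /matching_momP[_ h] qk.
have hn n' : exists N', supp N' (iter n' (subdiv a) v).
  elim: n' => [|n' [N' IH]] /=; first by exists N.
  by exists (2 * N' + Na)%N; exact: subdiv_supp.
have [N' hN'] := hn n.
rewrite -(seq_conv_iter_subdiv n ha hv hu) !seq_conv_gconv.
apply: (@mom_conv_eq _ _ _ _ _ _ _ _ (maxn N N') Nu) => // [||i iq].
- by apply: supp_le hN'; exact: leq_maxr.
- by apply: supp_le hv; exact: leq_maxl.
- by apply: (mom_iter_subdiv n ha hv h); exact: leq_ltn_trans qk.
Qed.

(* If [A_n * u] decays faster than [2^(-nq)], then the [q]-th moment of [v * u]
   vanishes. *)
Lemma mom_conv_bound k (u : int -> 'cV[C]_r) Nu q : supp Nu u -> matching_filter a k v -> (q < k)%N ->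
  exists2 K : R, 0 <= K & forall n (e : R),
    (forall j l, cmod (seq_conv (Apow a n) u j l ord0) <= e) ->
    cmod (mom q (seq_conv v u) ord0 ord0) <= K * ((2 ^+ n) ^+ q * e).
Proof.
move=> hu hm qk; have [x x0 hx] := supp_bounded hv.
(* Here D 2^n bounds the support radius, hence the weights, 3 D 2^n the number of terms, and K0 e
   the size of each entry of the convolution with [v]. *)
pose D : R := (N + Na + Nu).+1%:R; pose K0 : R := (2 * N).+1%:R * (r%:R * x).
exists (3 * D * D ^+ q * K0); first by rewrite !mulr_ge0 ?exprn_ge0.
move=> n e he; have h2 : 0 < 2 ^+ n :> R by rewrite exprn_gt0.
have hB : supp ((Na + Nu) * 2 ^ n) (seq_conv (Apow a n) u).
  have := seq_conv_supp (Apow_supp ha (n := n)) hu; apply: supp_le.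
  by rewrite mulnDl leq_add2l leq_pmulr // expn_gt0.
set B := seq_conv _ _ in he hB; pose L := ((N + Na + Nu) * 2 ^ n)%N.
have hG : supp L (gconv ((2 ^ n)%N%:Z) v B).
  by have := gconv_supp (e := (2 ^ n)%N%:Z) hv hB; rewrite absz_nat mulnC -mulnDl addnA.
have := mom_gconv_matching n hu hm qk; rewrite -/B => /matrixP/(_ ord0 ord0).
rewrite [RHS]mxE => E; rewrite -(ler_pM2l h2).
have -> : 2 ^+ n * cmod (mom q (seq_conv v u) ord0 ord0) =
    cmod (2 ^+ n * mom q (seq_conv v u) ord0 ord0).
  by rewrite cmodM cmodX (cmod_nat R 2).
rewrite -E (mom_entry _ _ _ hG).
have e0 : r = 0%N \/ 0 <= e.
  have [r0|r0] := posnP r; first by left.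
  by right; apply: (le_trans _ (he 0 (Ordinal r0))); exact: cmod_ge0.
have K0e : 0 <= K0 * e.
  case: e0 => [r0|e0]; last by rewrite !mulr_ge0.
  by rewrite (_ : K0 = 0) ?mul0r // /K0 r0 mul0r mulr0.
have b1 j : cmod (gconv ((2 ^ n)%N%:Z) v B j ord0 ord0) <= K0 * e.
  rewrite /gconv (@Zsum_mxE _ N) => [|i iN]; last by rewrite hv ?mul0mx.
  rewrite /K0 -!mulrA; apply: cmod_Zsum => [i iN|i].
    by rewrite hv ?mul0mx // mxE.
  by apply: cmod_mulmx => // l; exact: he.
have LD : L%:R <= D * 2 ^+ n.
  by rewrite /L natrM natrX ler_pM2r // /D ler_nat leqnSn.
apply: le_trans (cmod_Zsum (N := L) (e := (D * 2 ^+ n) ^+ q * (K0 * e)) _ _) _.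
- by move=> j jL; rewrite hG // mxE mulr0.
- move=> j; have [jL|jL] := ltnP L `|j|.
    rewrite hG // mxE mulr0 cmod0 mulr_ge0 // exprn_ge0 // mulr_ge0 //; exact: ltW.
  rewrite cmodM cmodX cmod_int; apply: ler_pM; rewrite ?exprn_ge0 ?cmod_ge0 //.
  apply: lerXn2r; rewrite ?nnegrE ?mulr_ge0 ?(ltW h2) //.
  apply: le_trans LD; rewrite -intr_norm -[L%:R]/(L%:~R) ler_int; lia.
- have c3 : (2 * L).+1%:R <= 3 * (D * 2 ^+ n).
    have : 1 <= D * 2 ^+ n.
      by apply: mulr_ege1; [rewrite /D ler1n | rewrite exprn_ege1 // ler1n].
    by move=> D1; rewrite mulrS natrM; move: LD D1; set t := D * _; lra.
  have -> : 2 ^+ n * (3 * D * D ^+ q * K0 * ((2 ^+ n) ^+ q * e)) =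
    3 * (D * 2 ^+ n) * ((D * 2 ^+ n) ^+ q * (K0 * e)) by rewrite exprMn; ring.
  apply: ler_wpM2r c3; rewrite mulr_ge0 // exprn_ge0 // mulr_ge0 //; exact: ltW.
Qed.

End MatchingMoments.

End Moments.

(** * Joint spectral radius *)

Section JointSpectralRadius.
Variable R : realType.
Local Notation C := R[i].

Lemma limn_esup_lt (x : nat -> \bar R) (e : \bar R) : (limn_esup x < e)%E ->
  exists n0, forall n, (n0 <= n)%N -> (x n < e)%E.
Proof.
move=> /ereal_inf_lt[_ [V [n0 _ hV] <-] hlt]; exists n0 => n hn.
by apply: le_lt_trans hlt; apply: ereal_sup_ubound; exists n => //; exact: hV.
Qed.

Lemma limn_esup_le (x : nat -> \bar R) (e : \bar R) n0 :
  (forall n, (n0 <= n)%N -> (x n <= e)%E) -> (limn_esup x <= e)%E.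
Proof.
move=> h; apply: (@le_trans _ _ (ereal_sup (x @` [set n | (n0 <= n)%N]))).
  by apply: ereal_inf_lbound; exists [set n | (n0 <= n)%N] => //; exists n0.
by apply: ge_ereal_sup => _ [n hn <-]; exact: h.
Qed.

Lemma linfty_root_lt r (w : int -> 'cV[C]_r) n (q : R) : (0 < n)%N ->
  (linfty_norm w `^ n%:R^-1 < q%:E)%E -> forall k l, cmod (w k l ord0) <= q ^+ n.
Proof.
move=> n0 h k l; have n0' : 0 < n%:R^-1 :> R by rewrite invr_gt0 ltr0n.
have b : ((cmod (w k l ord0))%:E <= linfty_norm w)%E.
  by apply: ereal_sup_ubound; exists k, l.
have w0 : (0 <= linfty_norm w)%E by apply: le_trans b; rewrite lee_fin cmod_ge0.
have := gt0_ler_poweR (ltW n0') _ _ b; rewrite !in_itv /= !leey !andbT => /(_ _ _).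
move=> /(_ _ _)/le_lt_trans /(_ h); rewrite lee_fin cmod_ge0 w0 => /(_ isT isT).
rewrite lte_fin => lq.
have c0 := cmod_ge0 (w k l ord0).
have -> : cmod (w k l ord0) = (cmod (w k l ord0) `^ n%:R^-1) ^+ n.
  by rewrite -powR_mulrn ?powR_ge0 // -powRrM mulVf ?powRr1 // pnatr_eq0 -lt0n.
by apply: lerXn2r (ltW lq); rewrite nnegrE ?powR_ge0 // (le_trans _ (ltW lq)) ?powR_ge0.
Qed.

Lemma linfty_root_le r (w : int -> 'cV[C]_r) n (q : R) : (0 < n)%N -> 0 <= q ->
  (forall k l, cmod (w k l ord0) <= q ^+ n) -> (linfty_norm w `^ n%:R^-1 <= q%:E)%E.
Proof.
move=> n0 q0 h; have n0' : 0 < n%:R^-1 :> R by rewrite invr_gt0 ltr0n.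
have b : (linfty_norm w <= (q ^+ n)%:E)%E.
  by apply: ge_ereal_sup => _ [k [l ->]]; rewrite lee_fin.
have [w0|w0] := leP 0%E (linfty_norm w).
  have := gt0_ler_poweR (ltW n0') _ _ b; rewrite !in_itv /= !leey !andbT w0 lee_fin.
  rewrite exprn_ge0 // => /(_ isT isT) /le_trans; apply.
  rewrite lee_fin -powR_mulrn // -powRrM mulfV ?powRr1 //.
  by rewrite pnatr_eq0 -lt0n.
(* A negative supremum occurs only when there are no entries at all, that is for r = 0. *)
have -> : linfty_norm w = -oo%E.
  rewrite /linfty_norm /ereal_sup /supremum; case: ifPn => // /set0P[_ [k [l _]]].
  exfalso; move: w0; apply/negP; rewrite -leNgt.
  apply: le_trans (ereal_sup_ubound _); last by exists k, l.
  by rewrite lee_fin cmod_ge0.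
by rewrite poweRNyr ?lee_fin // gt_eqF.
Qed.

Lemma rho_lt_decay r j (a : int -> 'M[C]_r) v (q : R) :
  (rho_infty j a v < q%:E)%E -> forall u, V_ j v u ->
  exists n0, forall n, (n0 <= n)%N -> forall k l,
    cmod (seq_conv (Apow a n) u k l ord0) <= q ^+ n.
Proof.
move=> h u hu.
have /limn_esup_lt[n0 hn0] : (limn_esup (fun n : nat =>
  linfty_norm (seq_conv (iter n (subdiv a) (dirac_mx R r)) u) `^ n%:R^-1) < q%:E)%E.
  by apply: le_lt_trans h; apply: ereal_sup_ubound; exists u.
exists n0.+1 => n hn; apply: linfty_root_lt; first exact: leq_trans hn.
by apply: hn0; exact: ltnW.
Qed.

Lemma decay_rho_le r j (a : int -> 'M[C]_r) v (q : R) : 0 <= q ->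
  (forall u, V_ j v u -> exists n0, forall n, (n0 <= n)%N -> forall k l,
    cmod (seq_conv (Apow a n) u k l ord0) <= q ^+ n) ->
  (rho_infty j a v <= q%:E)%E.
Proof.
move=> q0 h; apply: ge_ereal_sup => _ [u hu <-].
have [n0 hn0] := h u hu; apply: (@limn_esup_le _ _ n0.+1) => n hn.
apply: linfty_root_le => //; first exact: leq_trans hn.
by apply: hn0; exact: ltnW.
Qed.

(** For positive [rho] the rate is the midpoint between it and 2^(-M). The value +oo would make
    [sm_infty_mask] equal to -oo, and for [rho] at most 0 any positive rate below 2^(-M) serves. *)
Lemma sm_mask_gt r (a : int -> 'M[C]_r) M : (M%:R%:E < sm_infty_mask a)%E ->
  exists q : R, [/\ 0 < q, q * 2 ^+ M < 1 & (rho_infty (sr a) a (sr_filter a) < q%:E)%E].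
Proof.
rewrite /sm_infty_mask; set rho := rho_infty _ _ _.
have l2 : 0 < ln 2 :> R by rewrite ln_gt0 // ltr1n.
have p2 : 0 < 2 ^+ M :> R by rewrite exprn_gt0.
have [rho0 _|rho0] := leP rho 0%E.
  exists (2^-1 / 2 ^+ M); split; first by rewrite divr_gt0.
    by rewrite divfK ?gt_eqF // invf_lt1 ?ltr1n.
  by apply: le_lt_trans rho0 _; rewrite lte_fin divr_gt0.
case: rho rho0 => [x| |] //; last first.
  by move=> _; rewrite /= mulyr gtr0_sg ?invr_gt0 // mul1e.
rewrite lte_fin => x0; rewrite lne_EFin // -EFinM -EFinN lte_fin => h.
have : ln (x * 2 ^+ M) < 0.
  move: h; rewrite -mulNr ltr_pdivlMr // lnM ?posrE // lnXn // -mulr_natl; lra.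
have [x1|x1 _] := leP 1 (x * 2 ^+ M); first by have := ln_ge0 x1; lra.
exists ((x + 2 ^- M) / 2); have : x < 2 ^- M by rewrite -[ltRHS]mul1r ltr_pdivlMr.
have p2' : 0 < 2 ^- M :> R by rewrite invr_gt0.
move=> h1; split; [lra| |by rewrite lte_fin; lra].
rewrite -ltr_pdivlMr // mul1r; lra.
Qed.

Lemma sm_mask_gt0 r (a : int -> 'M[C]_r) (q : R) : 0 <= q < 1 ->
  (rho_infty (sr a) a (sr_filter a) <= q%:E)%E -> (0 < sm_infty_mask a)%E.
Proof.
move=> /andP[q0 q1] h; rewrite /sm_infty_mask; set rho := rho_infty _ _ _ in h *.
have : (lne rho < 0)%E by rewrite lne_lt0; apply: le_lt_trans h _; rewrite lte_fin.
have l2 : 0 < (ln 2)^-1 :> R by rewrite invr_gt0 ln_gt0 // ltr1n.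
case: (lne rho) => [x| |] //; last first.
  by move=> _; rewrite mulNyr gtr0_sg // mul1e.
by rewrite lte_fin -EFinM -EFinN lte_fin oppr_gt0 => x0; rewrite pmulr_llt0.
Qed.

End JointSpectralRadius.

(** * Sufficiency: convergence of the scheme *)

Section Division.
Variables (R : realType) (r : nat).
Local Notation C := R[i].
Implicit Types (a : int -> 'M[C]_r) (v : int -> 'rV[C]_r) (u : int -> 'cV[C]_r).

(** The assumption at order 0 covers the case where [sr] falls back to its default; otherwise the
    definition of [sr] supplies a filter. *)
Lemma sr_filterP a : (exists v, sum_rules a 0 v) -> sum_rules a (sr a) (sr_filter a).
Proof.
move=> h0; suff [v hv] : exists v, sum_rules a (sr a) v.
  by rewrite /sr_filter; case: xgetP => [w _ //|/(_ v)].
by rewrite /sr; case: xgetP => [k _ [] //|_].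
Qed.

Lemma seq_conv_lincomb t (w : int -> 'M[C]_(t, r)) L s (c : nat -> C)
    (f : nat -> int -> 'cV[C]_r) (z : int -> 'cV[C]_r) k :
  (forall q, (q < s)%N -> supp L (f q)) -> supp L z ->
  seq_conv w (fun k => \sum_(q < s) c q *: f q k + z k) k =
  \sum_(q < s) c q *: seq_conv w (f q) k + seq_conv w z k.
Proof.
move=> hf hz; rewrite /seq_conv.
have e (g : int -> 'cV[C]_r) : supp L g -> \sum_(j \in [set: int]) w (k - j) *m g j =
    \sum_(j <- int_range L) w (k - j) *m g j.
  by move=> hg; apply: Zsum_seq => j jL; rewrite hg ?mulmx0.
rewrite e => [|j jL]; last by rewrite hz // addr0 big1 // => q _; rewrite hf ?scaler0.
rewrite (e z hz); under [X in X + _]eq_bigr => q _ do rewrite (e _ (hf q (ltn_ord q))) scaler_sumr.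
rewrite exchange_big -big_split /=; apply: eq_bigr => j _.
by rewrite mulmxDr mulmx_sumr; congr (_ + _); apply: eq_bigr => q _; rewrite scalemxAr.
Qed.

(** The functionals whose common kernel for d < j, on finitely supported sequences, is [V_ j v];
    they are triangular on the iterated differences of a sequence. *)
Definition vmom v (d : nat) (u : int -> 'cV[C]_r) : C := mom d (seq_conv v u) ord0 ord0.

Section Vmom.
Variables (v : int -> 'rV[C]_r) (N : nat).
Hypothesis hv : supp N v.

Lemma vmom_lincomb d L s (c : nat -> C) (f : nat -> int -> 'cV[C]_r) z :
  (forall q, (q < s)%N -> supp L (f q)) -> supp L z ->
  vmom v d (fun k => \sum_(q < s) c q *: f q k + z k) =
  \sum_(q < s) c q * vmom v d (f q) + vmom v d z.
Proof.
move=> hf hz; rewrite /vmom.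
have -> : seq_conv v (fun k => \sum_(q < s) c q *: f q k + z k) =
    fun k => \sum_(q < s) c q *: seq_conv v (f q) k + seq_conv v z k.
  by apply/funext => k; exact: seq_conv_lincomb hf hz.
have hs q : (q < s)%N -> supp (N + L) (seq_conv v (f q)).
  by move=> qs; exact: seq_conv_supp hv (hf q qs).
have hsz := seq_conv_supp hv hz.
rewrite (@mom_seq _ _ _ _ _ (N + L)) => [|k kL]; last first.
  by rewrite hsz // addr0 big1 // => q _; rewrite hs ?scaler0.
rewrite (mom_seq _ hsz) summxE [X in _ = _ + X]summxE.
under [X in _ = X + _]eq_bigr => q _ do rewrite (mom_seq _ (hs q (ltn_ord q))) summxE mulr_sumr.
rewrite exchange_big -big_split /=; apply: eq_bigr => k _.
rewrite !mxE mulrDr summxE mulr_sumr; congr (_ + _); apply: eq_bigr => q _.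
by rewrite !mxE mulrCA.
Qed.

Lemma vmom_iter_nabla u Nu d : supp Nu u ->
  (forall q, (q < d)%N -> vmom v q (iter d (@nabla R r 1) u) = 0) /\
  vmom v d (iter d (@nabla R r 1) u) = (-1) ^+ d * d`!%:R * vmom v 0 u.
Proof.
move=> hu; rewrite /vmom (seq_conv_iter_nabla v d hu).
have [h1 h2] := mom_iter_nabla d (seq_conv_supp hv hu).
by split=> [q qd|]; [rewrite h1 // mxE | rewrite h2 mxE].
Qed.

Lemma sign_fact_neq0 d : (-1) ^+ d * d`!%:R != 0 :> C.
Proof. by rewrite mulf_neq0 ?signr_eq0 // pnatr_eq0 -lt0n fact_gt0. Qed.

(** Triangular elimination: the functional of order [s] is nonzero on the s-th difference of [u0],
    and the lower ones vanish there, so a multiple of this difference cancels the next moment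
    without disturbing the earlier ones. *)
Lemma nabla_division u0 u L s : supp L u0 -> supp L u -> vmom v 0 u0 != 0 ->
  exists c : nat -> C, exists z : int -> 'cV[C]_r,
    [/\ supp (L + s) z, forall q, (q < s)%N -> vmom v q z = 0 &
        u = fun k => \sum_(q < s) c q *: iter q (@nabla R r 1) u0 k + z k].
Proof.
move=> h0 hu k0; elim: s => [|s [c [z [hz vz uE]]]].
  exists (fun=> 0), u; split=> //; first by rewrite addn0.
  by apply/funext => k; rewrite big_ord0 add0r.
pose y := vmom v s z / vmom v s (iter s (@nabla R r 1) u0).
have hD := iter_nabla_supp (n := s) h0.
have [v1 v2] := vmom_iter_nabla s h0.
(* A sum with one term, only to match the form of [vmom_lincomb]. *)
pose z' k := \sum_(q < 1) - y *: iter s (@nabla R r 1) u0 k + z k.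
exists (fun q => if q == s then y else c q), z'; split.
- move=> k kL; rewrite /z' big_ord1 hD ?hz ?scaler0 ?addr0 //; move: kL; lia.
- move=> q; rewrite ltnS leq_eqVlt /z' => qs.
  rewrite (@vmom_lincomb q (L + s) 1 (fun=> - y) (fun=> iter s (@nabla R r 1) u0)) // big_ord1.
  case/orP: qs => [/eqP->|qs]; last by rewrite vz // v1 // mulr0 addr0.
  by rewrite mulNr /y divfK ?addNr // v2 mulf_neq0 // sign_fact_neq0.
- rewrite uE; apply/funext => k; rewrite big_ord_recr /= eqxx /z' big_ord1.
  rewrite scaleNr addrA addrK; congr (_ + _).
  by apply: eq_bigr => q _; rewrite ltn_eqF.
Qed.

End Vmom.

Variables (a : int -> 'M[C]_r) (Na : nat).
Hypothesis ha : supp Na a.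

Definition decays (q : R) (u : int -> 'cV[C]_r) := exists n0, forall n, (n0 <= n)%N ->
  forall k l, cmod (seq_conv (Apow a n) u k l ord0) <= q ^+ n.

Lemma expr_lt_small (q K e : R) : 0 <= q < 1 -> 0 < e -> exists n0, forall n,
  (n0 <= n)%N -> K * q ^+ n < e.
Proof.
move=> /andP[q0 q1] e0.
have h : (fun n => K * q ^+ n) @ \oo --> (0 : R).
  by rewrite -[X in _ --> X](mulr0 K); apply: cvgMr; apply: cvg_expr; rewrite ger0_norm.
have /cvgr0Pnorm_lt/(_ e e0)[n0 _ hn0] := h.
by exists n0 => n hn; apply: le_lt_trans (ler_norm _) (hn0 n hn).
Qed.

(** The bound of [mom_conv_bound] is at most a constant times (q 2^M)^n for large n, which tends to
    0. The filter [va] need not be the one with respect to which the decay was obtained. *)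
Lemma decays_vmom0 (va : int -> 'rV[C]_r) N M q u Nu d : supp N va -> supp Nu u ->
  matching_filter a M.+1 va -> 0 < q -> q * 2 ^+ M < 1 -> decays q u -> (d <= M)%N ->
  vmom va d u = 0.
Proof.
move=> hva hu hm q0 q1 [n0 hn0] dM.
have [K K0 hK] := mom_conv_bound ha hva hu hm (dM : (d < M.+1)%N).
apply/eqP; rewrite -cmod_eq0; apply/eqP/le_anti; rewrite cmod_ge0 andbT.
apply/ler_addgt0Pr => e e0; rewrite add0r.
have q01 : 0 <= q * 2 ^+ M < 1 by rewrite q1 mulr_ge0 ?exprn_ge0 // ltW.
have [n1 hn1] := expr_lt_small K q01 e0.
pose n := maxn n0 n1; apply: le_trans (hK n (q ^+ n) _) _; first exact/hn0/leq_maxl.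
apply: le_trans (ltW (hn1 n (leq_maxr _ _))); apply: ler_wpM2l => //.
rewrite exprMn mulrC ler_wpM2l ?exprn_ge0 ?(ltW q0) //.
by rewrite -!exprM mulnC ler_weXn2l ?ler1n // leq_mul2r dM orbT.
Qed.

Definition dirac_col (l : 'I_r) : int -> 'cV[C]_r := fun k => col l (dirac_mx R r k).

Lemma dirac_col_supp l : supp 0 (dirac_col l).
Proof.
move=> k k0; rewrite /dirac_col /dirac_mx; case: eqP => [k1|_]; first by move: k0; rewrite k1.
by apply/colP => i; rewrite !mxE.
Qed.

Lemma seq_conv_dirac_col t (w : int -> 'M[C]_(t, r)) l :
  seq_conv w (dirac_col l) = fun k => col l (w k).
Proof.
apply/funext => k; rewrite /seq_conv (Zsum1 (k0 := 0)) ?subr0 => [|j /negbTE j0].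
  by rewrite /dirac_col /dirac_mx eqxx !colE mul1mx.
by rewrite /dirac_col /dirac_mx j0 colE mul0mx mulmx0.
Qed.

Lemma vmom_dirac_col v N d l : supp N v -> vmom v d (dirac_col l) = mom d v ord0 l.
Proof.
move=> hv; rewrite /vmom seq_conv_dirac_col (mom_entry _ _ _ hv) (@mom_entry _ _ _ _ _ N).
  by apply: eq_fsbigr => k _; rewrite mxE.
by move=> k kN; rewrite hv //; apply/colP => i; rewrite !mxE.
Qed.

(* The columns of [A_n] are differences of samples of the refinable function,
   up to higher differences and a sequence on which the scheme decays. *)
Lemma column_decomposition (va v : int -> 'rV[C]_r) Nva Nv M s q p L l nu :
  supp Nva va -> supp Nv v -> supp L p ->
  matching_filter a M.+1 va -> symbol v 0 != 0 ->
  0 < q -> q * 2 ^+ M < 1 -> (forall u, V_ s v u -> decays q u) ->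
  vmom va 0 p = 1 -> (nu <= M)%N ->
  eqO nu.+1 (fun xi => symbol va xi ord0 l) (fun xi => (0 +i* xi) ^+ nu) ->
  exists c : nat -> C, exists z : int -> 'cV[C]_r, decays q z /\ forall n k,
    col l (Apow a n k) =
    iter nu (@nabla R r 1) (seq_conv (Apow a n) p) k +
    \sum_(j < s | (nu < j)%N) c j *: iter j (@nabla R r 1) (seq_conv (Apow a n) p) k +
    seq_conv (Apow a n) z k.
Proof.
move=> hva hv hp hm v0 q0 q1 dec np nuM hva_l.
have decV z Nz : supp Nz z -> (forall d, (d < s)%N -> vmom v d z = 0) -> decays q z.
  move=> hz vz; apply: dec; apply/(V_momP hv s hz) => d ds.
  by apply/matrixP => i j; rewrite !ord1 [RHS]mxE; exact: vz.
have van z Nz d : supp Nz z -> decays q z -> (d <= M)%N -> vmom va d z = 0.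
  by move=> hz dz dM; exact: decays_vmom0 hva hz hm q0 q1 dz dM.
have hde l' : supp L (dirac_col l') by apply: supp_le (@dirac_col_supp l').
(* Otherwise expand [p] in differences of a Dirac column not annihilated by [v]. The coefficient of
   order 0 would vanish, and higher differences as well as the decaying part have zero mean against
   [va], contradicting [np]. *)
have kap : vmom v 0 p != 0.
  apply/negP => /eqP kap0.
  have [l0 hl0] : exists l0, symbol v 0 ord0 l0 != 0.
    have [//|h] := pselect (exists l0, symbol v 0 ord0 l0 != 0).
    case/eqP: v0; apply/rowP => l0; rewrite [RHS]mxE; apply/eqP/negPn/negP => h0.
    by apply: h; exists l0.
  have vd : vmom v 0 (dirac_col l0) != 0 by rewrite (vmom_dirac_col _ _ hv) (mom0_symbol v).
  have [c [z [hz vz pE]]] := nabla_division hv s (hde l0) hp vd.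
  have hD q' : (q' < s)%N -> supp (L + s) (iter q' (@nabla R r 1) (dirac_col l0)).
    by move=> qs; apply: supp_le (iter_nabla_supp (n := q') (hde l0)); lia.
  have dz := decV _ _ hz vz.
  have c0 : (0 < s)%N -> c 0%N = 0.
    move=> s0; have := kap0; rewrite pE (vmom_lincomb hv 0 c hD hz) vz // addr0.
    rewrite (bigD1 (Ordinal s0)) //= big1 ?addr0.
      by move/eqP; rewrite mulf_eq0 (negbTE vd) orbF => /eqP.
    move=> i i0; have [h _] := vmom_iter_nabla hv i (hde l0); rewrite h ?mulr0 //.
    by rewrite lt0n; apply: contraNneq i0 => i0; apply/eqP/val_inj.
  have := np; rewrite pE (vmom_lincomb hva 0 c hD hz) (van _ _ _ hz dz) // addr0 big1.
    by move/eqP; rewrite eq_sym oner_eq0.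
  move=> i _; case: (posnP i) => [i0|i0].
    by rewrite i0 c0 ?mul0r //; case: i i0 => i /= ? <-.
  by have [h _] := vmom_iter_nabla hva i (hde l0); rewrite h // mulr0.
have hnu := iter_nabla_supp (n := nu) hp.
(* By the filter condition this difference has vanishing moments against [va] up to order [nu]. *)
pose u k := \sum_(i < 1) (-1) *: iter nu (@nabla R r 1) p k + dirac_col l k.
have hu : supp (L + nu) u.
  by move=> k kL; rewrite /u big_ord1 hnu // (hde l) ?scaler0 ?addr0 //; lia.
have hpL : supp (L + nu) p by apply: supp_le hp; lia.
have [c [z [hz vz uE]]] := nabla_division hv s hpL hu kap.
have dz := decV _ _ hz vz.
have hD q' : (q' < s)%N -> supp (L + nu + s) (iter q' (@nabla R r 1) p).
  by move=> qs; apply: supp_le (iter_nabla_supp (n := q') hp); lia.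
have vau d : (d <= nu)%N -> vmom va d u = 0.
  move=> dnu; rewrite (@vmom_lincomb va _ hva d (L + nu) 1 (fun=> -1) (fun=> iter nu (@nabla R r 1) p)) //; last first.
    by apply: supp_le (hde l); lia.
  rewrite big_ord1 (vmom_dirac_col _ _ hva); move/(eqO_momP hva)/(_ d dnu): hva_l => ->.
  have [w1 w2] := vmom_iter_nabla hva nu hp.
  case: eqP => [->|/eqP dn]; first by rewrite w2 np mulr1 mulN1r addNr.
  by rewrite w1 ?mulr0 ?addr0 // ltn_neqAle dn.
(* The moments of [u] and of [z] against [va] vanish up to order [nu], so triangularity of the
   differences of [p], now for [va] instead of [v], clears the low coefficients one by one. *)
have c0 : forall d, (d <= nu)%N -> (d < s)%N -> c d = 0.
  elim/ltn_ind => d IH dnu ds.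
  have := vau d dnu; rewrite uE (vmom_lincomb hva d c hD hz) (van _ _ _ hz dz) ?(leq_trans dnu) // addr0.
  rewrite (bigD1 (Ordinal ds)) //= big1 ?addr0.
    have [_ ->] := vmom_iter_nabla hva d hp; rewrite np mulr1 => /eqP.
    by rewrite mulf_eq0 (negbTE (sign_fact_neq0 d)) orbF => /eqP.
  move=> i id; have [i_d|d_i] := ltnP i d; first by rewrite IH ?mul0r //; lia.
  have [h _] := vmom_iter_nabla hva i hp; rewrite h ?mulr0 //.
  by rewrite ltn_neqAle d_i andbT; apply: contraNneq id => id; apply/eqP/val_inj; rewrite /= -id.
exists c, z; split=> // n k.
have e1 : seq_conv (Apow a n) u k = col l (Apow a n k) -
    iter nu (@nabla R r 1) (seq_conv (Apow a n) p) k.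
  rewrite (@seq_conv_lincomb _ (Apow a n) (L + nu) 1 (fun=> -1) (fun=> iter nu (@nabla R r 1) p)) //; last first.
    by apply: supp_le (hde l); lia.
  by rewrite big_ord1 seq_conv_dirac_col (seq_conv_iter_nabla _ _ hp) scaleN1r addrC.
have e2 : seq_conv (Apow a n) u k =
    \sum_(j < s | (nu < j)%N) c j *: iter j (@nabla R r 1) (seq_conv (Apow a n) p) k +
    seq_conv (Apow a n) z k.
  rewrite uE (seq_conv_lincomb (Apow a n) c _ hD hz); congr (_ + _).
  rewrite (bigID (fun j : 'I_s => (nu < j)%N)) /= [X in _ + X]big1 ?addr0.
    by apply: eq_bigr => j _; rewrite (seq_conv_iter_nabla _ _ hp).
  by move=> j; rewrite -leqNgt => jn; rewrite c0 ?scale0r.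
by rewrite -addrA -e2 e1 addrC subrK.
Qed.

End Division.

(** * Finite differences, and smoothness as a local property *)

Section FiniteDifferences.
Variable R : realType.
Local Notation C := R[i].
Implicit Types (f g : R -> C).

Lemma ord_eventually r (P : 'I_r -> nat -> Prop) :
  (forall i, exists n0, forall n, (n0 <= n)%N -> P i n) ->
  exists n0, forall i n, (n0 <= n)%N -> P i n.
Proof.
move=> h; exists (\max_(i < r) sval (cid (h i))) => i n hn.
apply: (svalP (cid (h i))); apply: leq_trans hn; exact: (leq_bigmax i).
Qed.

Lemma cderivn_local m f g K j : C_ m g -> (forall x, `|x| < K -> f x = g x) ->
  (j <= m)%N -> forall x, `|x| < K -> cderivn j f x = cderivn j g x.
Proof.
move=> hg fg; elim: j => [_ x xK|j IH jm x xK]; first by rewrite !cderivn0 fg.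
have nr : \forall z \near x, cderivn j g z = cderivn j f z.
  have := xK; rewrite ltr_norml => /andP[x1 x2].
  near=> z; rewrite IH ?(ltnW jm) // ltr_norml; apply/andP; split; near: z.
    exact: lt_nbhsr.
  exact: lt_nbhsl.
have [dr di] := C_cder hg jm x.
apply: eqReIm.
  have : is_derive x (1 : R) (Ref (cderivn j f)) (Ref (cderivn j.+1 g) x).
    by apply: near_eq_is_derive dr; apply: filterS nr => z; rewrite /Ref => ->.
  move=> h; transitivity (Ref (cderivn j.+1 f) x) => //.
  by rewrite Ref_cderivn derive1nS derive1E -Ref_cderivn; exact: derive_val.
have : is_derive x (1 : R) (Imf (cderivn j f)) (Imf (cderivn j.+1 g) x).
  by apply: near_eq_is_derive di; apply: filterS nr => z; rewrite /Imf => ->.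
move=> h; transitivity (Imf (cderivn j.+1 f) x) => //.
by rewrite Imf_cderivn derive1nS derive1E -Imf_cderivn; exact: derive_val.
Unshelve. all: by end_near. Qed.

(** Needed because the limit for arbitrary initial data is an infinite sum that is only locally
    finite. *)
Lemma C_local m f :
  (forall K : R, exists2 g, C_ m g & forall x, `|x| < K -> f x = g x) -> C_ m f.
Proof.
move=> h; rewrite -[f]cderivn0.
have near_eq j (x : R) : (j <= m)%N -> exists2 g, C_ m g & \forall z \near x, cderivn j g z = cderivn j f z.
  move=> jm; have [g hg fg] := h (`|x| + 1); exists g => //.
  have [x1 x2] : - (`|x| + 1) < x /\ x < `|x| + 1.
    by apply/andP; rewrite -ltr_norml ltrDl.
  near=> z; apply/esym/(cderivn_local hg fg jm).
  rewrite ltr_norml; apply/andP; split; near: z.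
    exact: lt_nbhsr.
  exact: lt_nbhsl.
apply: (@C_tower _ m (fun j => cderivn j f)) => [j jm x|].
  have [g hg nr] := near_eq j x (ltnW jm).
  have [g' hg' nr'] := near_eq j.+1 x jm.
  have [K hK] : exists K : R, `|x| < K by exists (`|x| + 1); lra.
  have [g2 hg2 fg2] := h K.
  have [dr di] := C_cder hg2 jm x.
  have e z : `|z| < K -> forall i, (i <= m)%N -> cderivn i g2 z = cderivn i f z.
    by move=> zK i im; exact/esym/(cderivn_local hg2 fg2 im).
  have nr2 : \forall z \near x, cderivn j g2 z = cderivn j f z.
    have := hK; rewrite ltr_norml => /andP[x1 x2].
    near=> z; apply: e; last exact: ltnW.
    rewrite ltr_norml; apply/andP; split; near: z.
      exact: lt_nbhsr.
    exact: lt_nbhsl.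
  rewrite /Ref /Imf -(e x hK _ jm); split.
    by apply: near_eq_is_derive dr; apply: filterS nr2 => z; rewrite /Ref => ->.
  by apply: near_eq_is_derive di; apply: filterS nr2 => z; rewrite /Imf => ->.
split=> x; have [g hg nr] := near_eq m x (leqnn m); have [cr ci] := C_ccont hg (leqnn m).
  have xx : Ref (cderivn m g) x = Ref (cderivn m f) x by rewrite /Ref (nbhs_singleton nr).
  rewrite /continuous_at -xx; apply: cvg_trans (cr x); apply: near_eq_cvg.
  by apply: filterS nr => z; rewrite /Ref => ->.
have xx : Imf (cderivn m g) x = Imf (cderivn m f) x by rewrite /Imf (nbhs_singleton nr).
rewrite /continuous_at -xx; apply: cvg_trans (ci x); apply: near_eq_cvg.
by apply: filterS nr => z; rewrite /Imf => ->.
Unshelve. all: by end_near. Qed.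

Lemma csupp_cderivn m K f j : C_ m f -> csupp K f -> (j <= m)%N -> csupp K (cderivn j f).
Proof.
move=> hf [_ f0] jm; split; first by apply: (C_ccont hf).
elim: j jm => [_ x|j IH jm x xK]; first by rewrite cderivn0; exact: f0.
have d := C_cder hf jm; have z0 := IH (ltnW jm).
apply: (cder_local0 d (u := x - (`|x| - K)) (v := x + (`|x| - K))); last first.
  by apply/andP; split; lra.
move=> y /andP[y1 y2]; apply: z0.
have : `|x - y| < `|x| - K by rewrite ltr_norml; apply/andP; split; lra.
have := ler_distD y x 0; rewrite !subr0; lra.
Qed.

Definition dh (h : R) f : R -> C := fun x => f x - f (x - h).

Lemma cder_iter_dh h f f' n : cder f f' -> cder (iter n (dh h) f) (iter n (dh h) f').
Proof.
move=> d; elim: n => //= n IH; apply: cderB => //.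
exact: cder_comp_shift IH.
Qed.

(** One mean value step per difference; the constant 4^n is convenient because 2 (4^n + 1) is at
    most 4^(n+1). *)
Lemma iter_dh_close n (F : nat -> R -> C) (h E : R) : 0 <= h ->
  (forall j, (j < n)%N -> cder (F j) (F j.+1)) ->
  (forall y z, `|y - z| <= h -> cmod (F n y - F n z) <= E) ->
  forall x, cmod (iter n (dh h) (F 0%N) x - h%:C ^+ n * F n x) <= 4 ^+ n * h ^+ n * E.
Proof.
move=> h0; elim: n F => [|n IH] F dF hE x.
  by rewrite !expr0 !mul1r; apply: hE; rewrite subrr normr0.
have E0 : 0 <= E by apply: le_trans (hE 0 0 _); rewrite ?cmod_ge0 // subrr normr0.
have IH' := IH (fun j => F j.+1) (fun j jn => dF j.+1 jn) hE.
set G := iter n (dh h) (F 0%N); have dG : cder G (iter n (dh h) (F 1%N)).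
  by apply: cder_iter_dh; exact: dF.
(* Subtracting the linear function with slope [c] makes the increment over [x - h, x] the error
   itself, so the mean value bound acts on the error directly. *)
pose c := h%:C ^+ n * F n.+1 x.
have dg : cder (fun y => G y - c * y%:C) (fun y => iter n (dh h) (F 1%N) y - c * 1).
  by apply: cderB => //; apply: cderZ; exact: cder_id.
have hn0 : 0 <= h ^+ n by rewrite exprn_ge0.
have := @cmvt _ _ _ (4 ^+ n * h ^+ n * E + h ^+ n * E) (x - h) x dg.
have -> : G x - c * x%:C - (G (x - h) - c * (x - h)%:C) =
    iter n.+1 (dh h) (F 0%N) x - h%:C ^+ n.+1 * F n.+1 x.
  by rewrite /= /dh -/G /c exprS rmorphB /=; ring.
move=> H; apply: le_trans (H _) _ => [y|].
  have xh : x - h <= x by lra.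
  rewrite (min_idPl xh) (max_idPr xh) => /andP[y1 y2].
  rewrite mulr1 (_ : _ - c = (iter n (dh h) (F 1%N) y - h%:C ^+ n * F n.+1 y) +
     h%:C ^+ n * (F n.+1 y - F n.+1 x)); last by rewrite /c; ring.
  apply: le_trans (cmodD _ _) _; apply: lerD; first exact: IH'.
  rewrite cmodM cmodX cmodR (ger0_norm h0) ler_wpM2l //; apply: hE.
  by rewrite ler_norml; apply/andP; split; lra.
have -> : `|x - (x - h)| = h by rewrite opprB addrC subrK ger0_norm.
have e4 : 1 <= 4 ^+ n :> R by rewrite exprn_ege1 // ler1n.
have -> : 2 * h * (4 ^+ n * h ^+ n * E + h ^+ n * E) = h ^+ n.+1 * E * (2 * (4 ^+ n + 1)).
  by rewrite exprS; ring.
have -> : 4 ^+ n.+1 * h ^+ n.+1 * E = h ^+ n.+1 * E * (4 * 4 ^+ n) by rewrite [4 ^+ n.+1]exprS; ring.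
apply: ler_wpM2l; first by rewrite mulr_ge0 // exprn_ge0.
lra.
Qed.

Lemma iter_nabla_sample r (F : 'I_r -> R -> C) (h : R) n k l :
  iter n (@nabla R r 1) (fun j : int => Fvec F (h * j%:~R)) k l ord0 =
  iter n (dh h) (F l) (h * k%:~R).
Proof.
elim: n k => [|n IH] k; first by rewrite /= mxE.
set u := (fun j : int => _) in IH *.
have -> : iter n.+1 (@nabla R r 1) u k l ord0 =
    iter n (@nabla R r 1) u k l ord0 - iter n (@nabla R r 1) u (k - 1) l ord0.
  by rewrite /= {1}/nabla !mxE.
by rewrite !IH rmorphB /= mulrBr mulr1.
Qed.

Lemma iter_nabla_le s t (w : int -> 'M[C]_(s, t)) i j e n :
  (forall k, cmod (w k i j - w (k - 1) i j) <= e) ->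
  forall k, cmod (iter n.+1 (@nabla R s t) w k i j) <= 2 ^+ n * e.
Proof.
move=> h; elim: n => [|n IH] k; first by rewrite /= /nabla !mxE expr0 mul1r.
have -> : iter n.+2 (@nabla R s t) w k i j =
    iter n.+1 (@nabla R s t) w k i j - iter n.+1 (@nabla R s t) w (k - 1) i j.
  by rewrite iterS {1}/nabla !mxE.
apply: le_trans (cmodB _ _) _; have := IH k; have := IH (k - 1).
by rewrite /= exprS; lra.
Qed.

End FiniteDifferences.

(** * Convergence of the columns and of the scheme *)

Section ColumnConvergence.
Variables (R : realType) (r : nat).
Local Notation C := R[i].
Local Notation mu := (@lebesgue_measure R).

Section Columns.
Variables (a : int -> 'M[C]_r) (Na : nat) (m : nat) (F : 'I_r -> R -> C) (K : R).
Hypotheses (ha : supp Na a) (CF : forall l, C_ m (F l)) (sF : forall l, csupp K (F l)).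
Hypothesis F_ref : forall x,
  Fvec F x = 2 *: \sum_(k \in [set: int]) a k *m Fvec F (2 * x - k%:~R).

Lemma sample_supp : exists L, supp L (fun j : int => Fvec F j%:~R).
Proof.
exists (Num.truncn `|K|).+1 => j jL; apply/colP => l; rewrite !mxE.
case: (sF l) => _; apply; apply: le_lt_trans (ler_norm K) _.
apply: lt_le_trans (truncnS_gt _) _; rewrite -intr_norm pmulrn ler_int.
by move: jL; rewrite -abszE lez_nat; exact: ltnW.
Qed.

(** Scaled by 2^(nu n), the leading difference approaches the derivative uniformly. Every higher
    difference is a difference of this almost continuous sequence, hence small, and the last part
    decays like (q 2^M)^n. *)
Lemma column_convergence (va v : int -> 'rV[C]_r) Nva Nv M s (q : R) l nu :
  supp Nva va -> supp Nv v -> 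
  matching_filter a M.+1 va -> symbol v 0 != 0 ->
  0 < q -> q * 2 ^+ M < 1 -> (forall u, V_ s v u -> decays a q u) ->
  vmom va 0 (fun j : int => Fvec F j%:~R) = 1 -> (nu <= M)%N -> (nu <= m)%N ->
  eqO nu.+1 (fun xi => symbol va xi ord0 l) (fun xi => (0 +i* xi) ^+ nu) ->
  forall e : R, 0 < e -> exists n0, forall n, (n0 <= n)%N -> forall k i,
    cmod (Apow a n k i l * 2 ^+ (nu * n) - cderivn nu (F i) (2 ^- n * k%:~R)) <= e.
Proof.
move=> hva hv hm v0 q0 q1 dec np nuM num hva_l e e0.
have [L hp] := sample_supp.
have [c [z [[nz dz] hdec]]] := column_decomposition ha hva hv hp hm v0 q0 q1 dec np nuM hva_l.
pose S := \sum_(j < s) cmod (c j).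
have S0 : 0 <= S by apply: sumr_ge0 => j _; exact: cmod_ge0.
have p4 : 1 <= 4 ^+ nu :> R by rewrite exprn_ege1 // ler1n.
have ps : 1 <= 2 ^+ s :> R by rewrite exprn_ege1 // ler1n.
(* The first term is the cost of the leading difference, the second that of all higher ones;
   together they use e / 2, and the decaying part the other half. *)
pose D := 4 ^+ nu + S * (2 ^+ s * (3 * 4 ^+ nu)).
have D0 : 0 < D by rewrite /D ltr_pwDl ?mulr_ge0 //; lra.
pose E := e / (2 * D); have E0 : 0 < E by rewrite divr_gt0 // mulr_gt0.
have unif : exists n0, forall i n, (n0 <= n)%N -> forall y z : R, `|y - z| <= 2 ^- n ->
    cmod (cderivn nu (F i) y - cderivn nu (F i) z) <= E.
  apply: ord_eventually => i.
  have [d d0 hd] := csupp_uniform (csupp_cderivn (CF i) (sF i) num) E0.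
  have h01 : 0 <= (2^-1 : R) < 1 by rewrite invr_ge0 ler0n invf_lt1 ?ltr1n.
  have [n0 hn0] := expr_lt_small 1 h01 d0.
  exists n0 => n hn y y' hy; apply: hd; apply: le_lt_trans hy _.
  by have := hn0 n hn; rewrite mul1r exprVn.
have q01 : 0 <= q * 2 ^+ M < 1 by rewrite q1 mulr_ge0 ?exprn_ge0 // ltW.
have e2 : 0 < e / 2 by rewrite divr_gt0.
have [n1 hn1] := expr_lt_small 1 q01 e2.
have [n2 hn2] := unif.
exists (maxn nz (maxn n1 n2)) => n; rewrite !geq_max => /and3P[nzn n1n n2n] k i.
pose T : C := 2 ^+ (nu * n).
have cT : cmod T = 2 ^+ (nu * n) by rewrite /T cmodX (cmod_nat R 2).
pose h : R := 2 ^- n; have h0 : 0 <= h by rewrite invr_ge0 exprn_ge0.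
have hT : T = (h%:C ^+ nu)^-1.
  have -> : h%:C = (2 ^+ n)^-1 :> C by rewrite /h fmorphV rmorphXn rmorph_nat.
  by rewrite exprVn invrK -exprM mulnC.
have hne : h%:C ^+ nu != 0 :> C.
  by rewrite expf_neq0 // -cmod_eq0 cmodR normr_eq0 invr_eq0 expf_neq0.
pose Fn := seq_conv (Apow a n) (fun j : int => Fvec F j%:~R).
have FnE : Fn = fun j : int => Fvec F (h * j%:~R).
  by apply/funext => j; rewrite /Fn -(refine_dyadic ha n j F_ref).
pose W k := T * iter nu (@nabla R r 1) Fn k i ord0.
have close j : cmod (W j - cderivn nu (F i) (h * j%:~R)) <= 4 ^+ nu * E.
  rewrite /W FnE iter_nabla_sample.
  have dF k' : (k' < nu)%N -> cder (cderivn k' (F i)) (cderivn k'.+1 (F i)).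
    by move=> kn; apply: (C_cder (CF i)); exact: leq_trans num.
  have := iter_dh_close h0 dF (hn2 i n n2n) (h * j%:~R); rewrite cderivn0.
  set X := iter _ _ _ _; set Y := cderivn _ _ _ => H.
  have -> : T * X - Y = T * (X - h%:C ^+ nu * Y).
    by rewrite mulrBr mulrA hT mulVf // mul1r.
  rewrite cmodM cT; apply: le_trans (ler_wpM2l _ H) _; first by rewrite exprn_ge0.
  have -> : 2 ^+ (nu * n) * (4 ^+ nu * h ^+ nu * E) = (2 ^+ (nu * n) * h ^+ nu) * (4 ^+ nu * E) by ring.
  by rewrite mulnC exprM -exprMn /h divff ?expf_neq0 // expr1n mul1r.
(* Two approximation errors of 4^nu E and one modulus of continuity E, counted as 4^nu E. *)
have Wd j : cmod (W j - W (j - 1)) <= 3 * 4 ^+ nu * E.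
  have h1 := close j; have h2 := close (j - 1).
  have h3 : cmod (cderivn nu (F i) (h * j%:~R) - cderivn nu (F i) (h * (j - 1)%:~R)) <= E.
    apply: (hn2 i n n2n); rewrite -mulrBr -rmorphB /= opprB addrC subrK mulr1 ger0_norm //.
  move: h1 h2 h3; set x := cderivn _ _ _; set y := cderivn _ _ _ => h1 h2 h3.
  have -> : W j - W (j - 1) = (W j - x) - (W (j - 1) - y) + (x - y) by ring.
  have h4 := cmodB (W j - x) (W (j - 1) - y).
  apply: le_trans (cmodD _ _) _.
  have : E <= 4 ^+ nu * E by rewrite ler_peMl // ltW.
  lra.
have := hdec n k => /colP/(_ i); rewrite mxE => ->.
rewrite -/Fn [X in cmod (X * _ - _)]mxE [X in cmod ((X + _) * _ - _)]mxE summxE -/h.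
have -> : (iter nu (@nabla R r 1) Fn k i ord0 +
    \sum_(j < s | (nu < j)%N) (c j *: iter j (@nabla R r 1) Fn k) i ord0 +
    seq_conv (Apow a n) z k i ord0) * T - cderivn nu (F i) (h * k%:~R) =
  (W k - cderivn nu (F i) (h * k%:~R)) +
   (\sum_(j < s | (nu < j)%N) c j * (T * iter j (@nabla R r 1) Fn k i ord0)) +
   T * seq_conv (Apow a n) z k i ord0.
  rewrite /W !mulrDl mulr_suml.
  rewrite (eq_bigr (fun j : 'I_s => c j * (T * iter j (@nabla R r 1) Fn k i ord0))) => [|j _].
    by ring.
  by rewrite mxE; ring.
have b3 : cmod (T * seq_conv (Apow a n) z k i ord0) <= e / 2.
  rewrite cmodM cT; apply: (@le_trans _ _ ((2 ^+ M * q) ^+ n)).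
    rewrite exprMn; apply: ler_pM; rewrite ?exprn_ge0 ?cmod_ge0 ?dz //.
    by rewrite -exprM ler_weXn2l ?ler1n // leq_mul2r nuM orbT.
  by have := hn1 n n1n; rewrite mul1r [q * _]mulrC => /ltW.
have b2 : cmod (\sum_(j < s | (nu < j)%N) c j * (T * iter j (@nabla R r 1) Fn k i ord0)) <=
    S * (2 ^+ s * (3 * 4 ^+ nu * E)).
  apply: le_trans (cmod_sum _ _ _) _; rewrite /S mulr_suml.
  rewrite [leLHS]big_mkcond /=; apply: ler_sum => j _.
  have E3 : 0 <= 3 * 4 ^+ nu * E.
    by apply: mulr_ge0 (ltW E0); rewrite mulr_ge0 ?exprn_ge0.
  have B0 : 0 <= 2 ^+ s * (3 * 4 ^+ nu * E) by rewrite mulr_ge0 ?exprn_ge0.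
  case: ifP => nj; last by rewrite mulr_ge0 ?cmod_ge0.
  rewrite cmodM ler_wpM2l ?cmod_ge0 //.
  have [d dj] : exists d, nat_of_ord j = (d.+1 + nu)%N by exists (j - nu.+1)%N; rewrite addSnnS subnK.
  rewrite dj iterD cmodM cT.
  have := @iter_nabla_le R r 1 (iter nu (@nabla R r 1) Fn) i ord0
     (3 * 4 ^+ nu * E / 2 ^+ (nu * n)) d _ k.
  have T0 : 0 < 2 ^+ (nu * n) :> R by rewrite exprn_gt0.
  move=> H; rewrite mulrC -ler_pdivlMr //; apply: le_trans (H _) _ => [k'|].
    rewrite ler_pdivlMr // mulrC -cT -cmodM mulrBr; exact: Wd.
  have -> : 2 ^+ d * (3 * 4 ^+ nu * E / 2 ^+ (nu * n)) =
      2 ^+ d * (3 * 4 ^+ nu * E) / 2 ^+ (nu * n) by rewrite mulrA.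
  rewrite ler_pM2r ?invr_gt0 //; apply: ler_wpM2r => //.
  rewrite ler_weXn2l ?ler1n //; apply: leq_trans (ltnW (ltn_ord j)).
  by rewrite dj addSn leqW // leq_addr.
apply: le_trans (cmodD _ _) _; rewrite [e]splitr; apply: lerD b3.
apply: le_trans (cmodD _ _) _; apply: le_trans (lerD (close k) b2) _.
have -> : e / 2 = D * E by rewrite /E; field; rewrite gt_eqF.
rewrite le_eqVlt; apply/orP; left; apply/eqP; rewrite /D; ring.
Qed.

End Columns.

Lemma ereal_cvg0 (x : nat -> \bar R) : (forall n, (0 <= x n)%E) ->
  (forall e : R, 0 < e -> exists n0, forall n, (n0 <= n)%N -> (x n <= e%:E)%E) ->
  x @ \oo --> 0%E.
Proof.
move=> x0 h; apply/fine_cvgP.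
have fx n (e : R) : (x n <= e%:E)%E -> x n \is a fin_num.
  by move=> xe; rewrite ge0_fin_numE // (le_lt_trans xe) // ltry.
split.
  by have [n0 hn0] := h 1 ltr01; exists n0 => // n nn; exact: (fx n 1 (hn0 n nn)).
apply/cvgr0Pnorm_le => e e0; have [n0 hn0] := h e e0; exists n0 => // n nn /=.
have xe := hn0 n nn; rewrite ger0_norm ?fine_ge0 //.
by rewrite -lee_fin fineK //; exact: fx xe.
Qed.

Lemma ereal_cvg0_lt (x : nat -> \bar R) : x @ \oo --> 0%E ->
  forall e : R, 0 < e -> exists n0, forall n, (n0 <= n)%N -> (x n < e%:E)%E.
Proof.
move=> /fine_cvgP[[n1 _ hn1] /cvgr0Pnorm_lt h] e e0.
have [n2 _ hn2] := h e e0; exists (maxn n1 n2) => n; rewrite geq_max => /andP[h1 h2].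
rewrite -(fineK (hn1 n h1)) lte_fin; apply: le_lt_trans (ler_norm _) _; exact: hn2.
Qed.

(** By [iter_subdivE] the limit for data [w0] must be the sum of the products of w0(j) with F(. -
    j). On a bounded interval finitely many j matter, uniformly in the level. *)
Lemma hermite_convergent_columns (a : int -> 'M[C]_r) Na m (nu : 'I_r -> 'I_m.+1)
    (F : 'I_r -> R -> C) K0 : supp Na a -> (forall l, C_ m (F l)) -> (forall l, csupp K0 (F l)) ->
  (forall l (e : R), 0 < e -> exists n0, forall n, (n0 <= n)%N -> forall k i,
    cmod (Apow a n k i l * 2 ^+ (nu l * n) - cderivn (nu l) (F i) (2 ^- n * k%:~R)) <= e) ->
  hermite_convergent nu a.
Proof.
move=> ha CF sF conv w0.
pose G L (x : R) : C := \sum_(j <- int_range L) \sum_i w0 j ord0 i * F i (x - j%:~R).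
pose eta (x : R) : C := \sum_(j \in [set: int]) \sum_i w0 j ord0 i * F i (x - j%:~R).
(* Beyond this radius neither the translates of [F] (through [K0]) nor those of A_n (through [Na])
   reach [-K, K]. *)
pose Lb (K : R) := ((Num.truncn (`|K| + `|K0|)).+1 + Na)%N.
have LbK (K : R) j : (Lb K < `|j|)%N -> `|K| + `|K0| + Na%:R < `|j%:~R : R|.
  move=> jL; apply: lt_le_trans (_ : (Lb K)%:R <= _).
    by rewrite /Lb natrD ltrD2r truncnS_gt.
  by rewrite -intr_norm pmulrn ler_int -abszE lez_nat ltnW.
have Gz (K : R) x j : `|x| <= `|K| -> (Lb K < `|j|)%N -> forall i, K0 < `|x - j%:~R|.
  move=> xK /LbK jL i; have := ler_distD x 0 (j%:~R : R); rewrite !sub0r normrN.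
  have := ler_norm K0; rewrite normrN; have : 0 <= Na%:R :> R by []; lra.
have etaG (K : R) x : `|x| <= `|K| -> eta x = G (Lb K) x.
  move=> xK; apply: Zsum_seq => j jL; rewrite big1 // => i _.
  by case: (sF i) => _ ->; rewrite ?mulr0 //; exact: Gz jL i.
have CG L : C_ m (G L).
  apply: C_sum => j _; apply: C_sum => i _; apply: C_M; first exact: C_cst.
  rewrite (_ : (fun x => _) = fun x => F i (1 * x + (- j%:~R))); first exact: C_comp.
  by apply/funext => x; rewrite mul1r.
have Ceta : C_ m eta.
  apply: C_local => K; exists (G (Lb K)) => // x xK; apply: etaG.
  by apply: (le_trans (ltW xK)); exact: ler_norm.
exists eta => // K Kgt0 l.
have dG L j : (j <= m)%N -> cderivn j (G L) =
   fun x => \sum_(i <- int_range L) \sum_i0 w0 i ord0 i0 * cderivn j (F i0) (x - i%:~R).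
  move=> jm; rewrite -(@cderivnE _ m (fun j x => \sum_(i <- int_range L) \sum_i0
     w0 i ord0 i0 * cderivn j (F i0) (x - i%:~R)) _ j jm).
    congr cderivn; apply/funext => x; apply: eq_bigr => i _; apply: eq_bigr => i0 _.
    by rewrite cderivn0.
  move=> j' jm'; apply: cder_sum => i _; apply: cder_sum => i0 _; apply: cderZ.
  exact: cder_comp_shift (C_cder (CF i0) jm').
have num : (nu l <= m)%N by have := ltn_ord (nu l).
(* The extra 1 makes [eta] agree with a finite sum on a neighbourhood of [-K, K], as comparing
   derivatives requires. *)
pose L := Lb (K + 1).
pose W : R := \sum_(j <- int_range L) \sum_i cmod (w0 j ord0 i).
have W0 : 0 <= W by apply: sumr_ge0 => j _; apply: sumr_ge0 => i _; exact: cmod_ge0.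
have main (e : R) : 0 < e -> exists n0, forall n, (n0 <= n)%N -> forall k : int,
    `|k%:~R : R| <= 2 ^+ n * K ->
    cmod (iter n (subdiv a) w0 k ord0 l * 2 ^+ (nu l * n) -
          cderivn (nu l) eta (2 ^- n * k%:~R)) <= e.
  move=> e0; have e1 : 0 < e / (W + 1) by rewrite divr_gt0 // ltr_wpDl.
  have [n0 hn0] := conv l _ e1; exists n0 => n nn k kK.
  have p2 : 0 < 2 ^+ n :> R by rewrite exprn_gt0.
  have xK : `|2 ^- n * k%:~R : R| <= K.
    by rewrite normrM ger0_norm ?invr_ge0 ?(ltW p2) // ler_pdivrMl.
  rewrite (@cderivn_local _ m eta (G L) (K + 1)) //; last 2 first.
  - move=> x xK1; apply: etaG; apply: (le_trans (ltW xK1)); exact: ler_norm.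
  - by apply: le_lt_trans xK _; rewrite ltrDl.
  rewrite dG // (iter_subdivE ha).
  rewrite (@Zsum_seq _ L) => [|j jL]; last first.
    rewrite (Apow_supp ha) ?mulmx0 //.
    have := LbK _ _ jL; rewrite (ger0_norm (_ : 0 <= K + 1)); last by rewrite addr_ge0 // ltW.
    move=> H; rewrite -(ltr_nat R) natrM natrX natr_absz intr_norm rmorphB rmorphM /=.
    have -> : ((2 ^ n)%N%:~R : R) = 2 ^+ n by rewrite -pmulrn natrX.
    have := ler_distD (k%:~R : R) 0 (2 ^+ n * j%:~R); rewrite !sub0r !normrN normrM.
    rewrite [`|2 ^+ n|]ger0_norm ?(ltW p2) //.
    have : 2 ^+ n * (K + 1 + `|K0| + Na%:R) < 2 ^+ n * `|j%:~R| by rewrite ltr_pM2l.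
    have : 0 <= 2 ^+ n * `|K0| by rewrite mulr_ge0 // ltW.
    rewrite !mulrDr; lra.
  rewrite summxE mulr_suml -sumrB.
  apply: le_trans (cmod_sum _ _ _) _.
  apply: (@le_trans _ _ (W * (e / (W + 1)))); last first.
    by rewrite mulrA ler_pdivrMr ?ltr_wpDl // mulrC ler_pM2l //; lra.
  rewrite /W mulr_suml; apply: ler_sum => j _.
  rewrite mxE mulr_suml mulr_suml -sumrB; apply: le_trans (cmod_sum _ _ _) _.
  apply: ler_sum => i _.
  have -> : 2 ^- n * k%:~R - j%:~R = 2 ^- n * (k - (2 ^ n)%N%:Z * j)%:~R :> R.
    rewrite rmorphB rmorphM /= mulrBr; congr (_ - _).
    by rewrite -pmulrn natrX mulrA mulVf ?mul1r // gt_eqF.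
  rewrite -mulrA -mulrBr cmodM ler_wpM2l ?cmod_ge0 //; exact: hn0.
have sup0 n : (0 <= ereal_sup [set (cmod (iter n (subdiv a) w0 k ord0 l * 2 ^+ (nu l * n) -
    cderivn (nu l) eta (2 ^- n * k%:~R))%R)%:E | k in [set k : int | (`|k%:~R : R| <= 2 ^+ n * K)%R]])%E.
  apply: le_trans (ereal_sup_ubound _); last first.
    by exists 0; rewrite //= normr0 mulr_ge0 ?exprn_ge0 // ltW.
  by rewrite lee_fin cmod_ge0.
apply: ereal_cvg0 => // e e0; have [n0 hn0] := main e e0; exists n0 => n nn.
by apply: ge_ereal_sup => _ [k hk <-]; rewrite lee_fin; exact: hn0.
Qed.

(** By matching, the mean of the samples on the grid of step 2^(-n), weighted by 2^(-n), does not
    depend on n; it is a Riemann sum, hence equal to its limit. *)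
Lemma vmom0_sample (a : int -> 'M[C]_r) Na (va : int -> 'rV[C]_r) Nva k
    (F : 'I_r -> R -> C) K : supp Na a -> supp Nva va -> matching_filter a k.+1 va ->
  (forall l, csupp K (F l)) ->
  (forall x, Fvec F x = 2 *: \sum_(k \in [set: int]) a k *m Fvec F (2 * x - k%:~R)) ->
  vmom va 0 (fun j : int => Fvec F j%:~R) = \sum_l symbol va 0 ord0 l * cintegral (F l).
Proof.
move=> ha hva hm sF Fref; have [L hp] := sample_supp sF.
set c := fun l => symbol va 0 ord0 l.
have E n : vmom va 0 (fun j : int => Fvec F j%:~R) =
    \sum_l c l * (2 ^- n * \sum_(k \in [set: int]) F l (2 ^- n * k%:~R)).
  have := mom_gconv_matching ha hva n hp hm (ltn0Sn k).
  have FnE : seq_conv (Apow a n) (fun j : int => Fvec F j%:~R) = fun j : int => Fvec F (2 ^- n * j%:~R).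
    by apply/funext => j; rewrite -(refine_dyadic ha n j Fref).
  have hB := seq_conv_supp (Apow_supp ha (n := n)) hp.
  rewrite (mom_gconv 0 _ hva hB) FnE big_ord1 => /matrixP/(_ ord0 ord0).
  rewrite FnE in hB; rewrite [RHS]mxE -/(vmom _ _ _) => H.
  apply: (mulfI (_ : (2 ^+ n : C) != 0)); first by rewrite expf_neq0.
  rewrite -H; set NN := (_ + L)%N in hB.
  have s1 : supp NN (fun k : int => mom 0 va *m Fvec F (2 ^- n * k%:~R)).
    by move=> j jN; rewrite hB ?mulmx0.
  have -> : \sum_(k \in [set: int]) ('C(0, 0)%:R * (2 ^ n)%N%:~R ^+ 0 * k%:~R ^+ (0 - 0)) *:
      (mom 0 va *m Fvec F (2 ^- n * k%:~R)) =
      \sum_(k \in [set: int]) mom 0 va *m Fvec F (2 ^- n * k%:~R).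
    by apply: eq_fsbigr => j _; rewrite bin0 !expr0 !mulr1 scale1r.
  rewrite -(Zsum_mulmxl _ hB) mxE mulr_sumr; apply: eq_bigr => l _.
  rewrite (mom0_symbol va) (Zsum_mxE _ _ hB) [RHS]mulrCA [2 ^+ n * _]mulrA.
  rewrite mulfV ?expf_neq0 // mul1r; congr (_ * _).
  by apply: eq_fsbigr => j _; rewrite mxE.
apply/eqP; rewrite -subr_eq0 -cmod_eq0 eq_le cmod_ge0 andbT.
apply/ler_addgt0Pr => e e0; rewrite add0r.
pose S := \sum_l cmod (c l); have S0 : 0 <= S by apply: sumr_ge0 => l _; exact: cmod_ge0.
have e1 : 0 < e / (S + 1) by rewrite divr_gt0 // ltr_wpDl.
have [n0 hn0] := ord_eventually (fun l => riemann_sum (sF l) e1).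
rewrite (E n0) -sumrB; apply: le_trans (cmod_sum _ _ _) _.
apply: (@le_trans _ _ (S * (e / (S + 1)))); last first.
  by rewrite mulrA ler_pdivrMr ?ltr_wpDl // mulrC ler_pM2l //; lra.
rewrite /S mulr_suml; apply: ler_sum => l _.
by rewrite -mulrBr cmodM ler_wpM2l ?cmod_ge0 //; exact: hn0.
Qed.

Lemma cintegral_ae (f g : R -> C) :
  measurable_fun setT (Ref f) -> measurable_fun setT (Imf f) ->
  measurable_fun setT (Ref g) -> measurable_fun setT (Imf g) ->
  {ae mu, forall x, f x = g x} -> cintegral f = cintegral g.
Proof.
move=> fr fi gr gi fg.
have h (u w : R -> R) : measurable_fun setT u -> measurable_fun setT w ->
    {ae mu, forall x, u x = w x} -> Rintegral mu setT u = Rintegral mu setT w.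
  move=> mu1 mw uw; rewrite /Rintegral; congr fine; apply: ae_eq_integral => //.
  - exact/measurable_EFinP.
  - exact/measurable_EFinP.
  - by apply: ae_imp uw => x -> _.
rewrite /cintegral; congr (_ +i* _); apply: h => //.
  by apply: ae_imp fg => x; rewrite /Ref => ->.
by apply: ae_imp fg => x; rewrite /Imf => ->.
Qed.

Lemma ccont_measurable (f : R -> C) : ccont f ->
  measurable_fun setT (Ref f) /\ measurable_fun setT (Imf f).
Proof. by move=> [c1 c2]; split; exact: continuous_measurable_fun. Qed.

Lemma measurable_mulc (f g : R -> C) :
  measurable_fun setT (Ref f) -> measurable_fun setT (Imf f) ->
  measurable_fun setT (Ref g) -> measurable_fun setT (Imf g) ->
  measurable_fun setT (Ref (fun x => f x * g x)) /\
  measurable_fun setT (Imf (fun x => f x * g x)).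
Proof.
move=> fr fi gr gi; split.
  rewrite (_ : Ref _ = (Ref f \* Ref g) \- (Imf f \* Imf g)).
    by apply: measurable_funB; exact: measurable_funM.
  by apply/funext => x; rewrite /Ref ReM.
rewrite (_ : Imf _ = (Ref f \* Imf g) \+ (Imf f \* Ref g)).
  by apply: measurable_funD; exact: measurable_funM.
by apply/funext => x; rewrite /Imf ImM.
Qed.

Lemma represents_ae (f F : R -> C) T : Linfty f -> ccont F ->
  {ae mu, forall x, F x = f x} -> represents f T -> represents F T.
Proof.
move=> [fr fi _] cF Ff hf g sg g0; rewrite (hf g sg g0).
have [Fr Fi] := ccont_measurable cF.
have [gr gi] := ccont_measurable (proj1 (C0E _) (sg 0%N)).
have [m1 m2] := measurable_mulc fr fi gr gi.
have [m3 m4] := measurable_mulc Fr Fi gr gi.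
by apply: cintegral_ae => //; apply: ae_imp Ff => x ->.
Qed.

Lemma sm_infty_dist_regular m (phi : 'I_r -> (R -> C) -> C) :
  sm_infty_dist_gt phi m%:R%:E ->
  exists F : 'I_r -> R -> C, (forall l, C_ m (F l)) /\ forall l, represents (F l) (phi l).
Proof.
move=> [f [fL frep hf]].
have h l : exists F, C_ m F /\ {ae mu, forall x, F x = f l x}.
  have lt : (m%:R%:E < sm_infty_fun (f l))%E.
    apply: lt_le_trans hf _; rewrite /sm_infty_vec (bigD1 l) //=.
    by rewrite ge_min lexx.
  by have [F CF aF] := sm_infty_regular lt; exists F.
exists (fun l => sval (cid (h l))); split=> l; case: (cid (h l)) => F [CF aF] //=.
apply: represents_ae (fL l) _ aF (frep l); rewrite -C0E; exact: C_le CF.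
Qed.

Theorem hermite_scheme_convergent m (nu : 'I_r -> 'I_m.+1) (a : int -> 'M[C]_r) Na
    (va : int -> 'rV[C]_r) (phi : 'I_r -> (R -> C) -> C) : supp Na a ->
  matching_filter a (\max_(l < r) nu l).+1 va ->
  (forall l, cs_distribution (phi l)) ->
  (forall xi : R, fourier_vec phi (2 * xi) = symbol a xi *m fourier_vec phi xi) ->
  symbol va 0 *m fourier_vec phi 0 = 1%:M ->
  (((\max_(l < r) nu l)%N)%:R%:E < sm_infty_mask a)%E ->
  sm_infty_dist_gt phi m%:R%:E ->
  hermite_filter_cond nu va ->
  hermite_convergent nu a.
Proof.
move=> ha hm phid phir phin hsm hphi hva; set M := (\max_(l < r) nu l)%N in hm hsm.
have [F [CF Frep]] := sm_infty_dist_regular hphi.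
have cF l : ccont (F l) by rewrite -C0E; exact: C_le (CF l).
have [K K0 sF] := represents_csupp phid cF Frep.
have Fref := represents_refine ha phid phir cF Frep.
have [/fin_suppP[Nva sva] _ _] := hm.
(* Sum rules of order 0 ask only for a filter that is nonzero at 0, so [va] provides them. *)
have hsr : sum_rules a (sr a) (sr_filter a).
  by apply: sr_filterP; exists va; split; [case: hm => *; split|].
have [[/fin_suppP[Nv sv] v0 _] _] := hsr.
have [q [q0 q1 hq]] := sm_mask_gt hsm.
have dec u : V_ (sr a) (sr_filter a) u -> decays a q u by exact: rho_lt_decay hq u.
have np : vmom va 0 (fun j : int => Fvec F j%:~R) = 1.
  rewrite (vmom0_sample ha sva hm sF Fref).
  move/matrixP/(_ ord0 ord0): phin; rewrite !mxE eqxx mulr1n => <-; apply: eq_bigr => l _.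
  rewrite mxE (represents_fourier phid cF Frep); congr (_ * cintegral _).
  by apply/funext => x; rewrite mulr0 oppr0 cis0 mulr1.
apply: (hermite_convergent_columns ha CF sF) => l e e0.
apply: (column_convergence ha CF sF Fref sva sv hm v0 q0 q1 dec np) => //.
  exact: leq_bigmax.
by have := ltn_ord (nu l).
Qed.

End ColumnConvergence.

(** * Necessity: the limit functions *)

Section LimitFunctions.
Variables (R : realType) (r : nat).
Local Notation C := R[i].

Lemma csupp_bounded (K : R) (h : R -> C) : csupp K h ->
  exists2 B : R, 0 <= B & forall x, cmod (h x) <= B.
Proof.
move=> [ch hK]; have [B B0 hB] := ccont_bounded (- `|K|) `|K| ch.
exists B => // x; have [xK|xK] := leP `|x| `|K|; last first.
  by rewrite hK ?cmod0 // (le_lt_trans (ler_norm K)).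
by apply: hB; rewrite -ler_norml.
Qed.

Lemma half_powers_small (e : R) : 0 < e -> exists n0, forall n, (n0 <= n)%N -> 2 ^- n < e.
Proof.
move=> e0; have h01 : 0 <= (2^-1 : R) < 1 by rewrite invr_ge0 ler0n invf_lt1 ?ltr1n.
have [n0 hn0] := expr_lt_small 1 h01 e0.
by exists n0 => n hn; have := hn0 n hn; rewrite mul1r exprVn.
Qed.

Lemma dyadic_floor (x : R) n : exists k : int, `|2 ^- n * k%:~R - x| <= 2 ^- n.
Proof.
have p2 : 0 < 2 ^+ n :> R by rewrite exprn_gt0.
exists (Num.floor (2 ^+ n * x)); rewrite -(ler_pM2l p2) mulfV ?gt_eqF //.
rewrite -[X in X * `|_|](ger0_norm (ltW p2)) -normrM mulrBr mulrA mulfV ?gt_eqF // mul1r.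
have := floor_le (2 ^+ n * x); have := floorD1_gt (2 ^+ n * x).
by rewrite rmorphD /= ler_norml => h1 h2; apply/andP; split; lra.
Qed.

(** The device by which identities between limit functions are read off from approximate identities
    on ever finer grids. *)
Lemma dyadic_zero (f : R -> C) x : ccont f ->
  (forall e : R, 0 < e -> exists n0, forall n, (n0 <= n)%N -> forall k : int,
     `|2 ^- n * k%:~R - x| <= 2 ^- n -> cmod (f (2 ^- n * k%:~R)) <= e) -> f x = 0.
Proof.
move=> cf h; apply/eqP; rewrite -cmod_eq0 eq_le cmod_ge0 andbT.
apply/ler_addgt0Pr => e e0; rewrite add0r; have e2 : 0 < e / 2 by rewrite divr_gt0.
have [d d0 hd] := ccont_eps x cf e2.
have [n1 hn1] := h _ e2; have [n2 hn2] := half_powers_small d0.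
pose n := maxn n1 n2; have [k hk] := dyadic_floor x n.
have h1 := hn1 n (leq_maxl _ _) k hk.
have h2 : cmod (f (2 ^- n * k%:~R) - f x) <= e / 2.
  by apply: hd; apply: le_lt_trans hk _; exact: hn2 (leq_maxr _ _).
rewrite -[f x](subKr (f (2 ^- n * k%:~R))) [e]splitr.
by apply: le_trans (cmodB _ _) _; exact: lerD.
Qed.

Definition column_limit (nu : 'I_r -> nat) (a : int -> 'M[C]_r) (eta : 'I_r -> R -> C) :=
  forall e : R, 0 < e -> exists n0, forall n, (n0 <= n)%N -> forall k i l,
    cmod (Apow a n k i l * 2 ^+ (nu l * n) - cderivn (nu l) (eta i) (2 ^- n * k%:~R)) <= e.

(** The scheme acts on rows, so starting it from the i-th row of the Dirac sequence produces the
    i-th row of A_n. Convergence is uniform on the whole grid because both A_n and the limits vanish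
    off [-Na, Na]. *)
Lemma hermite_limit m (nu : 'I_r -> 'I_m.+1) (a : int -> 'M[C]_r) Na l0 :
  supp Na a -> nu l0 = 0%N :> nat -> hermite_convergent nu a ->
  exists eta : 'I_r -> R -> C, [/\ forall i, C_ m (eta i), forall i, csupp Na%:R (eta i) &
    column_limit nu a eta].
Proof.
move=> ha nu0 conv; pose w i (k : int) := row i (dirac_mx R r k).
have wE i n k : iter n (subdiv a) (w i) k = row i (Apow a n k).
  rewrite (iter_subdivE ha) (Zsum1 (k0 := 0)) => [|j /negbTE j0].
    by rewrite /w /dirac_mx eqxx mulr0 subr0 -row_mul mul1mx.
  by rewrite /w /dirac_mx j0 -row_mul mul0mx; apply/rowP => l; rewrite !mxE.
pose eta i := sval (cid2 (conv (w i))).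
have CE i : C_ m (eta i) by rewrite /eta; case: cid2.
have cv (K e : R) : 0 < K -> 0 < e -> exists n0, forall n, (n0 <= n)%N -> forall k i l,
    `|k%:~R : R| <= 2 ^+ n * K ->
    cmod (Apow a n k i l * 2 ^+ (nu l * n) - cderivn (nu l) (eta i) (2 ^- n * k%:~R)) <= e.
  move=> K0 e0.
  have [n0 hn0] : exists n0, forall i n, (n0 <= n)%N -> forall l k, `|k%:~R : R| <= 2 ^+ n * K ->
      cmod (Apow a n k i l * 2 ^+ (nu l * n) - cderivn (nu l) (eta i) (2 ^- n * k%:~R)) <= e.
    apply: ord_eventually => i.
    suff [n0 hn0] : exists n0, forall l n, (n0 <= n)%N -> forall k, `|k%:~R : R| <= 2 ^+ n * K ->
      cmod (Apow a n k i l * 2 ^+ (nu l * n) - cderivn (nu l) (eta i) (2 ^- n * k%:~R)) <= e.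
      by exists n0 => n nn l; exact: hn0.
    apply: ord_eventually => l.
    have h : forall K : R, 0 < K -> forall l : 'I_r, (fun n : nat => ereal_sup [set
          (cmod (iter n (subdiv a) (w i) k ord0 l * 2 ^+ (nu l * n)
                 - cderivn (nu l) (eta i) (2 ^- n * k%:~R)))%:E
        | k in [set k : int | `|k%:~R| <= 2 ^+ n * K :> R]]) @ \oo --> 0%E.
      by rewrite /eta; case: cid2.
    have [n0 hn0] := ereal_cvg0_lt (h K K0 l) e0.
    exists n0 => n nn k hk; rewrite -lee_fin; apply: le_trans (ltW (hn0 n nn)).
    by apply: ereal_sup_ubound; exists k => //; rewrite wE mxE.
  by exists n0 => n nn k i l; exact: hn0.
have Az n k : (Na%:R : R) < `|2 ^- n * k%:~R| -> Apow a n k = 0.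
  move=> h; apply: (Apow_supp ha); move: h; have p2 : 0 < 2 ^+ n :> R by rewrite exprn_gt0.
  rewrite normrM ger0_norm ?invr_ge0 ?(ltW p2) // ltr_pdivlMl //.
  by rewrite -(ltr_nat R) natrM natrX natr_absz intr_norm mulrC.
(* Only a column with [nu] equal to 0 samples the limit itself rather than a derivative; [l0]
   provides one. *)
have sE i : csupp Na%:R (eta i).
  split=> [|x xN]; first by rewrite -C0E; exact: C_le (CE i).
  apply: dyadic_zero => [|e e0]; first by rewrite -C0E; exact: C_le (CE i).
  have K0 : 0 < `|x| + 1 by rewrite ltr_wpDl.
  have [n0 hn0] := cv _ _ K0 e0.
  have xN0 : 0 < `|x| - Na%:R by rewrite subr_gt0.
  have [n1 hn1] := half_powers_small xN0.
  have [n2 hn2] := half_powers_small (@ltr01 R).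
  exists (maxn n0 (maxn n1 n2)) => n; rewrite !geq_max => /and3P[h0 h1 h2] k hk.
  have p2 : 0 < 2 ^+ n :> R by rewrite exprn_gt0.
  have d1 := ler_distD (2 ^- n * k%:~R) x 0; have d2 := ler_distD x (2 ^- n * k%:~R) 0.
  rewrite !subr0 [`|x - _|]distrC in d1 d2.
  have := hn1 n h1; have := hn2 n h2 => l1 l2.
  have := hn0 n h0 k i l0; rewrite Az ?mxE ?mul0r ?sub0r ?cmodN; last lra.
  rewrite nu0 cderivn0; apply.
  rewrite -ler_pdivrMl //; move: d2; rewrite normrM ger0_norm ?invr_ge0 ?(ltW p2) //; lra.
exists eta; split=> // e e0.
have K0 : 0 < Na%:R + 1 :> R by rewrite ltr_wpDl.
have [n0 hn0] := cv _ _ K0 e0; exists n0 => n nn k i l.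
have [kK|kK] := leP `|k%:~R : R| (2 ^+ n * (Na%:R + 1)); first exact: hn0.
have p2 : 0 < 2 ^+ n :> R by rewrite exprn_gt0.
have kN : (Na%:R : R) < `|2 ^- n * k%:~R|.
  rewrite normrM ger0_norm ?invr_ge0 ?(ltW p2) // ltr_pdivlMl //.
  by apply: le_lt_trans kK; rewrite ler_pM2l // lerDl.
have num : (nu l <= m)%N by have := ltn_ord (nu l).
have [_ z] := csupp_cderivn (CE i) (sE i) num.
by rewrite Az // mxE z // mul0r subr0 cmod0 ltW.
Qed.

Section Limit.
Variables (a : int -> 'M[C]_r) (Na m : nat) (nu : 'I_r -> nat) (eta : 'I_r -> R -> C).
Hypotheses (ha : supp Na a) (num : forall l, (nu l <= m)%N).
Hypotheses (CE : forall i, C_ m (eta i)) (sE : forall i, csupp Na%:R (eta i)).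
Hypothesis cv : column_limit nu a eta.
Variable l0 : 'I_r.
Hypothesis nu0 : nu l0 = 0%N.

Let cE i : ccont (eta i). Proof. by case: (sE i). Qed.

(** [ApowS] multiplies by the mask on the right; this recursion extracts it on the left, the side on
    which it survives in the refinement equation of the limit. *)
Lemma Apow_left n k : Apow a n.+1 k = 2 *: \sum_(j \in [set: int])
  a j *m Apow a n (k - (2 ^ n)%N%:Z * j).
Proof.
rewrite /Apow iterSr (_ : subdiv a (dirac_mx R r) = fun k => 2 *: a k); last first.
  apply/funext => j; rewrite /subdiv (Zsum1 (k0 := 0)) => [|i /negbTE i0].
    by rewrite /dirac_mx eqxx mulr0 subr0 mul1mx.
  by rewrite /dirac_mx i0 mul0mx.
rewrite (iter_subdivE ha) (@Zsum_scale _ Na) => [|j jN]; last by rewrite ha ?mul0mx.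
by apply: eq_fsbigr => j _; rewrite scalemxAl.
Qed.

Lemma limit_refine x : Fvec eta x =
  2 *: \sum_(k \in [set: int]) a k *m Fvec eta (2 * x - k%:~R).
Proof.
have sA y : supp Na (fun k => a k *m Fvec eta (2 * y - k%:~R)).
  by move=> k kN; rewrite ha ?mul0mx.
apply/colP => i; rewrite (Zsum_seq (sA x)) !mxE summxE.
apply/eqP; rewrite -subr_eq0; apply/eqP.
pose S y := \sum_(k <- int_range Na) \sum_l a k i l * eta l (2 * y + - k%:~R).
have -> : \sum_(k <- int_range Na) (a k *m Fvec eta (2 * x - k%:~R)) i ord0 = S x.
  by apply: eq_bigr => k _; rewrite mxE; apply: eq_bigr => l _; rewrite mxE.
have cf : ccont (fun y => eta i y + -1 * (2 * S y)).
  apply: ccontD => //; apply: ccontM; first exact: ccont_cst.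
  apply: ccontM; first exact: ccont_cst.
  apply: ccont_sum => k _; apply: ccont_sum => l _; apply: ccontM; first exact: ccont_cst.
  exact: ccont_comp.
have : eta i x + -1 * (2 * S x) = 0; last by rewrite mulN1r.
apply: (dyadic_zero cf) => e e0.
pose W : R := \sum_(k <- int_range Na) \sum_l cmod (a k i l).
have W0 : 0 <= W by apply: sumr_ge0 => k _; apply: sumr_ge0 => l _; exact: cmod_ge0.
(* One unit of error for level n + 1, and 2 W for the mask applied to level n. *)
have e1 : 0 < e / (1 + 2 * W) by rewrite divr_gt0 // ltr_wpDr // mulr_ge0.
have [n0 hn0] := cv e1; exists n0.+1 => -[//|n] nn k _.
have A0 n' k' j : (n0 <= n')%N -> cmod (Apow a n' k' j l0 - eta j (2 ^- n' * k'%:~R)) <= e / (1 + 2 * W).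
  by move=> h; have := hn0 n' h k' j l0; rewrite nu0 mul0n expr0 mulr1 cderivn0.
have h1 := A0 _ k i (leqW nn).
have AE : Apow a n.+1 k i l0 = 2 * \sum_(j <- int_range Na) \sum_l a j i l * Apow a n (k - (2 ^ n)%N%:Z * j) l l0.
  rewrite Apow_left mxE (@Zsum_seq _ Na) => [|j jN]; last by rewrite ha ?mul0mx.
  by rewrite summxE; congr (_ * _); apply: eq_bigr => j _; rewrite mxE.
have -> : eta i (2 ^- n.+1 * k%:~R) + -1 * (2 * S (2 ^- n.+1 * k%:~R)) =
   - (Apow a n.+1 k i l0 - eta i (2 ^- n.+1 * k%:~R)) +
   2 * \sum_(j <- int_range Na) \sum_l a j i l *
     (Apow a n (k - (2 ^ n)%N%:Z * j) l l0 - eta l (2 ^- n * (k - (2 ^ n)%N%:Z * j)%:~R)).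
  have -> : \sum_(j <- int_range Na) \sum_l a j i l *
     (Apow a n (k - (2 ^ n)%N%:Z * j) l l0 - eta l (2 ^- n * (k - (2 ^ n)%N%:Z * j)%:~R)) =
     (\sum_(j <- int_range Na) \sum_l a j i l * Apow a n (k - (2 ^ n)%N%:Z * j) l l0) -
     S (2 ^- n.+1 * k%:~R).
    rewrite /S -sumrB; apply: eq_bigr => j _; rewrite -sumrB; apply: eq_bigr => l _.
    rewrite mulrBr; congr (_ - _ * eta l _).
    rewrite rmorphB rmorphM /= mulrBr -pmulrn natrX mulrA mulVf ?expf_neq0 // mul1r.
    by congr (_ - _); rewrite exprS invfM !mulrA mulfV // mul1r.
  rewrite AE; ring.
apply: (@le_trans _ _ (e / (1 + 2 * W) + 2 * (W * (e / (1 + 2 * W))))); last first.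
  by rewrite le_eqVlt; apply/orP; left; apply/eqP; field; apply/negP => /eqP; lra.
apply: le_trans (cmodD _ _) _; rewrite cmodN; apply: lerD h1 _.
rewrite cmodM (cmod_nat R 2) ler_wpM2l //.
apply: le_trans (cmod_sum _ _ _) _; rewrite /W mulr_suml; apply: ler_sum => j _.
apply: le_trans (cmod_sum _ _ _) _; rewrite mulr_suml; apply: ler_sum => l _.
by rewrite cmodM ler_wpM2l ?cmod_ge0 //; exact: A0.
Qed.

(* [A_n * u] converges to [eta] times [lam u]. *)
Definition lam (u : int -> 'cV[C]_r) : C := \sum_(l | nu l == 0%N) mom 0 u l ord0.

Lemma Apow_entry_limit (N : nat) (e : R) : 0 < e -> exists n0, forall n, (n0 <= n)%N ->
  forall i l k j, (`|j| <= N)%N ->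
    cmod (Apow a n (k - j) i l - (if nu l == 0%N then 1 else 0) * eta i (2 ^- n * k%:~R)) <= e.
Proof.
move=> e0; have e2 : 0 < e / 2 by rewrite divr_gt0.
suff [n0 hn0] : exists n0, forall i n, (n0 <= n)%N -> forall l k j, (`|j| <= N)%N ->
    cmod (Apow a n (k - j) i l - (if nu l == 0%N then 1 else 0) * eta i (2 ^- n * k%:~R)) <= e.
  by exists n0 => n nn i l k j; exact: hn0.
apply: ord_eventually => i.
suff [n0 hn0] : exists n0, forall l n, (n0 <= n)%N -> forall k j, (`|j| <= N)%N ->
    cmod (Apow a n (k - j) i l - (if nu l == 0%N then 1 else 0) * eta i (2 ^- n * k%:~R)) <= e.
  by exists n0 => n nn l k j; exact: hn0.
apply: ord_eventually => l; case: eqP => [nul|/eqP nul].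
  have [n1 hn1] := cv e2.
  have [d d0 hd] := csupp_uniform (sE i) e2.
  have dN : 0 < d / N.+1%:R by rewrite divr_gt0.
  have [n2 hn2] := half_powers_small dN.
  exists (maxn n1 n2) => n; rewrite geq_max => /andP[h1 h2] k j jN; rewrite mul1r.
  have := hn1 n h1 (k - j) i l; rewrite nul mul0n expr0 mulr1 cderivn0 => b1.
  have b2 : cmod (eta i (2 ^- n * (k - j)%:~R) - eta i (2 ^- n * k%:~R)) <= e / 2.
    apply: hd; rewrite -mulrBr -rmorphB /= addrAC subrr add0r normrM.
    have p2 : 0 < 2 ^- n :> R by rewrite invr_gt0 exprn_gt0.
    rewrite (ger0_norm (ltW p2)) rmorphN normrN /=.
    apply: (@le_lt_trans _ _ (2 ^- n * N.+1%:R)); last by rewrite -ltr_pdivlMr //; exact: hn2.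
    by rewrite ler_pM2l // -intr_norm -natr_absz ler_nat leqW.
  rewrite [e]splitr -[X in cmod (X - _)](subrK (eta i (2 ^- n * (k - j)%:~R))) -addrA.
  by apply: le_trans (cmodD _ _) _; exact: lerD.
have [B B0 hB] := csupp_bounded (csupp_cderivn (CE i) (sE i) (num l)).
have [n1 hn1] := cv (@ltr01 R).
have eB : 0 < e / (B + 1) by rewrite divr_gt0 // ltr_wpDl.
have [n2 hn2] := half_powers_small eB.
exists (maxn n1 n2) => n; rewrite geq_max => /andP[h1 h2] k j jN; rewrite mul0r subr0.
have b1 := hn1 n h1 (k - j) i l.
have b2 : cmod (Apow a n (k - j) i l * 2 ^+ (nu l * n)) <= B + 1.
  rewrite -[X in cmod X](subrK (cderivn (nu l) (eta i) (2 ^- n * (k - j)%:~R))) addrC [B + 1]addrC.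
  by rewrite addrC; apply: le_trans (cmodD _ _) _; exact: lerD.
have p2 : 0 < 2 ^+ n :> R by rewrite exprn_gt0.
have := hn2 n h2; rewrite ltr_pdivlMr ?ltr_wpDl // ltr_pdivrMl // => /ltW h3.
rewrite -(ler_pM2l p2); apply: le_trans h3; apply: le_trans b2.
rewrite cmodM cmodX (cmod_nat R 2) mulrC ler_wpM2l ?cmod_ge0 //.
by rewrite ler_weXn2l ?ler1n // leq_pmull // lt0n.
Qed.

Lemma seq_conv_limit (u : int -> 'cV[C]_r) N (e : R) : supp N u -> 0 < e ->
  exists n0, forall n, (n0 <= n)%N -> forall k i,
    cmod (seq_conv (Apow a n) u k i ord0 - eta i (2 ^- n * k%:~R) * lam u) <= e.
Proof.
move=> hu e0.
pose W : R := \sum_(j <- int_range N) \sum_l cmod (u j l ord0).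
have W0 : 0 <= W by apply: sumr_ge0 => k _; apply: sumr_ge0 => l _; exact: cmod_ge0.
have e1 : 0 < e / (W + 1) by rewrite divr_gt0 // ltr_wpDl.
have [n0 hn0] := Apow_entry_limit N e1; exists n0 => n nn k i.
have -> : eta i (2 ^- n * k%:~R) * lam u = \sum_(j <- int_range N) \sum_l
    (if nu l == 0%N then 1 else 0) * eta i (2 ^- n * k%:~R) * u j l ord0.
  rewrite /lam (mom_seq _ hu) exchange_big /= mulr_sumr big_mkcond /=; apply: eq_bigr => l _.
  rewrite summxE; case: ifP => _; last by rewrite big1 // => j _; rewrite !mul0r.
  by rewrite mulr_sumr; apply: eq_bigr => j _; rewrite mxE expr0 !mul1r.
rewrite /seq_conv (@Zsum_seq _ N) => [|j jN]; last by rewrite hu ?mulmx0.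
rewrite summxE -sumrB; apply: (@le_trans _ _ (W * (e / (W + 1)))); last first.
  by rewrite mulrA ler_pdivrMr ?ltr_wpDl // mulrC ler_pM2l //; lra.
apply: le_trans (cmod_sum _ _ _) _; rewrite /W mulr_suml.
rewrite big_seq [leRHS]big_seq; apply: ler_sum => j; rewrite mem_int_range => jN.
rewrite mxE -sumrB; apply: le_trans (cmod_sum _ _ _) _; rewrite mulr_suml; apply: ler_sum => l _.
rewrite -mulrBl cmodM mulrC ler_wpM2l ?cmod_ge0 //; exact: hn0.
Qed.

(** Convolution with A_(n+1) at 2 k + g is convolution of [trans a g u] with A_n at k. Both converge
    to the same value of [eta] times the respective [lam], and this value is nonzero at [x]. *)
Lemma lam_trans g (u : int -> 'cV[C]_r) N i x : supp N u -> (`|g| <= 1)%N ->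
  eta i x != 0 -> lam (trans a g u) = lam u.
Proof.
move=> hu g1 ex; apply/eqP; rewrite -subr_eq0; apply/eqP.
apply: (mulfI ex); rewrite mulr0.
have cf : ccont (fun y => eta i y * (lam (trans a g u) - lam u)).
  by apply: ccontM => //; exact: ccont_cst.
apply: (dyadic_zero cf) => e e0; have e3 : 0 < e / 3 by rewrite divr_gt0.
have [n1 hn1] := seq_conv_limit hu e3.
have [n2 hn2] := seq_conv_limit (trans_supp ha g1 hu) e3.
have eL : 0 < e / 3 / (cmod (lam u) + 1) by rewrite divr_gt0 // ltr_wpDl ?cmod_ge0.
have [d d0 hd] := csupp_uniform (sE i) eL.
have [n3 hn3] := half_powers_small d0.
exists (maxn n1 (maxn n2 n3)) => n; rewrite !geq_max => /and3P[h1 h2 h3] k _.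
have b1 := hn1 n.+1 (leqW h1) (2 * k + g) i; have b2 := hn2 n h2 k i.
rewrite (seq_conv_trans ha _ _ _ hu) in b1.
have b3 : cmod (eta i (2 ^- n.+1 * (2 * k + g)%:~R) - eta i (2 ^- n * k%:~R)) <= e / 3 / (cmod (lam u) + 1).
  apply: hd; have -> : 2 ^- n.+1 * (2 * k + g)%:~R - 2 ^- n * k%:~R = 2 ^- n.+1 * g%:~R :> R.
    rewrite rmorphD rmorphM /= mulrDr mulrA exprS invfM [_^-1 * _ * _]mulrAC mulVf // mul1r; ring.
  have p2 : 0 < 2 ^- n.+1 :> R by rewrite invr_gt0 exprn_gt0.
  rewrite normrM (ger0_norm (ltW p2)); apply: le_lt_trans (hn3 n.+1 (leqW h3)).
  rewrite -[leRHS]mulr1 ler_pM2l // -intr_norm -natr_absz.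
  by rewrite -[1]/(1%:R) ler_nat.
move: b1 b2 b3; set X := seq_conv _ _ _ _ _; set x1 := eta i _; set x2 := eta i _ => b1 b2 b3.
have -> : x2 * (lam (trans a g u) - lam u) = (X - x1 * lam u) - (X - x2 * lam (trans a g u)) +
   (x1 - x2) * lam u by ring.
apply: le_trans (cmodD _ _) _; have b4 := cmodB (X - x1 * lam u) (X - x2 * lam (trans a g u)).
have b5 : cmod ((x1 - x2) * lam u) <= e / 3.
  rewrite cmodM; have L0 := cmod_ge0 (lam u).
  apply: le_trans (ler_wpM2r L0 b3) _.
  rewrite mulrAC ler_pdivrMr ?ltr_wpDl // ler_pM2l // lerDl //.
lra.
Qed.

End Limit.
End LimitFunctions.

(** * Limits of complex sequences and moments of the limit functions *)

Section ComplexLimits.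
Variable R : realType.
Local Notation C := R[i].
Implicit Types (x y : nat -> C).

Definition clim x (L : C) := forall e : R, 0 < e ->
  exists n0, forall n, (n0 <= n)%N -> cmod (x n - L) <= e.

Lemma clim_uniq x L M : clim x L -> clim x M -> L = M.
Proof.
move=> hL hM; apply/eqP; rewrite -subr_eq0 -cmod_eq0 eq_le cmod_ge0 andbT.
apply/ler_addgt0Pr => e e0; rewrite add0r; have e2 : 0 < e / 2 by rewrite divr_gt0.
have [n1 h1] := hL _ e2; have [n2 h2] := hM _ e2.
have := h1 _ (leq_maxl n1 n2); have := h2 _ (leq_maxr n1 n2); set z := x _ => b1 b2.
have -> : L - M = (z - M) - (z - L) by ring.
by rewrite [e]splitr; apply: le_trans (cmodB _ _) _; exact: lerD.
Qed.

Lemma clim_cst (c : C) : clim (fun=> c) c.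
Proof. by move=> e e0; exists 0%N => n _; rewrite subrr cmod0 ltW. Qed.

Lemma climD x y L M : clim x L -> clim y M -> clim (fun n => x n + y n) (L + M).
Proof.
move=> hL hM e e0; have e2 : 0 < e / 2 by rewrite divr_gt0.
have [n1 h1] := hL _ e2; have [n2 h2] := hM _ e2; exists (maxn n1 n2) => n.
rewrite geq_max => /andP[/h1 b1 /h2 b2]; rewrite opprD addrACA [e]splitr.
by apply: le_trans (cmodD _ _) _; exact: lerD.
Qed.

Lemma climM x y L M : clim x L -> clim y M -> clim (fun n => x n * y n) (L * M).
Proof.
move=> hL hM e e0; have M0 := cmod_ge0 M; have L0 := cmod_ge0 L.
pose S := cmod L + cmod M + 1; have S0 : 0 < S by rewrite /S; lra.
pose d := Num.min 1 (e / S).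
have d0 : 0 < d by rewrite /d lt_min ltr01 divr_gt0.
have [n1 h1] := hL _ d0; have [n2 h2] := hM _ d0; exists (maxn n1 n2) => n.
rewrite geq_max => /andP[/h1 b1 /h2 b2].
have -> : x n * y n - L * M = (x n - L) * (y n - M) + ((x n - L) * M + L * (y n - M)) by ring.
have d1 : d <= 1 by rewrite /d ge_min lexx.
have dS : d * S <= e by rewrite -ler_pdivlMr // /d ge_min lexx orbT.
apply: le_trans (cmodD _ _) _; have := cmodD ((x n - L) * M) (L * (y n - M)).
rewrite !cmodM.
have t1 : cmod (x n - L) * cmod (y n - M) <= d * 1.
  by apply: ler_pM; rewrite ?cmod_ge0 // (le_trans b2).
have t2 : cmod (x n - L) * cmod M <= d * cmod M by exact: ler_wpM2r.
have t3 : cmod L * cmod (y n - M) <= cmod L * d by exact: ler_wpM2l.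
move: dS; rewrite /S; lra.
Qed.

Lemma climZ (c : C) x L : clim x L -> clim (fun n => c * x n) (c * L).
Proof. exact: climM (clim_cst c). Qed.

Lemma clim_sum (I : Type) (s : seq I) (x : I -> nat -> C) (L : I -> C) :
  (forall i, clim (x i) (L i)) -> clim (fun n => \sum_(i <- s) x i n) (\sum_(i <- s) L i).
Proof.
move=> h; elim: s => [|i s IH].
  rewrite big_nil (_ : (fun n => _) = fun=> 0); first exact: clim_cst.
  by apply/funext => n; rewrite big_nil.
rewrite big_cons (_ : (fun n => _) = fun n => x i n + \sum_(j <- s) x j n).
  exact: climD.
by apply/funext => n; rewrite big_cons.
Qed.

Lemma clim_half d : (0 < d)%N -> clim (fun n => (2 ^+ (d * n))^-1) 0.
Proof.
move=> d0 e e0; have [n0 hn0] := half_powers_small e0; exists n0 => n nn.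
rewrite subr0 cmodV cmodX (cmod_nat R 2); apply: le_trans (ltW (hn0 n nn)).
by rewrite lef_pV2 ?posrE ?exprn_gt0 // ler_weXn2l ?ler1n // leq_pmull.
Qed.

End ComplexLimits.

Section MomentIntegrals.
Variable R : realType.
Local Notation C := R[i].

Lemma cintegral_parts (K : R) (G G' : R -> C) p : csupp K G -> csupp K G' -> cder G G' ->
  cintegral (fun x => G' x * x%:C ^+ p) = - p%:R * cintegral (fun x => G x * x%:C ^+ p.-1).
Proof.
move=> sG sG' dG.
have cX q : ccont (fun x : R => x%:C ^+ q) by exact: cder_ccont (cderX q (@cder_id R)).
have s1 : csupp K (fun x => G' x * x%:C ^+ p) by exact: csuppMr.
have s2 : csupp K (fun x => G x * x%:C ^+ p.-1) by exact: csuppMr.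
have s3 := csuppD (csuppZ (p%:R) s2) s1.
have d3 : cder (fun x => G x * x%:C ^+ p)
    (fun x => p%:R * (G x * x%:C ^+ p.-1) + G' x * x%:C ^+ p).
  apply: cderE (cderM dG (cderX p (@cder_id R))) _ => x; ring.
have K1 := ler_norm K; have K2 := normr_ge0 K.
have c1 : - (`|K| + 1) < `|K| + 1 by lra.
have c2 : - (`|K| + 1) <= - K by lra.
have c3 : K <= `|K| + 1 by lra.
have := cintegralE s3 d3 c1 c2 c3; rewrite (cintegral_lin _ s2 s1).
case: sG => _ zG; rewrite !zG ?normrN ?(ger0_norm (_ : 0 <= `|K| + 1)); [|lra..].
by rewrite !mul0r subrr addrC => /eqP; rewrite addr_eq0 => /eqP ->; rewrite mulNr.
Qed.

End MomentIntegrals.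

Section LimitMoments.
Variables (R : realType) (r : nat).
Local Notation C := R[i].
Variables (a : int -> 'M[C]_r) (Na m : nat) (nu : 'I_r -> nat) (eta : 'I_r -> R -> C).
Hypotheses (ha : supp Na a) (num : forall l, (nu l <= m)%N).
Hypotheses (CE : forall i, C_ m (eta i)) (sE : forall i, csupp Na%:R (eta i)).
Hypothesis cv : column_limit nu a eta.

(** Up to a uniform error these are Riemann sums. Monomial weights give the moments of the limits,
    exponential weights their Fourier transforms. *)
Lemma weighted_limit (wt : R -> C) i l : ccont wt ->
  clim (fun n => (2 ^+ n)^-1 * \sum_(k \in [set: int])
          wt (2 ^- n * k%:~R) * (Apow a n k i l * 2 ^+ (nu l * n)))
       (cintegral (fun x => cderivn (nu l) (eta i) x * wt x)).
Proof.
move=> cw e e0; have [B B0 hB] := ccont_bounded (- Na%:R) Na%:R cw.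
set g := cderivn (nu l) (eta i).
have sg : csupp Na%:R g by exact: csupp_cderivn (CE i) (sE i) (num l).
have sh : csupp Na%:R (fun x => g x * wt x) by exact: csuppMr.
have e2 : 0 < e / 2 by rewrite divr_gt0.
pose D : R := (2 * Na).+1%:R * B + 1.
have D0 : 0 < D by rewrite /D ltr_wpDl // mulr_ge0.
have e1 : 0 < e / 2 / D by rewrite divr_gt0.
have [n1 hn1] := riemann_sum sh e2; have [n2 hn2] := cv e1.
exists (maxn n1 n2) => n; rewrite geq_max => /andP[h1 h2].
have p2 : 0 < 2 ^+ n :> R by rewrite exprn_gt0.
have sA : supp (Na * 2 ^ n) (fun k : int => wt (2 ^- n * k%:~R) * (Apow a n k i l * 2 ^+ (nu l * n))).
  by move=> k kN; rewrite (Apow_supp ha) // mxE mul0r mulr0.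
have sB : supp (Na * 2 ^ n) (fun k : int => g (2 ^- n * k%:~R) * wt (2 ^- n * k%:~R)).
  exact: (dyadic_supp (n := n) (proj2 sh)).
have sAB : supp (Na * 2 ^ n) (fun k : int => wt (2 ^- n * k%:~R) * (Apow a n k i l * 2 ^+ (nu l * n)) -
    g (2 ^- n * k%:~R) * wt (2 ^- n * k%:~R)).
  by move=> k kN; rewrite sA ?sB ?subr0.
have c2 : (2 ^+ n)^-1 = (2 ^- n)%:C :> C by rewrite fmorphV rmorphXn rmorph_nat.
have b1 := hn1 n h1; rewrite c2 in b1 *; move: b1.
set Y := (2 ^- n)%:C * _; set X := (2 ^- n)%:C * _; set I := cintegral _ => b1.
have -> : X - I = (X - Y) + (Y - I) by ring.
apply: le_trans (cmodD _ _) _; rewrite [e]splitr; apply: lerD b1.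
rewrite /X /Y -mulrBr -(ZsumB sA sB) cmodM cmodR ger0_norm ?invr_ge0 ?(ltW p2) //.
rewrite ler_pdivrMl //; apply: le_trans (cmod_Zsum (e := B * (e / 2 / D)) sAB _) _ => [k|].
  have [kN|kN] := ltnP (Na * 2 ^ n) `|k|.
    by rewrite sAB // cmod0 mulr_ge0 // ltW.
  rewrite [g _ * _]mulrC -mulrBr cmodM; apply: ler_pM; rewrite ?cmod_ge0 //; last exact: hn2.
  apply: hB; rewrite -ler_norml normrM ger0_norm ?invr_ge0 ?(ltW p2) // ler_pdivrMl //.
  by rewrite -intr_norm -natr_absz mulrC -natrX -natrM ler_nat.
have N2 : (2 * (Na * 2 ^ n)).+1%:R <= 2 ^+ n * (2 * Na).+1%:R :> R.
  by rewrite -natrX -natrM ler_nat mulnS [(2 ^ n * (2 * Na))%N]mulnCA [(2 ^ n * Na)%N]mulnC -add1n leq_add2r expn_gt0.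
have eD : 0 <= B * (e / 2 / D) by rewrite mulr_ge0 // ltW.
apply: le_trans (ler_wpM2r eD N2) _; rewrite -[leLHS]mulrA ler_pM2l //.
have -> : (2 * Na).+1%:R * (B * (e / 2 / D)) = e / 2 * ((2 * Na).+1%:R * B / D) by ring.
by rewrite ler_piMr ?(ltW e2) // ler_pdivrMr // mul1r /D lerDl.
Qed.

(** Integration by parts moves the derivatives onto x^p, without boundary terms. *)
Lemma cintegral_monomial i n p : (n <= m)%N -> (p <= n)%N ->
  cintegral (fun x => cderivn n (eta i) x * x%:C ^+ p) =
  if p == n then (-1) ^+ n * n`!%:R * cintegral (eta i) else 0.
Proof.
elim: n p => [|n IH] p nm pn.
  move: pn; rewrite leqn0 => /eqP ->; rewrite eqxx cderivn0 expr0 mul1r mul1r.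
  by congr cintegral; apply/funext => x; rewrite expr0 mulr1.
have sn k (km : (k <= m)%N) := csupp_cderivn (CE i) (sE i) km.
rewrite (cintegral_parts p (sn n (ltnW nm)) (sn n.+1 nm) (C_cder (CE i) nm)).
case: p pn => [|p] pn /=; first by rewrite oppr0 mul0r.
rewrite IH ?(ltnW nm) // eqSS; case: eqP => [->|_]; last by rewrite mulr0.
rewrite factS natrM exprS; ring.
Qed.

(** The product of the symbol of [v] and the Fourier transform of [eta], both at 0. *)
Definition kap (v : int -> 'rV[C]_r) : C := \sum_i symbol v 0 ord0 i * cintegral (eta i).

(* The [q]-th moment of [v] subdivided [n] times is [2 ^ n] times that of [v], and
   at the same time a combination of Riemann sums for the moments of [eta]. *)
Lemma matching_moments v k Nv q l : supp Nv v -> matching_filter a k v -> (q < k)%N ->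
  (q <= nu l)%N -> mom q v ord0 l = if q == nu l then (-1) ^+ q * q`!%:R * kap v else 0.
Proof.
move=> hv hm qk qn.
pose W n p j := (2 ^+ n)^-1 * \sum_(k \in [set: int])
  (2 ^- n * k%:~R)%:C ^+ p * (Apow a n k j l * 2 ^+ (nu l * n)).
have Wlim p j : clim (fun n => W n p j) (cintegral (fun x => cderivn (nu l) (eta j) x * x%:C ^+ p)).
  exact: weighted_limit (cder_ccont (cderX p (@cder_id R))).
pose S n := \sum_(i < q.+1) 'C(q, i)%:R * \sum_j mom i v ord0 j * W n (q - i)%N j.
(* The exponent collects 2^n from matching, 2^(-n) from the Riemann weight, 2^(-qn) from rescaling a
   monomial of degree q, and 2^(nu n) from the column. *)
have SE n : 2 ^+ ((nu l - q) * n) * mom q v ord0 l = S n.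
  have p2 : (2 ^+ n : C) != 0 by rewrite expf_neq0.
  have := mom_gconv_matching ha hv n (@dirac_col_supp R r l) hm qk.
  have sAl : supp (Na * 2 ^ n) (fun k => col l (Apow a n k)).
    by move=> j jN; rewrite (Apow_supp ha) //; apply/colP => i; rewrite !mxE.
  rewrite seq_conv_dirac_col (mom_gconv q _ hv sAl) => /matrixP/(_ ord0 ord0).
  rewrite [RHS]mxE -/(vmom v q _) (vmom_dirac_col _ _ hv) summxE => E.
  have -> : 2 ^+ ((nu l - q) * n) * mom q v ord0 l =
      2 ^+ (nu l * n) * (2 ^+ n)^-1 ^+ q.+1 * (2 ^+ n * mom q v ord0 l).
    rewrite mulrA exprSr -!mulrA mulKf // mulrA; congr (_ * _).
    by rewrite -{2}(subnK qn) mulnDl exprD exprVn -exprM -mulrA [(n * q)%N]mulnC mulfV ?mulr1 ?expf_neq0.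
  rewrite -E mulr_sumr; apply: eq_bigr => i _.
  have iq : (i <= q)%N by rewrite -ltnS.
  rewrite (@Zsum_mxE _ (Na * 2 ^ n)) => [|j jN]; last by rewrite sAl ?mulmx0 ?scaler0.
  transitivity (2 ^+ (nu l * n) * (2 ^+ n)^-1 ^+ q.+1 * ('C(q, i)%:R * (2 ^+ n) ^+ i *
      \sum_j mom i v ord0 j * \sum_(k \in [set: int]) k%:~R ^+ (q - i) * Apow a n k j l)).
    congr (_ * _).
    rewrite (@Zsum_seq _ (Na * 2 ^ n)) => [|j jN]; last by rewrite sAl // mulmx0 scaler0 mxE.
    have sj j : supp (Na * 2 ^ n) (fun k : int => k%:~R ^+ (q - i) * Apow a n k j l).
      by move=> k' kN; rewrite (Apow_supp ha) // mxE mulr0.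
    under [X in _ = _ * X]eq_bigr => j _ do rewrite (Zsum_seq (sj j)) mulr_sumr.
    rewrite exchange_big /= mulr_sumr; apply: eq_bigr => k' _.
    rewrite !mxE -pmulrn natrX !mulr_sumr; apply: eq_bigr => j _; rewrite mxE; ring.
  rewrite [LHS]mulrCA -!mulrA; congr (_ * _).
  rewrite !mulr_sumr; apply: eq_bigr => j _; rewrite /W.
  have sj : supp (Na * 2 ^ n) (fun k : int => k%:~R ^+ (q - i) * Apow a n k j l).
    by move=> k' kN; rewrite (Apow_supp ha) // mxE mulr0.
  have -> : \sum_(k \in [set: int]) (2 ^- n * k%:~R)%:C ^+ (q - i) * (Apow a n k j l * 2 ^+ (nu l * n)) =
      (2 ^+ n)^-1 ^+ (q - i) * 2 ^+ (nu l * n) * \sum_(k \in [set: int]) k%:~R ^+ (q - i) * Apow a n k j l.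
    rewrite (@Zsum_seq _ (Na * 2 ^ n)) => [|k' kN]; last by rewrite (Apow_supp ha) // mxE mul0r mulr0.
    rewrite (Zsum_seq sj) mulr_sumr; apply: eq_bigr => k' _.
    rewrite rmorphM /= fmorphV rmorphXn rmorph_nat rmorph_int exprMn; ring.
  have e1 : (2 ^+ n)^-1 ^+ q * (2 ^+ n) ^+ i = (2 ^+ n)^-1 ^+ (q - i) :> C.
    by rewrite -{1}(subnK iq) exprD -mulrA -exprMn mulVf // expr1n mulr1.
  rewrite exprS -e1; ring.
have Slim : clim S (\sum_(i < q.+1) 'C(q, i)%:R * \sum_j mom i v ord0 j *
    cintegral (fun x => cderivn (nu l) (eta j) x * x%:C ^+ (q - i))).
  by apply: clim_sum => i; apply: climZ; apply: clim_sum => j; apply: climZ; exact: Wlim.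
(* For i > 0 the monomial has degree q - i below [nu l] and is annihilated by the derivative, so
   only the moment of order 0 of [v] survives. *)
have LE : \sum_(i < q.+1) 'C(q, i)%:R * \sum_j mom i v ord0 j *
    cintegral (fun x => cderivn (nu l) (eta j) x * x%:C ^+ (q - i)) =
    if q == nu l then (-1) ^+ q * q`!%:R * kap v else 0.
  rewrite big_ord_recl /= bin0 mul1r subn0 [X in _ + X]big1 ?addr0 => [|i _]; last first.
    rewrite big1 ?mulr0 // => j _; rewrite cintegral_monomial //; last by lia.
    case: eqP => [h|_]; last by rewrite mulr0.
    by exfalso; move: (ltn_ord i) qn h; rewrite /fintype.bump leq0n; lia.
  case: eqP => qE; last first.
    by rewrite big1 // => j _; rewrite cintegral_monomial //; case: eqP => // _; rewrite mulr0.
  rewrite /kap mulr_sumr; apply: eq_bigr => j _.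
  by rewrite cintegral_monomial // qE eqxx -(mom0_symbol v); ring.
rewrite LE in Slim.
have SE' : S = fun n => 2 ^+ ((nu l - q) * n) * mom q v ord0 l.
  by apply/funext => n; rewrite SE.
move: Slim; rewrite SE'; case: eqP => qE Slim.
  apply: (clim_uniq (clim_cst _)); move: Slim.
  by rewrite -qE subnn; under eq_fun do rewrite mul0n expr0 mul1r.
apply: (clim_uniq (clim_cst _)).
(* Below the diagonal the moment times a growing power of 2 converges, so the moment itself
   vanishes. *)
have qn' : (0 < nu l - q)%N by rewrite subn_gt0 ltn_neqAle qn andbT; apply/eqP.
rewrite -[0](mul0r 0); have := climM (clim_half qn') Slim.
by under eq_fun do rewrite mulKf ?expf_neq0 //.
Qed.
End LimitMoments.

(** * Identification of the limit with the refinable distribution *)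

Section LimitIdentification.
Variables (R : realType) (r : nat).
Local Notation C := R[i].

Lemma fourier_continuous0 (T : (R -> C) -> C) (xi : R) : cs_distribution T ->
  clim (fun n => fourier T (2 ^- n * xi)) (fourier T 0).
Proof.
move=> hT; have [N [K [c [K0 c0 hb]]]] := dist_bound hT.
have key (t : R) : `|t| <= 1 -> cmod (fourier T t - fourier T 0) <= c * ((2 * K + 1) * `|t|).
  move=> t1.
  have -> : fourier T t - fourier T 0 = T (cis_rem t 1).
    have -> : cis_rem t 1 = fun x => -1 * cis (- (x * 0)) + cis (- (x * t)).
      apply/funext => x; rewrite /cis_rem big_ord1 !expr0 fact0 divr1 mulr1.
      by rewrite mulr0 oppr0 cis0 mulN1r addrC.
    by rewrite (dist_lin _ hT) ?mulN1r 1?addrC //; exact: cisN_smooth.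
  apply: hb; first exact: cis_rem_smooth.
  move=> j x jN xK; rewrite cderivn_cis_rem cmodM cmodX cmodN cmodM cmodi mul1r cmodR.
  have t0 := normr_ge0 t; have tt : 0 <= 2 * K * `|t| by rewrite !mulr_ge0 // ltW.
  case: j jN => [|j] jN.
    have := @cis_rem_le _ t K x 1 xK; rewrite expr0 mul1r subn0 expr1; lra.
  rewrite subSS sub0n /cis_rem big_ord0 subr0 cmod_cis mulr1 exprS.
  have : `|t| * `|t| ^+ j <= `|t| * 1 by rewrite ler_wpM2l // exprn_ile1.
  lra.
move=> e e0; pose D := c * (2 * K + 1) * (`|xi| + 1).
have D0 : 0 < D by rewrite /D !mulr_gt0 ?ltr_wpDl //; have := ltW K0; lra.
have eD : 0 < Num.min (e / D) (`|xi| + 1)^-1 by rewrite lt_min divr_gt0 // invr_gt0 ltr_wpDl.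
have [n0 hn0] := half_powers_small eD; exists n0 => n nn.
have := hn0 n nn; rewrite lt_min => /andP[h1 h2].
have p2 : 0 < 2 ^- n :> R by rewrite invr_gt0 exprn_gt0.
have x1 : `|2 ^- n * xi| <= 2 ^- n * (`|xi| + 1).
  by rewrite normrM (ger0_norm (ltW p2)) ler_pM2l // lerDl.
have x2 : 2 ^- n * (`|xi| + 1) <= 1.
  by rewrite -ler_pdivlMr ?ltr_wpDl // mul1r ltW.
apply: le_trans (key _ (le_trans x1 x2)) _.
rewrite ltr_pdivlMr // in h1; apply: le_trans (ltW h1); rewrite /D.
have -> : 2 ^- n * (c * (2 * K + 1) * (`|xi| + 1)) = c * ((2 * K + 1) * (2 ^- n * (`|xi| + 1))) by ring.
by apply: ler_wpM2l (ltW c0) _ _ _; apply: ler_wpM2l => //; have := ltW K0; lra.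
Qed.

Variables (a : int -> 'M[C]_r) (Na m : nat) (nu : 'I_r -> nat) (eta : 'I_r -> R -> C).
Hypotheses (ha : supp Na a) (num : forall l, (nu l <= m)%N).
Hypotheses (CE : forall i, C_ m (eta i)) (sE : forall i, csupp Na%:R (eta i)).
Hypothesis cv : column_limit nu a eta.
Variables (va : int -> 'rV[C]_r) (Nva M : nat).
Hypotheses (hva : supp Nva va) (hm : matching_filter a M.+1 va).
Hypothesis (nuM : forall l, (nu l <= M)%N).
Variable l1 : 'I_r.
Hypothesis va_l1 : symbol va 0 ord0 l1 = 1.

(** The moment of order 0 in entry [l1] is [kap] or 0 according to whether [nu l1] is 0, and it
    equals 1. *)
Lemma kap_filter : kap eta va = 1.
Proof.
have := matching_moments ha num CE sE cv (l := l1) hva hm (ltn0Sn M) (leq0n _).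
rewrite (mom0_symbol va) va_l1; case: eqP => [_|_ /eqP]; last by rewrite oner_eq0.
by rewrite expr0 fact0 !mul1r.
Qed.

Lemma limit_filter_moments l q : (q <= nu l)%N ->
  mom q va ord0 l = if q == nu l then (-1) ^+ nu l * (nu l)`!%:R else 0.
Proof.
move=> qn; rewrite (matching_moments ha num CE sE cv hva hm) ?kap_filter //.
  by case: eqP => [->|//]; rewrite mulr1.
by rewrite ltnS (leq_trans qn).
Qed.

Lemma limit_filter0 l : symbol va 0 ord0 l = if nu l == 0%N then 1 else 0.
Proof.
rewrite -(mom0_symbol va) limit_filter_moments // eq_sym; case: eqP => // ->.
by rewrite expr0 fact0 mul1r.
Qed.

Variable phi : 'I_r -> (R -> C) -> C.
Hypothesis phi_dist : forall l, cs_distribution (phi l).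
Hypothesis phi_ref : forall xi : R,
  fourier_vec phi (2 * xi) = symbol a xi *m fourier_vec phi xi.
Hypothesis phi_normalized : symbol va 0 *m fourier_vec phi 0 = 1%:M.

Lemma symbol_dirac xi : symbol (dirac_mx R r) xi = 1%:M.
Proof.
rewrite /symbol (Zsum1 (k0 := 0)) => [|k /negbTE k0].
  by rewrite mul0r oppr0 cis0 scale1r.
by rewrite /dirac_mx k0 scaler0.
Qed.

Lemma fourier_power n xi : 2 ^+ n *: fourier_vec phi (2 ^+ n * xi) =
  symbol (Apow a n) xi *m fourier_vec phi xi.
Proof.
elim: n xi => [|n IH] xi.
  by rewrite expr0 expr0 mul1r scale1r symbol_dirac mul1mx.
rewrite (symbol_subdiv xi ha (Apow_supp ha (n := n))) -scalemxAl -mulmxA -phi_ref -IH.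
by rewrite scalerA -exprS mulrA -exprSr.
Qed.

(** After n refinements the transform at [xi] is 2^(-n) times the symbol of A_n at 2^(-n) xi,
    applied to the transform at 2^(-n) xi. In the limit only columns of order 0 contribute, each
    giving the transform of [eta]; their weights sum to 1 by [phi_normalized]. *)
Lemma fourier_limit i xi :
  fourier (phi i) xi = cintegral (fun x => eta i x * cis (- (x * xi))).
Proof.
pose W n l := (2 ^+ n)^-1 * \sum_(k \in [set: int])
  cis (- (2 ^- n * k%:~R * xi)) * (Apow a n k i l * 2 ^+ (nu l * n)).
have Wlim l : clim (fun n => W n l)
    (cintegral (fun x => cderivn (nu l) (eta i) x * cis (- (x * xi)))).
  exact: (weighted_limit (wt := fun x => cis (- (x * xi))) ha num CE sE cv i l (ccont_cisN xi)).
have E n : fourier (phi i) xi = \sum_l (2 ^+ (nu l * n))^-1 * W n l * fourier (phi l) (2 ^- n * xi).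
  have p2 : (2 ^+ n : C) != 0 by rewrite expf_neq0.
  have := fourier_power n (2 ^- n * xi).
  rewrite mulrA mulfV ?expf_neq0 // mul1r => /colP/(_ i); rewrite !mxE => H.
  apply: (mulfI p2); rewrite H mulr_sumr; apply: eq_bigr => l _.
  rewrite mxE mulrA; congr (_ * _).
  have sA : supp (Na * 2 ^ n) (fun k => cis (- (k%:~R * (2 ^- n * xi))) *: Apow a n k).
    by move=> k kN; rewrite (Apow_supp ha) // scaler0.
  rewrite /symbol (Zsum_mxE _ _ sA) (@Zsum_seq _ (Na * 2 ^ n)) => [|k kN]; last first.
    by rewrite sA // mxE.
  rewrite /W (@Zsum_seq _ (Na * 2 ^ n)) => [|k kN]; last first.
    by rewrite (Apow_supp ha) // mxE mul0r mulr0.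
  rewrite !mulr_sumr; apply: eq_bigr => k _; rewrite mxE.
  have -> : k%:~R * (2 ^- n * xi) = 2 ^- n * k%:~R * xi :> R by rewrite mulrA [k%:~R * _]mulrC.
  by field; rewrite !expf_neq0.
have coef l : clim (fun n => (2 ^+ (nu l * n))^-1 * W n l)
    ((if nu l == 0%N then 1 else 0) * cintegral (fun x => eta i x * cis (- (x * xi)))).
  case: eqP => [nul|/eqP nul].
    rewrite mul1r; have := Wlim l; rewrite nul cderivn0.
    by under [in X in _ -> X]eq_fun do rewrite mul0n expr0 invr1 mul1r.
  rewrite mul0r -[0](mul0r (cintegral (fun x => cderivn (nu l) (eta i) x * cis (- (x * xi))))).
  by apply: climM (Wlim l); apply: clim_half; rewrite lt0n.
have lim := clim_sum (index_enum 'I_r) (fun l => climM (coef l) (fourier_continuous0 xi (phi_dist l))).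
rewrite /= in lim.
have E' : (fun n => \sum_l (2 ^+ (nu l * n))^-1 * W n l * fourier (phi l) (2 ^- n * xi)) =
   fun=> fourier (phi i) xi by apply/funext => n; rewrite -E.
rewrite E' in lim; rewrite (clim_uniq (clim_cst _) lim).
move/matrixP/(_ ord0 ord0): phi_normalized; rewrite !mxE eqxx mulr1n => H.
have RE (I : C) : I = \sum_j symbol va 0 ord0 j * fourier_vec phi 0 j ord0 * I.
  by rewrite -mulr_suml H mul1r.
rewrite [RHS]RE; apply: eq_bigr => l _.
by rewrite limit_filter0 mxE mulrAC.
Qed.

Lemma limit_represents i : represents (eta i) (phi i).
Proof.
move=> g sg _.
have hI : cs_distribution (fun g => cintegral (fun x => eta i x * g x)).
  exact: cintegral_dist (ler0n _ _) (sE i).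
pose T g := -1 * cintegral (fun x => eta i x * g x) + phi i g.
have hT : cs_distribution T.
  split=> [c f h sf sh|].
    by rewrite /T (dist_lin c hI sf sh) (dist_lin c (phi_dist i) sf sh); ring.
  have [N1 [K1 [c1 [K10 c10 h1]]]] := dist_bound hI.
  have [N2 [K2 [c2 [K20 c20 h2]]]] := dist_bound (phi_dist i).
  exists (maxn N1 N2), (Num.max K1 K2), (c1 + c2) => f M' sf hf.
  rewrite /T mulN1r addrC mulrDl; apply: le_trans (cmodB _ _) _; rewrite addrC; apply: lerD.
    apply: h1 => // j x jN xK; apply: hf; first by rewrite leq_max jN.
    by rewrite le_max xK.
  apply: h2 => // j x jN xK; apply: hf; first by rewrite leq_max jN orbT.
  by rewrite le_max xK orbT.
have T0 xi : fourier T xi = 0.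
  rewrite /fourier /T mulN1r; have := fourier_limit i xi; rewrite /fourier => ->.
  by rewrite addNr.
have := dist_inj hT T0 sg; rewrite /T mulN1r addrC => /eqP.
by rewrite subr_eq0 => /eqP.
Qed.

End LimitIdentification.

(** * Necessity: smoothness of the mask *)

Section Windows.
Variables (R : realType) (r : nat).
Local Notation C := R[i].
Implicit Types (u : int -> 'cV[C]_r) (v : int -> 'rV[C]_r).

Definition wdim (N : nat) := #|{: 'I_(2 * N).+1 * 'I_r}|.

(** Coordinates on the sequences supported in [-N, N], for [contraction], which works on a subspace
    of the space of all sequences. *)
Definition wco (N : nat) u : 'rV[C]_(wdim N) :=
  \row_(d < wdim N) u ((enum_val d).1%:Z - N%:Z) (enum_val d).2 ord0.

Lemma wco_lin N c u w : wco N (c *: u + w) = c *: wco N u + wco N w.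
Proof. by apply/rowP => d; rewrite !mxE. Qed.

Lemma wco_entry N (k : int) l : (`|k| <= N)%N ->
  exists d, forall u, wco N u ord0 d = u k l ord0.
Proof.
move=> kN; have h : (`|(k + N%:Z)%R|%N < (2 * N).+1)%N by lia.
exists (enum_rank (Ordinal h, l)) => u; rewrite mxE enum_rankK /=; congr (u _ l ord0).
lia.
Qed.

Lemma wco_index N d : exists (k : int) l, (`|k| <= N)%N /\ forall u, wco N u ord0 d = u k l ord0.
Proof.
exists ((enum_val d).1%:Z - N%:Z), (enum_val d).2; split; last by move=> u; rewrite mxE.
by case: (enum_val d) => -[i /= hi] _ /=; lia.
Qed.

Lemma wco_inj N u : supp N u -> wco N u = 0 -> u = 0.
Proof.
move=> hu h; apply/funext => k; apply/colP => l; have [kN|kN] := ltnP N `|k|.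
  by rewrite hu.
by have [d hd] := wco_entry l kN; rewrite -hd h !mxE.
Qed.

Lemma wco_le N b u : (forall k l, cmod (u k l ord0) <= b) -> entries_le (wco N) b u.
Proof. by move=> h d; have [k [l [_ ->]]] := wco_index d. Qed.

Lemma wco_le_entry N b u k l : supp N u -> 0 <= b -> entries_le (wco N) b u ->
  cmod (u k l ord0) <= b.
Proof.
move=> hu b0 h; have [kN|kN] := ltnP N `|k|; first by rewrite hu // mxE cmod0.
by have [d hd] := wco_entry l kN; rewrite -hd.
Qed.

Variables (a : int -> 'M[C]_r) (Na : nat).
Hypothesis ha : supp Na a.

Definition btrans (b : bool) u := trans a b%:Z u.

Lemma trans_lin g c u w : trans a g (c *: u + w) = c *: trans a g u + trans a g w.
Proof.
apply/funext => j; rewrite /trans.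
have s1 (z : int -> 'cV[C]_r) : supp (2 * `|j| + `|g| + Na) (fun t => a (2 * j + g - t) *m z t).
  by move=> t tN; rewrite ha ?mul0mx //; lia.
rewrite (Zsum_seq (s1 _)) -[(_ + _) j]/(c *: (2 *: _) + 2 *: _).
rewrite (Zsum_seq (s1 _)) (Zsum_seq (s1 _)) scalerA [c * 2]mulrC -scalerA -scalerDr; congr (_ *: _).
rewrite scaler_sumr -big_split /=; apply: eq_bigr => t _.
by rewrite -[(c *: u + w) t]/(c *: u t + w t) mulmxDr scalemxAr.
Qed.

Lemma btrans_supp b u : supp Na.+1 u -> supp Na.+1 (btrans b u).
Proof.
move=> hu; have b1 : (`|b%:Z| <= 1)%N by case: b.
by apply: supp_le (trans_supp ha b1 hu); lia.
Qed.

Lemma seq_conv_dirac u N : supp N u -> seq_conv (Apow a 0) u = u.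
Proof.
move=> hu; apply/funext => k; rewrite /seq_conv (Zsum1 (k0 := k)).
  by rewrite subrr /Apow /= /dirac_mx eqxx mul1mx.
move=> j jk; rewrite /Apow /= /dirac_mx subr_eq0 eq_sym (negbTE jk) mul0mx //.
Qed.

Lemma btrans_supp_ex b u N : supp N u -> exists N', supp N' (btrans b u).
Proof.
move=> hu; have b1 : (`|b%:Z| <= 1)%N by case: b.
by have h := trans_supp ha b1 hu; eexists; exact: h.
Qed.

Lemma words_Apow w u N i : supp N u ->
  exists k, words btrans w u i = seq_conv (Apow a (size w)) u k.
Proof.
elim: w u N => [|g w IH] u N hu; first by exists i; rewrite (seq_conv_dirac hu).
have [N' hN'] := btrans_supp_ex g hu; have [k hk] := IH _ _ hN'.
by exists (2 * k + g%:Z); rewrite (seq_conv_trans ha _ _ _ hu).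
Qed.

(** The letters are the last [n] binary digits of [k], least significant first. With [words_Apow]
    this makes the values of A_n * u the same as the values of all words of length [n]. *)
Lemma Apow_words n u N k : supp N u ->
  exists w i, size w = n /\ seq_conv (Apow a n) u k = words btrans w u i.
Proof.
elim: n u N k => [|n IH] u N k hu.
  by exists [::], k; rewrite (seq_conv_dirac hu).
have [b [j ->]] : exists (b : bool) (j : int), k = 2 * j + b%:Z.
  by exists ((k %% 2)%Z == 1), (k %/ 2)%Z; lia.
have [N' hN'] := btrans_supp_ex b hu; have [w [i [sw wE]]] := IH _ _ j hN'.
by exists (b :: w), i; rewrite (seq_conv_trans ha _ _ _ hu) wE /= sw.
Qed.

Lemma vmom0E v Nv u N : supp Nv v -> supp N u ->
  vmom v 0 u = \sum_l symbol v 0 ord0 l * mom 0 u l ord0.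
Proof.
move=> hv hu; rewrite /vmom seq_conv_gconv (mom_gconv 0 1 hv hu) big_ord1.
have -> : \sum_(k \in [set: int]) ('C(0, 0)%:R * 1%:~R ^+ 0 * k%:~R ^+ (0 - 0)) *: (mom 0 v *m u k) =
    mom 0 v *m mom 0 u.
  rewrite (@Zsum_seq _ N) => [|k kN]; last by rewrite hu ?mulmx0 ?scaler0.
  rewrite (mom_seq 0 hu) mulmx_sumr; apply: eq_bigr => k _.
  by rewrite bin0 !expr0 !mulr1 !scale1r.
by rewrite mxE; apply: eq_bigr => l _; rewrite (mom0_symbol v).
Qed.

Definition alt s t (w : int -> 'M[C]_(s, t)) : int -> 'M[C]_(s, t) :=
  fun k => (-1) ^+ `|k|%N *: w k.

Lemma alt_supp s t (w : int -> 'M[C]_(s, t)) N : supp N w -> supp N (alt w).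
Proof. by move=> hw k kN; rewrite /alt hw ?scaler0. Qed.

Lemma signz_add (j k : int) : (-1) ^+ absz (j + k)%R = (-1) ^+ `|j|%N * (-1) ^+ `|k|%N :> C.
Proof.
rewrite -exprD -signr_odd -[RHS]signr_odd; congr (_ ^+ nat_of_bool _).
rewrite oddD; lia.
Qed.

Lemma alt_seq_conv s t (w : int -> 'M[C]_(s, r)) (u : int -> 'M[C]_(r, t)) N :
  supp N u -> alt (seq_conv w u) = seq_conv (alt w) (alt u).
Proof.
move=> hu; apply/funext => k; rewrite /alt /seq_conv (@Zsum_scale _ N) => [|j jN]; last first.
  by rewrite hu ?mulmx0.
apply: eq_fsbigr => j _; rewrite -scalemxAl -scalemxAr scalerA -signz_add.
by rewrite subrK.
Qed.

Section SumRules.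
Variables (v : int -> 'rV[C]_r) (Nv k : nat).
Hypotheses (hv : supp Nv v) (hsr : sum_rules a k v).

Lemma alt_subdiv_mom q : (q < k)%N -> mom q (alt (subdiv a v)) = 0.
Proof.
move=> qk; have [_ h] := (sum_rulesP ha k hv).1 hsr.
apply/rowP => l; rewrite (mom_entry _ _ _ (alt_supp (subdiv_supp ha hv))) [RHS]mxE -[RHS](h q l qk).
by apply: eq_fsbigr => t _; rewrite /alt mxE mulrCA.
Qed.

Lemma seq_conv_subdiv_even u N j : supp N u ->
  seq_conv (subdiv a v) u (2 * j) = seq_conv v (btrans false u) j.
Proof.
move=> hu; have := seq_conv_iter_subdiv 1 ha hv hu; rewrite /= => ->.
rewrite (seq_conv_gconv v) /gconv; apply: eq_fsbigr => i _; congr (_ *m _).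
rewrite expn1 -mulrBr mul1r -[2 * _]addr0 (seq_conv_trans ha 0 0 (j - i) hu).
by have [N' hN'] := btrans_supp_ex false hu; rewrite (seq_conv_dirac hN').
Qed.

(** Let w be the convolution of [subdiv a v] with [u]. Matching gives its moment as twice that of v
    * u, the sum rules make the alternating moment vanish, so the even indices carry exactly half.
    There w is v * T_0 u, read at 2 j, whence the factor 2^q. *)
Lemma vmom_btrans q u N : supp N u -> (q < k)%N ->
  2 ^+ q * vmom v q (btrans false u) = vmom v q u.
Proof.
move=> hu qk; set w := seq_conv (subdiv a v) u.
have hS := subdiv_supp ha hv; have hw : supp (2 * Nv + Na + N) w := seq_conv_supp hS hu.
have [N' hN'] := btrans_supp_ex false hu.
have hvt := seq_conv_supp hv hN'.
have m1 : mom q w = 2 *: mom q (seq_conv v u).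
  rewrite /w !seq_conv_gconv.
  apply: (@mom_conv_eq _ _ _ _ _ _ _ _ _ (maxn Nv (2 * Nv + Na)) N) => // [||i iq].
  - by apply: supp_le hS; exact: leq_maxr.
  - by apply: supp_le hv; exact: leq_maxl.
  - have [hm _] := hsr; have [_ h] := (matching_momP ha hv k).1 hm.
    by apply: h; exact: leq_ltn_trans qk.
have m2 : mom q (alt w) = 0.
  rewrite /w (alt_seq_conv _ hu) seq_conv_gconv -[RHS](scale0r (mom q (gconv 1 (alt (subdiv a v)) (alt u)))).
  apply: (@mom_conv_eq _ _ _ _ _ _ _ _ _ (2 * Nv + Na) N) => [|||i iq].
  - exact: alt_supp.
  - exact: alt_supp.
  - exact: alt_supp.
  - by rewrite scale0r alt_subdiv_mom // (leq_ltn_trans iq).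
pose f (k : int) : C := k%:~R ^+ q * w k ord0 ord0.
have sf : supp (2 * Nv + Na + N) f by move=> j jN; rewrite /f hw // mxE mulr0.
have sfa : supp (2 * Nv + Na + N) (fun j : int => (-1) ^+ `|j|%N * f j).
  by move=> j jN; rewrite sf // mulr0.
have E1 : \sum_(j \in [set: int]) f j = 2 * vmom v q u.
  by move/matrixP/(_ ord0 ord0): m1; rewrite (mom_entry _ _ _ hw) mxE.
have E2 : \sum_(j \in [set: int]) (-1) ^+ `|j|%N * f j = 0.
  move/matrixP/(_ ord0 ord0): m2; rewrite (mom_entry _ _ _ (alt_supp hw)) [X in _ = X -> _]mxE => H.
  rewrite -[RHS]H.
  by apply: eq_fsbigr => j _; rewrite /alt mxE /f; ring.
rewrite (Zsum_parity sf) in E1; rewrite (Zsum_parity sfa) in E2.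
have e0 j : (-1) ^+ absz (2 * j)%R = 1 :> C by rewrite abszM exprM sqrrN !expr1n.
have E2' : \sum_(j \in [set: int]) f (2 * j) - \sum_(j \in [set: int]) f (2 * j + 1) = 0.
  rewrite -[RHS]E2; congr (_ + _).
    by apply: eq_fsbigr => j _; rewrite e0 mul1r.
  have so : supp (2 * Nv + Na + N) (fun j => f (2 * j + 1)).
    by move=> j jN; apply: sf; lia.
  rewrite -(ZsumN so); apply: eq_fsbigr => j _.
  by rewrite signz_add e0 mul1r expr1 mulN1r.
have E3 : \sum_(j \in [set: int]) f (2 * j) = 2 ^+ q * vmom v q (btrans false u).
  rewrite /vmom (mom_entry _ _ _ hvt) (@Zsum_mulr _ (Nv + N')) => [|j jN]; last first.
    by rewrite hvt // mxE mulr0.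
  apply: eq_fsbigr => j _; rewrite /f /w (seq_conv_subdiv_even _ hu) rmorphM exprMn.
  by rewrite mulrA.
have alg (E O y : C) : E + O = 2 * y -> E - O = 0 -> E = y.
  move=> h1 /eqP; rewrite subr_eq0 => /eqP h2; move: h1; rewrite -h2 => h1.
  apply: (mulfI (_ : (2 : C) != 0)); first by rewrite pnatr_eq0.
  by rewrite -h1 mulr_natl mulr2n.
exact: (etrans (esym E3) (alg _ _ _ E1 E2')).
Qed.

(** A gain of one unit per step is crude but lets the number of steps be read off from the initial
    radius. *)
Lemma iter_btrans_supp n u N : supp N u -> supp (Na.+1 + (N - n)) (iter n (btrans false) u).
Proof.
move=> hu; elim: n => [|n IH]; first by apply: supp_le hu; lia.
by have := @trans_supp _ _ a Na ha _ 0 _ isT IH; apply: supp_le; lia.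
Qed.

Lemma vmom_iter_btrans q n u N : supp N u -> (q < k)%N ->
  2 ^+ (q * n) * vmom v q (iter n (btrans false) u) = vmom v q u.
Proof.
move=> hu qk; elim: n => [|n IH]; first by rewrite muln0 expr0 mul1r.
have hn := iter_btrans_supp (n := n) hu.
rewrite -[RHS]IH mulnS addnC exprD -mulrA; congr (_ * _).
exact: (vmom_btrans hn qk).
Qed.

(* The sequences [f j] all live in one window and are linearly independent,
   because the functionals [vmom v q] are triangular on them. *)
Lemma sum_rules_bound : (k <= wdim Na.+1)%N.
Proof.
rewrite leqNgt; apply/negP; set D := wdim _ => Dk.
have [/= hm _] := hsr; have [_ v0 _] := hm.
have [l vl] : exists l, symbol v 0 ord0 l != 0.
  have [//|h] := pselect (exists l, symbol v 0 ord0 l != 0).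
  case/eqP: v0; apply/rowP => l0; rewrite [RHS]mxE; apply/eqP/negPn/negP => h0.
  by apply: h; exists l0.
(* The j-th difference has radius j < k, so [k] steps of T_0 bring it into the window; by
   [vmom_iter_btrans] they only rescale its moments by nonzero factors. *)
pose f j := iter k (btrans false) (iter j (@nabla R r 1) (dirac_col R l)).
have hd j := iter_nabla_supp (n := j) (@dirac_col_supp R r l).
have sf j : (j < k)%N -> supp Na.+1 (f j).
  by move=> jk; apply: supp_le (iter_btrans_supp (n := k) (hd j)); lia.
have vl0 : vmom v 0 (dirac_col R l) != 0 by rewrite (vmom_dirac_col _ _ hv) (mom0_symbol v).
have p2 n : (2 ^+ n : C) != 0 by rewrite expf_neq0 // pnatr_eq0.
have f_diag q j : (q < k)%N -> (q <= j)%N -> (vmom v q (f j) == 0) = (q < j)%N.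
  move=> qk qj; have := vmom_iter_btrans k (hd j) qk; rewrite -/(f j) => E.
  rewrite -(mulrI_eq0 _ (mulfI (p2 (q * k)%N))) E.
  have [h1 h2] := vmom_iter_nabla hv j (@dirac_col_supp R r l).
  move: qj; rewrite leq_eqVlt => /orP[/eqP->|qj]; last by rewrite h1 // eqxx qj.
  by rewrite h2 ltnn; apply/negbTE/mulf_neq0 => //; exact: sign_fact_neq0.
case: k Dk f_diag sf => [//|k'] Dk f_diag sf.
pose U : 'M[C]_(k'.+1, D) := \matrix_(j < k'.+1) wco Na.+1 (f j).
have : kermx U != 0.
  rewrite kermx_eq0 /row_free; apply/negP => /eqP rU.
  by have := rank_leq_col U; rewrite rU leqNgt Dk.
move=> /rowV0Pn[c /sub_kermxP cU c0].
pose cn (j : nat) := c ord0 (inord j).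
pose u := fun t : int => \sum_(j < k'.+1) cn j *: f j t + (fun=> 0) t.
have cnE (j : 'I_k'.+1) : cn j = c ord0 j by rewrite /cn inord_val.
have su : supp Na.+1 u.
  by move=> t tN; rewrite /u addr0 big1 // => j _; rewrite sf ?scaler0.
have u0 : u = 0.
  apply: (wco_inj su); apply/rowP => d; rewrite [RHS]mxE.
  have [t [i [_ hd']]] := wco_index d; rewrite hd' /u addr0 summxE.
  transitivity ((c *m U) ord0 d); last by rewrite cU mxE.
  by rewrite mxE; apply: eq_bigr => j _; rewrite mxE cnE mxE hd'.
have [j0 cj0] : exists j, cn j != 0 /\ (j < k'.+1)%N.
  case/rV0Pn: c0 => j cj; exists j; rewrite cnE; split=> //.
(* In a vanishing combination, the functional of the least index with nonzero coefficient sees that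
   term alone. *)
pose Q j := (cn j != 0) && (j < k'.+1)%N.
have exQ : exists j, Q j by exists j0; apply/andP.
case: (ex_minnP exQ) => j1 /andP[c1 jk] jmin.
have := @vmom_lincomb R r v Nv hv j1 Na.+1 k'.+1 cn f (fun=> 0) sf (fun _ _ => erefl).
rewrite -/u u0.
have vz : vmom v j1 (fun=> 0) = 0.
  have e0 : seq_conv v (fun=> 0 : 'cV[C]_r) = fun=> 0.
    by apply/funext => t; apply: fsbig1 => t' _; rewrite mulmx0.
  have e1 : mom j1 (fun=> 0 : 'M[C]_1) = 0 by apply: fsbig1 => t _; rewrite scaler0.
  by rewrite /vmom e0 e1 mxE.
rewrite -[0]/(fun=> 0).
rewrite vz addr0 (bigD1 (Ordinal jk)) //= big1 ?addr0 => [/esym/eqP|j jj].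
  by rewrite mulf_eq0 (negbTE c1) f_diag //= ltnn.
have [j_lt|j_ge] := ltnP j j1.
  have [->|cj] := eqVneq (cn j) 0; first by rewrite mul0r.
  by have := jmin j; rewrite /Q cj ltn_ord => /(_ isT); rewrite leqNgt j_lt.
have h : (j1 < j)%N by rewrite ltn_neqAle j_ge andbT; apply: contraNneq jj => h; apply/eqP/val_inj; rewrite /= -h.
by have := f_diag j1 j jk j_ge; rewrite h => /eqP ->; rewrite mulr0.
Qed.

End SumRules.
End Windows.

(** * Geometric decay on the kernel of the limit functional *)

Section MaskSmoothness.
Variables (R : realType) (r : nat).
Local Notation C := R[i].
Variables (a : int -> 'M[C]_r) (Na m : nat) (nu : 'I_r -> nat) (eta : 'I_r -> R -> C).
Hypotheses (ha : supp Na a) (num : forall l, (nu l <= m)%N).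
Hypotheses (CE : forall i, C_ m (eta i)) (sE : forall i, csupp Na%:R (eta i)).
Hypothesis cv : column_limit nu a eta.
Variables (va : int -> 'rV[C]_r) (Nva M : nat).
Hypotheses (hva : supp Nva va) (hm : matching_filter a M.+1 va).
Variable l1 : 'I_r.
Hypothesis va_l1 : symbol va 0 ord0 l1 = 1.

Lemma limit_nonzero : exists i x, eta i x != 0.
Proof.
have [//|h] := pselect (exists i x, eta i x != 0).
have k1 := kap_filter ha num CE sE cv hva hm va_l1.
move/eqP: (oner_eq0 C); rewrite -k1 /kap big1 ?eqxx // => i _.
rewrite (_ : eta i = fun=> 0) ?cintegral0 ?mulr0 //.
apply/funext => x; apply/eqP/negPn/negP => e0; apply: h; by exists i, x.
Qed.

Lemma lam_btrans b u N : supp N u -> lam nu (btrans a b u) = lam nu u.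
Proof.
move=> hu; have [i [x ex]] := limit_nonzero.
by apply: (lam_trans ha num CE sE cv hu _ ex); case: b.
Qed.

Lemma lam_lin c (u w : int -> 'cV[C]_r) N : supp N u -> supp N w ->
  lam nu (c *: u + w) = c * lam nu u + lam nu w.
Proof.
move=> hu hw; rewrite /lam mulr_sumr -big_split /=; apply: eq_bigr => l _.
by have /colP/(_ l) := momD 0 c hu hw; rewrite !mxE => ->.
Qed.

Lemma lam_decay_window : exists q K : R, [/\ 0 < q < 1, 0 <= K & forall u b n k l,
  supp Na.+1 u -> lam nu u = 0 -> (forall k l, cmod (u k l ord0) <= b) ->
  cmod (seq_conv (Apow a n) u k l ord0) <= K * q ^+ n * b].
Proof.
pose P (u : int -> 'cV[C]_r) := supp Na.+1 u /\ lam nu u = 0.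
have P0 : P 0.
  split=> //; have h0 : supp 0 (0 : int -> 'cV[C]_r) by [].
  by have := lam_lin (-1) h0 h0; rewrite scaleN1r addNr mulN1r addNr.
have P_lin c u w : P u -> P w -> P (c *: u + w).
  move=> [hu lu] [hw lw]; split; last by rewrite (lam_lin c hu hw) lu lw mulr0 addr0.
  by move=> k kN; rewrite -[LHS]/(c *: u k + w k) hu ?hw ?scaler0 ?addr0.
have co_inj u : P u -> wco Na.+1 u = 0 -> u = 0 by move=> [hu _]; exact: wco_inj.
have T_P g u : P u -> P (btrans a g u).
  by move=> [hu lu]; split; [exact: btrans_supp | rewrite (lam_btrans g hu)].
have decay u : P u -> forall e : R, 0 < e -> exists n0 : nat, forall w,
    (n0 <= size w)%N -> entries_le (wco Na.+1) e (words (btrans a) w u).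
  move=> [hu lu] e e0; have [n0 hn0] := seq_conv_limit num CE sE cv hu e0.
  exists n0 => w nw; apply: wco_le => k l; have [k' ->] := words_Apow ha w k hu.
  by have := hn0 _ nw k' l; rewrite lu mulr0 subr0.
have [q [K [q01 K0 hK]]] := contraction (@wco_lin R r Na.+1) P0 P_lin co_inj
   (fun g c u w => trans_lin ha g c u w) T_P decay.
exists q, K; split=> // u b n k l hu lu hb.
have [w [i [<- ->]]] := Apow_words ha n k hu.
have b0 : 0 <= b by apply: le_trans (hb 0 l); exact: cmod_ge0.
have wP : P (words (btrans a) w u).
  have : P u by [].
  elim: (w) u {hu lu hb} => //= g w' IH u Pu; apply: IH; exact: T_P.
have [sw _] := wP; apply: (wco_le_entry _ _ sw); first by rewrite !mulr_ge0 // exprn_ge0 // ltW; case/andP: q01.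
by apply: hK => //; exact: wco_le.
Qed.

(** Beyond the window the transition operators strictly reduce the radius and preserve [lam], so
    induction on the radius brings every sequence into the window at the expense of a larger
    constant. *)
Lemma lam_decay : exists2 q : R, 0 < q < 1 & forall u N, supp N u -> lam nu u = 0 ->
  decays a q u.
Proof.
have [q [K [/andP[q0 q1] K0 hK]]] := lam_decay_window.
have geo N : forall u, supp N u -> lam nu u = 0 -> exists2 B : R, 0 <= B & forall n k l,
    cmod (seq_conv (Apow a n) u k l ord0) <= B * q ^+ n.
  elim/ltn_ind: N => N IH u hu lu.
  have [b b0 hb] := supp_bounded hu.
  have hb' k l : cmod (u k l ord0) <= b by exact: hb.
  have [NN|NN] := leqP N Na.+1.
    exists (K * b); first by rewrite mulr_ge0.
    by move=> n k l; rewrite mulrAC; apply: hK => //; apply: supp_le hu.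
  have st g : exists2 B : R, 0 <= B & forall n k l,
      cmod (seq_conv (Apow a n) (btrans a g u) k l ord0) <= B * q ^+ n.
    have g1 : (`|g%:Z| <= 1)%N by case: g.
    have hs := trans_supp ha g1 hu.
    apply: (IH ((Na + 1 + N) %/ 2)%N); [by lia | exact: hs |].
    by rewrite (lam_btrans g hu).
  have [B0 B00 h0] := st false; have [B1 B10 h1] := st true.
  have q_ge0 := ltW q0; have B2 : 0 <= (B0 + B1) / q by rewrite divr_ge0 // addr_ge0.
  exists (b + (B0 + B1) / q); first by rewrite addr_ge0.
  case=> [|n] k l.
    by rewrite (seq_conv_dirac a hu) expr0 mulr1; apply: le_trans (hb' k l) _; rewrite lerDl.
  have [g [j ->]] : exists (g : bool) (j : int), k = 2 * j + g%:Z.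
    by exists ((k %% 2)%Z == 1), (k %/ 2)%Z; lia.
  rewrite (seq_conv_trans ha _ _ _ hu).
  apply: (@le_trans _ _ ((B0 + B1) * q ^+ n)).
    case: g; first by apply: le_trans (h1 n j l) _; rewrite ler_wpM2r ?exprn_ge0 // lerDr.
    by apply: le_trans (h0 n j l) _; rewrite ler_wpM2r ?exprn_ge0 // lerDl.
  have -> : (b + (B0 + B1) / q) * q ^+ n.+1 = b * q ^+ n.+1 + (B0 + B1) * q ^+ n.
    by rewrite exprS; field; rewrite gt_eqF.
  by rewrite lerDr mulr_ge0 // exprn_ge0.
(* A slightly larger rate absorbs the constant, which depends on [u], as [decays] requires. *)
pose q' := (q + 1) / 2; have q'0 : 0 < q' by rewrite /q'; lra.
have qq : q < q' by rewrite /q'; lra.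
exists q'; first by rewrite q'0 /q'; lra.
move=> u N hu lu; have [B B0 hB] := geo N u hu lu.
have r01 : 0 <= q / q' < 1 by rewrite divr_ge0 ?ltW //= ltr_pdivrMr // mul1r.
have [n0 hn0] := expr_lt_small B r01 ltr01; exists n0 => n nn k l.
apply: le_trans (hB n k l) _; have := hn0 n nn.
by rewrite expr_div_n mulrA ltr_pdivrMr ?exprn_gt0 // mul1r => /ltW.
Qed.

Hypothesis nuM : forall l, (nu l <= M)%N.

Lemma lam_va u N : supp N u -> vmom va 0 u = lam nu u.
Proof.
move=> hu; rewrite (vmom0E hva hu) /lam [RHS]big_mkcond; apply: eq_bigr => l _.
rewrite (limit_filter0 ha num CE sE cv hva hm nuM va_l1).
by case: eqP; rewrite ?mul1r ?mul0r.
Qed.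

(** By [lam_va] and [lam_btrans] the mean against [va] of T_0 and T_1 applied to a Dirac column is
    the same: the even and odd sums of the mask agree after multiplication by the symbol of [va] at
    0. *)
Lemma order1_sum_rules : sum_rules a 1 va.
Proof.
have [fa v0 h] := hm; split; first by split=> // i j q q1; apply: h; lia.
move=> i l q; rewrite ltnS leqn0 => /eqP ->; rewrite !cderivn0 (ord1 i) mulr0.
have hd := @dirac_col_supp R r l.
have key b : lam nu (btrans a b (dirac_col R l)) = lam nu (dirac_col R l).
  exact: lam_btrans hd.
have [N0 h0] := btrans_supp_ex ha false hd; have [N1 h1] := btrans_supp_ex ha true hd.
have E b N (hb : supp N (btrans a b (dirac_col R l))) :
   lam nu (btrans a b (dirac_col R l)) =
   2 * \sum_i symbol va 0 ord0 i * \sum_(k \in [set: int]) a (2 * k + b%:Z) i l.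
  rewrite -(lam_va hb) (vmom0E hva hb) mulr_sumr; apply: eq_bigr => i' _.
  rewrite mulrCA; congr (_ * _); rewrite (mom_entry _ _ _ hb).
  rewrite (@Zsum_mulr _ (Na + 2)) => [|k kN]; last by rewrite ha ?mxE //; lia.
  apply: eq_fsbigr => k _; rewrite expr0 mul1r /btrans /trans.
  have -> : \sum_(t \in [set: int]) a (2 * k + b%:Z - t) *m dirac_col R l t = seq_conv a (dirac_col R l) (2 * k + b%:Z) by [].
  by rewrite seq_conv_dirac_col !mxE.
have := key true; rewrite -(key false) (E true N1 h1) (E false N0 h0) => /(mulfI (_ : (2 : C) != 0)).
rewrite pnatr_eq0 => /(_ isT) EE.
rewrite mxE (symbol_pi a 0).
have sA : supp Na (fun k => cis (- (k%:~R * 0)) *: ((-1) ^+ `|k|%N *: a k)).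
  by move=> k kN; rewrite ha ?scaler0.
have e j : symbol (fun k => (-1) ^+ `|k|%N *: a k) 0 j l =
   \sum_(k \in [set: int]) a (2 * k + 0) j l - \sum_(k \in [set: int]) a (2 * k + 1) j l.
  rewrite /symbol (Zsum_mxE _ _ sA).
  have sf : supp Na (fun k => (cis (- (k%:~R * 0)) *: ((-1) ^+ `|k|%N *: a k)) j l).
    by move=> k kN; rewrite sA // mxE.
  have e0 k : (-1) ^+ absz (2 * k)%R = 1 :> C by rewrite abszM exprM sqrrN !expr1n.
  rewrite (Zsum_parity sf); congr (_ + _).
    by apply: eq_fsbigr => k _; rewrite mulr0 oppr0 cis0 !scale1r e0 scale1r addr0.
  rewrite -(@ZsumN _ Na) => [|k kN]; last by rewrite ha ?mxE //; lia.
  apply: eq_fsbigr => k _; rewrite mulr0 oppr0 cis0 scale1r signz_add e0 mul1r expr1.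
  by rewrite scaleN1r mxE.
under eq_bigr => j _ do rewrite e mulrBr.
by rewrite sumrB mxE; apply/eqP; rewrite subr_eq0; apply/eqP; exact: (esym EE).
Qed.

Lemma mask_smoothness : (0 < sm_infty_mask a)%E.
Proof.
have [q q01 dec] := lam_decay; have /andP[q0 q1] := q01.
have ex1 : exists v, sum_rules a 1 v by exists va; exact: order1_sum_rules.
have hsr : sum_rules a (sr a) (sr_filter a).
  by apply: sr_filterP; have [v [[fv v0 _] _]] := ex1; exists v; split.
(* [sum_rules_bound] makes the set of orders bounded, so [sr a] is a true maximum and dominates the
   order 1 just found. *)
have sr1 : (1 <= sr a)%N.
  pose Q k := `[< exists v, sum_rules a k v >].
  have exQ : exists k, Q k by exists 1%N; apply/asboolP.
  have ubQ k : Q k -> (k <= wdim r Na.+1)%N.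
    move=> /asboolP[v hv]; have [/= [/fin_suppP[Nv sv] _ _] _] := hv.
    exact: (sum_rules_bound ha sv hv).
  rewrite /sr; case: xgetP => [k _ [_ hk]|hn]; first exact: hk.
  case: (ex_maxnP exQ ubQ) => k /asboolP hk kmax; exfalso; apply: (hn k); split=> // k' hk'.
  by apply: kmax; apply/asboolP.
have [hm' _] := hsr; have [/fin_suppP[Nv sv] v0 _] := hm'.
(* The filter behind [sr a] is thus proportional at 0 to the functional [lam], so every sequence in
   its space has [lam] equal to 0 and decays. *)
have vl l : symbol (sr_filter a) 0 ord0 l = if nu l == 0%N then kap eta (sr_filter a) else 0.
  have := matching_moments ha num CE sE cv sv hm' sr1 (leq0n (nu l)).
  by rewrite (mom0_symbol (sr_filter a)) eq_sym => ->; case: eqP => // _; rewrite expr0 fact0 !mul1r.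
have k0 : kap eta (sr_filter a) != 0.
  apply/negP => /eqP k0; case/eqP: v0; apply/rowP => l.
  by rewrite vl k0 mxE; case: ifP.
apply: (sm_mask_gt0 (q := q)); first by rewrite (ltW q0).
apply: decay_rho_le (ltW q0) _ => u hu.
have [/fin_suppP[N su] _] := hu; apply: (dec u N su).
have := (V_momP sv _ su).1 hu 0%N sr1 => /matrixP/(_ ord0 ord0).
rewrite [RHS]mxE -/(vmom _ 0 u) (vmom0E sv su) => H.
apply: (mulfI k0); rewrite mulr0 -[RHS]H /lam mulr_sumr big_mkcond; apply: eq_bigr => l _.
by rewrite vl; case: eqP; rewrite ?mul0r.
Qed.

End MaskSmoothness.

(** * Necessity: smoothness of the limit functions *)

Section LimitSmoothness.
Variables (R : realType) (r : nat).
Local Notation C := R[i].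

Lemma Linfty_norm_le (f : R -> C) (B : R) : 0 <= B -> (forall x, cmod (f x) <= B) ->
  (Linfty_norm f <= B%:E)%E.
Proof.
move=> B0 h; rewrite /Linfty_norm unlock; case: ifP => _ //.
apply/ess_supP; apply: nearW => x /=.
by rewrite lee_fin ger0_norm ?cmod_ge0.
Qed.

Lemma csupp_Linfty (K : R) (f : R -> C) : csupp K f -> Linfty f.
Proof.
move=> sf; have [m1 m2] := ccont_measurable (proj1 sf); have [B B0 hB] := csupp_bounded sf.
by split=> //; apply: le_lt_trans (Linfty_norm_le B0 hB) _; rewrite ltry.
Qed.

Lemma cder_lipschitz_ac (K : R) (f f' : R -> C) : cder f f' -> csupp K f' ->
  absolutely_continuous_fun f.
Proof.
move=> d sf; have [B B0 hB] := csupp_bounded sf.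
move=> e e0; exists (e / (2 * B + 1)); first by rewrite divr_gt0 // ltr_wpDl // mulr_ge0.
move=> n x y xy _ hs.
have l i : cmod (f (y i) - f (x i)) <= 2 * B * (y i - x i).
  apply: le_trans (cmvt d (fun z _ => hB z)) _.
  by rewrite ger0_norm ?subr_ge0 // mulrAC.
apply: le_lt_trans (ler_sum _ (fun i _ => l i)) _; rewrite -mulr_sumr.
have s0 : 0 <= \sum_(i < n) (y i - x i) by apply: sumr_ge0 => i _; rewrite subr_ge0.
have := hs; rewrite ltr_pdivlMr ?ltr_wpDl ?mulr_ge0 // => hs'.
by apply: le_lt_trans hs'; rewrite [leRHS]mulrC ler_wpM2r // lerDl.
Qed.

Lemma geometric_powR (q : R) : 0 < q -> exists tau : R, tau = - ln q / ln 2 /\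
  forall n, q ^+ n = (2 ^- n) `^ tau.
Proof.
move=> q0; pose tau := - ln q / ln 2; exists tau; split=> // n.
have l2 : ln 2 != 0 :> R by rewrite gt_eqF // ln_gt0 // ltr1n.
have i2 : 0 <= 2^-1 :> R by rewrite invr_ge0.
have E : q = 2^-1 `^ tau.
  rewrite /powR invr_eq0 pnatr_eq0 /= lnV ?posrE //.
  have -> : tau * - ln 2 = ln q by rewrite /tau; field.
  by rewrite lnK.
by rewrite {1}E -powR_mulrn ?powR_ge0 // powRAC powR_mulrn // exprVn.
Qed.

(* Geometric decay of the oscillation on dyadic scales is Hoelder continuity. *)
Lemma dyadic_hoelder (g : R -> C) (B K q : R) : 0 <= B -> (forall x, cmod (g x) <= B) ->
  2^-1 < q < 1 -> 0 <= K ->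
  (forall n x y, `|x - y| <= 2 ^- n -> cmod (g x - g y) <= K * q ^+ n) ->
  exists2 tau : R, 0 < tau < 1 & Lip_infty tau g.
Proof.
move=> B0 hB /andP[q2 q1] K0 h.
have q0 : 0 < q by apply: lt_trans q2; rewrite invr_gt0.
have [tau [tE qE]] := geometric_powR q0.
have l2 : 0 < ln 2 :> R by rewrite ln_gt0 // ltr1n.
have lq : ln q < 0 by rewrite ln_lt0 // q0.
have t0 : 0 < tau by rewrite tE divr_gt0 // oppr_gt0.
(* Here q > 1/2 is used: tau is the logarithm of 1/q to base 2. *)
have t1 : tau < 1.
  rewrite tE ltr_pdivrMr // mul1r ltrNl -lnV ?posrE // ltr_ln ?posrE // invr_gt0 //.
exists tau; first by rewrite t0.
exists (K / q + 2 * B + 1); first by rewrite ltr_wpDl // addr_ge0 ?mulr_ge0 // invr_ge0 ltW.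
move=> t; apply: Linfty_norm_le.
  by rewrite mulr_ge0 ?powR_ge0 // !addr_ge0 ?mulr_ge0 // invr_ge0 ltW.
move=> x; have p0 : 0 <= `|t| `^ tau by exact: powR_ge0.
have Kq : 0 <= K / q by rewrite divr_ge0 // ltW.
have [->|tn0] := eqVneq t 0.
  by rewrite subr0 subrr cmod0 mulr_ge0 ?powR_ge0 //; lra.
have tp : 0 < `|t| by rewrite normr_gt0.
(* Large shifts are handled by boundedness alone, which accounts for the 2 B in the constant. *)
have [tl|tg] := leP `|t| 1; last first.
  have : 1 <= `|t| `^ tau.
    have h1 : 1 `^ tau = 1 :> R by rewrite powR1.
    rewrite -[X in X <= _]h1; apply: ge0_ler_powR; rewrite ?nnegrE ?(ltW t0) //.
    exact: ltW.
  have b3 := cmodB (g x) (g (x - t)); have b2 := hB x; have b1 := hB (x - t) => b4.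
  apply: (@le_trans _ _ ((2 * B) * `|t| `^ tau)).
    apply: (@le_trans _ _ (2 * B * 1)); first lra.
    by apply: ler_wpM2l => //; rewrite mulr_ge0.
  by apply: ler_wpM2r => //; lra.
have exn : exists n, 2 ^- n < `|t|.
  by have [n0 hn0] := half_powers_small tp; exists n0; exact: hn0.
(* Minimality places |t| between 2^(-n-1) and 2^(-n); the lost step is the division of [K] by
   [q]. *)
case: (ex_minnP exn) => -[|n] hn nmin.
  by move: hn; rewrite expr0 invr1 ltNge tl.
have tn : `|t| <= 2 ^- n.
  by rewrite leNgt; apply/negP => /nmin; rewrite ltnn.
have := h n x (x - t); rewrite opprB addrC subrK => /(_ tn) hb.
apply: le_trans hb _; apply: (@le_trans _ _ (K / q * `|t| `^ tau)); last first.
  by apply: ler_wpM2r => //; lra.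
rewrite -mulrA; apply: ler_wpM2l => //.
rewrite mulrC ler_pdivlMr // -exprSr qE; apply: ge0_ler_powR; rewrite ?nnegrE ?(ltW t0) //.
exact: ltW.
Qed.

Variables (a : int -> 'M[C]_r) (Na m : nat) (eta : 'I_r -> R -> C).
Hypotheses (ha : supp Na a).
Hypotheses (CE : forall i, C_ m (eta i)) (sE : forall i, csupp Na%:R (eta i)).
Hypothesis eta_ref : forall x, Fvec eta x =
  2 *: \sum_(k \in [set: int]) a k *m Fvec eta (2 * x - k%:~R).

Let D j i := cderivn j (eta i).

Lemma derivative_refine j x : (j <= m)%N -> Fvec (D j) x =
  2 ^+ j *: (2 *: \sum_(k \in [set: int]) a k *m Fvec (D j) (2 * x - k%:~R)).
Proof.
move=> jm.
pose S j i x := 2 ^+ j.+1 * \sum_(k <- int_range Na) \sum_l a k i l * D j l (2 * x + - k%:~R).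
have SE j' y i : (2 ^+ j' *: (2 *: \sum_(k \in [set: int]) a k *m Fvec (D j') (2 * y - k%:~R))) i ord0 = S j' i y.
  rewrite (@Zsum_seq _ Na) => [|k kN]; last by rewrite ha ?mul0mx.
  rewrite scalerA -exprSr mxE summxE; congr (_ * _).
  by apply: eq_bigr => k _; rewrite mxE; apply: eq_bigr => l _; rewrite mxE.
suff h i : D j i = S j i by apply/colP => i; rewrite SE mxE h.
elim: j jm i => [|j IH] jm i.
  have D0 : D 0 = eta by apply/funext => l; rewrite /D cderivn0.
  by apply/funext => y; rewrite -(SE 0%N y i) D0 expr0 scale1r -(eta_ref y) mxE.
have d1 := C_cder (CE i) jm.
apply: (cder_uniq d1); rewrite -/(D j i) (IH (ltnW jm)).
have d2 : cder (S j i) (fun x => 2 ^+ j.+1 * \sum_(k <- int_range Na) \sum_l a k i l *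
    ((2 : R)%:C * D j.+1 l (2 * x + - k%:~R))).
  apply: cderZ; apply: cder_sum => k _; apply: cder_sum => l _; apply: cderZ.
  exact: (cder_comp _ _ (C_cder (CE l) jm)).
apply: cderE d2 _ => y; rewrite /S [2 ^+ j.+2]exprSr -mulrA; congr (_ * _).
rewrite mulr_sumr; apply: eq_bigr => k _; rewrite mulr_sumr; apply: eq_bigr => l _.
by rewrite (rmorph_nat (real_complex R) 2); ring.
Qed.

(** The values of the m-th derivative along the coset x + Z. For x in [0, 1] this sequence lies in
    the window. *)
Let U (x : R) : int -> 'cV[C]_r := fun t => Fvec (D m) (x + t%:~R).
Let T (b : bool) (u : int -> 'cV[C]_r) : int -> 'cV[C]_r := 2 ^+ m *: btrans a b u.

Let sD i : csupp Na%:R (D m i). Proof. exact: csupp_cderivn (CE i) (sE i) (leqnn m). Qed.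

Let U_supp x : 0 <= x <= 1 -> supp Na.+1 (U x).
Proof.
move=> /andP[x0 x1] t tN; apply/colP => l; rewrite !mxE; case: (sD l) => _; apply.
have tb : (Na.+2)%:R <= `|t%:~R : R| by rewrite -intr_norm -natr_absz ler_nat.
have N2 : (Na.+2)%:R = Na%:R + 2 :> R by rewrite -addn2 natrD.
have h := ler_normB (x + t%:~R) x; have e : x + t%:~R - x = t%:~R by rewrite addrAC subrr add0r.
rewrite e (ger0_norm x0) in h; rewrite N2 in tb; lra.
Qed.

(** The refinement equation of the m-th derivative, whose extra factor 2^m is built into [T]. The
    operators act on these sequences through the two halving maps of [0, 1]. *)
Let T_U b x : T b (U x) = U ((x + (b : nat)%:R) / 2).
Proof.
apply/funext => j; rewrite /U (derivative_refine _ (leqnn m)) /T.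
rewrite -[LHS]/(2 ^+ m *: btrans a b (U x) j) /btrans /trans; congr (_ *: (_ *: _)).
rewrite -[LHS](Zsum_rev (2 * j + b%:Z)); apply: eq_fsbigr => k _.
have -> : 2 * j + b%:Z - (2 * j + b%:Z - k) = k by ring.
congr (_ *m Fvec (D m) _).
by rewrite rmorphB rmorphD rmorphM /= -pmulrn; field.
Qed.

(* The windows of differences of [eta^(m)] span a finite-dimensional space on
   which the operators [T b] tend to 0 along all words. *)
Inductive difference_span : (int -> 'cV[C]_r) -> Prop :=
| difference_span0 : difference_span 0
| difference_spanD c x y u : 0 <= x <= 1 -> 0 <= y <= 1 -> difference_span u ->
    difference_span (c *: (U x - U y) + u).

Let half01 (b : bool) (x : R) : 0 <= x <= 1 -> 0 <= (x + (b : nat)%:R) / 2 <= 1.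
Proof. by move=> /andP[x0 x1]; case: b => /=; apply/andP; split; lra. Qed.

Let T_lin b c u w : T b (c *: u + w) = c *: T b u + T b w.
Proof.
by rewrite /T /btrans (trans_lin ha) scalerDr !scalerA [_ * c]mulrC.
Qed.

Let T_B b u w : T b (u - w) = T b u - T b w.
Proof. by have := T_lin b (-1) w u; rewrite !scaleN1r ![- _ + _]addrC. Qed.

Let words_diff w x y : 0 <= x <= 1 -> 0 <= y <= 1 -> exists x' y',
  [/\ 0 <= x' <= 1, 0 <= y' <= 1, `|x' - y'| = 2 ^- size w * `|x - y| &
      words T w (U x - U y) = U x' - U y'].
Proof.
elim: w x y => [|b w IH] x y hx hy.
  by exists x, y; rewrite expr0 invr1 mul1r.
have [x' [y' [h1 h2 h3 h4]]] := IH _ _ (half01 b hx) (half01 b hy).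
exists x', y'; split=> //.
  have -> : 2 ^- size (b :: w) = 2 ^- size w * 2^-1 :> R by rewrite /= exprSr invfM mulrC.
  have e : (x + (b : nat)%:R) / 2 - (y + (b : nat)%:R) / 2 = 2^-1 * (x - y) by field.
  by rewrite h3 e normrM [`|2^-1|]ger0_norm ?invr_ge0 // mulrA.
by rewrite -h4 /= T_B !T_U.
Qed.

(** The binary digits of [k] describe how to reach the dyadic cell from [0, 1], so the oscillation
    on any cell of level n is an entry of a word of length n. *)
Let diff_words n (k : int) x y : 0 <= x <= 1 -> 0 <= y <= 1 -> exists w (j : int), size w = n /\
  Fvec (D m) (2 ^- n * (k%:~R + x)) - Fvec (D m) (2 ^- n * (k%:~R + y)) = words T w (U x - U y) j.
Proof.
elim: n k x y => [|n IH] k x y hx hy.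
  by exists [::], k; rewrite expr0 invr1 !mul1r /= /U ![k%:~R + _]addrC.
have [b [k' kE]] : exists (b : bool) (j : int), k = 2 * j + b%:Z.
  by exists ((k %% 2)%Z == 1), (k %/ 2)%Z; lia.
have [w [j [sw wE]]] := IH k' _ _ (half01 b hx) (half01 b hy).
exists (b :: w), j; split; first by rewrite /= sw.
rewrite /= T_B !T_U -wE.
have e z : 2 ^- n.+1 * (k%:~R + z) = 2 ^- n * (k'%:~R + (z + (b : nat)%:R) / 2) :> R.
  by rewrite kE rmorphD rmorphM /= -pmulrn exprS; field; rewrite expf_neq0.
by rewrite !e.
Qed.

(** By [words_diff] a word sends a difference to one between points closer by the factor 2^(-size
    w), so uniform continuity gives convergence to 0 on the span, and [contraction] makes it
    geometric. *)
Lemma dyadic_oscillation : exists K q : R, [/\ 0 <= K, 0 < q < 1 & forall n (k : int) x y l,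
  0 <= x <= 1 -> 0 <= y <= 1 ->
  cmod (D m l (2 ^- n * (k%:~R + x)) - D m l (2 ^- n * (k%:~R + y))) <= K * q ^+ n].
Proof.
have bD : exists2 B : R, 0 <= B & forall l x, cmod (D m l x) <= B.
  have h l := cid2 (csupp_bounded (sD l)).
  exists (\sum_l s2val (h l)); first by apply: sumr_ge0 => l _; exact: (s2valP (h l)).
  move=> l x; rewrite (bigD1 l) //=; apply: le_trans (s2valP' (h l) x) _.
  by rewrite lerDl; apply: sumr_ge0 => i _; exact: (s2valP (h i)).
have [B B0 hB] := bD.
pose P := difference_span.
have P0 : P 0 by exact: difference_span0.
have P_lin c u w : P u -> P w -> P (c *: u + w).
  move=> hu hw; elim: hu => [|c' x y u' hx hy _ IH]; first by rewrite scaler0 add0r.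
  by rewrite scalerDr scalerA -addrA; exact: difference_spanD.
have P_supp u : P u -> supp Na.+1 u.
  elim=> [//|c x y u' hx hy _ IH] k kN.
  rewrite -[LHS]/(c *: (U x k - U y k) + u' k).
  by rewrite !U_supp // IH // subrr scaler0 addr0.
have co_inj u : P u -> wco Na.+1 u = 0 -> u = 0.
  by move=> /P_supp; exact: wco_inj.
have T_P g u : P u -> P (T g u).
  elim=> [|c x y u' hx hy _ IH].
    by have := T_lin g (-1) 0 0; rewrite !scaleN1r !addNr => ->.
  by rewrite T_lin T_B !T_U; apply: difference_spanD => //; exact: half01.
have wlin w c u z : words T w (c *: u + z) = c *: words T w u + words T w z.
  by elim: w u z => //= g w IH u z; rewrite T_lin IH.
have UE x y k l : (U x - U y) k l ord0 = D m l (x + k%:~R) - D m l (y + k%:~R).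
  by rewrite -[LHS]/((U x k - U y k) l ord0) !mxE.
have decay u : P u -> forall e : R, 0 < e -> exists n0 : nat, forall w,
    (n0 <= size w)%N -> forall k l, cmod (words T w u k l ord0) <= e.
  elim=> [|c x y u' hx hy _ IH] e e0.
    exists 0%N => w _ k l; have -> : words T w 0 = 0.
      by have := wlin w (-1) 0 0; rewrite !scaleN1r !addNr.
    by rewrite mxE cmod0 ltW.
  have e2 : 0 < e / 2 by rewrite divr_gt0.
  have [n1 hn1] := IH _ e2.
  have ec : 0 < e / 2 / (cmod c + 1) by rewrite divr_gt0 // ltr_wpDl // cmod_ge0.
  have [n2 hn2] : exists n2, forall l n, (n2 <= n)%N -> forall x y, `|x - y| <= 2 ^- n ->
      cmod (D m l x - D m l y) <= e / 2 / (cmod c + 1).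
    apply: ord_eventually => l; have [d d0 hd] := csupp_uniform (sD l) ec.
    have [n2 hn2] := half_powers_small d0; exists n2 => n nn x1 y1 h1; apply: hd.
    exact: le_lt_trans h1 (hn2 n nn).
  exists (maxn n1 n2) => w; rewrite geq_max => /andP[w1 w2] k l.
  have -> : words T w (c *: (U x - U y) + u') k l ord0 =
      c * words T w (U x - U y) k l ord0 + words T w u' k l ord0.
    by rewrite wlin -[LHS]/((c *: (words T w (U x - U y) k) + words T w u' k) l ord0) !mxE.
  apply: le_trans (cmodD _ _) _; rewrite [e]splitr; apply: lerD (hn1 w w1 k l).
  rewrite cmodM.
  have [x' [y' [_ _ e1 ->]]] := words_diff w hx hy; rewrite UE.
  have b1 : cmod (D m l (x' + k%:~R) - D m l (y' + k%:~R)) <= e / 2 / (cmod c + 1).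
    apply: (hn2 l _ w2); rewrite opprD addrACA subrr addr0 e1.
    rewrite ler_piMr ?invr_ge0 ?exprn_ge0 //; case/andP: hx => ? ?; case/andP: hy => ? ?.
    by rewrite ler_norml; apply/andP; split; lra.
  have c0 := cmod_ge0 c; apply: le_trans (ler_wpM2l c0 b1) _.
  by rewrite mulrA ler_pdivrMr ?ltr_wpDl // mulrC ler_pM2l // lerDl.
have decay' u : P u -> forall e : R, 0 < e -> exists n0 : nat, forall w,
    (n0 <= size w)%N -> entries_le (wco Na.+1) e (words T w u).
  move=> Pu e e0; have [n0 hn0] := decay u Pu e e0; exists n0 => w nw.
  by apply: wco_le => k l; exact: hn0.
have [q [K [q01 K0 hK]]] := contraction (@wco_lin R r Na.+1) P0 P_lin co_inj T_lin T_P decay'.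
exists (K * (2 * B)), q; split=> //; first by rewrite !mulr_ge0.
move=> n k x y l hx hy.
have Pd : P (U x - U y).
  by have := difference_spanD 1 hx hy P0; rewrite scale1r addr0.
have [w [j [<- /colP/(_ l)]]] := diff_words n k hx hy.
rewrite [LHS]mxE mxE [X in _ + X]mxE [X in _ - X]mxE => ->.
have wP u : P u -> P (words T w u).
  by elim: (w) u => //= g w' IH u Pu; apply: IH; exact: T_P.
have q0 : 0 <= q by case/andP: q01 => /ltW.
rewrite mulrAC; apply: (wco_le_entry _ _ (P_supp _ (wP _ Pd))).
  by rewrite !mulr_ge0 // exprn_ge0.
apply: hK => //; apply: wco_le => k' l'.
rewrite UE; apply: le_trans (cmodB _ _) _; have := hB l' (x + k'%:~R); have := hB l' (y + k'%:~R); lra.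
Qed.

Lemma limit_sm_infty l : (m%:R%:E < sm_infty_fun (eta l))%E.
Proof.
have [K [q [K0 /andP[q0 q1] hK]]] := dyadic_oscillation.
(* Raised above 1/2 to meet the hypothesis of [dyadic_hoelder], which keeps the exponent below 1. *)
pose q' := Num.max q (3 / 4).
have qq : q <= q' by rewrite le_max lexx.
have q'01 : 2^-1 < q' < 1.
  by apply/andP; split; [rewrite lt_max; apply/orP; right; lra | rewrite gt_max q1 /=; lra].
have q'0 : 0 < q' by exact: lt_le_trans qq.
have [B B0 hB] := csupp_bounded (sD l).
(* Two points this close lie in one dyadic cell or in two adjacent ones; the factor 2 pays for
   passing through the common endpoint. *)
have osc n x y : `|x - y| <= 2 ^- n -> cmod (D m l x - D m l y) <= 2 * K * q' ^+ n.
  wlog xy : x y / x <= y.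
    move=> h; case: (leP x y) => [|/ltW] xy hxy; first exact: h.
    by rewrite cmodBC; apply: h => //; rewrite distrC.
  rewrite distrC ger0_norm ?subr_ge0 // => hxy.
  have p2 : 0 < 2 ^+ n :> R by rewrite exprn_gt0.
  pose k := Num.floor (2 ^+ n * x); pose s := 2 ^+ n * x - k%:~R.
  have s0 : 0 <= s by rewrite subr_ge0 /k floor_le.
  have s1 : s <= 1.
    by have := floorD1_gt (2 ^+ n * x); rewrite rmorphD /= -/k /s => ?; lra.
  have xE : x = 2 ^- n * (k%:~R + s).
    by rewrite /s addrC subrK mulrA mulVf ?mul1r // gt_eqF.
  have hq : K * q ^+ n <= K * q' ^+ n.
    by apply: ler_wpM2l => //; apply: lerXn2r => //; rewrite nnegrE ltW.
  have Kq0 : 0 <= K * q' ^+ n by rewrite mulr_ge0 // exprn_ge0 // ltW.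
  pose t := 2 ^+ n * y - k%:~R.
  have yE : y = 2 ^- n * (k%:~R + t).
    by rewrite /t addrC subrK mulrA mulVf ?mul1r // gt_eqF.
  have st : s <= t by rewrite /s /t lerD2r ler_pM2l.
  have ts : t - s <= 1.
    have -> : t - s = 2 ^+ n * (y - x) by rewrite /s /t; ring.
    by rewrite -ler_pdivlMl // mulr1.
  have bb := hK n k s.
  have [t1|t1] := leP t 1.
    have hs : 0 <= s <= 1 by rewrite s0.
    have ht : 0 <= t <= 1 by rewrite t1 (le_trans s0).
    have := bb t l hs ht; rewrite -xE -yE; move: hq Kq0; rewrite -mulrA; lra.
  have E1 : D m l x - D m l y = (D m l x - D m l (2 ^- n * (k%:~R + 1))) +
      (D m l (2 ^- n * ((k + 1)%:~R + 0)) - D m l (2 ^- n * ((k + 1)%:~R + (t - 1)))).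
    rewrite rmorphD /= addr0; have -> : k%:~R + 1 + (t - 1) = k%:~R + t by ring.
    by rewrite -yE; ring.
  rewrite E1; apply: le_trans (cmodD _ _) _; rewrite [2 * K * _](_ : _ = K * q' ^+ n + K * q' ^+ n); last by ring.
  apply: lerD; apply: le_trans hq.
    by rewrite {1}xE; apply: hK; rewrite ?s0 ?ler01 ?lexx.
  by apply: hK; rewrite ?lexx ?ler01 //; apply/andP; split; lra.
have [tau /andP[tau0 tau1] hL] := dyadic_hoelder B0 hB q'01 (mulr_ge0 (ler0n R 2) K0) osc.
apply: (@lt_le_trans _ _ (m%:R + tau)%:E); first by rewrite lte_fin ltrDl.
apply: ereal_sup_ubound; exists m, tau, (fun j => cderivn j (eta l)); split=> //.
  by rewrite (ltW tau0).
have sj j (jm : (j <= m)%N) := csupp_cderivn (CE l) (sE l) jm.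
split=> [|j jm|j jm|j jm].
- by apply: nearW => x; rewrite cderivn0.
- exact: csupp_Linfty (sj j jm).
- exact: cder_lipschitz_ac (C_cder (CE l) jm) (sj j.+1 jm).
- by apply: nearW => x; exact: (C_cder (CE l) jm).
Qed.

Lemma limit_sm_infty_dist (phi : 'I_r -> (R -> C) -> C) :
  (forall l, represents (eta l) (phi l)) -> sm_infty_dist_gt phi m%:R%:E.
Proof.
move=> rep; exists eta; split=> // [l|]; first exact: csupp_Linfty (sE l).
rewrite /sm_infty_vec; elim/big_ind: _ => [|x y hx hy|l _]; first exact: ltry.
  by rewrite lt_min hx.
exact: limit_sm_infty.
Qed.

End LimitSmoothness.

Theorem theorem10 (R : realType) (r m : nat) (r_gt0 : (0 < r)%N)
  (nu : 'I_r -> 'I_m.+1) (nu1 : nu (Ordinal r_gt0) = 0%N :> nat)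
  (a : int -> 'M[R[i]]_r) (fin_a : fin_supp a)
  (simple1 : mup 1 (char_poly (symbol a 0)) = 1%N)
  (no_eigen2 : forall k : nat, (0 < k)%N ->
     ~~ eigenvalue (symbol a 0) (2 ^+ k))
  (va : int -> 'rV[R[i]]_r)
  (va_matching : matching_filter a (\max_(l < r) nu l).+1 va)
  (va_first : exists2 l : 'I_r, symbol va 0 ord0 l = 1 &
     forall l' : 'I_r, (l' < l)%N -> symbol va 0 ord0 l' = 0)
  (phi : 'I_r -> (R -> R[i]) -> R[i])
  (phi_dist : forall l, cs_distribution (phi l))
  (phi_refinable : forall xi : R,
     fourier_vec phi (2 * xi) = symbol a xi *m fourier_vec phi xi)
  (phi_normalized : symbol va 0 *m fourier_vec phi 0 = 1%:M) :
  (hermite_convergent nu a ->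
     [/\ (0 < sm_infty_mask a)%E, sm_infty_dist_gt phi m%:R%:E &
         hermite_filter_cond nu va])
  /\
  ((((\max_(l < r) nu l)%N)%:R%:E < sm_infty_mask a)%E ->
     sm_infty_dist_gt phi m%:R%:E ->
     hermite_filter_cond nu va ->
     hermite_convergent nu a).
Proof.
have [Na ha] := (fin_suppP a).1 fin_a.
split=> [conv|]; last first.
  exact: (hermite_scheme_convergent ha va_matching phi_dist phi_refinable phi_normalized).
have [eta [CE sE cv]] := hermite_limit ha nu1 conv.
have [/fin_suppP[Nva hva] _ _] := va_matching; have [l1 va1 _] := va_first.
have num l : (nu l <= m)%N by have := ltn_ord (nu l).
have nuM l : (nu l <= \max_(l < r) nu l)%N by exact: (leq_bigmax l).
split.
- exact: (mask_smoothness ha num CE sE cv hva va_matching va1 nuM).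
- have eta_ref := limit_refine ha sE cv nu1.
  apply: (limit_sm_infty_dist ha CE sE eta_ref) => l.
  exact: (limit_represents ha num CE sE cv hva va_matching nuM va1 phi_dist phi_refinable phi_normalized).
- move=> l; apply/(eqO_momP hva) => q qn.
  by rewrite (limit_filter_moments ha num CE sE cv hva va_matching nuM va1 qn).
Qed.
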